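(* Consider the following cases for a prime $l$, a finite group $G$ and a pair of subfields. (1) $l$ is an odd prime, $G=D_{2l}$ is the dihedral group of order $2l$, $K_1$ is any of the subfields of $L$ of degree $l$ over $F$, and $K_2$ is the quadratic subfield of $L$. (2) $l,r$ are odd primes with $l\equiv 1 \pmod r$, $G=\mathbb{Z}/l\mathbb{Z}\rtimes\mathbb{Z}/r\mathbb{Z}$ is the non-abelian semidirect product, $K_1$ is any of the subfields of $L$ of degree $l$ over $F$, and $K_2$ is the subfield of degree $r$. Let $S$ be either $\mathrm{Spec}\,\mathbb{Z}[1/l]$ or $\mathbb{P}^1_{\mathbb{F}_p}$ with $p$ a prime distinct from $l$, and let $F$ be the function field of $S$ (so $F=\mathbb{Q}$ or $F=\mathbb{F}_p(T)$). Then there are explicitly computable constants $C_1,C_2,C_3,C_4$, depending only on the case (including $l$, $r$ and whether $S=\mathrm{Spec}\,\mathbb{Z}[1/l]$ or $S=\mathbb{P}^1_{\mathbb{F}_p}$) and, if $S=\mathbb{P}^1_{\mathbb{F}_p}$, on whether $\mu_l\subset\mathbb{F}_p$, such that the following holds. For every Galois extension $L/F$ with $\mathrm{Gal}(L/F)\cong G$ and every pair of intermediate fields $K_1,K_2$ as in the case considered, such that $L/K_2$ is unramified and $K_2$ is disjoint from $F(\mu_l)$ over $F$, $$C_1\,\mathrm{rk}_l\,Cl(K_2)+C_2\le \mathrm{rk}_l\,Cl(K_1)\le C_3\,\mathrm{rk}_l\,Cl(K_2)+C_4 .$$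
   Context: For an abelian group $A$, $\mathrm{rk}_l A=\dim_{\mathbb{F}_l}A[l]$. If $S=\mathrm{Spec}\,\mathbb{Z}[1/l]$, then $Cl(K)$ is the ideal class group of the number field $K$. If $S=\mathbb{P}^1_{\mathbb{F}_p}$, then $Cl(K)$ means $\mathrm{Pic}(C)$, where $C$ is the complete connected smooth curve over $\mathbb{F}_p$ with function field $K$. $\mu_l$ is the group of $l$-th roots of unity. ''Unramified'' for number fields means unramified at all finite primes (no condition at infinite places); for function fields it means unramified at all places. The group in case (2) has presentation $\langle\sigma,\tau\mid \sigma^r=\tau^l=1,\ \sigma\tau\sigma^{-1}=\tau^{\zeta}\rangle$ with $\zeta\in(\mathbb{Z}/l\mathbb{Z})^\times$ of order $r$; the field $K_2$ is the fixed field of $\langle\tau\rangle$ and the fields $K_1$ are the conjugates of the fixed field of $\langle\sigma\rangle$. *)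

(* Defs.v *)
From HB Require Import structures.
From mathcomp Require Import all_boot all_order all_algebra.
From mathcomp Require Import all_fingroup all_solvable all_field.
From mathcomp Require Import boolp classical_sets.
From mathcomp.multinomials Require Import freeg.

Set Implicit Arguments.
Unset Strict Implicit.
Unset Printing Implicit Defensive.

Import GRing.Theory.

Local Open Scope ring_scope.
Local Open Scope classical_set_scope.

(* Since A[l] is killed by the prime l, it is an 'F_l-vector space whose
   linear maps are just the additive ones, so an additive bijection from F_l^d
   to A[l] says exactly that dim A[l] = d.  As usual for total dimension
   functions, rk l A is 0 when A[l] is infinite. *)
Definition torsion_dim (l : nat) (A : zmodType) (d : nat) : Prop :=
  exists f : {additive 'rV['F_l]_d -> A},
    injective f /\ range f = [set x | x *+ l = 0].

Definition rk (l : nat) (A : zmodType) : nat := xget 0%N (torsion_dim l A).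

Section IdealClassGroup.
Variable K : fieldExtType rat.
Implicit Types (I J : set K) (a x y : K).

Definition ring_of_integers : set K := [set x | integralOver (intr : int -> K) x].
Local Notation O := ring_of_integers.

Definition fractional_ideal I : Prop :=
  [/\ I 0,
      forall x y, I x -> I y -> I (x + y),
      forall a x, O a -> I x -> I (a * x)
    & exists2 d, O d /\ d != 0 & forall x, I x -> O (d * x)].

Definition idealM I J : set K :=
  [set z | exists2 s : seq (K * K),
     (forall p, p \in s -> I p.1 /\ J p.2) & z = \sum_(p <- s) p.1 * p.2].

Lemma idealM_mul I J x y : I x -> J y -> idealM I J (x * y).
Proof.
move=> Ix Jy; exists [:: (x, y)]; last by rewrite big_seq1.
by move=> p; rewrite inE => /eqP ->.
Qed.

Lemma idealM0 I J : idealM I J 0.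
Proof. by exists [::]; rewrite ?big_nil. Qed.

Lemma idealMD I J x y : idealM I J x -> idealM I J y -> idealM I J (x + y).
Proof.
move=> [s Hs ->] [t Ht ->]; exists (s ++ t); last by rewrite big_cat.
by move=> p; rewrite mem_cat => /orP[/Hs|/Ht].
Qed.

Lemma idealM_min I J (P : set K) :
  P 0 -> (forall x y, P x -> P y -> P (x + y)) ->
  (forall x y, I x -> J y -> P (x * y)) -> idealM I J `<=` P.
Proof.
move=> P0 PD PM z [s + ->]; elim: s => [|p s IHs] Hs; first by rewrite big_nil.
rewrite big_cons; apply: PD.
  by have [] := Hs p (mem_head _ _); exact: PM.
by apply: IHs => q qs; apply: Hs; rewrite inE qs orbT.
Qed.

Lemma idealMC I J : idealM I J = idealM J I.
Proof.
have sub X Y : idealM X Y `<=` idealM Y X.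
  apply: idealM_min; [exact: idealM0 | exact: idealMD |].
  by move=> x y Xx Yy; rewrite mulrC; exact: idealM_mul.
by apply/seteqP; split; exact: sub.
Qed.

Lemma idealMA I J H : idealM I (idealM J H) = idealM (idealM I J) H.
Proof.
have sub X Y Z : idealM X (idealM Y Z) `<=` idealM (idealM X Y) Z.
  apply: idealM_min; [exact: idealM0 | exact: idealMD |] => x w Xx.
  move: w; apply: idealM_min => [|w w' Hw Hw'|y z Yy Zz].
  - by rewrite mulr0; exact: idealM0.
  - by rewrite mulrDr; exact: idealMD.
  - by rewrite mulrA; apply: idealM_mul => //; exact: idealM_mul.
apply/seteqP; split; first exact: sub.
rewrite [idealM (idealM I J) H]idealMC [idealM I J]idealMC.
by rewrite [idealM J H]idealMC [idealM I _]idealMC; exact: sub.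
Qed.

Lemma O0 : O 0. Proof. exact: integral0. Qed.
Lemma O1 : O 1. Proof. exact: integral1. Qed.
Lemma OD x y : O x -> O y -> O (x + y). Proof. exact: integral_add. Qed.
Lemma OM x y : O x -> O y -> O (x * y). Proof. exact: integral_mul. Qed.

Lemma fractional_ideal_O : fractional_ideal O.
Proof.
split; [exact: O0 | exact: OD | exact: OM |].
by exists 1; rewrite ?oner_eq0; [split; [exact: O1|] | move=> x; rewrite mul1r].
Qed.

Lemma fractional_idealM I J :
  fractional_ideal I -> fractional_ideal J -> fractional_ideal (idealM I J).
Proof.
move=> [I0 ID IM [d [Od d0] Hd]] [J0 JD JM [e [Oe e0] He]]; split.
- exact: idealM0.
- exact: idealMD.
- move=> a x Oa; move: x; apply: idealM_min => [|x y|x y Ix Jy].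
  + by rewrite mulr0; exact: idealM0.
  + by rewrite mulrDr; exact: idealMD.
  + by rewrite mulrA; apply: idealM_mul => //; exact: IM.
- exists (d * e); first by split; [exact: OM | rewrite mulf_neq0].
  apply: idealM_min => [|x y|x y Ix Jy].
  + by rewrite mulr0; exact: O0.
  + by rewrite mulrDr; exact: OD.
  + by rewrite mulrACA; apply: OM; [exact: Hd | exact: He].
Qed.

Lemma idealOM I : fractional_ideal I -> idealM O I = I.
Proof.
move=> [I0 ID IM _]; apply/seteqP; split; first by apply: idealM_min => // *; exact: IM.
by move=> x Ix; rewrite -[x]mul1r; apply: idealM_mul => //; exact: O1.
Qed.

Definition invertible_ideal I : Prop :=
  fractional_ideal I /\ exists2 J, fractional_ideal J & idealM I J = O.

Record ideal_group := IdealGroup {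
  ideal_set :> set K;
  ideal_setP : `[< invertible_ideal ideal_set >] }.

HB.instance Definition _ := [isSub for ideal_set].
HB.instance Definition _ := [Choice of ideal_group by <:].

Definition mk_ideal I (H : invertible_ideal I) : ideal_group :=
  IdealGroup (introT (asboolP _) H).

Lemma ideal_groupP (I : ideal_group) : invertible_ideal I.
Proof. exact: (elimT (asboolP _) (ideal_setP I)). Qed.

Lemma ideal_frac (I : ideal_group) : fractional_ideal I.
Proof. by case: (ideal_groupP I). Qed.

Lemma invertible_O : invertible_ideal O.
Proof.
have fO := fractional_ideal_O.
by split=> //; exists O => //; exact: idealOM.
Qed.

Lemma invertibleM I J :
  invertible_ideal I -> invertible_ideal J -> invertible_ideal (idealM I J).
Proof.
move=> [fI [I' fI' II']] [fJ [J' fJ' JJ']]; split; first exact: fractional_idealM.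
exists (idealM I' J'); first exact: fractional_idealM.
rewrite idealMA -[idealM (idealM I J) I']idealMA [idealM J I']idealMC.
by rewrite idealMA II' (idealOM fJ).
Qed.

Lemma invertibleV (I : ideal_group) :
  exists J : ideal_group, idealM I J = O.
Proof.
have [fI [J fJ IJ]] := ideal_groupP I.
have iJ : invertible_ideal J by split=> //; exists I => //; rewrite idealMC.
by exists (mk_ideal iJ).
Qed.

Definition ideal_one : ideal_group := mk_ideal invertible_O.
Definition ideal_mul (I J : ideal_group) : ideal_group :=
  mk_ideal (invertibleM (ideal_groupP I) (ideal_groupP J)).
Definition ideal_inv (I : ideal_group) : ideal_group := projT1 (cid (invertibleV I)).

Lemma ideal_mulA : associative ideal_mul.
Proof. by move=> I J H; apply: val_inj; exact: idealMA. Qed.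

Lemma ideal_mulC : commutative ideal_mul.
Proof. by move=> I J; apply: val_inj; exact: idealMC. Qed.

Lemma ideal_mul1 : left_id ideal_one ideal_mul.
Proof. by move=> I; apply: val_inj; exact: (idealOM (ideal_frac I)). Qed.

Lemma ideal_mulV : left_inverse ideal_one ideal_inv ideal_mul.
Proof.
move=> I; apply: val_inj => /=; rewrite idealMC /ideal_inv.
by case: (cid _).
Qed.

(* The group of invertible fractional ideals (all the nonzero ones, since the
   ring of integers is a Dedekind domain) is written additively: + is the
   product of ideals and 0 is the ring of integers. *)
HB.instance Definition _ :=
  GRing.isZmodule.Build ideal_group ideal_mulA ideal_mulC ideal_mul1 ideal_mulV.

Definition principal_ideal : {pred ideal_group} :=
  [pred I : ideal_group |
    `[< exists2 a : K, a != 0 & ideal_set I = [set a * x | x in O] >]].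

Lemma principal_idealP (I : ideal_group) :
  reflect (exists2 a : K, a != 0 & ideal_set I = [set a * x | x in O])
          (I \in principal_ideal).
Proof. exact: asboolP. Qed.

Lemma mul_principal a b :
  idealM [set a * x | x in O] [set b * x | x in O] = [set a * b * x | x in O].
Proof.
apply/seteqP; split.
  apply: idealM_min => [|_ _ [x Ox <-] [y Oy <-]|_ _ [x Ox <-] [y Oy <-]].
  - by exists 0; [exact: O0 | rewrite mulr0].
  - by exists (x + y); [exact: OD | rewrite mulrDr].
  - by exists (x * y); [exact: OM | rewrite mulrACA].
move=> _ [x Ox <-]; rewrite -mulrA; apply: idealM_mul; last by exists x.
by exists 1; [exact: O1 | rewrite mulr1].
Qed.

Lemma principal_ideal_zmod : zmod_closed principal_ideal.
Proof.
split.
  apply/principal_idealP; exists 1; rewrite ?oner_eq0 //=.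
  apply/seteqP; split=> [x Ox|_ [x Ox <-]]; last by rewrite mul1r.
  by exists x => //; rewrite mul1r.
move=> I J /principal_idealP[a a0 Ia] /principal_idealP[b b0 Jb].
apply/principal_idealP; exists (a / b); first by rewrite mulf_neq0 ?invr_eq0.
have HJ : idealM (- J) J = O := congr1 ideal_set (addNr J).
have -> : ideal_set (I - J) = idealM I (- J) by [].
have fN : fractional_ideal (- J) := ideal_frac (- J).
suff -> : ideal_set (- J) = [set b^-1 * x | x in O] by rewrite Ia mul_principal.
have one1 : [set 1 * x | x in O] = O.
  apply/seteqP; split=> [_ [x Ox <-]|x Ox]; first by rewrite mul1r.
  by exists x => //; rewrite mul1r.
have fb : idealM O [set b^-1 * x | x in O] = [set b^-1 * x | x in O].
  by rewrite -{1}one1 mul_principal mul1r.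
rewrite -[RHS]fb -[X in idealM X _]HJ -idealMA Jb mul_principal divff // one1.
by rewrite idealMC idealOM.
Qed.

HB.instance Definition _ :=
  GRing.isZmodClosed.Build ideal_group principal_ideal principal_ideal_zmod.

Definition Cl : zmodType := Quotient.quot principal_ideal.

End IdealClassGroup.

(* Normalized discrete valuations; v 0, which should be infinite, is fixed to
   be 0 so that a place is determined by its values on the nonzero elements. *)
Definition discrete_valuation (K : fieldType) (v : K -> int) : Prop :=
  [/\ v 0 = 0,
      forall x y, x != 0 -> y != 0 -> v (x * y) = v x + v y,
      forall x y, x != 0 -> y != 0 -> x + y != 0 ->
        Order.min (v x) (v y) <= v (x + y)
    & forall n : int, exists2 x, x != 0 & v x = n].

Section DivisorClassGroup.
Variable K : fieldType.

(* For K a finite extension of Q these are the finite primes of K.  For K a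
   finite extension of F_p(T) these are all the places of K, that is, the
   closed points of the complete smooth curve with function field K:
   valuations are trivial on the finite field of constants. *)
Record place := Place {
  place_val :> K -> int;
  place_valP : `[< discrete_valuation place_val >] }.

HB.instance Definition _ := [isSub for place_val].
HB.instance Definition _ := [Choice of place by <:].

Lemma place_dval (v : place) : discrete_valuation v.
Proof. exact: (elimT (asboolP _) (place_valP v)). Qed.

Definition divisor := {freeg place / int}.

Definition principal_divisor : {pred divisor} :=
  [pred D : divisor |
    `[< exists2 f : K, f != 0 & forall v : place, coeff v D = v f >]].

Lemma principal_divisorP (D : divisor) :
  reflect (exists2 f : K, f != 0 & forall v : place, coeff v D = v f)
          (D \in principal_divisor).
Proof. exact: asboolP. Qed.

Lemma principal_divisor_zmod : zmod_closed principal_divisor.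
Proof.
have v1 (v : place) : v 1 = 0.
  have [_ vM _ _] := place_dval v.
  apply: (addrI (v 1)); rewrite -vM ?oner_eq0 // mulr1.
  by rewrite addr0.
split.
  apply/principal_divisorP; exists 1; first by rewrite oner_eq0.
  by move=> v; rewrite coeff0 v1.
move=> D E /principal_divisorP[f f0 Df] /principal_divisorP[g g0 Eg].
apply/principal_divisorP; exists (f / g); first by rewrite mulf_neq0 ?invr_eq0.
move=> v; have [_ vM _ _] := place_dval v.
rewrite coeffB Df Eg vM ?invr_eq0 //; congr (_ + _).
by apply/eqP; rewrite eq_sym -addr_eq0 -vM ?invr_eq0 // mulVf // v1.
Qed.

HB.instance Definition _ :=
  GRing.isZmodClosed.Build divisor principal_divisor principal_divisor_zmod.

Definition divisor_class_group : zmodType := Quotient.quot principal_divisor.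

End DivisorClassGroup.

(* Pic of the complete smooth curve with function field K, as its group of
   Weil divisors modulo linear equivalence. *)
Definition Pic (p : nat) (K : fieldExtType {fraction {poly 'F_p}}) : zmodType :=
  divisor_class_group K.

(* Every place w of L has ramification index [w(L^x) : w(K^x)] = 1, where ^x
   denotes the nonzero elements.  Residue fields are finite for the fields
   considered here, hence residue extensions are separable. *)
Definition unramified_over (F : fieldType) (L : fieldExtType F)
    (K : {subfield L}) : Prop :=
  forall w : place L,
    [set w x | x in [set x : L | x \in K /\ x != 0]] =
    [set w x | x in [set x : L | x != 0]].

(* K is Galois over F wherever this is used, so being linearly disjoint from
   F(mu_l) over F amounts to K :&: F(mu_l) = F.  The intersection is formed
   inside some extension M of F that contains both L and F(mu_l). *)
Definition disjoint_from_Fmu (F : fieldType) (L : fieldExtType F) (l : nat)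
    (K : {subfield L}) : Prop :=
  exists (M : fieldExtType F) (iota : 'AHom(L, M)) (z : M),
    l.-primitive_root z /\ (iota @: K :&: <<1; z>>)%AS = 1%AS.

Inductive galois_case :=
  | DihedralCase of nat
  | SemidirectCase of nat & nat.

Definition case_l (c : galois_case) : nat :=
  match c with DihedralCase l => l | SemidirectCase l _ => l end.

Definition case_r (c : galois_case) : nat :=
  match c with DihedralCase _ => 2%N | SemidirectCase _ r => r end.

Definition case_ok (c : galois_case) : Prop :=
  match c with
  | DihedralCase l => prime l /\ odd l
  | SemidirectCase l r =>
      [/\ prime l, odd l, prime r, odd r & l = 1%N %[mod r]]
  end.

Definition case_group (c : galois_case) (gT : finGroupType) (G : {group gT}) : Prop :=
  match c with
  | DihedralCase l => (G \isog 'D_(2 * l))%g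
  | SemidirectCase l r =>
      exists2 z : {unit 'F_l}, #[z]%g = r &
        (G \isog Grp (s : t :
           s ^+ r, t ^+ l, s * t * s^-1 = t ^+ (nat_of_ord (val z))))%g
  end.

Definition case_fields (c : galois_case) (F : fieldType) (L : splittingFieldType F)
    (K1 K2 : {subfield L}) : Prop :=
  [/\ galois 1 {:L}, case_group c 'Gal({:L} / 1)%G,
      \dim K1 = case_l c & \dim K2 = case_r c].

(* SpecZ stands for Spec Z[1/l], and P1 b for the projective line over some
   F_p with p != l, b telling whether mu_l is contained in F_p. *)
Inductive base_scheme := SpecZ | P1 of bool.

Definition has_mu (l p : nat) : bool := [exists z : 'F_p, l.-primitive_root z].

(* Total recursive functions of a list of arguments, missing ones being 0. *)
Inductive recursive : (seq nat -> nat) -> Prop :=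
  | rec_zero : recursive (fun=> 0%N)
  | rec_succ : recursive (fun s => (nth 0%N s 0).+1)
  | rec_proj i : recursive (fun s => nth 0%N s i)
  | rec_comp n f (g : nat -> seq nat -> nat) :
      recursive f -> (forall i, (i < n)%N -> recursive (g i)) ->
      recursive (fun s => f (mkseq (g^~ s) n))
  | rec_prim f g :
      recursive f -> recursive g ->
      recursive (fun s =>
        nat_rect (fun=> nat) (f (behead s)) (fun n m => g (n :: m :: behead s))
          (nth 0%N s 0))
  | rec_min f (f0 : forall s, exists n, f (n :: s) == 0%N) :
      recursive f -> recursive (fun s => ex_minn (f0 s))
  | rec_ext f g : f =1 g -> recursive f -> recursive g.

Definition case_code (c : galois_case) : seq nat :=
  match c with DihedralCase l => [:: 0; l; 0]%N | SemidirectCase l r => [:: 1; l; r]%N end.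

Definition base_code (b : base_scheme) : nat :=
  match b with SpecZ => 0%N | P1 false => 1%N | P1 true => 2%N end.

Definition computable (C : galois_case -> base_scheme -> rat) : Prop :=
  exists f g h : seq nat -> nat,
    [/\ recursive f, recursive g, recursive h &
        forall c b, let s := rcons (case_code c) (base_code b) in
          C c b = ((f s)%:R - (g s)%:R) / (h s).+1%:R].

(* Main.v *)
(* Write G = <sigma, tau> with tau of order l and sigma of order r acting on <tau> through a
   character of order r, so that K2 and K1 are the fixed fields of tau and sigma, and let
   n = l r.  Let A, B, C be the class groups of the integral closures in L, K2, K1 of the base
   ring Z or F_p[T].  For number fields they are the class groups; for function fields they
   are quotients of the Picard groups by the classes of at most n places at infinity, which
   changes l-ranks by at most n.

   Since r is prime to l, C[l] is the subgroup of A[l] fixed by sigma.  Since L / K2 is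
   unramified, Hilbert 90 embeds the kernel and the cokernel of B -> A^tau into units modulo
   l-th powers, and these are bounded by l^(n+1).  The norms from A have index at most l in B:
   otherwise l^2 characters of B would be trivial on norms, and letting s tend to 1 in the
   Euler products of their L-functions and of the zeta function of L, whose pole is simple,
   gives a contradiction.  Hence A^tau / (1 + tau + ... + tau^(l-1)) A has bounded order.

   Now tau - 1 shifts the eigenspaces of sigma in A[l], because sigma tau = tau^z sigma.
   Filtering the eigenspaces by the powers of tau - 1, the bound on the norm quotient controls
   the part of A[l]^tau in one eigenspace by its parts in the preceding ones, the first of
   which lies in A[l]^sigma = C[l].  This yields the lower bound on C[l]; the upper bound is
   |A[l]| <= |A[l]^tau|^l. *)

Require Import Defs.
From HB Require Import structures.
From mathcomp Require Import all_boot all_order all_algebra.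
From mathcomp Require Import all_fingroup all_solvable all_field.
From mathcomp Require Import boolp classical_sets.
From mathcomp.multinomials Require Import freeg.
From mathcomp Require Import complex reals Rstruct exp.
From mathcomp Require Import zify ring lra.

Set Implicit Arguments.
Unset Strict Implicit.
Unset Printing Implicit Defensive.

Import Order.TTheory GRing.Theory Num.Theory.
Local Open Scope ring_scope.

(** * Valuations and Dedekind domains *)

(** Number fields and function fields are treated at once: what is used of either is finiteness of
    quotients, a product formula and counts of points in boxes, the absolute values being one
    absolute value of L composed with the Galois group.

    In the analytic step let pi be the product of 1 - N(v)^-(1+e) over the places v, from a finite
    set, whose class is a norm. At most l places of L lie above each such v, and all other places
    contribute a bounded factor, so the pole of the zeta function of L gives pi^l = O(e). Of the l^2
    L-functions only the trivial one is unbounded, of size 1/e; hence e = O(pi^(l^2)) = O(e^l),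
    which fails for small e since l >= 2. Truncation to finite sets of places keeps every product
    finite.

    In a finite module, ker N / (tau - 1) has the same order as the fixed elements modulo norms. So
    the bound on the norm quotient also says that, up to bounded index, an element of norm 0 can be
    divided by tau - 1, and this is what climbs the filtration. Each eigenspace is then bounded by
    the product of the preceding ones; the exponents double at every stage, whence the 2^r in C1 and
    C2. *)

Section ValuationTheory.
Variable K : fieldType.
Implicit Types (v w : place K) (x y : K) (n : int).
Local Open Scope classical_set_scope.

Lemma val0 v : v 0 = 0.
Proof. by case: (place_dval v). Qed.

Lemma valM v x y : x != 0 -> y != 0 -> v (x * y) = v x + v y.
Proof. by case: (place_dval v) => _ + _ _; apply. Qed.

Lemma val1 v : v 1 = 0.
Proof. by apply: (addrI (v 1)); rewrite -valM ?oner_eq0 // mulr1 addr0. Qed.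

Lemma valV v x : v x^-1 = - v x.
Proof.
have [->|x0] := eqVneq x 0; first by rewrite invr0 val0 oppr0.
by apply/eqP; rewrite -addr_eq0 -valM ?invr_eq0 // mulVf // val1.
Qed.

Lemma valf v x y : x != 0 -> y != 0 -> v (x / y) = v x - v y.
Proof. by move=> x0 y0; rewrite valM ?invr_eq0 // valV. Qed.

Lemma valX v x k : v (x ^+ k) = v x *+ k.
Proof.
have [->|x0] := eqVneq x 0.
  by case: k => [|k]; rewrite ?expr0 ?val1 ?mulr0n // exprS mul0r val0 mul0rn.
elim: k => [|k IH]; first by rewrite val1.
by rewrite exprS valM ?expf_neq0 // IH mulrS.
Qed.

Lemma valXz v x (k : int) : v (x ^ k) = k * v x.
Proof. by case: k => n; rewrite ?NegzE -?exprnN -?exprnP ?valV ?valX -mulr_natl ?natz ?mulNr. Qed.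

Lemma valN v x : v (- x) = v x.
Proof.
have [->|x0] := eqVneq x 0; first by rewrite oppr0.
rewrite -mulN1r valM ?oppr_eq0 ?oner_eq0 //.
suff -> : v (-1) = 0 by rewrite add0r.
have : v (-1) *+ 2 = 0 by rewrite -valX sqrrN expr1n val1.
by move/eqP; rewrite mulrn_eq0 => /eqP.
Qed.

Lemma val_surj v n : exists2 x, x != 0 & v x = n.
Proof. by case: (place_dval v). Qed.

(* The valuation of 0 should be infinite, but [place_val] sends 0 to 0. *)
Definition vge v n x := (x == 0) || (n <= v x).

Lemma vge0 v n : vge v n 0. Proof. by rewrite /vge eqxx. Qed.

Lemma vgeE v n x : x != 0 -> vge v n x = (n <= v x).
Proof. by move=> x0; rewrite /vge (negPf x0). Qed.

Lemma vge_le v n m x : m <= n -> vge v n x -> vge v m x.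
Proof. by rewrite /vge => mn /orP[->//|h]; rewrite (le_trans mn h) orbT. Qed.

Lemma vgeN v n x : vge v n (- x) = vge v n x.
Proof. by rewrite /vge oppr_eq0 valN. Qed.

Lemma vgeD v n x y : vge v n x -> vge v n y -> vge v n (x + y).
Proof.
rewrite /vge; have [->|x0] := eqVneq x 0; first by rewrite add0r.
have [->|y0] := eqVneq y 0; first by rewrite addr0 (negPf x0).
have [//|xy0] := eqVneq (x + y) 0 => /= hx hy.
case: (place_dval v) => _ _ h _; apply: le_trans (h _ _ x0 y0 xy0).
by rewrite le_min hx.
Qed.

Lemma vgeB v n x y : vge v n x -> vge v n y -> vge v n (x - y).
Proof. by move=> hx hy; apply: vgeD; rewrite ?vgeN. Qed.

Lemma vgeM v n m x y : vge v n x -> vge v m y -> vge v (n + m) (x * y).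
Proof.
rewrite /vge mulf_eq0; have [//|x0] := eqVneq x 0.
by have [//|y0] := eqVneq y 0 => /= hx hy; rewrite valM // lerD.
Qed.

Lemma vge_sum v n (I : Type) (r : seq I) (P : pred I) (F : I -> K) :
  (forall i, P i -> vge v n (F i)) -> vge v n (\sum_(i <- r | P i) F i).
Proof. by move=> h; elim/big_ind: _ => //; [exact: vge0|move=> x y; exact: vgeD]. Qed.

Lemma vge_prod v (I : Type) (r : seq I) (P : pred I) (F : I -> K) :
  (forall i, P i -> vge v 0 (F i)) -> vge v 0 (\prod_(i <- r | P i) F i).
Proof.
move=> h; elim/big_ind: _ => //; first by rewrite /vge val1 lexx orbT.
by move=> x y hx hy; rewrite -[0]addr0; exact: vgeM.
Qed.

(** The ultrametric inequality in both directions: an error of valuation strictly above that of [x]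
    changes neither nonvanishing nor the valuation. *)
Lemma val_close v x y : x != 0 -> vge v (v x + 1) (y - x) -> y != 0 /\ v y = v x.
Proof.
move=> x0 h.
have y0 : y != 0.
  by apply/eqP => y0; move: h; rewrite y0 sub0r vgeN vgeE //; lia.
split=> //; apply: le_anti.
have h1 : vge v (v x) y.
  have -> : y = (y - x) + x by ring.
  by apply: vgeD; [apply: vge_le h; lia | rewrite vgeE].
rewrite vgeE // in h1; rewrite h1 andbT leNgt; apply/negP => h2.
have : vge v (v x + 1) x.
  rewrite -[X in vge v _ X](_ : y - (y - x) = x); last by ring.
  by apply: vgeB => //; rewrite vgeE //; lia.
by rewrite vgeE //; lia.
Qed.

Lemma placeP v w : (forall x, v x = w x) -> v = w.
Proof. by move=> h; apply: val_inj; apply: funext. Qed.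

(* Junk if [f] is not finitely supported. *)
Definition divf (f : place K -> int) : divisor K :=
  xget 0 [set D : divisor K | forall v, coeff v D = f v].

Lemma divfE f (s : seq (place K)) : (forall v, f v != 0 -> v \in s) ->
  forall v, coeff v (divf f) = f v.
Proof.
move=> hs; rewrite /divf; case: xgetP => [D _ //|/(_ (\sum_(w <- undup s) << f w *g w >>)) []].
move=> v /=; rewrite raddf_sum /=.
under eq_bigr do rewrite coeffU.
have [vs|vs] := boolP (v \in undup s).
  rewrite (bigD1_seq v) ?undup_uniq //= eqxx mulr1 big1 ?addr0 // => w /negPf ->.
  by rewrite mulr0.
rewrite big1_seq; last first.
  move=> w /andP[_ ws]; case: eqP => [wv|_]; last by rewrite mulr0.
  by rewrite wv (negPf vs) in ws.
by apply/esym/eqP; apply: contraNT vs => /hs; rewrite mem_undup.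
Qed.

Lemma divP (D E : divisor K) : (forall v, coeff v D = coeff v E) -> D = E.
Proof. by move=> h; apply/eqP/freeg_eqP. Qed.

End ValuationTheory.

Section FiniteClassical.
Local Open Scope classical_set_scope.

Lemma pigeonhole (T : eqType) (f : nat -> T) (r : seq T) : (forall k, f k \in r) ->
  exists i j, [/\ (i < j)%N, (j <= size r)%N & f i = f j].
Proof.
move=> h; have : ~~ uniq (mkseq f (size r).+1).
  apply/negP => u; have : (size (mkseq f (size r).+1) <= size r)%N.
    by apply: uniq_leq_size u _ => _ /mapP[k _ ->].
  by rewrite size_mkseq ltnn.
move=> /(uniqPn (f 0)) [i [j [ij]]]; rewrite size_mkseq ltnS => jr.
by rewrite !nth_mkseq ?ltnS // ?(leq_trans (ltnW ij)) // => e; exists i, j.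
Qed.

(** [k] boolean tests that separate the elements leave at most 2^k of them. The tests will be the
    membership of given residues in a prime, or the values of given coefficients. *)
Lemma finite_by_mask (T : choiceType) (X : set T) (k : nat) (m : T -> 'I_k -> bool) :
  (forall x y, X x -> X y -> m x =1 m y -> x = y) ->
  exists s : seq T, forall x, X x -> x \in s.
Proof.
move=> inj; case: (pselect (exists x, X x)) => [[x0 _]|no]; last first.
  by exists [::] => x Xx; case: no; exists x.
exists [seq xget x0 [set x | X x /\ m x =1 (b : {ffun 'I_k -> bool})] | b <- enum {ffun 'I_k -> bool}].
move=> x Xx; apply/mapP; exists [ffun i => m x i]; first by rewrite mem_enum.
case: xgetP => [y _ [Xy h]|/(_ x) []]; last by split=> // i; rewrite ffunE.
by apply: inj => // i; rewrite h ffunE.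
Qed.

End FiniteClassical.

(** * Places of a Dedekind domain and its maximal ideals *)

Section Dedekind.
Variable K : fieldType.
Local Open Scope classical_set_scope.

(* A Dedekind domain with finite quotients and fraction field [K].  Integral
   closedness is only required for the equations [x ^+ j = x ^+ i + c], the
   only ones that arise from the pigeonhole principle. *)
Record dedekind (O : set K) : Prop := Dedekind {
  ded1 : O 1;
  dedB : forall x y, O x -> O y -> O (x - y);
  dedM : forall x y, O x -> O y -> O (x * y);
  ded_frac : forall x, exists a b, [/\ O a, O b, b != 0 & x = a / b];
  ded_int : forall x i j, (i < j)%N -> O (x ^+ j - x ^+ i) -> O x;
  ded_fin : forall a, O a -> a != 0 ->
    exists s : seq K, forall x, O x -> exists2 y, y \in s & O ((x - y) / a) }.

Variables (O : set K) (dO : dedekind O).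
Implicit Types (v w : place K) (x y : K) (I J P : set K).

Let O1 := ded1 dO.
Let OB := dedB dO.
Let OM := dedM dO.
Lemma ded0 : O 0. Proof. by rewrite -(subrr 1); exact: OB. Qed.
Lemma dedN x : O x -> O (- x). Proof. by rewrite -sub0r; apply: OB ded0. Qed.
Lemma dedD x y : O x -> O y -> O (x + y).
Proof. by move=> Ox Oy; rewrite -[y]opprK; apply: OB => //; exact: dedN. Qed.
Lemma dedX x k : O x -> O (x ^+ k).
Proof. by move=> Ox; elim: k => [|k IH]; rewrite ?expr0 ?exprS //; exact: OM. Qed.
Lemma ded_prod (I : Type) (r : seq I) (P : pred I) (F : I -> K) :
  (forall i, P i -> O (F i)) -> O (\prod_(i <- r | P i) F i).
Proof. by move=> h; apply: big_ind. Qed.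
Lemma ded_sum (I : Type) (r : seq I) (P : pred I) (F : I -> K) :
  (forall i, P i -> O (F i)) -> O (\sum_(i <- r | P i) F i).
Proof. by move=> h; apply: big_ind => //; [exact: ded0|exact: dedD]. Qed.

Definition ideal I : Prop :=
  [/\ I 0, forall x y, I x -> I y -> I (x - y),
      forall a x, O a -> I x -> I (a * x) & I `<=` O].

Lemma idealD I x y : ideal I -> I x -> I y -> I (x + y).
Proof.
move=> [I0 IB _ _] Ix Iy; rewrite -[y]opprK; apply: (IB _ _ Ix).
by rewrite -sub0r; exact: IB.
Qed.

Lemma ideal_pmul I x : ideal I -> I x -> forall a, O a -> I (x * a).
Proof. by move=> [_ _ IM _] Ix a Oa; rewrite mulrC; exact: IM. Qed.

(** With [s] a list of residues modulo some [a], this measures the ideals containing [a]; extremal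
    choices for it take the place of Noetherian induction. *)
Definition mu (s : seq K) I := count (fun y => `[< I y >]) s.

Let covers a (s : seq K) := forall x, O x -> exists2 y, y \in s & O ((x - y) / a).

(** An ideal containing [a] is a union of classes modulo [a], so an element of [J] outside [I] has a
    representative counted for [J] but not for [I]. *)
Lemma mu_sub a s I J : a != 0 -> covers a s -> ideal I -> ideal J ->
  I a -> I `<=` J -> (mu s J <= mu s I)%N -> J `<=` I.
Proof.
move=> a0 cs iI iJ Ia IJ le x Jx.
have [IO JO] : I `<=` O /\ J `<=` O by split; [case: iI|case: iJ].
have [y ys Oy] := cs x (JO _ Jx).
have xy : I (x - y) by rewrite -(divfK a0 (x - y)); case: iI => _ _ IM _; exact: IM.
have Jy : J y by have -> : y = x - (x - y) by [ring]; case: iJ => _ JB _ _; apply: JB => //; exact: IJ.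
suff Iy : I y by have -> : x = (x - y) + y by [ring]; exact: idealD.
apply: contrapT => nIy.
have : (mu s I < mu s J)%N; last by rewrite ltnNge le.
have -> : mu s J = (mu s I + count (fun y => `[< J y >] && ~~ `[< I y >]) s)%N.
  rewrite /mu -(count_predUI (fun y => `[< I y >])) [X in (_ + X)%N](eq_count (a2 := pred0)) ?count_pred0 ?addn0.
    apply: eq_count => z /=; case: (boolP `[< I z >]) => //= [/asboolP /IJ Jz|]; first exact/asboolP.
    by rewrite andbT.
  by move=> z /=; case: `[< I z >]; rewrite /= ?andbF.
rewrite -[X in (X < _)%N]addn0 ltn_add2l -has_count; apply/hasP; exists y => //.
by apply/andP; split; [exact/asboolP|apply/asboolP].
Qed.

Definition maximal P := [/\ ideal P, ~ P 1 & forall Q, ideal Q -> ~ Q 1 -> P `<=` Q -> Q `<=` P].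

Lemma ex_maximal I a : ideal I -> ~ I 1 -> I a -> a != 0 ->
  exists2 P, maximal P & I `<=` P.
Proof.
move=> iI nI1 Ia a0; have Oa : O a by case: iI => _ _ _; apply.
have [s cs] := ded_fin dO Oa a0.
pose Q n := `[< exists P, [/\ ideal P, ~ P 1, I `<=` P & mu s P = n] >].
have exQ : exists n, Q n by exists (mu s I); apply/asboolP; exists I; split=> //.
have bQ n : Q n -> (n <= size s)%N by move=> /asboolP[P [_ _ _ <-]]; exact: count_size.
case: (ex_maxnP exQ bQ) => n /asboolP[P [iP nP1 IP <-]] maxP.
exists P => //; split=> // J iJ nJ1 PJ.
apply: (mu_sub a0 cs iP iJ (IP _ Ia) PJ).
by apply: maxP; apply/asboolP; exists J; split=> // x /IP /PJ.
Qed.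

Section Maximal.
Variables (P : set K) (mP : maximal P).
Let iP : ideal P. Proof. by case: mP. Qed.
Let P1 : ~ P 1. Proof. by case: mP. Qed.
Let PO : P `<=` O. Proof. by case: iP. Qed.
Let P0 : P 0. Proof. by case: iP. Qed.
Let PB : forall x y, P x -> P y -> P (x - y). Proof. by case: iP. Qed.
Let PM : forall a x, O a -> P x -> P (a * x). Proof. by case: iP. Qed.

Lemma max_inv x : O x -> ~ P x -> exists2 y, O y & P (1 - x * y).
Proof.
move=> Ox nPx; pose Q := [set z | exists p y, [/\ P p, O y & z = p + x * y]].
have iQ : ideal Q.
  split.
  - by exists 0, 0; rewrite mulr0 addr0; split=> //; exact: ded0.
  - move=> _ _ [p [y [Pp Oy ->]]] [q [z [Pq Oz ->]]].
    by exists (p - q), (y - z); split; [exact: PB|exact: OB|ring].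
  - move=> a _ Oa [p [y [Pp Oy ->]]]; exists (a * p), (a * y).
    by split; [exact: PM|exact: OM|ring].
  - by move=> _ [p [y [Pp Oy ->]]]; apply: dedD; [exact: PO|exact: OM].
have [[p [y [Pp Oy e]]]|nQ1] := pselect (Q 1).
  by exists y => //; rewrite e addrK.
case: mP => _ _ /(_ Q iQ nQ1) h; case: nPx; apply: h.
  by move=> p Pp; exists p, 0; rewrite mulr0 addr0; split=> //; exact: ded0.
by exists 0, 1; rewrite mulr1 add0r.
Qed.

Lemma max_prime x y : O x -> O y -> P (x * y) -> P x \/ P y.
Proof.
move=> Ox Oy Pxy; case: (pselect (P x)) => [|nPx]; first by left.
right; have [z Oz Pz] := max_inv Ox nPx.
have -> : y = y * (1 - x * z) + z * (x * y) by ring.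
by apply: (idealD iP); apply: PM.
Qed.

Lemma max_primeN x y : O x -> O y -> ~ P x -> ~ P y -> ~ P (x * y).
Proof. by move=> Ox Oy nx ny /(max_prime Ox Oy)[]. Qed.

Lemma max_N1 p : P p -> O (1 - p) /\ ~ P (1 - p).
Proof.
move=> Pp; split; first by apply: OB => //; exact: PO.
by move=> Pq; apply: P1; rewrite -[1](subrK p); exact: (idealD iP).
Qed.

Variables (a : K).
Hypotheses (Pa : P a) (a0 : a != 0).
Let Oa : O a := PO Pa.

(* An element outside [P] killing modulo [a] whatever is killed by some element
   outside [P]: up to the nilpotents it is the idempotent cutting out the local
   factor of [O / a O] at [P]. *)
Lemma max_local_elt : exists s, [/\ O s, ~ P s &
  forall z t, O z -> O t -> ~ P t -> O (t * z / a) -> O (s * z / a)].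
Proof.
have [r cr] := ded_fin dO Oa a0.
have ht z : exists t, [/\ O t, ~ P t & forall t', O t' -> ~ P t' -> O (t' * z / a) -> O (t * z / a)].
  case: (pselect (exists t, [/\ O t, ~ P t & O (t * z / a)])) => [[t [Ot nt h]]|no].
    by exists t.
  by exists 1; split=> // t' Ot' nt' h; case: no; exists t'.
pose T z := projT1 (cid (ht z)); pose hT z := projT2 (cid (ht z)).
have OT z : O (T z) by case: (hT z).
have nPprod (q : seq K) : ~ P (\prod_(z <- q) T z).
  elim: q => [|z q IH]; first by rewrite big_nil.
  by rewrite big_cons; apply: max_primeN => //; [exact: ded_prod|case: (hT z)].
exists (\prod_(z <- r) T z); split=> //; first exact: ded_prod.
move=> z t Oz Ot nt Otz; have [y yr Oy] := cr z Oz.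
have Oy' : O y.
  have -> : y = z - (z - y) / a * a by rewrite divfK //; ring.
  by apply: OB => //; exact: OM.
have hTy : O (T y * y / a).
  case: (hT y) => _ _ /(_ t); rewrite -/(T y); apply=> //.
  have -> : t * y / a = t * z / a - t * ((z - y) / a) by ring.
  by apply: OB => //; exact: OM.
rewrite (big_rem y) //=; set S := \prod_(_ <- _) _.
have -> : T y * S * z / a = T y * S * ((z - y) / a) + S * (T y * y / a) by ring.
have OS : O S by exact: ded_prod.
by apply: dedD; apply: OM => //; exact: OM.
Qed.

(** Among the multiples of [s] that [a] does not divide, take one that generates with [a] the
    smallest ideal. If some [p] in [P] did not kill it modulo [a], its multiple by [p] would
    generate the same ideal; then some [1 - p * u], which lies outside [P], would kill it, against
    the choice of [s]. *)
Lemma max_socle : exists y, [/\ O y, ~ O (y / a) & forall p, P p -> O (y * p / a)].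
Proof.
have [s [Os nPs hs]] := max_local_elt.
have [r cr] := ded_fin dO Oa a0.
pose Jd y := [set z | exists u w : K, [/\ O u, O w & z = y * u + a * w]].
have iJ y : O y -> ideal (Jd y).
  move=> Oy; split.
  - by exists 0, 0; rewrite !mulr0 addr0; split=> //; exact: ded0.
  - move=> _ _ [u [w [Ou Ow ->]]] [u' [w' [Ou' Ow' ->]]].
    by exists (u - u'), (w - w'); split; [exact: OB|exact: OB|ring].
  - move=> b _ Ob [u [w [Ou Ow ->]]]; exists (b * u), (b * w).
    by split; [exact: OM|exact: OM|ring].
  - by move=> _ [u [w [Ou Ow ->]]]; apply: dedD; exact: OM.
pose good y := exists2 z, O z & y = s * z.
pose Q n := `[< exists y, [/\ good y, ~ O (y / a) & mu r (Jd y) = n] >].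
have exQ : exists n, Q n.
  exists (mu r (Jd s)); apply/asboolP; exists s; split=> //; first by exists 1; rewrite ?mulr1.
  by move=> Osa; apply: nPs; rewrite -(divfK a0 s); exact: PM.
case: (ex_minnP exQ) => n /asboolP[_ [[z Oz ->] nsz <-]] minQ.
exists (s * z); split=> //; first exact: OM.
move=> p Pp; apply: contrapT => nO; have Op := PO Pp.
have Oy : O (s * z) by exact: OM.
have Oyp : O (s * z * p) by exact: OM.
have /(mu_sub a0 cr (iJ _ Oyp) (iJ _ Oy)) sub : Jd (s * z * p) a.
  by exists 0, 1; split; [exact: ded0|exact: O1|rewrite mulr0 mulr1 add0r].
have : Jd (s * z * p) (s * z).
  apply: sub; last by exists 1, 0; split; [exact: O1|exact: ded0|rewrite mulr1 mulr0 addr0].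
    move=> _ [u [w [Ou Ow ->]]]; exists (p * u), w; split=> //; first exact: OM.
    by rewrite mulrA.
  apply: minQ; apply/asboolP; exists (s * z * p); split=> //.
  by exists (z * p); [exact: OM|rewrite mulrA].
move=> [u [w [Ou Ow e]]]; apply: nsz.
have [Oq nPq] : O (1 - p * u) /\ ~ P (1 - p * u) by apply: max_N1; exact: (ideal_pmul iP).
apply: (hs z ((1 - p * u) * s)) => //; [exact: OM|exact: max_primeN|].
have -> : (1 - p * u) * s * z = a * w by rewrite -mulrA mulrBl mul1r {1}e; ring.
by rewrite mulrAC divff // mul1r.
Qed.

(** The classical proof that a prime is invertible: [x] = [y / a] multiplies [P] into [O] without
    lying in [O]. If it takes some [pi] of [P] outside [P], then [pi] generates [P] up to elements
    outside [P]. If it maps [P] into itself, all [x ^+ k * a] lie in [O], two of them agree modulo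
    [a], and integral closedness puts [x] in [O]. *)
Lemma max_uniformizer : exists pi, P pi /\ pi != 0 /\
  forall p, P p -> exists u z, [/\ O u, ~ P u, O z & p * u = pi * z].
Proof.
have [y [Oy nya hy]] := max_socle; pose x := y / a.
have xP p : P p -> O (x * p) by move=> Pp; rewrite /x mulrAC; exact: hy.
have [[pi Ppi nPx]|all] := pselect (exists2 pi, P pi & ~ P (x * pi)).
  exists pi; split=> //; split.
    by apply: contra_notN nPx => /eqP ->; rewrite mulr0.
  move=> p Pp; exists (x * pi), (x * p); split=> //; [exact: xP|exact: xP|ring].
case: nya; rewrite -/x.
have Pxk k : P (x ^+ k * a).
  elim: k => [|k IH]; first by rewrite expr0 mul1r.
  by rewrite exprS -mulrA; apply: contrapT => h; apply: all; exists (x ^+ k * a).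
have [r cr] := ded_fin dO Oa a0.
have fP k : {z | z \in r /\ O ((x ^+ k * a - z) / a)}.
  by apply/cid; have [z zr Oz] := cr _ (PO (Pxk k)); exists z.
have [i [j [ij _ e]]] := pigeonhole (fun k => proj1 (projT2 (fP k))).
apply: (ded_int dO ij).
have [_ hi] := projT2 (fP i); have [_ hj] := projT2 (fP j).
have -> : x ^+ j - x ^+ i = (x ^+ j * a - projT1 (fP j)) / a - (x ^+ i * a - projT1 (fP i)) / a.
  by rewrite e -mulrBl opprB addrA subrK -mulrBl mulfK.
exact: OB.
Qed.

Section Uniformizer.
Variable pi : K.
Hypotheses (Ppi : P pi) (pi0 : pi != 0)
  (hpi : forall p, P p -> exists u z, [/\ O u, ~ P u, O z & p * u = pi * z]).

Let vrep x (k : int) := exists t z, [/\ O t, ~ P t, O z, ~ P z & t * x = pi ^ k * z].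

Let nP0 t : ~ P t -> t != 0. Proof. by apply: contra_notN => /eqP ->. Qed.

(** The exponent is the last [k] for which [x] lies in [Pk k]. There is one: these ideals descend,
    so if all of them contained [x], their size modulo [x] would be minimal at some [k]; then [Pk k]
    would equal [Pk k.+1], and [pi ^+ k] in the latter would put an element outside [P] into
    [pi O]. *)
Let vrep_ex x : O x -> x != 0 -> exists k : nat, vrep x k.
Proof.
move=> Ox x0; have [r cr] := ded_fin dO Ox x0.
pose Pk (k : nat) := [set y | O y /\ exists t z, [/\ O t, ~ P t, O z & t * y = pi ^+ k * z]].
have iPk k : ideal (Pk k).
  split.
  - by split; [exact: ded0|exists 1, 0; rewrite !mulr0; split=> //; exact: ded0].
  - move=> y y' [Oy [t [z [Ot nt Oz e]]]] [Oy' [t' [z' [Ot' nt' Oz' e']]]].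
    split; first exact: OB.
    exists (t * t'), (t' * z - t * z'); split; [exact: OM|exact: max_primeN|by apply: OB; exact: OM|].
    have -> : t * t' * (y - y') = t' * (t * y) - t * (t' * y') by ring.
    by rewrite e e'; ring.
  - move=> b y Ob [Oy [t [z [Ot nt Oz e]]]]; split; first exact: OM.
    by exists t, (b * z); split=> //; [exact: OM|rewrite mulrCA e mulrCA].
  - by move=> y [].
have nall : exists k : nat, ~~ `[< Pk k x >].
  apply: contrapT => all; have {}all k : Pk k x.
    by apply: contrapT => h; apply: all; exists k; apply/asboolPn.
  have exQ : exists n, `[< exists k, mu r (Pk k) = n >] by exists (mu r (Pk 0)); apply/asboolP; exists 0%N.
  case: (ex_minnP exQ) => n /asboolP[k <-] minQ.
  have sub : Pk k `<=` Pk k.+1.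
    apply: (mu_sub x0 cr) => //; last by apply: minQ; apply/asboolP; exists k.+1.
    move=> y [Oy [t [z [Ot nt Oz e]]]]; split=> //; exists t, (pi * z).
    by split=> //; [apply: OM => //; exact: PO|rewrite e exprSr mulrA].
  have [|_ [t [z [Ot nt Oz e]]]] := sub (pi ^+ k).
    by split; [apply: dedX; exact: PO|exists 1, 1; rewrite mul1r mulr1].
  apply: nt; suff -> : t = pi * z by exact: (ideal_pmul iP).
  by apply: (mulIf (expf_neq0 k pi0)); rewrite e exprS; ring.
case: (ex_minnP nall) => -[|k] /asboolPn nk mink.
  by case: nk; split=> //; exists 1, x; rewrite expr0 !mul1r.
have /negPn/asboolP [_ [t [z [Ot nt Oz e]]]] : ~~ ~~ `[< Pk k x >].
  by apply/negP => /mink; rewrite ltnn.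
exists k, t, z; split=> // Pz; apply: nk; split=> //.
have [u [z' [Ou nu Oz' e']]] := hpi Pz.
exists (t * u), z'; split=> //; [exact: OM|exact: max_primeN|].
by rewrite mulrAC e -mulrA e' exprSr mulrA.
Qed.

Let vrep_exK x : x != 0 -> exists k : int, vrep x k.
Proof.
move=> x0; have [b [c [Ob Oc c0 e]]] := ded_frac dO x.
have b0 : b != 0 by apply: contra_neq x0 => b0; rewrite e b0 mul0r.
have [k [t [z [Ot nt Oz nz e1]]]] := vrep_ex Ob b0.
have [m [t' [z' [Ot' nt' Oz' nz' e2]]]] := vrep_ex Oc c0.
exists (k%:Z - m%:Z), (t * z'), (z * t').
split; [exact: OM|exact: max_primeN|exact: OM|exact: max_primeN|].
rewrite expfzDr // -exprnN -!exprnP e.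
have -> : t * z' * (b / c) = (t * b) * z' / c by ring.
rewrite e1 -exprnP; apply: (mulIf c0); rewrite divfK //.
have -> : pi ^+ k * (pi ^+ m)^-1 * (z * t') * c = pi ^+ k * (pi ^+ m)^-1 * z * (t' * c) by ring.
by rewrite e2 -exprnP; field; rewrite expf_neq0.
Qed.

Let vrep_le x k m : x != 0 -> vrep x k -> vrep x m -> (m <= k)%R.
Proof.
move=> x0 [t [z [Ot nt Oz nz e]]] [t' [z' [Ot' nt' Oz' nz' e']]].
rewrite leNgt; apply/negP => km.
have [d dm] : exists d : nat, m = k + d.+1%:Z by exists (`|m - k|%N.-1); lia.
apply: (max_primeN Ot' Oz nt' nz); have -> : t' * z = pi * (pi ^+ d * (t * z')).
  apply: (mulfI (expfz_neq0 k pi0)).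
  have -> : pi ^ k * (t' * z) = t' * (pi ^ k * z) by ring.
  rewrite -e mulrCA e' dm expfzDr // -exprnP exprS; ring.
apply: (ideal_pmul iP) => //; apply: OM; last exact: OM.
by apply: dedX; exact: PO.
Qed.

Let vrep_uniq x k m : x != 0 -> vrep x k -> vrep x m -> k = m.
Proof. by move=> x0 h h'; apply/le_anti; rewrite !(vrep_le x0). Qed.

Let vfun x : int := if x == 0 then 0 else xget 0 [set k | vrep x k].

Let vfunP x : x != 0 -> vrep x (vfun x).
Proof.
move=> x0; rewrite /vfun (negPf x0); case: xgetP => // h.
by have [k /h] := vrep_exK x0.
Qed.

Let vfunE x k : x != 0 -> vrep x k -> vfun x = k.
Proof. by move=> x0; apply: vrep_uniq => //; exact: vfunP. Qed.

Let vfun_ge0 x : O x -> 0 <= vfun x.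
Proof.
move=> Ox; have [->|x0] := eqVneq x 0; first by rewrite /vfun eqxx.
by have [k /(vfunE x0) ->] := vrep_ex Ox x0.
Qed.

Let vrepM x y k m : vrep x k -> vrep y m -> vrep (x * y) (k + m).
Proof.
move=> [t [z [Ot nt Oz nz e]]] [t' [z' [Ot' nt' Oz' nz' e']]].
exists (t * t'), (z * z'); split; [exact: OM|exact: max_primeN|exact: OM|exact: max_primeN|].
by rewrite expfzDr // mulrACA e e'; ring.
Qed.

Let vfun_pi (k : int) : vfun (pi ^ k) = k.
Proof.
by apply: vfunE; [exact: expfz_neq0|exists 1, 1; rewrite mul1r mulr1].
Qed.

Let vfun_dval : discrete_valuation vfun.
Proof.
split.
- by rewrite /vfun eqxx.
- move=> x y x0 y0; apply: vfunE; first by rewrite mulf_neq0.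
  by apply: vrepM; exact: vfunP.
- move=> x y x0 y0 xy0.
  wlog le : x y x0 y0 xy0 / vfun x <= vfun y => [H|].
    case/orP: (le_total (vfun x) (vfun y)) => h; first exact: H.
    by rewrite minC addrC; apply: H => //; rewrite addrC.
  rewrite min_l //.
  have [t [z [Ot nt Oz nz e]]] := vfunP x0.
  have [t' [z' [Ot' nt' Oz' nz' e']]] := vfunP y0.
  have [d ed] : exists d : nat, vfun y = vfun x + d%:Z by exists (`|vfun y - vfun x|%N); lia.
  pose w := t' * z + pi ^+ d * (t * z').
  have ew : t * t' * (x + y) = pi ^ (vfun x) * w.
    have -> : t * t' * (x + y) = t' * (t * x) + t * (t' * y) by ring.
    by rewrite e e' ed expfzDr // /w -exprnP; ring.
  have Ow : O w.
    by apply: dedD; apply: OM => //; [apply: dedX; exact: PO|exact: OM].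
  have w0 : w != 0.
    apply: contra_neq xy0 => w0; move: ew; rewrite w0 mulr0 => /eqP.
    by rewrite !mulf_eq0 (negPf (nP0 nt)) (negPf (nP0 nt')) => /eqP.
  have [k [t2 [z2 [Ot2 nt2 Oz2 nz2 e2]]]] := vrep_ex Ow w0.
  suff /(vfunE xy0) -> : vrep (x + y) (vfun x + k%:Z) by rewrite lerDl.
  exists (t2 * (t * t')), z2; split=> //.
  + by apply: OM => //; exact: OM.
  + by apply: max_primeN => //; [exact: OM|exact: max_primeN].
  + by rewrite -mulrA ew mulrCA e2 expfzDr // mulrA.
- by move=> n; exists (pi ^ n); [exact: expfz_neq0|exact: vfun_pi].
Qed.

Let vP : place K := Place (introT (asboolP _) vfun_dval).

Lemma place_of_uniformizer : exists v : place K,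
  [/\ forall x, O x -> 0 <= v x, forall x, P x -> vge v 1 x,
      forall t, O t -> ~ P t -> v t = 0 &
      forall x, x != 0 -> exists t z, [/\ O t, ~ P t, O z, ~ P z & t * x = pi ^ (v x) * z]].
Proof.
exists vP; split; [exact: vfun_ge0| | |exact: vfunP].
- move=> x Px; rewrite /vge; have [//|x0] := eqVneq x 0.
  have [u [z [Ou nu Oz e]]] := hpi Px; have u0 := nP0 nu.
  have z0 : z != 0.
    by apply: contraNneq x0 => z0; move: e; rewrite z0 mulr0 => /eqP; rewrite mulf_eq0 (negPf u0) orbF.
  have : vfun (x * u) = vfun (pi * z) by rewrite e.
  have [_ M _ _] := vfun_dval; rewrite !M //.
  have -> : vfun u = 0 by apply: vfunE => //; exists 1, u; rewrite expr0z !mul1r; split.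
  have := vfun_pi 1; rewrite expr1z => ->; have := vfun_ge0 Oz.
  by rewrite /= addr0 => h ->; lia.
- move=> t Ot nt; apply: vfunE; first exact: nP0.
  by exists 1, t; rewrite expr0z !mul1r; split.
Qed.

End Uniformizer.

(** For the uniqueness in the last clause: such a [w] is [v] times the constant [w pi], and since
    both take the value 1, the constant is 1. *)
Lemma max_place : exists v : place K,
  [/\ forall x, O x -> 0 <= v x, forall x, P x -> vge v 1 x,
      forall t, O t -> ~ P t -> v t = 0,
      forall x, x != 0 -> 0 <= v x -> exists t, [/\ O t, ~ P t & O (t * x)] &
      forall w : place K, (forall x, P x -> vge w 1 x) ->
         (forall t, O t -> ~ P t -> w t = 0) -> w = v].
Proof.
have [pi [Ppi [pi0 hpi]]] := max_uniformizer.
have [v [h1 h2 h3 h4]] := place_of_uniformizer Ppi pi0 hpi.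
exists v; split=> //.
  move=> x x0 vx; have [t [z [Ot nt Oz nz e]]] := h4 x x0.
  exists t; split=> //; rewrite e; apply: OM => //.
  by move: vx; case: (v x) => // n _; apply: dedX; exact: PO.
move=> w w1 w2.
have nz t : ~ P t -> t != 0 by apply: contra_notN => /eqP ->.
have wpi k : w (pi ^ k) = k * w pi by exact: valXz.
have wv x : w x = v x * w pi.
  have [->|x0] := eqVneq x 0; first by rewrite !val0 mul0r.
  have [t [z [Ot nt Oz nzz e]]] := h4 x x0.
  have : w (t * x) = w (pi ^ (v x) * z) by rewrite e.
  by rewrite valM ?(nz _ nt) // valM ?(nz _ nzz) ?expfz_neq0 // wpi (w2 _ Ot nt) (w2 _ Oz nzz) add0r addr0.
have wpi1 : 1 <= w pi by rewrite -(vgeE w _ pi0); exact: w1.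
have [x _ wx] := val_surj w 1.
suff wp : w pi = 1 by apply: placeP => x'; rewrite wv wp mulr1.
have := wv x; rewrite wx => e; have vx : 0 < v x by nia.
nia.
Qed.

End Maximal.

Definition fin v := `[< forall x, O x -> 0 <= v x >].

Lemma finP v : reflect (forall x, O x -> 0 <= v x) (fin v).
Proof. exact: asboolP. Qed.

Lemma fin_vge v x : fin v -> O x -> vge v 0 x.
Proof. by move=> /finP h Ox; rewrite /vge h ?orbT. Qed.

Definition primeI v := [set x | O x /\ vge v 1 x].

Lemma primeI_ideal v : fin v -> ideal (primeI v).
Proof.
move=> fv; split.
- by split; [exact: ded0|exact: vge0].
- by move=> x y [Ox hx] [Oy hy]; split; [exact: OB|exact: vgeB].
- move=> a x Oa [Ox hx]; split; first exact: OM.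
  by rewrite -[1]add0r; apply: vgeM => //; exact: fin_vge.
- by move=> x [].
Qed.

Lemma primeI_neq0 v : fin v -> exists a, primeI v a /\ a != 0.
Proof.
move=> fv; have [x x0 vx] := val_surj v 1.
have [a [b [Oa Ob b0 e]]] := ded_frac dO x.
have a0 : a != 0 by apply: contra_neq x0 => a0; rewrite e a0 mul0r.
exists a; split=> //; split=> //; rewrite vgeE //.
by move: vx; rewrite e valf //; move/finP: fv => /(_ b Ob); lia.
Qed.

Lemma primeIN v x : fin v -> O x -> ~ primeI v x -> x != 0 /\ v x = 0.
Proof.
move=> fv Ox n; have x0 : x != 0.
  by apply: contra_notN n => /eqP ->; split; [exact: ded0|exact: vge0].
split=> //; apply/eqP; move/finP: fv => /(_ x Ox); rewrite le_eqVlt eq_sym => /orP[//|h].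
by case: n; split=> //; rewrite vgeE //; lia.
Qed.

(** An [x] outside the prime has valuation 0. Two of its powers agree modulo an element [a] of the
    prime, so [x ^+ (j - i) - 1] lies in the prime and [x] is invertible modulo it. *)
Lemma primeI_maximal v : fin v -> maximal (primeI v).
Proof.
move=> fv; have iP := primeI_ideal fv; split=> //.
  by move=> [_]; rewrite vgeE ?oner_eq0 // val1.
move=> Q [_ QB QM QO] nQ1 PQ x Qx; apply: contrapT => nPx.
have Ox := QO _ Qx; have [a [Pa a0]] := primeI_neq0 fv.
have Oa : O a by case: Pa.
have [r cr] := ded_fin dO Oa a0.
have fP k : {z | z \in r /\ O ((x ^+ k - z) / a)}.
  by apply/cid; have [z zr Oz] := cr _ (dedX k Ox); exists z.
have [i [j [ij _ e]]] := pigeonhole (fun k => proj1 (projT2 (fP k))).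
have [_ hi] := projT2 (fP i); have [_ hj] := projT2 (fP j).
have h : O ((x ^+ j - x ^+ i) / a).
  have -> : (x ^+ j - x ^+ i) / a = (x ^+ j - projT1 (fP j)) / a - (x ^+ i - projT1 (fP i)) / a.
    by rewrite e -mulrBl opprB addrA subrK.
  exact: OB.
have [x0 vx0] := primeIN fv Ox nPx.
have P1x : vge v 1 (x ^+ (j - i) - 1).
  have -> : x ^+ (j - i) - 1 = (x ^+ j - x ^+ i) / a * a / x ^+ i.
    have -> : x ^+ j = x ^+ (j - i) * x ^+ i by rewrite -exprD subnK // ltnW.
    by rewrite divfK // mulrBl mulfK ?divff ?expf_neq0.
  rewrite -[1]addr0; apply: vgeM; last by rewrite vgeE ?invr_eq0 ?expf_neq0 // valV valX vx0 mul0rn.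
  by rewrite -[1]add0r; apply: vgeM; [exact: fin_vge|case: Pa].
apply: nQ1; have -> : 1 = x ^+ (j - i).-1 * x - (x ^+ (j - i) - 1).
  by rewrite -exprSr prednK ?subn_gt0 //; ring.
apply: QB; first by apply: QM => //; exact: dedX.
by apply: PQ; split=> //; apply: OB => //; exact: dedX.
Qed.

Lemma prime_place P a : maximal P -> P a -> a != 0 ->
  exists v, [/\ fin v, forall x, O x -> (vge v 1 x <-> P x) &
   forall x, vge v 0 x -> exists t, [/\ O t, t != 0, v t = 0 & O (t * x)]].
Proof.
move=> mP Pa a0; have [v [h1 h2 h3 h4 _]] := max_place mP Pa a0.
have h5 x : O x -> vge v 1 x -> P x.
  move=> Ox vx; apply: contrapT => nP; have := vx; rewrite /vge (h3 _ Ox nP) orbF => /eqP x0.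
  by case: mP => -[P0 _ _ _] _ _; apply: nP; rewrite x0.
exists v; split; first exact/finP.
  by move=> x Ox; split; [exact: h5|exact: h2].
move=> x /orP[/eqP ->|vx].
  by exists 1; rewrite mulr0 val1 oner_eq0; split=> //; exact: ded0.
have [->|x0] := eqVneq x 0.
  by exists 1; rewrite mulr0 val1 oner_eq0; split=> //; exact: ded0.
have [t [Ot nt Otx]] := h4 x x0 vx.
exists t; split=> //; last exact: h3.
by apply: contra_notN nt => /eqP ->; case: mP => -[].
Qed.

Lemma fin_inj v w : fin v -> fin w -> primeI v `<=` primeI w -> v = w.
Proof.
move=> fv fw vw; have mv := primeI_maximal fv; have mw := primeI_maximal fw.
have wv : primeI w `<=` primeI v by case: mv => _ _; apply=> //; case: mw.
have [a [Pa a0]] := primeI_neq0 fv.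
have [u [_ _ _ _ hu]] := max_place mv Pa a0.
transitivity u; [apply: hu|apply/esym/hu].
- by move=> x [].
- by move=> t Ot nt; case: (primeIN fv Ot nt).
- by move=> x /vw [].
- by move=> t Ot nt; case: (primeIN fw Ot) => // /wv.
Qed.

Lemma fin_local v x : fin v -> vge v 0 x ->
  exists t, [/\ O t, t != 0, v t = 0 & O (t * x)].
Proof.
move=> fv; have mv := primeI_maximal fv; have [a [Pa a0]] := primeI_neq0 fv.
have [w [fw hw1 hw2]] := prime_place mv Pa a0.
suff -> : v = w by exact: hw2.
by apply: fin_inj => // y [Oy vy]; split=> //; apply/(hw1 y Oy).
Qed.

Lemma ex_place I a : ideal I -> ~ I 1 -> I a -> a != 0 ->
  exists v, fin v /\ forall x, I x -> vge v 1 x.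
Proof.
move=> iI nI1 Ia a0; have [P mP IP] := ex_maximal iI nI1 Ia a0.
have [v [fv h _]] := prime_place mP (IP _ Ia) a0.
exists v; split=> // x Ix; apply/h; last exact: IP.
by case: iI => _ _ _; apply.
Qed.

(** The ideal of denominators of [x] contains, for each finite place, an element of valuation 0
    there ([fin_local]). No place is positive on it, so it contains 1. *)
Lemma ded_place x : (forall v, fin v -> vge v 0 x) -> O x.
Proof.
move=> h; have [->|x0] := eqVneq x 0; first exact: ded0.
apply: contrapT => nOx; pose I := [set y | O y /\ O (y * x)].
have iI : ideal I.
  split.
  - by split; rewrite ?mul0r; exact: ded0.
  - by move=> y z [? ?] [? ?]; split; [exact: OB|rewrite mulrBl; exact: OB].
  - by move=> b y ? [? ?]; split; [exact: OM|rewrite -mulrA; exact: OM].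
  - by move=> y [].
have [a [b [Oa Ob b0 e]]] := ded_frac dO x.
have Ib : I b by split=> //; rewrite e mulrC divfK.
have nI1 : ~ I 1 by move=> []; rewrite mul1r.
have [v [fv hv]] := ex_place iI nI1 Ib b0.
have [t [Ot t0 vt Otx]] := fin_local fv (h v fv).
have := hv t (conj Ot Otx); by rewrite vgeE // vt.
Qed.

End Dedekind.

(** * Approximation *)

Section Approximation.
Variable K : fieldType.
Local Open Scope classical_set_scope.
Variables (O : set K) (dO : dedekind O).
Implicit Types (v w : place K) (x y : K) (D E : divisor K).

Let O1 := ded1 dO.
Let OB := dedB dO.
Let OM := dedM dO.
Local Notation fin := (fin O).

Lemma vgeX v x (n : nat) : vge v 1 x -> vge v n%:Z (x ^+ n).
Proof.
move=> h; elim: n => [|n IH]; first by rewrite expr0 /vge val1 lexx orbT.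
by rewrite exprS intS; exact: vgeM.
Qed.

Lemma vge_dvd v n x y : fin v -> O y -> vge v n x -> vge v n (x * y).
Proof. by move=> fv Oy h; rewrite -[n]addr0; apply: vgeM => //; exact: (fin_vge fv). Qed.

Lemma fin_sep v w : fin v -> fin w -> v != w ->
  exists x, [/\ O x, vge v 1 x & vge w 1 (1 - x)].
Proof.
move=> fv fw vw.
have [p [[Op vp] np]] : exists p, primeI O v p /\ ~ primeI O w p.
  apply: contrapT => no; case/eqP: vw; apply: (fin_inj dO fv fw) => p Pp.
  by apply: contrapT => np; apply: no; exists p.
have [y Oy [_ h]] := max_inv dO (primeI_maximal dO fw) Op np.
by exists (p * y); split=> //; [exact: OM|exact: vge_dvd].
Qed.

Lemma fin_sepX v w (n : nat) : fin v -> fin w -> v != w ->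
  exists x, [/\ O x, vge v n%:Z x & vge w n%:Z (1 - x)].
Proof.
move=> fv fw vw; have [x [Ox vx wx]] := fin_sep fv fw vw.
have eX (u : K) : 1 - u ^+ n = (1 - u) * \sum_(i < n) u ^+ i.
  by rewrite -[LHS]opprB subrX1 -mulNr opprB.
have OS (u : K) : O u -> O (\sum_(i < n) u ^+ i).
  by move=> Ou; apply: (ded_sum dO) => i _; exact: (dedX dO).
(* As 1 - u divides 1 - u^n, this element is a multiple of x^n, while its difference from 1, the
   power (1 - x^n)^n, is a multiple of (1 - x)^n. *)
exists (1 - (1 - x ^+ n) ^+ n); split.
- by apply: OB => //; apply: (dedX dO); apply: OB => //; exact: (dedX dO).
- rewrite [X in vge _ _ X](eX (1 - x ^+ n)) opprB addrC subrK; apply: vge_dvd => //; last exact: vgeX.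
  by apply: OS; apply: OB => //; exact: (dedX dO).
- rewrite opprB addrC subrK; apply: vgeX; rewrite (eX x); apply: vge_dvd => //.
  exact: OS.
Qed.

Lemma crt_unit v0 (S : seq (place K)) (n : nat) : fin v0 -> all (fun v => fin v) S -> v0 \notin S ->
  exists x, [/\ O x, vge v0 n%:Z (1 - x) & forall v, v \in S -> vge v n%:Z x].
Proof.
move=> f0; elim: S => [|v S IH].
  by move=> _ _; exists 1; split=> //; rewrite subrr; exact: vge0.
move=> /= /andP[fv fS]; rewrite inE negb_or => /andP[vv0 v0S].
have [x [Ox h0 hS]] := IH fS v0S.
have [y [Oy hv hy]] : exists y, [/\ O y, vge v n%:Z y & vge v0 n%:Z (1 - y)].
  by apply: fin_sepX => //; rewrite eq_sym.
exists (x * y); split; first exact: OM.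
  have -> : 1 - x * y = (1 - x) + (1 - y) * x by ring.
  by apply: vgeD => //; exact: vge_dvd.
move=> w; rewrite inE => /orP[/eqP ->|wS]; first by rewrite mulrC; exact: vge_dvd.
by apply: vge_dvd; rewrite ?hS //; exact: (allP fS).
Qed.

(** For [a] in [O], a place positive at [a] is determined by which representatives modulo [a] lie in
    its prime, so there are finitely many. *)
Lemma fin_supp x : x != 0 -> exists s : seq (place K), forall v, fin v -> v x != 0 -> v \in s.
Proof.
suff H a : O a -> a != 0 -> exists s : seq (place K), forall v, fin v -> v a != 0 -> v \in s.
  move=> x0; have [a [b [Oa Ob b0 e]]] := ded_frac dO x.
  have a0 : a != 0 by apply: contra_neq x0 => a0; rewrite e a0 mul0r.
  have [s hs] := H a Oa a0; have [t ht] := H b Ob b0.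
  exists (s ++ t) => v fv; rewrite e valf // mem_cat => h.
  have [/eqP va|/hs->//] := boolP (v a == 0); rewrite ht ?orbT //.
  by apply: contraNneq h => ->; rewrite va.
move=> Oa a0; have [r cr] := ded_fin dO Oa a0.
pose m v (i : 'I_(size r)) := `[< primeI O v r`_i >].
have [|s hs] := @finite_by_mask _ [set v | fin v /\ v a != 0] _ m; last first.
  by exists s => v fv va; apply: hs.
have aP v z : fin v -> v a != 0 -> O z -> O (z / a) -> primeI O v z.
  move=> fv va Oz Oza; split=> //; rewrite -(divfK a0 z) mulrC; apply: vge_dvd => //.
  by rewrite vgeE //; move/finP: fv => /(_ a Oa); lia.
suff sub v w : fin v -> v a != 0 -> fin w -> w a != 0 -> m v =1 m w -> primeI O v `<=` primeI O w.
  by move=> v w [fv va] [fw wa] e; apply: (fin_inj dO) => //; exact: sub.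
move=> fv va fw wa e {}x [Ox vx]; have [y yr Oxy] := cr x Ox.
have Oy : O y.
  have -> : y = x - (x - y) / a * a by rewrite divfK //; ring.
  by apply: OB => //; exact: OM.
have Oxy' : O (x - y) by exact: OB.
have iv := primeI_ideal dO fv; have iw := primeI_ideal dO fw.
have Py : primeI O v y.
  have -> : y = x - (x - y) by ring.
  by case: iv => _ h _ _; apply: h => //; exact: aP.
have [i lti yi] : exists2 i, (i < size r)%N & r`_i = y by apply/nthP.
have := e (Ordinal lti); rewrite /m /= yi (asboolT Py) => /esym/asboolP Py'.
have -> : x = (x - y) + y by ring.
by apply: (idealD iw) => //; exact: aP.
Qed.

Definition dv x : divisor K := divf (fun v => if fin v then v x else 0).

Lemma dvE x v : coeff v (dv x) = if fin v then v x else 0.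
Proof.
have [->|x0] := eqVneq x 0.
  rewrite (divfE (s := [::])) // => w; rewrite val0 if_same eqxx //.
have [s hs] := fin_supp x0.
by rewrite (divfE (s := s)) // => w; case: ifP => // fw; exact: hs.
Qed.

Lemma dvM x y : x != 0 -> y != 0 -> dv (x * y) = dv x + dv y.
Proof.
by move=> x0 y0; apply: divP => v; rewrite coeffD !dvE; case: ifP => // _; rewrite valM.
Qed.

Lemma dv1 : dv 1 = 0.
Proof. by apply: divP => v; rewrite coeff0 dvE val1 if_same. Qed.

Lemma dv_prod (I : eqType) (r : seq I) (F : I -> K) : (forall i, i \in r -> F i != 0) ->
  dv (\prod_(i <- r) F i) = \sum_(i <- r) dv (F i).
Proof.
elim: r => [|i r IH] h; first by rewrite !big_nil dv1.
have hr : forall j, j \in r -> F j != 0 by move=> j jr; rewrite h // inE jr orbT.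
by rewrite !big_cons dvM ?IH ?h ?mem_head // prodf_seq_neq0; apply/allP.
Qed.

Lemma ded_denominator (S : seq (place K)) (c : place K -> K) :
  exists a, [/\ O a, a != 0 & forall v, v \in S -> O (a * c v)].
Proof.
elim: S => [|v S [a [Oa a0 IH]]]; first by exists 1; rewrite oner_eq0.
have [b [d [Ob Od d0 e]]] := ded_frac dO (c v).
exists (a * d); rewrite mulf_neq0 //; split=> //; first exact: OM.
move=> w; rewrite inE => /orP[/eqP ->|/IH h].
  by rewrite e -mulrA [d * _]mulrC divfK //; exact: OM.
by rewrite mulrAC; exact: OM.
Qed.

(** [a] clears the denominators of the targets, and [T] adds to [S] the places where [a] is not a
    unit. The sum of the [a * c v * y v] approximates [a * c v] at each [v] of [S] and is highly
    divisible at the rest of [T], so that it can be divided by [a] without losing integrality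
    outside [S]. *)
Lemma strong_approx (S : seq (place K)) (c : place K -> K) (n : nat) : all (fun v => fin v) S ->
  exists x, (forall v, v \in S -> vge v n%:Z (x - c v)) /\
    (forall v, fin v -> v \notin S -> vge v 0 x).
Proof.
move=> fS; have [a [Oa a0 ha]] := ded_denominator S c.
have [s0 hs0] := fin_supp a0.
pose s := undup S; pose T := undup (S ++ [seq v <- s0 | fin v]).
have fT v : v \in T -> fin v.
  by rewrite mem_undup mem_cat mem_filter => /orP[|/andP[]//]; exact: (allP fS).
have finT v : fin v -> v \notin T -> v a = 0.
  rewrite mem_undup mem_cat mem_filter negb_or => fv; rewrite fv /= => /andP[_ h].
  by apply/eqP; apply: contraNT h; exact: hs0.
(* The precision [n], increased by what the final division by [a] can lose. *)
pose M := (n + \sum_(v <- T) `|v a|)%N.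
have hM v : v \in T -> n%:Z + v a <= M%:Z.
  move=> vT; rewrite /M (big_rem v) //=; lia.
have hy v : exists y, v \in S -> [/\ O y, vge v M%:Z (1 - y) & forall w, w \in T -> w != v -> vge w M%:Z y].
  have [vS|] := boolP (v \in S); last by exists 0.
  have vT : v \in T by rewrite mem_undup mem_cat vS.
  have [||y [Oy y1 y2]] := @crt_unit v (rem v T) M (fT _ vT).
  - by apply/allP => w /mem_rem /fT.
  - by rewrite mem_rem_uniq ?undup_uniq // inE eqxx.
  - exists y => _; split=> // w wT wv; apply: y2.
    by rewrite mem_rem_uniq ?undup_uniq // inE wv.
have {hy} /choice[y hy] := hy.
pose x' := \sum_(v <- s) a * c v * y v.
have sS v : v \in s -> v \in S by rewrite mem_undup.
have Ox' : O x'.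
  rewrite /x' big_seq; apply: (ded_sum dO) => v /sS vS.
  by apply: OM; [exact: ha|case: (hy v vS)].
have big w : w \in T -> w \notin S -> vge w M%:Z x'.
  move=> wT wS; rewrite /x' big_seq; apply: vge_sum => v /sS vS.
  rewrite mulrC; apply: vge_dvd; [exact: fT|exact: ha|].
  by case: (hy v vS) => _ _; apply=> //; apply: contraNneq wS => ->.
have divM w z : w \in T -> vge w M%:Z z -> vge w n%:Z (z / a).
  move=> wT h; apply: (vge_le (n := M%:Z - w a)); first by have := hM w wT; lia.
  by apply: vgeM => //; rewrite vgeE ?invr_eq0 // valV.
exists (x' / a); split=> w.
  move=> wS; have wT : w \in T by rewrite mem_undup mem_cat wS.
  have -> : x' / a - c w = (x' - a * c w) / a by field.
  apply: divM => //; rewrite /x' (bigD1_seq w) ?undup_uniq ?mem_undup //=.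
  have -> (u : K) : a * c w * y w + u - a * c w = - ((1 - y w) * (a * c w)) + u by ring.
  case: (hy w wS) => Oyw y1 _; apply: vgeD.
    by rewrite vgeN; apply: vge_dvd => //; [exact: fT|exact: ha].
  rewrite big_seq_cond; apply: vge_sum => v /andP[/sS vS vw].
  rewrite mulrC; apply: vge_dvd; [exact: fT|exact: ha|].
  by case: (hy v vS) => _ _; apply=> //; rewrite eq_sym.
move=> fw wS; have [wT|wT] := boolP (w \in T).
  by apply: (vge_le (n := n%:Z)) => //; apply: divM => //; exact: big.
rewrite -[0]addr0; apply: vgeM; first exact: (fin_vge fw).
by rewrite vgeE ?invr_eq0 // valV finT.
Qed.

Definition idealD_ D := [set x | forall v, fin v -> vge v (coeff v D) x].

Lemma strong_approxD (S : seq (place K)) (c : place K -> K) (n : nat) D : all (fun v => fin v) S ->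
  exists x, (forall v, v \in S -> vge v n%:Z (x - c v)) /\
    (forall v, fin v -> v \notin S -> vge v (coeff v D) x).
Proof.
move=> fS; pose T := S ++ [seq v <- dom D | fin v].
pose m := (n + \sum_(v <- dom D) `|coeff v D|)%N.
have [|x [h1 h2]] := @strong_approx T (fun v => if v \in S then c v else 0) m.
  by apply/allP => v; rewrite mem_cat mem_filter => /orP[|/andP[]//]; exact: (allP fS).
exists x; split=> v.
  move=> vS; have := h1 v; rewrite mem_cat vS => /(_ isT); apply: vge_le; rewrite /m; lia.
move=> fv vS; have [vD|vD] := boolP (v \in dom D); last first.
  by rewrite coeff_outdom //; apply: h2 => //; rewrite mem_cat mem_filter negb_or vS (negPf vD) andbF.
have := h1 v; rewrite mem_cat mem_filter fv vD orbT (negPf vS) subr0 => /(_ isT).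
by apply: vge_le; rewrite /m (big_rem v) //=; lia.
Qed.

(** A precision above every prescribed coefficient pins the valuations, by [val_close]. When no
    place is prescribed the approximant may be 0, whence the disjunction. *)
Lemma exact_elt (S : seq (place K)) D : all (fun v => fin v) S ->
  exists x, [/\ x != 0 \/ S = [::], idealD_ D x & forall v, v \in S -> v x = coeff v D].
Proof.
move=> fS.
have hc v : {c | c != 0 & v c = coeff v D}.
  by apply/cid2; exact: val_surj.
pose c v := s2val (hc v); have c0 v : c v != 0 := s2valP (hc v).
have vc v : v (c v) = coeff v D := s2valP' (hc v).
pose m := (1 + \sum_(v <- S) `|coeff v D|)%N.
have [x [h1 h2]] := @strong_approxD S c m D fS.
have cl v : v \in S -> x != 0 /\ v x = coeff v D.
  move=> vS; rewrite -vc; apply: val_close => //; apply: vge_le (h1 v vS).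
  by rewrite vc /m (big_rem v) //=; lia.
exists x; split.
- by case: S cl {fS h1 h2 m} => [|v S] cl; [right|left; case: (cl v (mem_head _ _))].
- move=> v fv; have [vS|/h2->//] := boolP (v \in S).
  by have [x0 vx] := cl v vS; rewrite vgeE // vx.
- by move=> v /cl[].
Qed.

End Approximation.

(** * Indices of additive subgroups *)

Section Index.
Variable K : zmodType.
Local Open Scope classical_set_scope.
Implicit Types X Y Z : set K.

Definition addg X := X 0 /\ forall x y, X x -> X y -> X (x - y).

Lemma addgN X x : addg X -> X x -> X (- x).
Proof. by move=> [X0 XB] Xx; rewrite -sub0r; exact: XB. Qed.

Lemma addgD X x y : addg X -> X x -> X y -> X (x + y).
Proof. by move=> gX Xx Xy; rewrite -[y]opprK; case: (gX) => _; apply=> //; exact: addgN. Qed.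

Lemma addgBC X x y : addg X -> X (x - y) -> X (y - x).
Proof. by move=> gX h; rewrite -opprB; exact: addgN. Qed.

Definition separated Y (s : seq K) :=
  uniq s /\ forall x y, x \in s -> y \in s -> Y (x - y) -> x = y.

(** The subgroups are usually infinite, so the index is expressed by an exact list of
    representatives. *)
Definition idx X Y (m : nat) := exists s : seq K,
  [/\ size s = m, separated Y s, forall y, y \in s -> X y
    & forall x, X x -> exists2 y, y \in s & Y (x - y)].

Lemma idx_sep X Y m t : addg Y -> idx X Y m -> separated Y t ->
  (forall y, y \in t -> X y) -> (size t <= m)%N.
Proof.
move=> gY [s [<- _ _ cov]] [ut st] tX.
have h x : exists y, x \in t -> y \in s /\ Y (x - y).
  have [xt|] := boolP (x \in t); last by exists 0.
  by have [y ys Yxy] := cov x (tX x xt); exists y.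
have {h} /choice[f hf] := h.
rewrite -(size_map f); apply: uniq_leq_size.
  rewrite map_inj_in_uniq // => x y xt yt e; apply: st => //.
  have [_ h1] := hf x xt; have [_ h2] := hf y yt.
  have -> : x - y = (x - f x) - (y - f y) by rewrite e opprB addrA subrK.
  by case: gY => _; apply.
by move=> _ /mapP[x xt ->]; case: (hf x xt).
Qed.

Lemma idx_uniq X Y m k : addg Y -> idx X Y m -> idx X Y k -> m = k.
Proof.
move=> gY hm hk; apply/eqP; rewrite eqn_leq; apply/andP; split.
  by case: (hm) => s [<- ss sX _]; exact: idx_sep hk ss sX.
by case: (hk) => s [<- ss sX _]; exact: idx_sep hm ss sX.
Qed.

Lemma idx_trans X Y Z m k : addg X -> addg Y -> addg Z -> Y `<=` X -> Z `<=` Y ->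
  idx X Y m -> idx Y Z k -> idx X Z (m * k).
Proof.
move=> gX gY gZ YX ZY [s [<- [us ss] sX cs]] [t [<- [ut st] tY ct]].
pose st' := [seq a + b | a <- s, b <- t].
have inj a b a' b' : a \in s -> b \in t -> a' \in s -> b' \in t ->
    Z (a + b - (a' + b')) -> a = a' /\ b = b'.
  move=> hs ht hs' ht' h; have e : a = a'.
    apply: ss => //; have -> : a - a' = (a + b - (a' + b')) + (b' - b).
      by rewrite opprD (addrACA a b) -[b' - b]opprB addrK.
    by apply: addgD => //; [exact: ZY|case: gY => _; apply; exact: tY].
  split=> //; apply: st => //; move: h; rewrite e opprD addrACA subrr add0r //.
exists st'; split.
- by rewrite size_allpairs.
- split.
    apply: allpairs_uniq => // -[a b] [a' b'] /allpairsP[[x y] /= [xs yt [-> ->]]].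
    move=> /allpairsP[[x' y'] /= [xs' yt' [-> ->]]] /= e.
    have [|-> ->//] := inj x y x' y' xs yt xs' yt'.
    by rewrite e subrr; case: gZ.
  move=> _ _ /allpairsP[[a b] /= [? ? ->]] /allpairsP[[a' b'] /= [? ? ->]] /inj h.
  by have [] := h; rewrite // => -> ->.
- move=> _ /allpairsP[[a b] /= [? ? ->]]; apply: (addgD gX); first exact: sX.
  by apply: YX; exact: tY.
- move=> x Xx; have [a aS Yxa] := cs x Xx; have [b bt Zb] := ct _ Yxa.
  exists (a + b); last by rewrite opprD addrA.
  by apply/allpairsP; exists (a, b).
Qed.

Lemma idx_cover X Y (r : seq K) : addg X -> addg Y -> Y `<=` X ->
  (forall x, X x -> exists2 y, y \in r & Y (x - y)) ->
  exists m, (m <= size r)%N /\ idx X Y m.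
Proof.
move=> gX gY YX cov.
suff [s [ls ss sX cs]] : exists s : seq K, [/\ (size s <= size r)%N, separated Y s, forall y, y \in s -> X y
    & forall x, x \in r -> X x -> exists2 y, y \in s & Y (x - y)].
  exists (size s); split=> //; exists s; split=> // x Xx.
  have [y yr Yxy] := cov x Xx.
  have Xy : X y by have -> : y = x - (x - y) by [rewrite opprB addrCA subrr addr0]; case: gX => _; apply=> //; exact: YX.
  have [z zs Yyz] := cs y yr Xy; exists z => //.
  by rewrite -(subrK y x) -addrA; exact: addgD.
elim: r {cov} => [|a r [s [ls [us ss] sX cs]]].
  by exists [::]; split.
have [good|bad] := pselect (X a /\ ~ exists2 y, y \in s & Y (a - y)).
  case: good => Xa na; exists (a :: s); split=> //.
  - split; first by rewrite /= us andbT; apply/negP => h; apply: na; exists a => //; rewrite subrr; case: gY.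
    move=> x y; rewrite !inE => /orP[/eqP->|xs] /orP[/eqP->|ys] // h; last exact: ss.
      by case: na; exists y.
    by case: na; exists x => //; exact: addgBC.
  - by move=> y; rewrite inE => /orP[/eqP->|/sX].
  - move=> x; rewrite inE => /orP[/eqP-> _|xr Xx].
      by exists a; rewrite ?mem_head // subrr; case: gY.
    by have [y ys h] := cs x xr Xx; exists y => //; rewrite inE ys orbT.
exists s; split=> //; first by rewrite (leq_trans ls).
move=> x; rewrite inE => /orP[/eqP-> Xa|]; last exact: cs.
by apply: contrapT => h; apply: bad.
Qed.

End Index.

(** * Norms of places and divisors *)

Section Norms.
Variable K : fieldType.
Local Open Scope classical_set_scope.
Variables (O : set K) (dO : dedekind O).
Implicit Types (v w : place K) (x y : K) (D E : divisor K).

Let O1 := ded1 dO.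
Let OB := dedB dO.
Let OM := dedM dO.
Local Notation fin := (fin O).
Local Notation dv := (dv O).
Local Notation I_ := (idealD_ O).

Lemma addgO : addg O. Proof. by split; [exact: (ded0 dO)|exact: OB]. Qed.

Lemma addg_idealD D : addg (I_ D).
Proof.
by split=> [v _|x y hx hy v fv]; [exact: vge0|apply: vgeB; [exact: hx|exact: hy]].
Qed.

Lemma addg_primeI v : fin v -> addg (primeI O v).
Proof. by move=> fv; case: (primeI_ideal dO fv). Qed.

Lemma idealD0 : I_ 0 = O.
Proof.
apply/seteqP; split=> x h; last by move=> v fv; rewrite coeff0; exact: (fin_vge fv).
by apply: (ded_place dO) => v fv; have := h v fv; rewrite coeff0.
Qed.

Lemma idealD_le D E : (forall v, fin v -> coeff v D <= coeff v E) -> I_ E `<=` I_ D.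
Proof. by move=> h x hx v fv; apply: vge_le (hx v fv); exact: h. Qed.

Lemma idealD_mul a x D : O a -> I_ D x -> I_ D (a * x).
Proof. by move=> Oa h v fv; rewrite mulrC; apply: (vge_dvd fv Oa); exact: h. Qed.

Lemma idealDP D x : x != 0 -> I_ D x <-> forall v, fin v -> coeff v D <= v x.
Proof.
by move=> x0; split=> h v fv; have := h v fv; rewrite vgeE.
Qed.

Definition Nv v : nat := xget 1%N [set m | idx O (primeI O v) m].

Lemma NvP v : fin v -> idx O (primeI O v) (Nv v).
Proof.
move=> fv; rewrite /Nv; case: xgetP => // none.
have [a [Pa a0]] := primeI_neq0 dO fv.
have Oa : O a by case: Pa.
have [r cr] := ded_fin dO Oa a0.
have [||m [_ h]] := idx_cover (r := r) addgO (addg_primeI fv).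
- by move=> x [].
- move=> x Ox; have [y yr h] := cr x Ox; exists y => //.
  rewrite -(divfK a0 (x - y)); case: (primeI_ideal dO fv) => _ _ M _; exact: M.
- by case: (none m).
Qed.

Lemma Nv_gt1 v : fin v -> (1 < Nv v)%N.
Proof.
move=> fv; apply: (@idx_sep _ O (primeI O v) (Nv v) [:: 0; 1] (addg_primeI fv) (NvP fv)).
  split; first by rewrite /= inE eq_sym oner_eq0.
  have h : ~ primeI O v 1 by move=> []; rewrite vgeE ?oner_eq0 // val1.
  have h' : ~ primeI O v (- 1) by move=> []; rewrite vgeN vgeE ?oner_eq0 // val1.
  by move=> x y; rewrite !inE => /orP[]/eqP-> /orP[]/eqP-> //; rewrite ?subr0 ?sub0r.
by move=> y; rewrite !inE => /orP[]/eqP-> //; exact: (ded0 dO).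
Qed.

Lemma Nv_gt0 v : (0 < Nv v)%N.
Proof.
rewrite /Nv; case: xgetP => // m _ [s [<- _ _]] /(_ 1 O1) [y].
by case: s.
Qed.

Definition eff D := forall v, 0 <= coeff v D /\ (coeff v D != 0 -> fin v).

Lemma eff0 : eff 0. Proof. by move=> v; rewrite coeff0 eqxx. Qed.

Lemma effD D E : eff D -> eff E -> eff (D + E).
Proof.
move=> hD hE v; rewrite coeffD; have [D0 Df] := hD v; have [E0 Ef] := hE v.
split; first by rewrite addr_ge0.
by case: (boolP (coeff v D == 0)) => [/eqP ->|/Df //]; rewrite add0r.
Qed.

Lemma effU v : fin v -> eff << v >>.
Proof. by move=> fv w; rewrite coeffU mul1r; case: eqP => [<-|]. Qed.

Lemma eff_dv x : O x -> eff (dv x).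
Proof.
move=> Ox v; rewrite (dvE dO); case: (boolP (fin v)) => // fv; split=> //.
by move/finP: fv; apply.
Qed.

Lemma eff_ind (P : divisor K -> Prop) : P 0 ->
  (forall D v, eff D -> fin v -> P D -> P (D + << v >>)) -> forall D, eff D -> P D.
Proof.
move=> P0 PS D; have [n] := ubnP `|deg D|%N; elim: n D => // n IH D lt eD.
have degE E : eff E -> 0 <= deg E.
  by move=> eE; rewrite -(freeg_sumE E) raddf_sum /=; apply: sumr_ge0 => v _; rewrite degU; case: (eE v).
case: (altP (D =P 0)) => [->//|D0].
have [v vD] : exists v, v \in dom D.
  by move: D0; rewrite -dom_eq0; case: (dom D) => // v s _; exists v; rewrite mem_head.
move: (vD); rewrite mem_dom => vD'; have [cD0 /(_ vD') fv] := eD v.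
have eDv : eff (D - << v >>).
  move=> w; rewrite coeffB coeffU mul1r; case: eqP => [<-|]; last by rewrite subr0.
  by split=> //=; lia.
rewrite -(subrK << v >> D); apply: PS => //; apply: IH => //.
have := degE _ eDv; move: lt; rewrite degB degU; lia.
Qed.

Lemma mul_exact D v : fin v -> exists x, [/\ x != 0, I_ D x & v x = coeff v D].
Proof.
move=> fv; have [|x [x0 Ix vx]] := @exact_elt K O dO [:: v] D; first by rewrite /= fv.
by exists x; split=> //; [case: x0|apply: vx; rewrite mem_head].
Qed.

(** Multiplication by an [x] in [I_ D] with exactly the valuation of [D] at [v] identifies the
    residue field of [v] with [I_ D] modulo [I_ (D + << v >>)]. For surjectivity, [y / x] is
    [v]-integral and is approximated at [v] by an element of [O]. *)
Lemma idx_step D v : fin v -> idx (I_ D) (I_ (D + << v >>)) (Nv v).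
Proof.
move=> fv; have [x [x0 Ix vx]] := mul_exact D fv.
have [s [ss [us sep] sO cov]] := NvP fv.
have key z : O z -> (I_ (D + << v >>) (z * x) <-> primeI O v z).
  move=> Oz; split.
    move=> /(_ v fv); rewrite coeffD coeffU mul1r eqxx /= => h; split=> //.
    move: h; have [->|z0] := eqVneq z 0; first by rewrite vge0.
    by rewrite !vgeE ?mulf_neq0 // valM // vx; lia.
  move=> [_ h] w fw; rewrite coeffD coeffU mul1r.
  case: eqP => [<-|_] /=; last by rewrite addr0; apply: (idealD_mul Oz Ix fw).
  by rewrite addrC; apply: vgeM => //; rewrite vgeE // vx.
exists [seq z * x | z <- s]; split.
- by rewrite size_map.
- split; first by rewrite map_inj_uniq //; exact: (mulIf x0).
  move=> _ _ /mapP[a sa ->] /mapP[b sb ->]; rewrite -mulrBl => /key h.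
  by congr (_ * _); apply: sep => //; apply: h; apply: OB; exact: sO.
- by move=> _ /mapP[a sa ->]; apply: idealD_mul => //; exact: sO.
- move=> y Iy.
  have vyx : vge v 0 (y / x).
    have := Iy v fv; have [->|y0] := eqVneq y 0; first by rewrite mul0r => _; exact: vge0.
    by rewrite !vgeE ?mulf_neq0 ?invr_eq0 // valf // vx; lia.
  have [|z [h1 h2]] := @strong_approx K O dO [:: v] (fun=> y / x) 1; first by rewrite /= fv.
  have vz := h1 v (mem_head _ _).
  have Oz : O z.
    apply: (ded_place dO) => w fw; have [->|wv] := eqVneq w v; last by apply: h2 => //; rewrite inE.
    by rewrite -(subrK (y / x) z); apply: vgeD => //; apply: vge_le vz.
  have [a sa [_ ha]] := cov z Oz; exists (a * x); first by apply/mapP; exists a.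
  have Oa : O a by exact: sO.
  move=> w fw; rewrite coeffD coeffU mul1r; case: eqP => [<-|_] /=; last first.
    by rewrite addr0; apply: vgeB; [exact: Iy|exact: (idealD_mul Oa Ix)].
  have -> : y - a * x = (- (z - y / x) + (z - a)) * x by field.
  rewrite addrC; apply: vgeM; last by rewrite vgeE // vx.
  by apply: vgeD => //; rewrite vgeN.
Qed.

Lemma idealD_ideal D : eff D -> ideal O (I_ D).
Proof.
move=> eD; split; [by case: (addg_idealD D)|by case: (addg_idealD D)|by move=> a x; exact: idealD_mul|].
by rewrite -[X in _ `<=` X]idealD0; apply: idealD_le => v _; rewrite coeff0; case: (eD v).
Qed.

Variable R : numFieldType.

Definition Nd D : R := \prod_(v <- dom D) (Nv v)%:R ^ (coeff v D).

Lemma NvR_gt0 v : 0 < (Nv v)%:R :> R. Proof. by rewrite ltr0n Nv_gt0. Qed.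
Lemma NvR_neq0 v : (Nv v)%:R != 0 :> R. Proof. by rewrite gt_eqF ?NvR_gt0. Qed.

Lemma Nd_sup D (s : seq (place K)) : uniq s -> {subset dom D <= s} ->
  Nd D = \prod_(v <- s) (Nv v)%:R ^ (coeff v D).
Proof.
move=> us sub; rewrite /Nd [RHS](bigID [in dom D]) /= [X in _ * X]big1; last first.
  by move=> v vD; rewrite coeff_outdom // expr0z.
rewrite mulr1 -[RHS]big_filter; apply: perm_big; apply: uniq_perm; rewrite ?filter_uniq ?uniq_dom //.
by move=> v; rewrite mem_filter; case: (boolP (v \in dom D)) => //= /sub ->.
Qed.

Lemma NdD D E : Nd (D + E) = Nd D * Nd E.
Proof.
pose s := undup (dom D ++ dom E).
rewrite !(@Nd_sup _ s) ?undup_uniq //.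
- rewrite -big_split /=; apply: eq_bigr => v _.
  by rewrite coeffD expfzDr ?NvR_neq0.
- by move=> v; rewrite mem_undup mem_cat => ->; rewrite orbT.
- by move=> v; rewrite mem_undup mem_cat => ->.
- by move=> v vDE; rewrite mem_undup; exact: domD_subset.
Qed.

Lemma Nd_gt0 D : 0 < Nd D.
Proof. by rewrite /Nd; apply: prodr_gt0 => v _; apply: exprz_gt0; exact: NvR_gt0. Qed.

Lemma Nd_neq0 D : Nd D != 0. Proof. by rewrite gt_eqF ?Nd_gt0. Qed.

Lemma Nd0 : Nd 0 = 1.
Proof. by rewrite /Nd dom0 big_nil. Qed.

Lemma NdN D : Nd (- D) = (Nd D)^-1.
Proof.
apply: (mulfI (Nd_neq0 D)); rewrite -NdD subrr Nd0 divff ?Nd_neq0 //.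
Qed.

Lemma NdB D E : Nd (D - E) = Nd D / Nd E.
Proof. by rewrite NdD NdN. Qed.

Lemma NdMn D n : Nd (D *+ n) = Nd D ^+ n.
Proof. by elim: n => [|n IH]; rewrite ?mulr0n ?Nd0 // mulrS NdD IH exprS. Qed.

Lemma NdU v : Nd << v >> = (Nv v)%:R.
Proof. by rewrite /Nd domU1 big_seq1 coeffU mul1r eqxx expr1z. Qed.

Lemma idx_idealD D : eff D -> exists2 m, idx O (I_ D) m & m%:R = Nd D.
Proof.
elim/eff_ind => [|{}D v eD fv [m hm em]].
  exists 1%N; rewrite ?Nd0 // idealD0; exists [:: 0]; split=> //.
  - by split=> // x y; rewrite !inE => /eqP-> /eqP->.
  - by move=> y; rewrite inE => /eqP->; exact: (ded0 dO).
  - by move=> x Ox; exists 0; rewrite ?mem_head // subr0.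
exists (m * Nv v)%N; last by rewrite natrM em NdD NdU.
apply: idx_trans hm (idx_step D fv); [exact: addgO|exact: addg_idealD|exact: addg_idealD| |].
  by case: (idealD_ideal eD).
by apply: idealD_le => w fw; rewrite coeffD coeffU mul1r; case: eqP => /= _; lia.
Qed.

Lemma Nd_nat D : eff D -> exists2 m : nat, (0 < m)%N & Nd D = m%:R.
Proof.
move=> eD; have [m _ e] := idx_idealD eD; exists m => //.
by rewrite -(ltr0n R) e Nd_gt0.
Qed.

Lemma Nd_ge1 D : eff D -> 1 <= Nd D.
Proof. by move=> /Nd_nat[m m0 ->]; rewrite ler1n. Qed.

Lemma Nd_le D E : eff (E - D) -> Nd D <= Nd E.
Proof.
by move=> /Nd_ge1; rewrite NdB ler_pdivlMr ?Nd_gt0 // mul1r.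
Qed.

End Norms.

(** * Divisors in Galois extensions *)

Section QuotientClasses.
Variables (V : zmodType) (S : zmodClosed V).

Definition qcls (x : V) : Quotient.quot S := \pi_(Quotient.quot S)%qT x.

Lemma qcls_eq x y : qcls x = qcls y <-> x - y \in S.
Proof. by rewrite Quotient.idealrBE; split=> [h|/eqP//]; apply/eqP. Qed.

Lemma qcls_is_additive : zmod_morphism qcls.
Proof.
by move=> x y; rewrite /qcls [LHS]Quotient.pi_add; congr (_ + _); exact: Quotient.pi_opp.
Qed.

HB.instance Definition _ :=
  GRing.isZmodMorphism.Build V (Quotient.quot S) qcls qcls_is_additive.

Lemma qcls_repr c : qcls (generic_quotient.repr c) = c.
Proof. exact: reprK. Qed.

Lemma qcls_eq0 x : qcls x = 0 <-> x \in S.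
Proof. by rewrite -(raddf0 qcls) qcls_eq subr0. Qed.

End QuotientClasses.

Section QuotientMaps.
Variables (V W : zmodType) (S : zmodClosed V) (T : zmodClosed W) (f : V -> W).
Hypotheses (fadd : zmod_morphism f) (fS : forall x, x \in S -> f x \in T).

Definition qmap (c : Quotient.quot S) : Quotient.quot T := qcls T (f (generic_quotient.repr c)).

Lemma qmapE x : qmap (qcls S x) = qcls T (f x).
Proof. by apply/qcls_eq; rewrite -fadd; apply/fS/qcls_eq; rewrite qcls_repr. Qed.

Lemma qmap_is_additive : zmod_morphism qmap.
Proof.
move=> c d; rewrite -(qcls_repr c) -(qcls_repr d) -raddfB !qmapE fadd raddfB //.
Qed.

End QuotientMaps.

Section ClassGroup.
Variable K : fieldType.
Variable O : set K.
Implicit Types (v : place K) (D E : divisor K).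

Definition fprincipal : {pred divisor K} :=
  [pred D : divisor K | `[< exists2 f : K, f != 0 & forall v, fin O v -> coeff v D = v f >]].

Lemma fprincipalP D :
  reflect (exists2 f : K, f != 0 & forall v, fin O v -> coeff v D = v f) (D \in fprincipal).
Proof. exact: asboolP. Qed.

Lemma fprincipal_zmod : zmod_closed fprincipal.
Proof.
split.
  by apply/fprincipalP; exists 1; rewrite ?oner_eq0 // => v _; rewrite coeff0 val1.
move=> D E /fprincipalP[f f0 Df] /fprincipalP[g g0 Eg].
apply/fprincipalP; exists (f / g); first by rewrite mulf_neq0 ?invr_eq0.
by move=> v fv; rewrite coeffB Df // Eg // valf.
Qed.

HB.instance Definition _ :=
  GRing.isZmodClosed.Build (divisor K) fprincipal fprincipal_zmod.

(* Places that are not finite on [O] are ignored. *)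
Definition Clf : zmodType := Quotient.quot fprincipal.

Definition cls : {additive divisor K -> Clf} := qcls fprincipal.

Lemma cls_eq D E : cls D = cls E <->
  exists2 f : K, f != 0 & forall v, fin O v -> coeff v D - coeff v E = v f.
Proof.
rewrite qcls_eq; split=> [/fprincipalP[f f0 h]|[f f0 h]].
  by exists f => // v fv; rewrite -coeffB h.
by apply/fprincipalP; exists f => // v fv; rewrite coeffB h.
Qed.

Lemma cls_eqf D E : (forall v, fin O v -> coeff v D = coeff v E) -> cls D = cls E.
Proof.
by move=> h; apply/cls_eq; exists 1; rewrite ?oner_eq0 // => v fv; rewrite val1 h ?subrr.
Qed.

Lemma cls_surj c : exists D, cls D = c.
Proof. by exists (generic_quotient.repr c); exact: qcls_repr. Qed.

End ClassGroup.

Section GaloisDivisors.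
Local Open Scope classical_set_scope.
Variables (K L : fieldType) (iota : {rmorphism K -> L}).
Variables (gT : finGroupType) (G : {group gT}) (act : gT -> {rmorphism L -> L}).
Hypothesis act1 : forall x, act 1%g x = x.
Hypothesis actM : forall g h x, act (g * h)%g x = act h (act g x).
Hypothesis actK : forall g y, g \in G -> act g (iota y) = iota y.
Hypothesis act_fix : forall x, (forall g, g \in G -> act g x = x) -> exists y, x = iota y.

Variables (OL : set L) (dL : dedekind OL).
Hypothesis OLact : forall g x, g \in G -> OL x -> OL (act g x).
Definition restrO : set K := [set x | OL (iota x)].
Local Notation OK := restrO.
Hypothesis den : forall x, exists d, [/\ d != 0, OK d & OL (iota d * x)].

Implicit Types (v : place K) (w : place L) (g h : gT).

Let OL1 := ded1 dL.
Let OLB := dedB dL.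
Let OLM := dedM dL.

Let actN g x : act g x = 0 -> x = 0.
Proof. by move/eqP; rewrite fmorph_eq0 => /eqP. Qed.

Lemma normP x : exists y, \prod_(g in G) act g x = iota y.
Proof.
apply: act_fix => h hG; rewrite rmorph_prod [RHS](reindex_acts 'R _ hG) ?astabsR //=.
by apply: eq_bigr => g gG; rewrite actM.
Qed.

Lemma norm_neq0 x : x != 0 -> \prod_(g in G) act g x != 0.
Proof. by move=> x0; apply/prodf_neq0 => g _; rewrite fmorph_eq0. Qed.

Lemma restr_dedekind : dedekind OK.
Proof.
split.
- by rewrite /restrO /= rmorph1.
- by move=> x y; rewrite /restrO /= rmorphB; exact: OLB.
- by move=> x y; rewrite /restrO /= rmorphM; exact: OLM.
- move=> x; have [d [d0 Od h]] := den (iota x); exists (d * x), d.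
  by split=> //; [rewrite /restrO /= rmorphM|field].
- move=> x i j ij; rewrite /restrO /= rmorphB !rmorphXn; exact: (ded_int dL ij).
- move=> a Oa a0; have a0' : iota a != 0 by rewrite fmorph_eq0.
  have [s cs] := ded_fin dL Oa a0'.
  pose P y := [set x : K | OK x /\ OL ((iota x - y) / iota a)].
  exists [seq xget 0 (P y) | y <- s] => x Ox; have [y ys h] := cs _ Ox.
  exists (xget 0 (P y)); first by apply/mapP; exists y.
  case: xgetP => [z _ [Oz hz]|/(_ x)[]]; last by split.
  rewrite /restrO /= fmorph_div rmorphB.
  have -> : (iota x - iota z) / iota a = (iota x - y) / iota a - (iota z - y) / iota a by ring.
  exact: OLB.
Qed.
Let dK := restr_dedekind.

Lemma fin_val_act w g x : g \in G -> fin OL w -> OL x -> vge w 0 (act g x).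
Proof. by move=> gG fw Ox; apply: (fin_vge fw); exact: OLact. Qed.

Lemma fin_norm_val w x : fin OL w -> OL x -> vge w 1 x ->
  vge w 1 (\prod_(g in G) act g x).
Proof.
move=> fw Ox wx; rewrite (bigD1 1%g) ?group1 //= act1.
rewrite -[1]addr0; apply: vgeM => //; apply: vge_prod => g /andP[gG _].
exact: fin_val_act.
Qed.

Definition above w v (e : nat) := (0 < e)%N /\ forall x, w (iota x) = v x * e%:Z.

(** The values of [w] on K form a group generated by some [e]. It is not zero: an integral element
    positive at [w] has its norm in K, and the norm is still positive at [w]. *)
Lemma above_ex w : fin OL w -> exists v e, above w v e.
Proof.
move=> fw.
have [a [[Oa wa] a0]] := primeI_neq0 dL fw.
have [n en] := normP a.
have wn : vge w 1 (iota n) by rewrite -en; exact: fin_norm_val.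
have n0 : n != 0 by rewrite -(fmorph_eq0 iota) -en norm_neq0.
pose Q k := `[< (0 < k)%N /\ exists2 x, x != 0 & w (iota x) = k%:Z >].
have exQ : exists k, Q k.
  exists `|w (iota n)|%N; apply/asboolP; rewrite vgeE ?fmorph_eq0 // in wn.
  by split; [lia|exists n => //; lia].
case: (ex_minnP exQ) => e /asboolP[e0 [p p0 wp]] mine.
have dvd x : w (iota x) = (w (iota x) %/ e%:Z)%Z * e%:Z.
  have [->|x0] := eqVneq x 0; first by rewrite rmorph0 val0 div0z mul0r.
  have ne0 : e%:Z != 0 by lia.
  have lt := ltz_pmod (w (iota x)) (d := e%:Z); have ge := modz_ge0 (w (iota x)) ne0.
  have ed := divz_eq (w (iota x)) e%:Z; rewrite {1}ed.
  set q := (_ %/ _)%Z in ed *; set r := (_ %% _)%Z in lt ge ed *.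
  have [->|r0] := eqVneq r 0; first by rewrite addr0.
  have qp0 : p ^ q != 0 by rewrite expfz_neq0.
  have wpq : w (iota (p ^ q)) = q * e%:Z.
    by rewrite rmorphXz ?unitfE // valXz wp.
  have : (e <= `|r|)%N.
    apply: mine; apply/asboolP; split; first lia.
    exists (x / p ^ q); first by rewrite mulf_neq0 ?invr_eq0.
    rewrite fmorph_div valf ?fmorph_eq0 // wpq ed addrAC subrr add0r.
    by rewrite gez0_abs.
  by move: lt => /(_ _); lia.
pose f (x : K) := (w (iota x) %/ e%:Z)%Z.
have fM x y : x != 0 -> y != 0 -> f (x * y) = f x + f y.
  move=> x0 y0; apply: (mulIf (x := e%:Z)); first by lia.
  by rewrite mulrDl /f -!dvd rmorphM valM ?fmorph_eq0.
have df : discrete_valuation f.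
  split=> //.
  - by rewrite /f rmorph0 val0 div0z.
  - move=> x y x0 y0 xy0; have e0' : 0 < e%:Z by lia.
    rewrite -(ler_pM2r e0') /f -dvd rmorphD.
    case: (place_dval w) => _ _ h _.
    have := h (iota x) (iota y); rewrite -rmorphD !fmorph_eq0 => /(_ x0 y0 xy0).
    rewrite rmorphD {1}[w (iota x)]dvd {1}[w (iota y)]dvd; apply: le_trans.
    by rewrite minr_pMl //; lia.
  - move=> k; exists (p ^ k); first by rewrite expfz_neq0.
    apply: (mulIf (x := e%:Z)); first by lia.
    rewrite /f -dvd.
    by rewrite rmorphXz ?unitfE // valXz wp.
by exists (Place (introT (asboolP _) df)), e; split=> // x /=; rewrite dvd.
Qed.

Lemma mulz_nat_antisym (a b : int) (e e' : nat) : (0 < e)%N -> (0 < e')%N ->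
  a * e%:Z = e'%:Z -> b * e'%:Z = e%:Z -> e = e'.
Proof.
clear=> e0 e'0 h h'; have a1 : 1 <= a by nia.
have b1 : 1 <= b by nia.
nia.
Qed.

Lemma above_uniq w v v' e e' : above w v e -> above w v' e' -> v = v' /\ e = e'.
Proof.
move=> [e0 h] [e0' h'].
have [x _ vx] := val_surj v 1; have [x' _ vx'] := val_surj v' 1.
have := h x; rewrite h' vx; have := h' x'; rewrite h vx' !mul1r => h1 h2.
have ee : e = e' by exact: mulz_nat_antisym h1 h2.
split=> //; apply: placeP => y; have := h y; rewrite h' ee => /mulIf -> //.
by rewrite eqz_nat -lt0n.
Qed.

Variables (p0 : place K) (pL : place L).

Definition resw w := xget p0 [set v | exists e, above w v e].
Definition ramw w := xget 1%N [set e | above w (resw w) e].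

Lemma reswP w : fin OL w -> above w (resw w) (ramw w).
Proof.
move=> fw; have [v [e h]] := above_ex fw.
have [e' h'] : exists e, above w (resw w) e.
  by rewrite /resw; case: xgetP => [//|/(_ v)[]]; exists e.
by rewrite /ramw; case: xgetP => [//|/(_ e')[]].
Qed.

Lemma reswE w v e : fin OL w -> above w v e -> resw w = v /\ ramw w = e.
Proof. by move=> fw h; apply: above_uniq (reswP fw) h. Qed.

Lemma ramw_gt0 w : fin OL w -> (0 < ramw w)%N. Proof. by move/reswP => []. Qed.

Lemma resw_val w x : fin OL w -> w (iota x) = resw w x * (ramw w)%:Z.
Proof. by move/reswP => [_]; apply. Qed.

Lemma fin_resw w : fin OL w -> fin OK (resw w).
Proof.
move=> fw; apply/finP => x Ox; have := resw_val x fw; move/finP: (fw) => /(_ _ Ox).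
by have := ramw_gt0 fw; nia.
Qed.

(** [x] has a simple pole at [v] and is integral at the other finite places. The ideal of
    denominators of [iota x] in [OL] contains the prime of [v] and is proper since [x] is not
    integral, so a place positive on it lies over [v]. *)
Lemma lies_over v : fin OK v -> exists2 w, fin OL w & resw w = v.
Proof.
move=> fv; have [|x [x0 Ix vx]] := @exact_elt K OK dK [:: v] (- << v >>); first by rewrite /= fv.
have {x0} x0 : x != 0 by case: x0.
have {}vx : v x = -1 by rewrite vx ?mem_head // coeffN coeffU eqxx.
pose I := [set z | OL z /\ OL (z * iota x)].
have iI : ideal OL I.
  split.
  - by split; rewrite ?mul0r; exact: (ded0 dL).
  - by move=> y z [? ?] [? ?]; split; [exact: OLB|rewrite mulrBl; exact: OLB].
  - by move=> b y ? [? ?]; split; [exact: OLM|rewrite -mulrA; exact: OLM].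
  - by move=> y [].
have PI a : primeI OK v a -> I (iota a).
  move=> [Oa va]; split=> //; rewrite -rmorphM; apply: (ded_place dK) => u fu.
  have := Ix u fu; rewrite coeffN coeffU mul1r; case: eqP => [vu|_] /= h; last first.
    by rewrite oppr0 in h; rewrite -[0]addr0; apply: vgeM => //; exact: (fin_vge fu).
  by rewrite -(subrr 1); apply: vgeM => //; rewrite -vu.
have nI1 : ~ I 1.
  move=> [_]; rewrite mul1r => Ox; have : OK x by [].
  by move/finP: fv => h /h; rewrite vx.
have [a [Pa a0]] := primeI_neq0 dK fv.
have [w [fw hw]] := ex_place dL iI nI1 (PI _ Pa) (etrans (congr1 negb (fmorph_eq0 iota a)) a0).
exists w => //; apply/esym/(fin_inj dK fv (fin_resw fw)) => b Pb.
split; first by case: Pb.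
have := hw _ (PI _ Pb); rewrite /vge fmorph_eq0 resw_val //.
by case/orP => [->//|h]; apply/orP; right; have := ramw_gt0 fw; nia.
Qed.

Lemma gact_dval w g : discrete_valuation (fun x => w (act g x)).
Proof.
split.
- by rewrite rmorph0 val0.
- by move=> x y x0 y0; rewrite rmorphM valM ?fmorph_eq0.
- move=> x y x0 y0 xy0; case: (place_dval w) => _ _ h _.
  by rewrite rmorphD; apply: h; rewrite -?rmorphD fmorph_eq0.
- move=> n; have [x x0 wx] := val_surj w n; exists (act g^-1%g x); first by rewrite fmorph_eq0.
  by rewrite -actM mulVg act1.
Qed.

Definition gact g w : place L := Place (introT (asboolP _) (gact_dval w g)).

Lemma gactE g w x : gact g w x = w (act g x). Proof. by []. Qed.

Lemma gact1 w : gact 1%g w = w.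
Proof. by apply: placeP => x; rewrite gactE act1. Qed.

Lemma gactM g h w : gact g (gact h w) = gact (g * h)%g w.
Proof. by apply: placeP => x; rewrite !gactE actM. Qed.

Lemma gactK g w : gact g^-1%g (gact g w) = w.
Proof. by rewrite gactM mulVg gact1. Qed.

Lemma fin_gact g w : g \in G -> fin OL w -> fin OL (gact g w).
Proof. by move=> gG /finP fw; apply/finP => x Ox; apply: fw; exact: OLact. Qed.

Lemma resw_gact g w : g \in G -> fin OL w -> resw (gact g w) = resw w /\ ramw (gact g w) = ramw w.
Proof.
move=> gG fw; apply: reswE; first exact: fin_gact.
by split; [exact: ramw_gt0|move=> x; rewrite gactE actK // resw_val].
Qed.

(** Were [w'] not conjugate to [w], some [x] would be positive at [w'] and congruent to 1 at all
    conjugates of [w]. Its norm would be positive at [w'] and have valuation 0 at [w], although both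
    places restrict to the same place of K. *)
Lemma resw_trans w w' : fin OL w -> fin OL w' -> resw w = resw w' ->
  exists2 g, g \in G & w' = gact g w.
Proof.
move=> fw fw' e; apply: contrapT => no.
pose S := [seq gact g w | g <- enum G].
have fS : all (fun w => fin OL w) S.
  by apply/allP => _ /mapP[g gG ->]; rewrite mem_enum in gG; exact: fin_gact.
have w'S : w' \notin S.
  by apply/negP => /mapP[g gG h]; rewrite mem_enum in gG; apply: no; exists g.
have [y [Oy h1 h2]] := crt_unit dL 1 fw' fS w'S.
pose x := 1 - y; have Ox : OL x by exact: OLB.
have wx g : g \in G -> act g x != 0 /\ w (act g x) = 0.
  move=> gG; have := h2 (gact g w); have gS : gact g w \in S by [apply/mapP; exists g; rewrite ?mem_enum]; move=> /(_ gS) hy.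
  have [|x0 vx] := @val_close _ (gact g w) 1 x (oner_neq0 _).
    by rewrite val1 add0r /x addrAC subrr sub0r vgeN.
  by split; [rewrite fmorph_eq0|rewrite -gactE vx val1].
have [n en] := normP x.
have wn : w (iota n) = 0.
  rewrite -en; suff [] : \prod_(g in G) act g x != 0 /\ w (\prod_(g in G) act g x) = 0 by [].
  elim/big_rec: _ => [|g z gG [z0 wz]]; first by rewrite oner_eq0 val1.
  by have [g0 wg] := wx g gG; rewrite mulf_neq0 // valM // wz wg.
have n0 : n != 0.
  rewrite -(fmorph_eq0 iota) -en norm_neq0 //.
  by have [] := wx 1%g (group1 _); rewrite act1.
have : vge w' 1 (iota n) by rewrite -en; exact: fin_norm_val.
rewrite vgeE ?fmorph_eq0 // (resw_val _ fw') -e.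
by move: wn; rewrite resw_val //; have := ramw_gt0 fw; nia.
Qed.

Lemma fiber v : exists s : seq (place L), forall w, fin OL w -> resw w = v -> w \in s.
Proof.
have [[w fw e]|no] := pselect (exists2 w, fin OL w & resw w = v).
  exists [seq gact g w | g <- enum G] => w' fw' e'.
  have [|g gG ->] := resw_trans fw fw'; first by rewrite e e'.
  by apply/mapP; exists g; rewrite ?mem_enum.
by exists [::] => w fw e; case: no; exists w.
Qed.

Definition jdiv (D : divisor K) : divisor L :=
  divf (fun w => if fin OL w then coeff (resw w) D * (ramw w)%:Z else 0).

Lemma jdivE D w : fin OL w -> coeff w (jdiv D) = coeff (resw w) D * (ramw w)%:Z.
Proof.
move=> fw; have /choice[s hs] := fiber.
rewrite (divfE (s := flatten [seq s v | v <- dom D])) ?fw // => u.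
case: ifP => // fu h; apply/flattenP; exists (s (resw u)); last exact: hs.
apply/mapP; exists (resw u) => //; rewrite mem_dom.
by apply: contraNneq h => ->; rewrite mul0r.
Qed.

Lemma jdivE0 D w : ~~ fin OL w -> coeff w (jdiv D) = 0.
Proof.
move=> fw; have /choice[s hs] := fiber.
rewrite (divfE (s := flatten [seq s v | v <- dom D])) ?(negPf fw) // => u.
case: ifP => // fu h; apply/flattenP; exists (s (resw u)); last exact: hs.
apply/mapP; exists (resw u) => //; rewrite mem_dom.
by apply: contraNneq h => ->; rewrite mul0r.
Qed.

Lemma jdiv_additive : zmod_morphism jdiv.
Proof.
move=> D E; apply: divP => w; rewrite coeffB.
case: (boolP (fin OL w)) => fw; last by rewrite !jdivE0 ?subrr.
by rewrite !jdivE // coeffB mulrBl.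
Qed.

Lemma jdiv_principal D : D \in fprincipal OK -> jdiv D \in fprincipal OL.
Proof.
move=> /fprincipalP[f f0 h]; apply/fprincipalP; exists (iota f); first by rewrite fmorph_eq0.
by move=> w fw; rewrite jdivE // h ?resw_val //; exact: fin_resw.
Qed.

Definition gdiv g (D : divisor L) : divisor L := divf (fun w => coeff (gact g w) D).

Lemma gdivE g D w : coeff w (gdiv g D) = coeff (gact g w) D.
Proof.
rewrite (divfE (s := [seq gact g^-1%g w | w <- dom D])) // => u.
by rewrite -mem_dom => h; apply/mapP; exists (gact g u); rewrite ?gactK.
Qed.

Lemma gdiv_additive g : zmod_morphism (gdiv g).
Proof. by move=> D E; apply: divP => w; rewrite coeffB !gdivE coeffB. Qed.

Lemma gdiv_principal g D : g \in G -> D \in fprincipal OL -> gdiv g D \in fprincipal OL.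
Proof.
move=> gG /fprincipalP[f f0 h]; apply/fprincipalP; exists (act g f); first by rewrite fmorph_eq0.
by move=> w fw; rewrite gdivE h ?gactE //; exact: fin_gact.
Qed.

Lemma val_norm w x : x != 0 ->
  w (\prod_(g in G) act g x) = \sum_(g in G) gact g w x.
Proof.
move=> x0; suff [] : \prod_(g in G) act g x != 0 /\ w (\prod_(g in G) act g x) = \sum_(g in G) gact g w x by [].
elim/big_rec2: _ => [|g y z gG [z0 e]]; first by rewrite oner_eq0 val1.
by rewrite mulf_neq0 ?fmorph_eq0 // valM ?fmorph_eq0 // e.
Qed.

(* The divisibility is read off an element with prescribed valuations along the
   fibre: the valuation of its norm is a multiple of the ramification index. *)
Lemma norm_dvd w D : fin OL w ->
  exists k : int, \sum_(g in G) coeff (gact g w) D = k * (ramw w)%:Z.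
Proof.
move=> fw; pose S := [seq gact g w | g <- enum G].
have fS : all (fun w => fin OL w) S.
  by apply/allP => _ /mapP[g gG ->]; rewrite mem_enum in gG; exact: fin_gact.
have [x [x0 _ hx]] := exact_elt dL D fS.
have {x0} x0 : x != 0.
  case: x0 => // S0; have : w \in S by apply/mapP; exists 1%g; rewrite ?gact1 ?mem_enum.
  by rewrite S0.
have [n en] := normP x.
exists (resw w n); rewrite -resw_val // -en val_norm //.
by apply: eq_bigr => g gG; rewrite hx //; apply/mapP; exists g; rewrite ?mem_enum.
Qed.

Definition liftw v := xget pL [set w | fin OL w /\ resw w = v].

Lemma liftwP v : fin OK v -> fin OL (liftw v) /\ resw (liftw v) = v.
Proof.
move=> fv; rewrite /liftw; case: xgetP => [//|].
by have [w fw e] := lies_over fv => /(_ w)[].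
Qed.

Lemma sum_gact h w (D : divisor L) : h \in G ->
  \sum_(g in G) coeff (gact g (gact h w)) D = \sum_(g in G) coeff (gact g w) D.
Proof.
move=> hG; rewrite [RHS](reindex_acts 'R _ hG) ?astabsR //=.
by apply: eq_bigr => g gG; rewrite gactM.
Qed.

(** The norm of divisors, computed at one chosen place above each [v]. The division is exact by
    [norm_dvd], and it makes the norm of a principal divisor the divisor of the norm. *)
Definition ndiv (D : divisor L) : divisor K :=
  divf (fun v => if fin OK v then
    ((\sum_(g in G) coeff (gact g (liftw v)) D) %/ (ramw (liftw v))%:Z)%Z else 0).

Let ndivE0 D v : coeff v (ndiv D) = if fin OK v then
    ((\sum_(g in G) coeff (gact g (liftw v)) D) %/ (ramw (liftw v))%:Z)%Z else 0.
Proof.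
rewrite (divfE (s := [seq resw w | w <- dom D])) // => u.
case: ifP => // fu h; have [fw ew] := liftwP fu.
have [g gG Dg] : exists2 g, g \in G & coeff (gact g (liftw u)) D != 0.
  apply: contrapT => no; case/eqP: h; rewrite big1 ?div0z // => g gG.
  by apply/eqP; apply: contrapT => /negP h; apply: no; exists g.
apply/mapP; exists (gact g (liftw u)); first by rewrite mem_dom.
by have [-> _] := resw_gact gG fw.
Qed.

Let ram_neq0 w : fin OL w -> (ramw w)%:Z != 0.
Proof. by move=> fw; rewrite eqz_nat -lt0n ramw_gt0. Qed.

Lemma ndivE w D : fin OL w ->
  coeff (resw w) (ndiv D) * (ramw w)%:Z = \sum_(g in G) coeff (gact g w) D.
Proof.
move=> fw; rewrite ndivE0 fin_resw //; have [fl el] := liftwP (fin_resw fw).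
have [h hG e] := resw_trans fl fw el.
rewrite [X in _ = X](_ : _ = \sum_(g in G) coeff (gact g (liftw (resw w))) D); last first.
  by rewrite [in LHS]e sum_gact.
have -> : ramw w = ramw (liftw (resw w)) by rewrite [in LHS]e; case: (resw_gact hG fl).
by have [k ->] := norm_dvd D fl; rewrite mulzK // ram_neq0.
Qed.

Lemma ndiv_additive : zmod_morphism ndiv.
Proof.
move=> D E; apply: divP => v; rewrite coeffB.
case: (boolP (fin OK v)) => fv; last by rewrite !ndivE0 (negPf fv) subrr.
have [w fw <-] := lies_over fv; apply: (mulIf (ram_neq0 fw)).
rewrite mulrBl !ndivE // -sumrB; apply: eq_bigr => g _.
by rewrite coeffB.
Qed.

Lemma ndiv_principal D : D \in fprincipal OL -> ndiv D \in fprincipal OK.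
Proof.
move=> /fprincipalP[f f0 h]; have [n en] := normP f.
apply/fprincipalP; exists n; first by rewrite -(fmorph_eq0 iota) -en norm_neq0.
move=> v fv; have [w fw <-] := lies_over fv; apply: (mulIf (ram_neq0 fw)).
rewrite ndivE // -resw_val // -en val_norm //.
by apply: eq_bigr => g gG; rewrite h //; exact: fin_gact.
Qed.

Local Notation ClK := (Clf OK).
Local Notation ClL := (Clf OL).

Definition jc : ClK -> ClL := qmap (fprincipal OL) jdiv.
Definition nc : ClL -> ClK := qmap (fprincipal OK) ndiv.
Definition gc g : ClL -> ClL := qmap (fprincipal OL) (gdiv g).

Lemma jcE D : jc (cls OK D) = cls OL (jdiv D).
Proof. exact: (qmapE jdiv_additive jdiv_principal). Qed.
Lemma ncE D : nc (cls OL D) = cls OK (ndiv D).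
Proof. exact: (qmapE ndiv_additive ndiv_principal). Qed.
Lemma gcE g D : g \in G -> gc g (cls OL D) = cls OL (gdiv g D).
Proof. by move=> gG; apply: (qmapE (gdiv_additive g)) => E; exact: gdiv_principal. Qed.

Lemma jc_additive : zmod_morphism jc.
Proof. exact: (qmap_is_additive jdiv_additive jdiv_principal). Qed.
Lemma nc_additive : zmod_morphism nc.
Proof. exact: (qmap_is_additive ndiv_additive ndiv_principal). Qed.
Lemma gc_additive g : g \in G -> zmod_morphism (gc g).
Proof. by move=> gG; apply: (qmap_is_additive (gdiv_additive g)) => E; exact: gdiv_principal. Qed.

Lemma nc_jc c : nc (jc c) = c *+ #|G|.
Proof.
have [D <-] := cls_surj c; rewrite jcE ncE -raddfMn; apply: cls_eqf => v fv.
have [w fw <-] := lies_over fv; apply: (mulIf (ram_neq0 fw)).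
rewrite ndivE // coeffMn mulrnAl -sumr_const; apply: eq_bigr => g gG.
by rewrite jdivE ?fin_gact //; have [-> ->] := resw_gact gG fw.
Qed.

Lemma jc_nc c : jc (nc c) = \sum_(g in G) gc g c.
Proof.
have [D <-] := cls_surj c; rewrite ncE jcE.
under eq_bigr do rewrite gcE //.
rewrite -raddf_sum; apply: cls_eqf => w fw.
rewrite jdivE // ndivE //; transitivity (\sum_(g in G) coeff w (gdiv g D)).
  by apply: eq_bigr => g _; rewrite gdivE.
by rewrite -(raddf_sum (coeff w)).
Qed.

Lemma gc_jc g c : g \in G -> gc g (jc c) = jc c.
Proof.
move=> gG; have [D <-] := cls_surj c; rewrite jcE gcE //; apply: cls_eqf => w fw.
by rewrite gdivE !jdivE ?fin_gact //; have [-> ->] := resw_gact gG fw.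
Qed.

Lemma gcM g h c : g \in G -> h \in G -> gc g (gc h c) = gc (h * g)%g c.
Proof.
move=> gG hG; have [D <-] := cls_surj c; rewrite !gcE ?groupM //; apply: cls_eqf => w fw.
by rewrite !gdivE gactM.
Qed.

Lemma gc1 c : gc 1%g c = c.
Proof.
have [D <-] := cls_surj c; rewrite gcE ?group1 //; apply: cls_eqf => w fw.
by rewrite gdivE gact1.
Qed.

Definition unitL x := [/\ x != 0, OL x & OL x^-1].

Lemma unitLP x : x != 0 -> (unitL x <-> forall w, fin OL w -> w x = 0).
Proof.
move=> x0; split=> [[_ Ox Oxi] w /finP fw|h].
  by have := fw _ Ox; have := fw _ Oxi; rewrite valV => h1 h2; apply: le_anti; rewrite h2 -oppr_ge0 h1.
split=> //; apply: (ded_place dL) => w fw; rewrite vgeE ?invr_eq0 // ?valV h //.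
Qed.

Lemma unitL_act g x : g \in G -> unitL x -> unitL (act g x).
Proof.
move=> gG [x0 Ox Oxi]; split; rewrite ?fmorph_eq0 -?fmorphV //; exact: OLact.
Qed.

Lemma unitL1 : unitL 1.
Proof. by split; rewrite ?oner_eq0 ?invr1. Qed.

Lemma unitLM x y : unitL x -> unitL y -> unitL (x * y).
Proof.
move=> [x0 Ox Oxi] [y0 Oy Oyi]; split; [by rewrite mulf_neq0|exact: OLM|].
by rewrite invfM; exact: OLM.
Qed.

Lemma unitLV x : unitL x -> unitL x^-1.
Proof. by move=> [x0 Ox Oxi]; split; rewrite ?invr_eq0 ?invrK. Qed.

(** Formulated for every subgroup [B] of the units, with [l]-th powers taken inside [B], because it
    serves for the units of norm 1 as well as for the units coming from K. *)
Definition unit_bound (l q : nat) := forall (B : set L), (forall x, B x -> unitL x) ->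
  B 1 -> (forall x y, B x -> B y -> B (x / y)) ->
  forall (I : eqType) (s : seq I) (u : I -> L), uniq s -> (forall i, i \in s -> B (u i)) ->
  (forall i j, i \in s -> j \in s -> (exists2 b, B b & u i / u j = b ^+ l) -> i = j) ->
  (size s <= q)%N.

(** * Kernel and cokernel of the extension of classes in a cyclic extension *)

Section Cyclic.
Variable tau : gT.
Hypothesis genG : G :=: <[tau]>%g.
Hypothesis H90 : forall a, \prod_(g in G) act g a = 1 -> exists2 b, b != 0 & a = b / act tau b.
Hypothesis unram : forall w, fin OL w -> ramw w = 1%N.

Let tauG : tau \in G. Proof. by rewrite genG cycle_id. Qed.

Lemma fix_gen x : act tau x = x -> exists y, x = iota y.
Proof.
move=> h; apply: act_fix => g; rewrite genG => /cycleP[i ->].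
by elim: i => [|i IH]; rewrite ?act1 // expgSr actM IH.
Qed.

(** When b has norm 1, b^n is the product of the quotients b / g b over the group. For g = tau^i the
    quotient is W / tau W with W the product of the tau^t b for t < i. *)
Lemma coboundary_pow b : unitL b -> \prod_(g in G) act g b = 1 ->
  exists2 W, unitL W & b ^+ #|G| = W / act tau W.
Proof.
move=> ub Nb.
have hW g : exists W, g \in G -> unitL W /\ b / act g b = W / act tau W.
  have [gG|] := boolP (g \in G); last by exists 1.
  move: (gG); rewrite {1}genG => /cycleP[i ei].
  suff [W h] : exists W, unitL W /\ b / act (tau ^+ i)%g b = W / act tau W.
    by exists W; rewrite ei.
  elim: i {ei gG} => [|i [W [uW IH]]].
    by exists 1; split; [exact: unitL1|rewrite act1 rmorph1 !divff ?oner_eq0 //; case: ub].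
  have ui : unitL (act (tau ^+ i)%g b) by apply: unitL_act; rewrite ?groupX.
  exists (W * act (tau ^+ i)%g b); split; first exact: unitLM.
  rewrite expgSr actM rmorphM /= -mulf_div -IH.
  have [i0 _ _] := ui; have := i0; rewrite -(fmorph_eq0 (act tau)) => i1.
  by field; rewrite i0 i1.
have {hW} /choice[W hW] := hW.
exists (\prod_(g in G) W g).
  elim/big_rec: _ => [|g z gG uz]; first exact: unitL1.
  by apply: unitLM => //; case: (hW g gG).
have e : \prod_(g in G) (b / act g b) = \prod_(g in G) (W g / act tau (W g)).
  by apply: eq_bigr => g gG; case: (hW g gG).
by rewrite rmorph_prod /= -prodf_div -e prodf_div prodr_const Nb divr1.
Qed.

(** A divisor of a class killed in L becomes the divisor of some [be], and [u] = tau be / be is a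
    unit of norm 1. If [u c / u d] is an n-th power of a unit of norm 1, it is W / tau W by
    [coboundary_pow]; then be c / be d * W is fixed by tau, and the element of K it comes from makes
    c and d equal. *)
Lemma ker_bound q (s : seq ClK) : unit_bound #|G| q -> uniq s ->
  (forall c, c \in s -> jc c = 0) -> (size s <= q)%N.
Proof.
move=> ub us hs.
have hb c : exists Db : divisor K * L, c \in s ->
    [/\ cls OK Db.1 = c, Db.2 != 0 & forall w, fin OL w -> coeff w (jdiv Db.1) = w Db.2].
  have [cs|] := boolP (c \in s); last by exists (0, 0).
  have [D eD] := cls_surj c; have := hs c cs; rewrite -eD jcE -(raddf0 (cls OL)).
  move=> /cls_eq[b b0 h]; exists (D, b) => _; split=> // w fw.
  by rewrite -h // coeff0 subr0.
have {hb} /choice[Db hD] := hb.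
pose be c := (Db c).2; pose u c := act tau (be c) / be c.
pose B := [set x | unitL x /\ \prod_(g in G) act g x = 1].
apply: (ub B _ _ _ _ _ u us) => /=.
- by move=> x [].
- by split; [exact: unitL1|apply: big1 => g _; rewrite rmorph1].
- move=> x y [ux Nx] [uy Ny]; split; first by apply: unitLM => //; exact: unitLV.
  rewrite (eq_bigr (fun g => act g x / act g y)) ?prodf_div ?Nx ?Ny ?divr1 //.
  by move=> g _; rewrite fmorph_div.
- move=> c cs; have [_ b0 h] := hD c cs; split.
    apply/unitLP; first by rewrite mulf_neq0 ?invr_eq0 ?fmorph_eq0.
    move=> w fw; rewrite valf ?fmorph_eq0 // -gactE -!h ?fin_gact // !jdivE ?fin_gact //.
    by have [-> ->] := resw_gact tauG fw; rewrite subrr.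
  rewrite (eq_bigr (fun g => act (tau * g)%g (be c) / act g (be c))); last first.
    by move=> g _; rewrite fmorph_div actM.
  rewrite prodf_div.
  rewrite [X in _ / X](reindex_inj (mulgI tau)) /=.
  rewrite [X in _ / X](eq_bigl (fun g => g \in G)); last by move=> g; rewrite groupMl.
  by rewrite divff //; apply/prodf_neq0 => g _; rewrite fmorph_eq0.
- move=> c d cs ds [b [ub' Nb] e].
  have [ec c0 hc] := hD c cs; have [ed d0 hd] := hD d ds.
  have [W uW eW] := coboundary_pow ub' Nb; have [W0 OW OWi] := uW.
  have [y ey] : exists y, be c / be d * W = iota y.
    apply: fix_gen; rewrite rmorphM fmorph_div /=.
    have : u c / u d * act tau W = W.
      by rewrite e eW divfK // fmorph_eq0.
    rewrite /u -/(be c) -/(be d) => {2}<-.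
    have hc0 : be c != 0 by []. have hd0 : be d != 0 by [].
    have hd1 : act tau (be d) != 0 by rewrite fmorph_eq0.
    by field; rewrite hc0 hd0 hd1.
  have y0 : y != 0 by rewrite -(fmorph_eq0 iota) -ey !mulf_neq0 ?invr_eq0.
  rewrite -ec -ed; apply/cls_eq; exists y => // v fv; have [w fw <-] := lies_over fv.
  apply: (mulIf (ram_neq0 fw)); rewrite -resw_val // -ey.
  rewrite valM ?mulf_neq0 ?invr_eq0 // valf // -hc // -hd // !jdivE //.
  have := (unitLP W0).1 uW _ fw => ->; rewrite addr0 -mulrBl //.
Qed.

(** For a fixed class, tau D - D is the divisor of some [be], whose norm [u] is a unit of K. If
    [u c / u d] is the n-th power of a unit b' of K, then be c / (be d * b') has norm 1, hence is
    gam / tau gam by Hilbert 90. The difference of the two divisors, plus the divisor of gam, is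
    then fixed by tau, and in the unramified case fixed divisors come from K. *)
Lemma coker_bound q (s : seq ClL) : unit_bound #|G| q -> uniq s ->
  (forall c, c \in s -> gc tau c = c) ->
  (forall c d, c \in s -> d \in s -> (exists k, c - d = jc k) -> c = d) -> (size s <= q)%N.
Proof.
move=> ub us hs sep.
have hb c : exists Db : divisor L * L, c \in s ->
    [/\ cls OL Db.1 = c, Db.2 != 0 &
     forall w, fin OL w -> coeff (gact tau w) Db.1 - coeff w Db.1 = w Db.2].
  have [cs|] := boolP (c \in s); last by exists (0, 0).
  have [D eD] := cls_surj c; have := hs c cs; rewrite -eD gcE //.
  move=> /cls_eq[b b0 h]; exists (D, b) => _; split=> // w fw.
  by rewrite -h // gdivE.
have {hb} /choice[Db hD] := hb.
pose be c := (Db c).2; pose u c := \prod_(g in G) act g (be c).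
pose B := [set x | unitL x /\ exists y, x = iota y].
apply: (ub B _ _ _ _ _ u us) => /=.
- by move=> x [].
- by split; [exact: unitL1|exists 1; rewrite rmorph1].
- move=> x' y' [ux [x ex]] [uy [y ey]]; split; first by apply: unitLM => //; exact: unitLV.
  rewrite ex ey; by exists (x / y); rewrite fmorph_div.
- move=> c cs; have [_ b0 h] := hD c cs; split; last exact: normP.
  apply/unitLP; first exact: norm_neq0.
  move=> w fw; rewrite val_norm //.
  rewrite (eq_bigr (fun g => coeff (gact (tau * g)%g w) (Db c).1 - coeff (gact g w) (Db c).1)); last first.
    by move=> g gG; rewrite -h ?fin_gact // gactM.
  rewrite sumrB [X in _ - X](reindex_inj (mulgI tau)) /=.
  rewrite [X in _ - X](eq_bigl (fun g => g \in G)) ?subrr //.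
  by move=> g; rewrite groupMl.
- move=> c d cs ds [b' [ub' [b eb]] e]; apply: sep => //.
  have [ec c0 hc] := hD c cs; have [ed d0 hd] := hD d ds.
  have b0 : b' != 0 by case: ub'.
  have [gam g0 eg] : exists2 gam, gam != 0 & be c / (be d * b') = gam / act tau gam.
    apply: H90; rewrite (eq_bigr (fun g => act g (be c) / (act g (be d) * b'))); last first.
      by move=> g gG; rewrite fmorph_div rmorphM /= eb actK.
    by rewrite prodf_div big_split /= prodr_const -e -/(u c) -/(u d) [X in _ / X]mulrC divfK ?divff ?norm_neq0.
  pose D := (Db c).1 - (Db d).1.
  have key w : fin OL w -> coeff (gact tau w) D + gact tau w gam = coeff w D + w gam.
    move=> fw; rewrite gactE; have : w (be c / (be d * b')) = w (gam / act tau gam) by rewrite eg.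
    rewrite !valf ?mulf_neq0 ?fmorph_eq0 // valM // ((unitLP b0).1 ub' _ fw) addr0 -hc // -hd // /D !coeffB.
    move=> h; lia.
  have key' w g : fin OL w -> g \in G -> coeff (gact g w) D + gact g w gam = coeff w D + w gam.
    move=> fw; rewrite genG => /cycleP[i ->]; elim: i => [|i IH]; first by rewrite gact1.
    rewrite expgS -gactM key //; apply: fin_gact => //; exact: groupX.
  pose E : divisor K := divf (fun v => if fin OK v then coeff (liftw v) D + liftw v gam else 0).
  have hE v : fin OK v -> coeff v E = coeff (liftw v) D + liftw v gam.
    move=> fv; have [sg hsg] := fin_supp dL g0.
    rewrite /E (divfE (s := [seq resw w | w <- dom D ++ sg])) ?fv // => x.
    case: ifP => // fx h; have [fw ew] := liftwP fx.
    apply/mapP; exists (liftw x) => //; rewrite mem_cat mem_dom.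
    have [/eqP D0|//] := boolP (coeff (liftw x) D == 0).
    by rewrite D0 add0r in h; exact: hsg.
  exists (cls OK E); rewrite jcE -ec -ed -raddfB -/D; apply/cls_eq.
  exists gam^-1; first by rewrite invr_eq0.
  move=> w fw; rewrite jdivE // unram // mulr1 hE ?fin_resw // valV.
  have [fl el] := liftwP (fin_resw fw); have [g gG eg'] := resw_trans fl fw el.
  by have := key' _ _ fl gG; rewrite -eg' => <-; rewrite opprD addrA subrr sub0r.
Qed.

End Cyclic.

(** A trivial decomposition group makes G act simply transitively on the fibre, so exactly one
    conjugate of any place of the fibre is [w]. *)
Lemma split_norm w : fin OL w -> ramw w = 1%N ->
  (forall g, g \in G -> gact g w = w -> g = 1%g) -> cls OK << resw w >> = nc (cls OL << w >>).
Proof.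
move=> fw rw st; rewrite ncE; apply: cls_eqf => v fv.
have [wl fl ev] := lies_over fv; subst v; apply: (mulIf (ram_neq0 fl)).
rewrite ndivE // coeffU mul1r.
have [e|ne] := eqVneq (resw w) (resw wl).
  have [g gG eg] := resw_trans fl fw (esym e).
  have -> : ramw wl = 1%N by rewrite -rw eg; case: (resw_gact gG fl) => _ ->.
  rewrite (bigD1 g) //= coeffU -eg eqxx !mul1r big1 ?addr0 // => h /andP[hG hg].
  rewrite coeffU mul1r; case: eqP => // eh; case/eqP: hg.
  have := st (h * g^-1)%g; rewrite groupM ?groupV // eg -gactM gactK -eh.
  by move=> /(_ isT eg) /eqP; rewrite -eq_mulgV1 => /eqP.
rewrite mul0r big1 // => g gG; rewrite coeffU mul1r; case: eqP => // eg.
by case/eqP: ne; rewrite eg; case: (resw_gact gG fl).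
Qed.

Lemma resw_primeI w x : fin OL w -> OK x -> primeI OL w (iota x) -> primeI OK (resw w) x.
Proof.
move=> fw Ox [_]; rewrite /vge fmorph_eq0 resw_val // => h; split=> //; rewrite /vge.
by case/orP: h => [->//|h]; apply/orP; right; have := ramw_gt0 fw; nia.
Qed.

Lemma primeI_resw w x : fin OL w -> primeI OK (resw w) x -> primeI OL w (iota x).
Proof.
move=> fw [Ox]; rewrite /vge => h; split=> //; rewrite /vge fmorph_eq0 resw_val //.
by case/orP: h => [->//|h]; apply/orP; right; have := ramw_gt0 fw; nia.
Qed.

Lemma Nv_resw w : fin OL w -> (Nv OK (resw w) <= Nv OL w)%N.
Proof.
move=> fw; have fv := fin_resw fw.
have [s [<- [us sep] sO _]] := NvP dK fv.
rewrite -(size_map iota); apply: (idx_sep (addg_primeI dL fw) (NvP dL fw)).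
  split; first by rewrite map_inj_uniq //; exact: fmorph_inj.
  move=> _ _ /mapP[a sa ->] /mapP[b sb ->]; rewrite -rmorphB => /(resw_primeI fw) h.
  by rewrite (sep a b) //; apply: h; apply: (dedB dK); exact: sO.
by move=> _ /mapP[a sa ->]; exact: sO.
Qed.

Lemma res_inv v x : fin OK v -> OK x -> ~ primeI OK v x ->
  exists2 y, OK y & primeI OK v (1 - x * y).
Proof. by move=> fv; exact: (max_inv dK (primeI_maximal dK fv)). Qed.

(* If every residue class at [w] came from [K], then a uniformizer of [K] would
   let us approximate every element by elements of [K] to any order, and [g]
   would act trivially. *)
Lemma inert_residue w g : fin OL w -> ramw w = 1%N -> g \in G -> gact g w = w ->
  (exists x, act g x != x) -> exists2 th, OL th & forall c, OK c -> ~ primeI OL w (th - iota c).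
Proof.
move=> fw rw gG gw [x0 gx0]; apply: contrapT => no.
have fv := fin_resw fw.
have {}no th : OL th -> exists2 c, OK c & primeI OL w (th - iota c).
  move=> Oth; apply: contrapT => nc; apply: no; exists th => // c Oc h; apply: nc.
  by exists c.
have [p [p0' Ip vp]] := mul_exact dK << resw w >> fv.
have {}vp : w (iota p) = 1.
  by rewrite resw_val // rw vp coeffU eqxx.
have loc x : vge w 0 x -> exists2 c, OK c & vge w 1 (x - iota c).
  move=> wx; have [t [Ot t0 wt Otx]] := fin_local dL fw wx.
  have [c1 Oc1 [_ h1]] := no _ Otx; have [c2 Oc2 [_ h2]] := no _ Ot.
  have nP : ~ primeI OK (resw w) c2.
    move=> /(primeI_resw fw)[_ h3]; have : vge w 1 t by rewrite -(subrK (iota c2) t); exact: vgeD.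
    by rewrite vgeE // wt.
  have [c3 Oc3 /(primeI_resw fw)[_ h3]] := res_inv fv Oc2 nP.
  rewrite rmorphB rmorph1 rmorphM /= in h3.
  exists (c1 * c3); first exact: (dedM dK).
  rewrite rmorphM /=.
  have -> : x - iota c1 * iota c3 = (1 - iota c2 * iota c3) * x + (t * x - iota c1) * iota c3
     - (t - iota c2) * (iota c3 * x) by ring.
  have wc3 : vge w 0 (iota c3) by apply: (fin_vge fw).
  have wc3x : vge w 0 (iota c3 * x) by rewrite -[0]addr0; exact: vgeM.
  by apply: vgeB; [apply: vgeD|]; rewrite -[1]addr0; exact: vgeM.
have triv (n : nat) x : vge w 0 x -> vge w n%:Z (act g x - x).
  elim: n x => [|n IH] x wx; first by apply: vgeB => //; rewrite /vge fmorph_eq0 -gactE gw.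
  have [c Oc hc] := loc x wx; pose z := (x - iota c) / iota p.
  have ip0 : iota p != 0 by rewrite fmorph_eq0.
  have wz : vge w 0 z.
    by rewrite -(subrr 1); apply: vgeM => //; rewrite vgeE ?invr_eq0 // valV vp.
  have -> : act g x - x = iota p * (act g z - z).
    rewrite /z fmorph_div rmorphB /= !actK //; field; done.
  by rewrite intS; apply: vgeM; [rewrite vgeE // vp|exact: IH].
have triv0 x : OL x -> act g x = x.
  move=> Ox; apply/eqP; rewrite -subr_eq0; apply/negPn/negP => n0.
  have := triv (`|w (act g x - x)%R|%N.+1) x (fin_vge fw Ox); rewrite vgeE //; lia.
have [a [b [Oa Ob b0 e]]] := ded_frac dL x0.
by case/eqP: gx0; rewrite e fmorph_div !triv0.
Qed.

(** By [inert_residue] some residue [th] does not come from K; 1 and [th] are then independent over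
    the residue field of K, and the combinations [a + b * th] are all distinct. *)
Lemma inert_Nv w g : fin OL w -> ramw w = 1%N -> g \in G -> gact g w = w ->
  (exists x, act g x != x) -> (Nv OK (resw w) * Nv OK (resw w) <= Nv OL w)%N.
Proof.
move=> fw rw gG gw ng; have [th Oth nth] := inert_residue fw rw gG gw ng.
have fv := fin_resw fw.
have [s [es [us sep] sO _]] := NvP dK fv.
rewrite -{1 2}es; pose f (ab : K * K) := iota ab.1 + iota ab.2 * th.
have key a b a' b' : a \in s -> b \in s -> a' \in s -> b' \in s ->
    primeI OL w (f (a, b) - f (a', b')) -> a = a' /\ b = b'.
  move=> as' bs a's b's; rewrite /f /= => h.
  have Oab : OK (a - a') by apply: (dedB dK); exact: sO.
  have Obb : OK (b - b') by apply: (dedB dK); exact: sO.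
  have [bb|nbb] := pselect (primeI OK (resw w) (b - b')).
    have e : b = b' by exact: sep.
    split=> //; apply: sep => //; apply: (resw_primeI fw Oab); move: h; rewrite e rmorphB.
    by congr (primeI _ _ _); ring.
  have [c Oc hc] := res_inv fv Obb nbb.
  case: (nth (- (c * (a - a')))); first by apply: (dedN dK); exact: (dedM dK).
  have iP := primeI_ideal dL fw; have hc' := primeI_resw fw hc.
  have -> : th - iota (- (c * (a - a'))) = th * iota (1 - (b - b') * c)
      + iota c * (iota a + iota b * th - (iota a' + iota b' * th)).
    by rewrite !(rmorphB, rmorphN, rmorphM, rmorph1); ring.
  apply: (idealD iP); case: iP => _ _ M _; first exact: M.
  exact: M.
pose t := [seq (a, b) | a <- s, b <- s].
have -> : (size s * size s)%N = size [seq f x | x <- t] by rewrite size_map size_allpairs.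
apply: (idx_sep (addg_primeI dL fw) (NvP dL fw)).
  have ut : uniq t by apply: allpairs_uniq => // -[a b] [a' b'] _ _ [-> ->].
  have inj x y : x \in t -> y \in t -> primeI OL w (f x - f y) -> x = y.
    move=> /allpairsP[[a b] /= [? ? ->]] /allpairsP[[a' b'] /= [? ? ->]].
    by move=> /key[]// -> ->.
  split.
    rewrite map_inj_in_uniq // => x y xt yt e; apply: inj => //.
    by rewrite e subrr; split; [exact: (ded0 dL)|exact: vge0].
  by move=> _ _ /mapP[x xt ->] /mapP[y yt ->] /inj -> //.
move=> _ /mapP[_ /allpairsP[[a b] /= [? ? ->]] ->]; apply: (dedD dL); first exact: sO.
by apply: OLM => //; exact: sO.
Qed.

End GaloisDivisors.

(** * Finiteness of the class number and units *)

Section FiniteCounting.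
Local Open Scope classical_set_scope.

Lemma finite_of_bound (T : eqType) (X : set T) (M : nat) :
  (forall s : seq T, uniq s -> (forall x, x \in s -> X x) -> (size s <= M)%N) ->
  exists s : seq T, [/\ uniq s, forall x, x \in s -> X x & forall x, X x -> x \in s].
Proof.
move=> h; pose Q m := `[< exists s : seq T, [/\ uniq s, forall x, x \in s -> X x & size s = m] >].
have exQ : exists m, Q m by exists 0%N; apply/asboolP; exists [::].
have bQ m : Q m -> (m <= M)%N by move=> /asboolP[s [us sX <-]]; exact: h.
case: (ex_maxnP exQ bQ) => m /asboolP[s [us sX <-]] maxs.
exists s; split=> // x Xx; apply/negPn/negP => xs.
suff /maxs : Q (size s).+1 by rewrite ltnn.
apply/asboolP; exists (x :: s); split=> //=; first by rewrite xs.
by move=> y; rewrite inE => /orP[/eqP->|/sX].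
Qed.

Lemma fiber_count (A : Type) (T : eqType) (p : seq A) (f : A -> T) (r : seq T) (q : nat) :
  all (fun a => f a \in r) p ->
  (forall y, y \in r -> (count (fun a => f a == y) p <= q)%N) -> (size p <= size r * q)%N.
Proof.
elim: r p => [|y r IH] p hp hq; first by case: p hp {hq}.
rewrite -(count_predC (fun a => f a == y) p) mulSn leq_add ?hq ?mem_head //.
rewrite -size_filter; apply: IH => [|z zr].
  rewrite all_filter; apply: sub_all hp => a /=.
  by rewrite inE => /orP[->//|->]; rewrite implybT.
apply: leq_trans (hq z _); last by rewrite inE zr orbT.
by rewrite count_filter; apply: sub_count => a /= /andP[].
Qed.

(** By Bernoulli's inequality, the exponent P * A already contradicts Q > P. *)
Lemma pow_growth (P Q A : nat) : (0 < P)%N -> (forall m, Q ^ m <= A * P ^ m)%N -> (Q <= P)%N.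
Proof.
move=> P0 h; rewrite leqNgt; apply/negP => PQ.
have ber m : ((P + m) * P ^ m <= P * (P.+1) ^ m)%N.
  elim: m => [|m IH]; first by rewrite !expn0 addn0.
  rewrite !expnS; have := leq_mul (leqnn P.+1) IH; nia.
have := ber (P * A)%N; have := h (P * A)%N.
have : (P.+1 ^ (P * A) <= Q ^ (P * A))%N.
  by case: (P * A)%N => // k; rewrite leq_exp2r.
set X := (P.+1 ^ _)%N; set Y := (Q ^ _)%N; set Z := (P ^ (P * A))%N.
have : (0 < Z)%N by rewrite expn_gt0 P0.
nia.
Qed.

End FiniteCounting.

(** * Geometry of numbers *)

Section GlobalField.
Local Open Scope classical_set_scope.
Variables (R : realType) (K : fieldType) (O : set K) (dO : dedekind O).
Variables (J : finType) (nrm : J -> K -> R).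
Local Notation n := #|J|.

(** The two counts say that [O] sits like a lattice in a space of dimension n, without naming that
    space, so that number rings and function rings both qualify. The index set will be a Galois
    group: the absolute values are listed with repetitions and enter the product formula with
    exponent 1. *)
Record global_data : Prop := GlobalData {
  glob_n : (0 < n)%N;
  nrm0 : forall j, nrm j 0 = 0;
  nrm_gt0 : forall j x, x != 0 -> 0 < nrm j x;
  nrmM : forall j x y, nrm j (x * y) = nrm j x * nrm j y;
  nrmD : forall j x y, nrm j (x + y) <= nrm j x + nrm j y;
  count_upper : exists2 C : R, 0 < C & forall T : R, 1 <= T -> forall s : seq K, uniq s ->
    (forall x, x \in s -> O x /\ forall j, nrm j x <= T) -> (size s)%:R <= C * T ^+ n;
  count_lower : exists2 c : R, 0 < c & forall T : R, 1 <= T -> exists s : seq K, [/\ uniq s,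
    forall x, x \in s -> O x /\ forall j, nrm j x <= T & c * T ^+ n <= (size s)%:R];
  product_formula : forall x, x != 0 -> Nd O R (dv O x) = \prod_j nrm j x;
  scalings : exists2 C : R, 1 <= C & forall T : R, 1 <= T ->
    exists a, O a /\ forall j, T <= nrm j a <= C * T }.

Hypothesis gd : global_data.
Implicit Types (x y : K) (j : J) (v : place K) (D E : divisor K).
Local Notation fin := (fin O).
Local Notation dv := (dv O).
Local Notation Nd := (Nd O R).
Local Notation Nv := (Nv O).
Local Notation I_ := (idealD_ O).
Local Notation unit := (unitL O).
Local Notation Cl := (Clf O).
Local Notation cls := (cls O).

Let n0 := glob_n gd.

Lemma nrm_ge0 j x : 0 <= nrm j x.
Proof. by have [->|x0] := eqVneq x 0; rewrite ?(nrm0 gd) // ltW // nrm_gt0. Qed.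

Lemma nrm1 j : nrm j 1 = 1.
Proof.
apply: (mulfI (x := nrm j 1)); last by rewrite -(nrmM gd) !mulr1.
by rewrite gt_eqF // nrm_gt0 // oner_eq0.
Qed.

Lemma nrmV j x : nrm j x^-1 = (nrm j x)^-1.
Proof.
have [->|x0] := eqVneq x 0; first by rewrite invr0 (nrm0 gd) invr0.
apply: (mulfI (x := nrm j x)); first by rewrite gt_eqF // nrm_gt0.
by rewrite -(nrmM gd) !divff ?nrm1 // gt_eqF // nrm_gt0.
Qed.

Lemma nrmf j x y : nrm j (x / y) = nrm j x / nrm j y.
Proof. by rewrite (nrmM gd) nrmV. Qed.

Lemma nrmX j x k : nrm j (x ^+ k) = nrm j x ^+ k.
Proof. by elim: k => [|k IH]; rewrite ?nrm1 // !exprS (nrmM gd) IH. Qed.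

Lemma nrmN j x : nrm j (- x) = nrm j x.
Proof.
have h : nrm j (-1) = 1.
  apply/eqP; rewrite -sqrp_eq1 ?nrm_ge0 //.
  by rewrite -nrmX sqrrN expr1n nrm1.
by rewrite -mulN1r (nrmM gd) h mul1r.
Qed.

Lemma nrmB j x y : nrm j (x - y) <= nrm j x + nrm j y.
Proof. by rewrite -(nrmN j y); exact: nrmD. Qed.

Definition Nm x : R := \prod_j nrm j x.
Definition ht x : R := \sum_j nrm j x.

Lemma NmE x : x != 0 -> Nm x = Nd (dv x).
Proof. by move=> x0; rewrite (product_formula gd). Qed.

Lemma Nm_gt0 x : x != 0 -> 0 < Nm x.
Proof. by move=> x0; apply: prodr_gt0 => j _; exact: nrm_gt0. Qed.

Lemma NmM x y : Nm (x * y) = Nm x * Nm y.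
Proof. by rewrite /Nm -big_split /=; apply: eq_bigr => j _; rewrite (nrmM gd). Qed.

Lemma nrm_le_ht j x : nrm j x <= ht x.
Proof. by rewrite /ht (bigD1 j) //= lerDl; apply: sumr_ge0 => i _; exact: nrm_ge0. Qed.

Lemma ht_ge0 x : 0 <= ht x.
Proof. by apply: sumr_ge0 => j _; exact: nrm_ge0. Qed.

Lemma ht_le x (T : R) : (forall j, nrm j x <= T) -> ht x <= n%:R * T.
Proof.
by move=> h; rewrite mulr_natl -sumr_const; apply: ler_sum => j _.
Qed.

Lemma ht_gt0 x : x != 0 -> 0 < ht x.
Proof.
move=> x0; have /card_gt0P[j _] := n0.
by apply: lt_le_trans (nrm_le_ht j x); exact: nrm_gt0.
Qed.

Lemma Nm_le_ht x : Nm x <= ht x ^+ n.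
Proof.
rewrite -prodr_const; apply: ler_prod => j _; rewrite nrm_ge0 /=; exact: nrm_le_ht.
Qed.

Lemma unitP x : x != 0 -> (unit x <-> forall v, fin v -> v x = 0).
Proof.
move=> x0; split=> [[_ Ox Oxi] w /finP fw|h].
  by have := fw _ Ox; have := fw _ Oxi; rewrite valV => h1 h2; apply: le_anti; rewrite h2 -oppr_ge0 h1.
by split=> //; apply: (ded_place dO) => w fw; rewrite vgeE ?invr_eq0 // ?valV h.
Qed.

Lemma dv_unit x : unit x -> dv x = 0.
Proof.
move=> ux; have [x0 _ _] := ux; apply: divP => v; rewrite (dvE dO) coeff0.
by case: ifP => // fv; apply: (unitP x0).1.
Qed.

Lemma Nm_unit x : unit x -> Nm x = 1.
Proof. by move=> ux; have [x0 _ _] := ux; rewrite NmE // dv_unit // Nd0. Qed.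

Lemma dv_eq_unit x y : x != 0 -> y != 0 -> dv x = dv y -> unit (x / y).
Proof.
move=> x0 y0 e; apply/unitP; first by rewrite mulf_neq0 ?invr_eq0.
move=> v fv; rewrite valf //; have := congr1 (coeff v) e.
by rewrite !(dvE dO) fv => ->; rewrite subrr.
Qed.

Lemma Nm_ge1 x : O x -> x != 0 -> 1 <= Nm x.
Proof. by move=> Ox x0; rewrite NmE //; apply: (Nd_ge1 dO); exact: (eff_dv dO). Qed.

(** A box containing more points of [O] than the index of the ideal has two congruent points, and
    their difference is the small element. *)
Lemma minkowski : exists2 C : R, 0 < C & forall D, eff O D ->
  exists y, [/\ y != 0, I_ D y & ht y ^+ n <= C * Nd D].
Proof.
have [c c0 hc] := count_lower gd.
pose C : R := (n%:R * 2) ^+ n * (1 + 2 ^+ n / c).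
have C0 : 0 < C by rewrite mulr_gt0 ?exprn_gt0 ?mulr_gt0 ?ltr0n // addr_gt0 // divr_gt0 // exprn_gt0.
exists C => // D eD; have N1 := Nd_ge1 dO R eD.
have [m hm em] := idx_idealD dO R eD.
have exk : exists k : nat, (0 < k)%N && (Nd D < c * k%:R ^+ n).
  exists (Num.truncn (Nd D / c)).+1; rewrite /= mulrC -ltr_pdivrMr //.
  have h : Nd D / c < (Num.truncn (Nd D / c)).+1%:R by rewrite truncnS_gt.
  apply: lt_le_trans h _; rewrite -[leLHS]expr1; apply: ler_weXn2l => //.
  by rewrite ler1n.
case: (ex_minnP exk) => k /andP[k0 hk] mink.
(* By minimality [k - 1] is too small, and k <= 2 (k - 1) unless k = 1; this gives the factor 2^n /
   c and the summand 1. *)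
have kle : k%:R ^+ n <= (1 + 2 ^+ n / c) * Nd D.
  case: k k0 hk mink => // -[_ _ _|k _ _ mink].
    by rewrite expr1n mulrDl mul1r ler_wpDr // mulr_ge0 // ?divr_ge0 ?exprn_ge0 ?ltW // (lt_le_trans _ N1).
  have : c * k.+1%:R ^+ n <= Nd D.
    rewrite leNgt; apply/negP => h.
    by have := mink k.+1; rewrite h ltnn => /(_ isT).
  move=> h; have : k.+2%:R ^+ n <= 2 ^+ n * k.+1%:R ^+ n :> R.
    rewrite -exprMn; apply: lerXn2r; rewrite ?nnegrE ?mulr_ge0 ?ler0n //.
    by rewrite -natrM ler_nat; lia.
  move=> h'; apply: le_trans h' _; rewrite mulrDl mul1r ler_wpDl ?(le_trans _ N1) //.
  rewrite -mulrA ler_wpM2l ?exprn_ge0 // mulrC -[leLHS]mul1r.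
  by rewrite mul1r mulrC -ler_pdivlMl in h *.
have [s [us hs ls]] := hc k%:R (ltac:(by rewrite ler1n)).
have [x [y [xs ys xy Ixy]]] : exists x y, [/\ x \in s, y \in s, x != y & I_ D (x - y)].
  apply: contrapT => no.
  have : (size s <= m)%N.
    apply: idx_sep (addg_idealD O D) hm _ _; last by move=> z /hs[].
    split=> // x y xs ys h; apply: contrapT => /eqP ne; apply: no; exists x, y; split=> //.
  rewrite -(ler_nat R) em => h; have := lt_le_trans hk ls; rewrite ltNge h //.
exists (x - y); split; rewrite ?subr_eq0 //.
have hj j : nrm j (x - y) <= 2 * k%:R.
  apply: le_trans (nrmB _ _ _) _; rewrite mulrDl mul1r lerD //; first by case: (hs x xs).
  by case: (hs y ys).
apply: (@le_trans _ _ ((n%:R * (2 * k%:R)) ^+ n)).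
  by apply: lerXn2r; rewrite ?nnegrE ?ht_ge0 ?mulr_ge0 //; exact: ht_le.
by rewrite mulrA exprMn -mulrA ler_wpM2l // exprn_ge0 // mulr_ge0.
Qed.

Lemma many_elements (B : nat) : exists s : seq K, [/\ uniq s, forall x, x \in s -> O x & (B < size s)%N].
Proof.
have [c c0 hc] := count_lower gd.
pose T : R := (Num.truncn (B%:R / c)).+1%:R.
have T1 : 1 <= T by rewrite ler1n.
have [s [us hs ls]] := hc T T1.
exists s; split=> //; first by move=> x /hs[].
rewrite -(ltr_nat R); apply: lt_le_trans ls; rewrite mulrC -ltr_pdivrMr //.
apply: (@lt_le_trans _ _ T); first by rewrite truncnS_gt.
by rewrite -[leLHS]expr1; apply: ler_weXn2l.
Qed.

(** Among more than [B] integral elements two are congruent modulo any prime of norm at most [B], so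
    that prime divides one of finitely many nonzero differences. *)
Lemma finite_places (B : nat) : exists s : seq (place K), forall v, fin v -> (Nv v <= B)%N -> v \in s.
Proof.
have [t [ut tO Bt]] := many_elements B.
have hs (xy : K * K) : exists s : seq (place K), xy.1 != xy.2 -> forall v, fin v -> v (xy.1 - xy.2) != 0 -> v \in s.
  have [->|ne] := eqVneq xy.1 xy.2; first by exists [::].
  by have [|s hs] := @fin_supp K O dO (xy.1 - xy.2); [rewrite subr_eq0|exists s].
have {hs} /choice[s hs] := hs.
exists (flatten [seq s xy | xy <- [seq (x, y) | x <- t, y <- t]]) => v fv vB.
have [x [y [xt yt xy [_ h]]]] : exists x y, [/\ x \in t, y \in t, x != y & primeI O v (x - y)].
  apply: contrapT => no; have : (size t <= Nv v)%N.
    apply: idx_sep (addg_primeI dO fv) (NvP dO fv) _ tO.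
    by split=> // x y xt yt h; apply: contrapT => /eqP ne; apply: no; exists x, y.
  lia.
apply/flattenP; exists (s (x, y)).
  by apply/mapP; exists (x, y) => //; apply/allpairsP; exists (x, y).
apply: hs => //=; move: h; rewrite /vge subr_eq0 (negPf xy) /=; lia.
Qed.

Lemma Nv_le_Nd D v : eff O D -> v \in dom D -> (Nv v)%:R <= Nd D /\ 2 ^+ `|coeff v D|%N <= Nd D.
Proof.
move=> eD; rewrite mem_dom => vD; have [v0 /(_ vD) fv] := eD v.
have e : Nd (<< v >> *+ `|coeff v D|%N) = (Nv v)%:R ^+ `|coeff v D|%N by rewrite NdMn // NdU.
have le : Nd (<< v >> *+ `|coeff v D|%N) <= Nd D.
  apply: (Nd_le dO) => w; rewrite coeffB coeffMn coeffU mul1r.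
  case: eqP => [<-|_] /=; last by rewrite mul0rn subr0.
  by rewrite pmulrn natz; split=> //; lia.
have N1 : 1 <= (Nv v)%:R :> R by rewrite ler1n Nv_gt0.
split.
  apply: le_trans le; rewrite e -[leLHS]expr1; apply: ler_weXn2l => //; lia.
apply: le_trans le; rewrite e; apply: lerXn2r; rewrite ?nnegrE ?ler0n //.
by rewrite ler_nat Nv_gt1.
Qed.

Lemma finite_divisors (B : R) : exists s : seq (divisor K), forall D, eff O D -> Nd D <= B -> D \in s.
Proof.
pose b := (Num.truncn B).+1.
have Bb : B < b%:R by rewrite truncnS_gt.
have [t ht'] := finite_places b.
have [|v0] := pselect (exists v0 : place K, True); last first.
  by exists [:: 0] => D eD _; rewrite inE; apply/eqP; apply: divP => v; case: v0; exists v.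
move=> [v0 _].
(* Test number k asks whether the place of index k / b in [t] has coefficient k mod b. *)
pose m D (k : 'I_(size t * b)) := coeff (nth v0 t (k %/ b)) D == (k %% b)%N%:Z.
have [|s hs] := @finite_by_mask _ [set D | eff O D /\ Nd D <= B] _ m; last first.
  by exists s => D eD ND; apply: hs.
suff H D E : eff O D -> Nd D <= B -> m D =1 m E -> forall v, v \in dom D -> coeff v D = coeff v E.
  move=> D E [eD ND] [eE NE] e; apply: divP => v.
  have [vD|vD] := boolP (v \in dom D); first exact: H.
  have [vE|vE] := boolP (v \in dom E); first by apply/esym/H => // k; rewrite e.
  by rewrite !coeff_outdom.
move=> eD ND e v vD; have [h1 h2] := Nv_le_Nd eD vD.
have [c0 /(_ (etrans (esym (mem_dom D v)) vD)) fv] := eD v.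
have vt : v \in t.
  apply: ht' => //; rewrite -(ler_nat R); apply: le_trans h1 _; exact: le_trans ND (ltW Bb).
have cb : (`|coeff v D| < b)%N.
  apply: leq_trans (ltn_expl _ (ltnSn 1)) _; rewrite -(ler_nat R) natrX.
  by apply: le_trans h2 _; exact: le_trans ND (ltW Bb).
have lt : (index v t * b + `|coeff v D|%N < size t * b)%N.
  have : (index v t < size t)%N by rewrite index_mem.
  by nia.
have := e (Ordinal lt); rewrite /m /= divnMDl // divn_small // addn0 modnMDl modn_small // nth_index //.
by rewrite gez0_abs // eqxx => /esym/eqP.
Qed.

Lemma eff_rep c : exists2 D, eff O D & cls D = c.
Proof.
have [D eD] := cls_surj c.
have [a [Oa a0 ha]] : exists a, [/\ O a, a != 0 & forall v, fin v -> - coeff v D <= v a].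
  have [|x [x0 Ix vx]] := @exact_elt K O dO [seq v <- dom D | fin v] (- D).
    by apply/allP => v; rewrite mem_filter => /andP[].
  have {x0} [x0|S0] := x0.
    have [b [d [Ob Od d0 e]]] := ded_frac dO x.
    have b0 : b != 0 by apply: contra_neq x0 => b0; rewrite e b0 mul0r.
    exists b; split=> // v fv; have := Ix v fv; rewrite vgeE // e valf // coeffN.
    by move/finP: (fv) => /(_ d Od); lia.
  exists 1; rewrite oner_eq0; split=> //; first exact: (ded1 dO).
  move=> v fv; rewrite val1 coeff_outdom ?oppr0 //; apply/negP => vD.
  by have : v \in [::] by rewrite -S0 mem_filter fv.
pose E : divisor K := divf (fun v => if fin v then coeff v D + v a else 0).
have [sa hsa] := fin_supp dO a0.
have hE v : coeff v E = if fin v then coeff v D + v a else 0.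
  rewrite /E (divfE (s := dom D ++ sa)) // => u; case: ifP => // fu.
  rewrite mem_cat mem_dom; have [->|//] := eqVneq (coeff u D) 0; rewrite add0r; exact: hsa.
exists E; first by move=> v; rewrite hE; case: ifP => // fv; split=> //; have := ha v fv; lia.
rewrite -eD; apply/cls_eq; exists a => // v fv.
by rewrite hE fv addrAC subrr add0r.
Qed.

(** For an effective [D] in the class opposite to [c], the small element [y] of its ideal makes
    [dv y - D] an effective divisor of class [c] and bounded norm. *)
Lemma class_group_finite : exists s : seq Cl, forall c, c \in s.
Proof.
have [C C0 hC] := minkowski; have [s hs] := finite_divisors C.
exists [seq cls D | D <- s] => c.
have [D eD ec] := eff_rep (- c); have [y [y0 Iy Ny]] := hC D eD.
have eE : eff O (dv y - D).
  move=> v; rewrite coeffB (dvE dO); have [D0 Df] := eD v; case: ifP => fv.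
    by split=> //; have := Iy v fv; rewrite vgeE //; lia.
  have -> : coeff v D = 0 by apply/eqP; apply: contraFT fv => /Df.
  by rewrite subrr.
apply/mapP; exists (dv y - D).
  apply: hs => //; rewrite NdB // -NmE // ler_pdivrMr ?Nd_gt0 //.
  exact: le_trans (Nm_le_ht _) Ny.
rewrite raddfB /= ec opprK; suff -> : cls (dv y) = 0 by rewrite add0r.
rewrite -(raddf0 cls); apply/cls_eq; exists y => // v fv.
by rewrite (dvE dO) fv coeff0 subr0.
Qed.

Lemma finite_bounded (B : R) : exists s : seq K, forall x, O x -> (forall j, nrm j x <= B) -> x \in s.
Proof.
have [C C0 hC] := count_upper gd.
pose T := Num.max 1 B; have T1 : 1 <= T by rewrite le_max lexx.
have [|s [_ _ hs]] := @finite_of_bound K [set x | O x /\ forall j, nrm j x <= T] (Num.truncn (C * T ^+ n)).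
  move=> s us sX; rewrite truncn_ge_nat; first exact: (hC T T1).
  by rewrite mulr_ge0 ?exprn_ge0 ?(ltW C0) // (le_trans _ T1).
by exists s => x Ox hx; apply: hs; split=> // j; rewrite le_max hx orbT.
Qed.

Lemma finite_generators (B : R) : exists s : seq K, (forall a, a \in s -> a != 0) /\
  forall x, O x -> x != 0 -> Nm x <= B -> exists2 a, a \in s & unit (x / a).
Proof.
have [s hs] := finite_divisors B.
exists [seq xget 1 [set a | a != 0 /\ dv a = D] | D <- s]; split.
  by move=> _ /mapP[D _ ->]; case: xgetP => [a _ []|_]; rewrite ?oner_eq0.
move=> x Ox x0 Nx; exists (xget 1 [set a | a != 0 /\ dv a = dv x]).
  by apply/mapP; exists (dv x) => //; apply: hs; [exact: (eff_dv dO)|rewrite -NmE].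
case: xgetP => [a _ [a0 ea]|/(_ x)[]//].
exact: dv_eq_unit.
Qed.

(** The small element [y] of the ideal [x O] has a quotient [y / x] of bounded norm, which up to a
    unit [u] is one of finitely many [a]. Then u x = y / a is as balanced as [y]. *)
Lemma cocompact : exists2 C : R, 0 < C & forall x, O x -> x != 0 ->
  exists2 u, unit u & ht (u * x) ^+ n <= C * Nm x.
Proof.
have [C C0 hC] := minkowski; have [s [s0 hs]] := finite_generators C.
pose M := 1 + \sum_(a <- s) \sum_j (nrm j a)^-1.
have M0 : 1 <= M.
  by rewrite lerDl; apply: sumr_ge0 => a _; apply: sumr_ge0 => j _; rewrite invr_ge0 nrm_ge0.
have hM a j : a \in s -> (nrm j a)^-1 <= M.
  move=> sa; have S0 (i : K) : 0 <= \sum_j (nrm j i)^-1.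
    by apply: sumr_ge0 => *; rewrite invr_ge0 nrm_ge0.
  apply: (@le_trans _ _ (\sum_j (nrm j a)^-1)).
    by rewrite (bigD1 j) //= lerDl; apply: sumr_ge0 => *; rewrite invr_ge0 nrm_ge0.
  rewrite /M (big_rem a) //= addrCA lerDl addr_ge0 //.
  by apply: sumr_ge0.
exists (M ^+ n * C); first by rewrite mulr_gt0 // exprn_gt0 // (lt_le_trans _ M0).
move=> x Ox x0; have [y [y0 Iy Ny]] := hC (dv x) (eff_dv dO Ox).
rewrite -NmE // in Ny.
have Oa : O (y / x).
  apply: (ded_place dO) => v fv; have := Iy v fv; rewrite (dvE dO) fv.
  by rewrite !vgeE ?mulf_neq0 ?invr_eq0 // valf //; lia.
have a0 : y / x != 0 by rewrite mulf_neq0 ?invr_eq0.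
have [|a sa ua] := hs _ Oa a0.
  rewrite NmM.
  have -> : Nm x^-1 = (Nm x)^-1.
    by rewrite /Nm -prodfV; apply: eq_bigr => j _; rewrite nrmV.
  by rewrite ler_pdivrMr ?Nm_gt0 // (le_trans (Nm_le_ht _)).
exists (y / x / a) => //.
have -> : y / x / a * x = y / a by field; rewrite x0 s0.
rewrite -mulrA; apply: le_trans (_ : (M * ht y) ^+ n <= _).
  apply: lerXn2r; rewrite ?nnegrE ?ht_ge0 ?mulr_ge0 ?ht_ge0 ?(le_trans _ M0) //.
  rewrite /ht mulr_sumr; apply: ler_sum => j _; rewrite nrmf mulrC.
  by rewrite ler_wpM2r ?nrm_ge0 // hM.
by rewrite exprMn ler_wpM2l // exprn_ge0 // (le_trans _ M0).
Qed.

(* Comparing the units of [B] of bounded height with their [l]-th powers: if [B]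
   had too many classes modulo [l]-th powers, the number of elements of height at
   most [T] would grow faster than the volume [T ^ n] of a box. *)
Lemma global_unit_bound (l : nat) : (1 < l)%N -> unit_bound O l (l ^ n.+1).
Proof.
move=> l1 B Bu B1 Bdiv I s u us sB sep.
have BM x y : B x -> B y -> B (x * y).
  move=> Bx By; have -> : x * y = x / (1 / y) by rewrite div1r invrK.
  exact: (Bdiv _ _ Bx (Bdiv _ _ B1 By)).
have BX x k : B x -> B (x ^+ k) by move=> Bx; elim: k => [|k IH] //; rewrite exprS; exact: BM.
pose bd (k : nat) x := forall j, 2 ^- k <= nrm j x <= 2 ^+ k.
have bdM k m x y : bd k x -> bd m y -> bd (k + m)%N (x * y).
  move=> hx hy j; have /andP[a1 a2] := hx j; have /andP[b1 b2] := hy j.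
  rewrite (nrmM gd) !exprD invfM; apply/andP; split.
    by apply: ler_pM; rewrite ?invr_ge0 ?exprn_ge0.
  by apply: ler_pM; rewrite ?nrm_ge0.
have bdX k m x : bd k x -> bd (m * k)%N (x ^+ m).
  move=> hx; elim: m => [|m IH]; last by rewrite exprS mulSn; exact: bdM.
  by move=> j; rewrite expr0 mul0n expr0 invr1 nrm1 lexx.
have bdex x : x != 0 -> exists k, bd k x.
  move=> x0; exists (\sum_j (Num.truncn (nrm j x) + Num.truncn (nrm j x)^-1).+1)%N => j.
  set k := (\sum_j _)%N.
  have hk (y : R) : y = nrm j x \/ y = (nrm j x)^-1 -> y <= 2 ^+ k.
    move=> hy; have : (Num.truncn y < k)%N.
      by rewrite /k (bigD1 j) //=; case: hy => ->; lia.
    move=> h; have y0 : 0 <= y by case: hy => ->; rewrite ?invr_ge0 nrm_ge0.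
    apply: ltW; apply: lt_le_trans (truncnS_gt y) _.
    by rewrite -natrX ler_nat; exact: leq_trans h (ltnW (ltn_expl _ _)).
  rewrite hk ?andbT; last by left.
  have h2 := hk _ (or_intror (erefl (nrm j x)^-1)).
  have xj : 0 < nrm j x by exact: nrm_gt0.
  by rewrite -[leRHS]invrK lef_pV2 // posrE ?invr_gt0 // exprn_gt0.
have [U0 hU0] := finite_bounded 2.
pose q0 := size U0.
(* Members with the same dyadic size at every [j] have quotients with all absolute values at most 2,
   hence in the finite list [U0]; there are (2 k + 1)^n possible sizes. *)
have box k t : uniq t -> (forall x, x \in t -> B x /\ bd k x) -> (size t <= (2 * k).+1 ^ n * q0)%N.
  move=> ut ht'.
  have he x j : exists e : 'I_(2 * k).+1, x \in t -> 2 ^- k * 2 ^+ e <= nrm j x <= 2 ^- k * 2 ^+ e * 2.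
    have [xt|] := boolP (x \in t); last by exists ord0.
    have [_ /(_ j) /andP[h1 h2]] := ht' x xt.
    have e2k : 2 ^- k * 2 ^+ (2 * k) = 2 ^+ k :> R.
      by rewrite mul2n -addnn exprD mulrA mulVf ?mul1r // expf_neq0 // pnatr_eq0.
    pose P m := (nrm j x <= 2 ^- k * 2 ^+ m * 2).
    have exP : exists m, P m.
      exists (2 * k)%N; rewrite /P e2k.
      by apply: le_trans h2 _; rewrite ler_peMr ?exprn_ge0 ?ler1n.
    case: (ex_minnP exP) => m Pm minm.
    have mk : (m < (2 * k).+1)%N.
      rewrite ltnS; apply: minm; rewrite /P e2k.
      by apply: le_trans h2 _; rewrite ler_peMr ?exprn_ge0 ?ler1n.
    exists (Ordinal mk) => _ /=; apply/andP; split; last exact: Pm.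
    case: m {mk Pm} minm => [|m] minm; first by rewrite expr0 mulr1.
    rewrite leNgt; apply/negP => h.
    suff /minm : P m by rewrite ltnn.
    by rewrite /P -mulrA -exprSr ltW.
  have {he} /choice[e he] : forall x, exists e : J -> 'I_(2 * k).+1, forall j, x \in t -> 2 ^- k * 2 ^+ (e j) <= nrm j x <= 2 ^- k * 2 ^+ (e j) * 2.
    by move=> x; have /choice[f hf] := he x; exists f.
  pose f x := [ffun j => e x j].
  apply: leq_trans (_ : size (enum {ffun J -> 'I_(2 * k).+1}) * q0 <= _)%N; last first.
    by rewrite -cardE card_ffun card_ord.
  apply: (@fiber_count _ _ t f); first by apply/allP => x _; rewrite mem_enum.
  move=> y _; rewrite -size_filter; set t' := filter _ t.
  case et : t' => [//|x0 t'' ]; rewrite -et.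
  have x0t' : x0 \in t' by rewrite et mem_head.
  have sub x : x \in t' -> x \in t /\ f x = y by rewrite mem_filter => /andP[/eqP].
  have [x0t fx0] := sub _ x0t'; have [Bx0 _] := ht' _ x0t; have [x00 _ _] := Bu _ Bx0.
  rewrite -(size_map (fun x => x / x0)); apply: uniq_leq_size.
    by rewrite map_inj_uniq ?filter_uniq //; apply: mulIf; rewrite invr_eq0.
  move=> _ /mapP[x xt' ->]; have [xt fx] := sub _ xt'; have [Bx _] := ht' _ xt.
  apply: hU0; first by have [_ ? _] := Bu _ (Bdiv _ _ Bx Bx0).
  move=> j; rewrite nrmf ler_pdivrMr ?nrm_gt0 //.
  have /andP[_ a2] := he x j xt; have /andP[b1 _] := he x0 j x0t.
  have ee : e x j = e x0 j by have := congr1 (fun g : {ffun _} => g j) (etrans fx (esym fx0)); rewrite !ffunE.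
  by apply: le_trans a2 _; rewrite ee mulrC ler_pM2l.
have [C0 hC0] : exists C0, forall i, i \in s -> bd C0 (u i).
  have hi i : exists k, i \in s -> bd k (u i).
    have [si|] := boolP (i \in s); last by exists 0%N.
    by have [|k hk] := bdex (u i); [case: (Bu _ (sB _ si))|exists k].
  have {hi} /choice[k hk] := hi; exists (\sum_(i <- s) k i)%N => i si j.
  have /andP[h1 h2] := hk i si j; have le : (k i <= \sum_(i <- s) k i)%N by rewrite (big_rem i) //= leq_addr.
  apply/andP; split.
    by apply: le_trans h1; rewrite lef_pV2 ?posrE ?exprn_gt0 // ler_weXn2l // ler1n.
  by apply: le_trans h2 _; rewrite ler_weXn2l // ler1n.
(* Form all products u_i x^l. A product determines i, since the u_i are distinct modulo l-th powers,
   and then x up to an l-th root of unity, so it arises from at most l pairs. *)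
have step k t : uniq t -> (forall x, x \in t -> B x /\ bd k x) ->
    exists t', [/\ uniq t', forall x, x \in t' -> B x /\ bd (l * k + C0)%N x & (size s * size t <= size t' * l)%N].
  move=> ut ht'; pose f (ix : I * K) := u ix.1 * ix.2 ^+ l.
  pose p := [seq (i, x) | i <- s, x <- t].
  have up : uniq p by apply: allpairs_uniq => // -[a b] [a' b'] _ _ [-> ->].
  have pP ix : ix \in p -> ix.1 \in s /\ ix.2 \in t.
    by move=> /allpairsP[[a b] /= [? ? ->]].
  exists (undup [seq f ix | ix <- p]); split; first exact: undup_uniq.
    move=> x; rewrite mem_undup => /mapP[[i y] /pP /= [si yt] ->]; have [By hy] := ht' y yt.
    by split; [apply: BM; [exact: sB|exact: BX]|rewrite /f /= addnC; apply: bdM; [exact: hC0|exact: bdX]].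
  have -> : (size s * size t)%N = size p by rewrite size_allpairs.
  apply: (fiber_count (f := f)); first by apply/allP => ix ixp; rewrite mem_undup; apply: map_f.
  move=> y _; rewrite -size_filter; set p' := filter _ p.
  case ep : p' => [//|[i0 x0] p'']; rewrite -ep.
  have p'P ix : ix \in p' -> [/\ ix.1 \in s, ix.2 \in t, ix \in p & f ix = y].
    by rewrite mem_filter => /andP[/eqP e /[dup] /pP[]].
  have [si0 x0t _ e0] : [/\ i0 \in s, x0 \in t, (i0, x0) \in p & f (i0, x0) = y].
    by apply: (p'P (i0, x0)); rewrite ep mem_head.
  have [Bx0 _] := ht' _ x0t; have [x00 _ _] := Bu _ Bx0.
  have same ix : ix \in p' -> ix.1 = i0 /\ (ix.2 / x0) ^+ l = 1.
    case: ix => i x /p'P /= [si xt _ e]; have [Bx _] := ht' _ xt; have [xn0 _ _] := Bu _ Bx.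
    have [ui0 _ _] := Bu _ (sB _ si0); have [ui _ _] := Bu _ (sB _ si).
    have ee : u i * x ^+ l = u i0 * x0 ^+ l by rewrite -[LHS]/(f (i, x)) e -e0.
    have ei : i = i0.
      apply: sep => //; exists (x0 / x); first exact: Bdiv.
      rewrite expr_div_n; apply: (mulIf (expf_neq0 l xn0)).
      by rewrite mulrAC ee divfK ?expf_neq0 // mulrAC divff // mul1r.
    split=> //; rewrite expr_div_n; apply: (mulfI ui0).
    by rewrite mulr1 mulrA -{1}ei ee mulfK // expf_neq0.
  have -> : size p' = size [seq ix.2 / x0 | ix <- p'] by rewrite size_map.
  have lp : ('X^l - 1 : {poly K}) != 0 by rewrite -size_poly_eq0 size_XnsubC // (ltn_trans _ l1).
  have := @max_poly_roots K ('X^l - 1) [seq ix.2 / x0 | ix <- p'] lp.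
  rewrite size_XnsubC ?(ltn_trans _ l1) // ltnS; apply.
    apply/allP => _ /mapP[ix ixp ->]; have [_ h] := same _ ixp.
    by rewrite rootE hornerD hornerN hornerC hornerXn h subrr.
  rewrite map_inj_in_uniq ?filter_uniq // => -[i x] [i' x'] /same[/= -> _] /same[/= -> _].
  by move/(mulIf (invr_neq0 x00)) => ->.
(* Each round multiplies the number of units by [size s] / l and the exponent of their height by l,
   up to a constant. After m rounds the box bound reads (size s / l)^m = O(l^(m n)), hence the
   exponent n + 1. *)
pose kk := fix kk m := if m is m'.+1 then (l * kk m' + C0)%N else 0%N.
have kkb m : (kk m <= C0 * l ^ m)%N.
  have : (kk m + C0 <= C0 * l ^ m)%N; last by lia.
  elim: m => [|m IH] /=; first by rewrite expn0 muln1.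
  rewrite expnS; have : (l * (kk m + C0) <= l * (C0 * l ^ m))%N by rewrite leq_pmul2l // (ltn_trans _ l1).
  nia.
have grow m : exists t, [/\ uniq t, forall x, x \in t -> B x /\ bd (kk m) x & (size s ^ m <= size t * l ^ m)%N].
  elim: m => [|m [t [ut ht' lt]]].
    exists [:: 1]; split=> // x; rewrite inE => /eqP->; split=> // j.
    by rewrite expr0 invr1 nrm1 lexx.
  have [t' [ut' ht'' lt']] := step _ _ ut ht'; exists t'; split=> //.
  rewrite !expnS; have := leq_mul (leqnn (size s)) lt.
  have := leq_mul lt' (leqnn (l ^ m)); nia.
apply: (@pow_growth _ _ ((2 * C0).+1 ^ n * q0)); first by rewrite expn_gt0 (ltn_trans _ l1).
move=> m; have [t [ut ht' lt]] := grow m; apply: leq_trans lt _.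
have lm : (0 < l ^ m)%N by rewrite expn_gt0 (ltn_trans _ l1).
have -> : ((2 * C0).+1 ^ n * q0 * (l ^ n.+1) ^ m = (((2 * C0).+1 * l ^ m) ^ n * q0) * l ^ m)%N.
  by rewrite -expnM mulnC [(n.+1 * m)%N]mulSn expnD expnMn -expnM [(m * n)%N]mulnC; ring.
rewrite leq_mul2r; apply/orP; right; apply: leq_trans (box _ _ ut ht') _.
rewrite leq_mul2r; apply/orP; right; rewrite leq_exp2r //.
have := kkb m; nia.
Qed.

End GlobalField.

(** * Zeta functions of ideal classes *)

Section RealEstimates.
Variable R : realType.
Implicit Types a b x y e : R.

(** Concavity of the logarithm, in the form ln z <= z - 1 at a / L and 1 / L with weights e and 1 -
    e. *)
Lemma powR_le_affine a e : 0 < a -> 0 <= e <= 1 -> a `^ e <= 1 + e * (a - 1).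
Proof.
move=> a0 /andP[e0 e1]; pose L := 1 + e * (a - 1).
have L0 : 0 < L.
  have -> : L = (1 - e) + e * a by rewrite /L; ring.
  have [e1'|e1'] := ltP e 1; first by rewrite ltr_pwDl ?subr_gt0 // mulr_ge0 // ltW.
  have -> : e = 1 by apply: le_anti; rewrite e1.
  by rewrite subrr add0r mul1r.
have lnle (z : R) : 0 < z -> ln z <= z - 1.
  move=> z0; have := @le_ln1Dx R (z - 1); rewrite addrCA subrr addr0; apply; lra.
have h1 : ln (a / L) <= a / L - 1 by apply: lnle; rewrite divr_gt0.
have h2 : ln (1 / L) <= 1 / L - 1 by apply: lnle; rewrite divr_gt0.
rewrite -ler_ln ?posrE ?powR_gt0 // ln_powR.
rewrite ln_div ?posrE // in h1; rewrite ln_div ?posrE // ln1 in h2.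
have h3 : e * (a / L - 1) + (1 - e) * (1 / L - 1) = 0.
  have -> : e * (a / L - 1) + (1 - e) * (1 / L - 1) = L / L - 1 by rewrite /L; field; rewrite gt_eqF.
  by rewrite divff ?subrr // gt_eqF.
have h4 := ler_wpM2l e0 h1.
have h5 : (1 - e) * (0 - ln L) <= (1 - e) * (1 / L - 1) by rewrite ler_wpM2l // subr_ge0.
rewrite -/L; lra.
Qed.

(** Multiplicative closeness, which passes through the sums, products, quotients and powers from
    which [Nm], [skew] and [wt] are built. *)
Definition near a x y := x <= a * y /\ y <= a * x.

Lemma nearC a x y : near a x y -> near a y x. Proof. by case. Qed.

Lemma nearM a b x y x' y' : 0 <= a -> 0 <= b -> 0 <= x -> 0 <= y -> 0 <= x' -> 0 <= y' ->
  near a x y -> near b x' y' -> near (a * b) (x * x') (y * y').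
Proof.
move=> a0 b0 x0 y0 x0' y0' [h1 h2] [h3 h4].
by split; rewrite mulrACA; apply: ler_pM.
Qed.

Lemma nearV a x y : 0 < x -> 0 < y -> near a x y -> near a x^-1 y^-1.
Proof.
move=> x0 y0 [h1 h2]; split.
  by rewrite -ler_pdivrMr ?invr_gt0 // invrK mulrC ler_pdivrMr // mulrC.
by rewrite -ler_pdivrMr ?invr_gt0 // invrK mulrC ler_pdivrMr // mulrC.
Qed.

Lemma nearX a x y k : 0 <= a -> 0 <= x -> 0 <= y -> near a x y -> near (a ^+ k) (x ^+ k) (y ^+ k).
Proof.
move=> a0 x0 y0 [h1 h2]; split; rewrite -exprMn; apply: lerXn2r => //; rewrite nnegrE //.
  exact: mulr_ge0.
exact: mulr_ge0.
Qed.

Lemma near_sum a (I : finType) (f g : I -> R) : (forall i, near a (f i) (g i)) ->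
  near a (\sum_i f i) (\sum_i g i).
Proof. by move=> h; split; rewrite mulr_sumr; apply: ler_sum => i _; case: (h i). Qed.

Lemma near_prod a (I : finType) (f g : I -> R) : 0 <= a -> (forall i, 0 <= f i) -> (forall i, 0 <= g i) ->
  (forall i, near a (f i) (g i)) -> near (a ^+ #|I|) (\prod_i f i) (\prod_i g i).
Proof.
move=> a0 f0 g0 h; split; rewrite -prodr_const -big_split /=; apply: ler_prod => i _.
  by rewrite f0; case: (h i).
by rewrite g0; case: (h i).
Qed.

Lemma near_powR a x y e : 1 <= a -> 0 <= e <= 1 -> 0 <= x -> 0 <= y ->
  near a x y -> near a (x `^ e) (y `^ e).
Proof.
move=> a1 /andP[e0 e1] x0 y0 [h1 h2]; have a0 : 0 <= a by lra.
have ae : a `^ e <= a by exact: ler1_powR.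
split.
  apply: le_trans (_ : (a * y) `^ e <= _); first by apply: ge0_ler_powR; rewrite ?nnegrE ?mulr_ge0.
  by rewrite powRM // ler_wpM2r ?powR_ge0.
apply: le_trans (_ : (a * x) `^ e <= _); first by apply: ge0_ler_powR; rewrite ?nnegrE ?mulr_ge0.
by rewrite powRM // ler_wpM2r ?powR_ge0.
Qed.

Lemma near_dist a x y : 1 <= a -> 0 <= x -> near a x y -> `|y - x| <= (a - 1) * x.
Proof.
move=> a1 x0 [h1 h2]; rewrite ler_norml; apply/andP; split; last by lra.
have a0 : 0 < a by lra.
have : x / a <= y by rewrite ler_pdivrMr // mulrC.
have : x * (1 - a^-1) <= x * (a - 1).
  rewrite ler_wpM2l // -subr_ge0.
  have -> : a - 1 - (1 - a^-1) = (a - 1) ^+ 2 / a by field; rewrite gt_eqF.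
  by rewrite divr_ge0 ?sqr_ge0 // ltW.
nra.
Qed.

Lemma expr1D_le (d : R) k : 0 <= d <= 1 -> (1 + d) ^+ k <= 1 + 3 ^+ k * d.
Proof.
move=> /andP[d0 d1]; elim: k => [|k IH]; first by rewrite !expr0; lra.
rewrite !exprS; apply: le_trans (ler_wpM2l _ IH) _; first by lra.
have h : (1 : R) <= 3 ^+ k by rewrite exprn_ege1 //; lra.
set t := 3 ^+ k in h *.
have h1 : d * 1 <= d * t by rewrite ler_wpM2l.
have h2 : d * d <= d * 1 by rewrite ler_wpM2l.
have h3 : t * (d * d) <= t * (d * 1) by rewrite ler_wpM2l //; lra.
by have -> : (1 + d) * (1 + t * d) = 1 + d + t * d + t * (d * d) by [ring]; lra.
Qed.

(** The term x^-(1+e) of a zeta function. The factor with exponent [e] in [0, 1] is kept apart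
    because it obeys bounds uniform in [e]. *)
Definition wt e x := x^-1 * (x `^ e)^-1.

Lemma wt_gt0 e x : 0 < x -> 0 < wt e x.
Proof. by move=> x0; rewrite mulr_gt0 ?invr_gt0 ?powR_gt0. Qed.

Lemma wt_ge0 e x : 0 <= x -> 0 <= wt e x.
Proof. by move=> x0; rewrite mulr_ge0 ?invr_ge0 ?powR_ge0. Qed.

Lemma wtM e x y : 0 <= x -> 0 <= y -> wt e (x * y) = wt e x * wt e y.
Proof. by move=> x0 y0; rewrite /wt powRM // !invfM mulrACA. Qed.

Lemma wt1 e : wt e 1 = 1.
Proof. by rewrite /wt powR1 invr1 mulr1. Qed.

Lemma wt_le e x y : 0 <= e -> 0 < x -> x <= y -> wt e y <= wt e x.
Proof.
move=> e0 x0 xy; have y0 : 0 < y by exact: lt_le_trans xy.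
apply: ler_pM; rewrite ?invr_ge0 ?powR_ge0 ?(ltW y0) //.
  by rewrite lef_pV2.
rewrite lef_pV2 ?posrE ?powR_gt0 //.
by apply: ge0_ler_powR; rewrite ?nnegrE // ltW.
Qed.

Lemma wt_le_inv e x : 0 <= e -> 1 <= x -> wt e x <= x^-1.
Proof.
move=> e0 x1; rewrite -[leRHS]mulr1 ler_wpM2l ?invr_ge0 ?(le_trans _ x1) //.
rewrite -[leRHS]invr1 lef_pV2 ?posrE ?powR_gt0 ?(lt_le_trans _ x1) //.
by rewrite -(powRr0 x); exact: ler_powR.
Qed.

Lemma near_wt a e x y : 1 <= a -> 0 <= e <= 1 -> 0 < x -> 0 < y ->
  near a x y -> near (a ^+ 2) (wt e x) (wt e y).
Proof.
move=> a1 he x0 y0 h; have a0 : 0 <= a by lra.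
rewrite expr2; apply: nearM; rewrite ?invr_ge0 ?powR_ge0 ?(ltW x0) ?(ltW y0) //.
  exact: nearV.
by apply: nearV; rewrite ?powR_gt0 //; apply: near_powR => //; exact: ltW.
Qed.

Lemma geom_le x (M : nat) : 0 <= x < 1 -> \sum_(i < M) x ^+ i <= (1 - x)^-1.
Proof.
move=> /andP[x0 x1]; have h : 0 < 1 - x by lra.
rewrite -[leRHS]mul1r ler_pdivlMr //.
have -> : (\sum_(i < M) x ^+ i) * (1 - x) = 1 - x ^+ M.
  by rewrite mulrC -[RHS]opprB subrX1 -mulNr opprB.
by rewrite lerBlDr lerDl exprn_ge0.
Qed.

Lemma wtV_le e x : 0 <= e <= 1 -> 1 <= x -> wt e x^-1 <= x ^+ 2.
Proof.
move=> /andP[e0 e1] x1; have x0 : 0 < x by exact: lt_le_trans x1.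
rewrite /wt invrK expr2 ler_wpM2l ?(ltW x0) //.
rewrite -[leRHS]invrK lef_pV2 ?posrE ?powR_gt0 ?invr_gt0 //.
have h : 0 < x^-1 <= 1 by rewrite invr_gt0 x0 invf_le1.
by have := ger_powR h e1; rewrite powRr1 // invr_ge0 ltW.
Qed.

Lemma powRX a e k : 0 <= a -> (a ^+ k) `^ e = (a `^ e) ^+ k.
Proof. by move=> a0; elim: k => [|k IH]; rewrite ?expr0 ?powR1 // !exprS powRM ?exprn_ge0 // IH. Qed.

Lemma max0_lip (x y : R) : `|Num.max 0 x - Num.max 0 y| <= `|x - y|.
Proof.
have := ler_norm (x - y); have := ler_norm (- (x - y)); rewrite normrN => h1 h2.
rewrite ler_norml; apply/andP; split; case: (leP 0 x); case: (leP 0 y); lra.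
Qed.

Lemma near_scale a c x y : 0 <= c -> near a x y -> near a (c * x) (c * y).
Proof. by move=> c0 [h1 h2]; split; rewrite mulrCA ler_wpM2l. Qed.

End RealEstimates.

Lemma sum_partition (R : nmodType) (T U : eqType) (t : seq T) (s : seq U) (g : T -> U) (f : T -> R) :
  uniq s -> (forall x, x \in t -> g x \in s) ->
  \sum_(x <- t) f x = \sum_(a <- s) \sum_(x <- t | g x == a) f x.
Proof.
move=> us ht; rewrite (exchange_big_dep xpredT) //= big_seq [RHS]big_seq; apply: eq_bigr => x xt.
rewrite -big_filter (eq_filter (a2 := pred1 (g x))) => [|a]; last by rewrite /= eq_sym.
by rewrite filter_pred1_uniq ?ht // big_seq1.
Qed.

Section ListSup.
Variable R : realType.
Local Open Scope classical_set_scope.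
Variables (T : eqType) (f : T -> R).
Implicit Types X : set T.

(** A series with non-negative terms is replaced by the supremum of its finite sums. This supremum
    is meaningful only for bounded sums, so a bound [B] accompanies its uses. *)
Definition lsums X : set R :=
  [set y | exists t : seq T, [/\ uniq t, forall x, x \in t -> X x & y = \sum_(x <- t) f x]].

Definition lsup X := sup (lsums X).

Lemma lsum_le X (B : R) (t : seq T) :
  (forall t : seq T, uniq t -> (forall x, x \in t -> X x) -> \sum_(x <- t) f x <= B) ->
  uniq t -> (forall x, x \in t -> X x) -> \sum_(x <- t) f x <= lsup X.
Proof.
move=> hB ut tX; apply: sup_ubound; last by exists t.
by exists B => _ [t' [ut' tX' ->]]; exact: hB.
Qed.

Lemma lsup_le X (B : R) :
  (forall t : seq T, uniq t -> (forall x, x \in t -> X x) -> \sum_(x <- t) f x <= B) ->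
  lsup X <= B.
Proof.
move=> hB; apply: ge_sup; last by move=> _ [t [ut tX ->]]; exact: hB.
by exists 0, [::]; rewrite big_nil.
Qed.

Lemma lsup_approx X (B e : R) : 0 < e ->
  (forall t : seq T, uniq t -> (forall x, x \in t -> X x) -> \sum_(x <- t) f x <= B) ->
  exists t : seq T, [/\ uniq t, forall x, x \in t -> X x & lsup X - e <= \sum_(x <- t) f x].
Proof.
move=> e0 hB; have hs : has_sup (lsums X).
  split; first by exists 0, [::]; rewrite big_nil.
  by exists B => _ [t [ut tX ->]]; exact: hB.
have [_ [t [ut tX ->]] h] := sup_adherent e0 hs.
by exists t; split=> //; exact: ltW.
Qed.

End ListSup.

(** * Weighted sums over the elements of an ideal *)

Section ZetaSums.
Local Open Scope classical_set_scope.
Variables (R : realType) (K : fieldType) (O : set K) (dO : dedekind O).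
Variables (J : finType) (nrm : J -> K -> R) (gd : global_data O nrm).
Local Notation n := #|J|.
Implicit Types (x y : K) (j : J) (v : place K) (D E : divisor K) (e : R) (t : seq K).
Local Notation fin := (fin O).
Local Notation dv := (dv O).
Local Notation Nd := (Nd O R).
Local Notation I_ := (idealD_ O).
Local Notation unit := (unitL O).
Local Notation cls := (cls O).
Local Notation Nm := (Nm nrm).
Local Notation ht := (ht nrm).

Let n0 := glob_n gd.

Lemma ht_ge1 x : O x -> x != 0 -> 1 <= ht x.
Proof.
move=> Ox x0; rewrite leNgt; apply/negP => h.
have := le_trans (Nm_ge1 dO gd Ox x0) (Nm_le_ht gd x).
by apply/negP; rewrite -ltNge exprn_ilt1 ?(ht_ge0 gd) // -lt0n.
Qed.

(** Sorting by the dyadic shell of [ht]: by [count_upper], the shell of index i holds O(2^(i n))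
    elements, on each of which [f] is at most [q i]. *)
Lemma dyadic_sum : exists2 C : R, 0 < C & forall t (f : K -> R) (q : nat -> R), uniq t ->
  (forall x, x \in t -> O x /\ x != 0) -> (forall i, 0 <= q i) ->
  (forall x i, x \in t -> 2 ^+ i <= ht x -> ht x < 2 ^+ i.+1 -> f x <= q i) ->
  exists M : nat, \sum_(x <- t) f x <= \sum_(i < M) C * (2 ^+ i) ^+ n * q i.
Proof.
have [C C0 hC] := count_upper gd.
exists (C * 2 ^+ n) => [|t f q ut tO q0 hf]; first by rewrite mulr_gt0 // exprn_gt0.
have hi x : exists i, x \in t -> 2 ^+ i <= ht x < 2 ^+ i.+1.
  have [xt|] := boolP (x \in t); last by exists 0%N.
  have [Ox x0] := tO x xt; have h1 := ht_ge1 Ox x0.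
  pose P i := ht x < 2 ^+ i.
  have exP : exists i, P i.
    exists (Num.truncn (ht x)).+1; apply: lt_le_trans (truncnS_gt _) _.
    by rewrite -natrX ler_nat ltnW // ltn_expl.
  case: (ex_minnP exP) => -[|i] Pi mini.
    by move: Pi; rewrite /P expr0 ltNge h1.
  exists i => _; rewrite [_ < _]Pi andbT leNgt; apply/negP => h.
  by have := mini i h; rewrite ltnn.
have {hi} /choice[ix hix] := hi.
pose M := (\sum_(x <- t) (ix x).+1)%N.
exists M; have ltM x : x \in t -> (ix x < M)%N.
  by move=> xt; rewrite /M (big_rem x) //=; lia.
have -> : \sum_(x <- t) f x = \sum_(i < M) \sum_(x <- t | ix x == i) f x.
  rewrite (exchange_big_dep xpredT) //= big_seq [RHS]big_seq; apply: eq_bigr => x xt.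
  rewrite (bigD1 (Ordinal (ltM x xt))) //= big1 ?addr0 // => i /andP[/eqP h1 /eqP h2].
  by case: h2; exact: val_inj.
apply: ler_sum => i _; rewrite -big_filter; set t' := filter _ t.
have t't x : x \in t' -> ix x = i /\ x \in t by rewrite mem_filter => /andP[/eqP].
apply: le_trans (_ : \sum_(x <- t') q i <= _).
  rewrite big_seq [leRHS]big_seq; apply: ler_sum => x /t't[e xt].
  by have /andP[h1 h2] := hix x xt; apply: hf => //; rewrite -e.
rewrite big_const_seq count_predT iter_addr_0 -[q i *+ _]mulr_natl ler_wpM2r //.
have h2 : 1 <= 2 ^+ i.+1 :> R by rewrite exprn_ege1 //; lra.
apply: le_trans (hC _ h2 t' _ _) _; first exact: filter_uniq.
  move=> x /t't[e xt]; have [Ox _] := tO x xt; split=> // j.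
  have /andP[_ h] := hix x xt; apply: le_trans (nrm_le_ht gd j x) _.
  by rewrite -e ltW.
by rewrite exprS exprMn mulrA.
Qed.

Lemma inv_ht_sum : exists2 C : R, 0 < C & forall t, uniq t -> (forall x, x \in t -> O x /\ x != 0) ->
  \sum_(x <- t) (ht x ^+ n.+1)^-1 <= C.
Proof.
have [C C0 hC] := dyadic_sum; exists (C * 2) => [|t ut tO]; first by rewrite mulr_gt0.
have [|x i xt h1 h2|M hM] := hC t (fun x => (ht x ^+ n.+1)^-1) (fun i => ((2 ^+ i) ^+ n.+1)^-1) ut tO.
- by move=> i; rewrite invr_ge0 !exprn_ge0.
- rewrite lef_pV2 ?posrE ?exprn_gt0 ?(lt_le_trans _ h1) ?exprn_gt0 //.
  by apply: lerXn2r; rewrite ?nnegrE ?exprn_ge0 ?(ht_ge0 gd).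
apply: le_trans hM _.
have -> : \sum_(i < M) C * (2 ^+ i) ^+ n * ((2 ^+ i) ^+ n.+1)^-1 = C * \sum_(i < M) (2^-1) ^+ i.
  rewrite mulr_sumr; apply: eq_bigr => i _.
  rewrite -mulrA; congr (_ * _); rewrite exprSr invfM mulrA divff ?mul1r ?exprVn //.
  by rewrite !expf_neq0 // pnatr_eq0.
rewrite ler_wpM2l ?(ltW C0) //; apply: le_trans (geom_le _ _) _; first by lra.
by have -> : (1 - 2^-1 : R) = 2^-1 by [lra]; rewrite invrK.
Qed.

Variable C1 : R.
Hypothesis C1_ge1 : 1 <= C1.
Hypothesis C1P : forall x, O x -> x != 0 -> exists2 u, unit u & ht (u * x) ^+ n <= C1 * Nm x.

(* [skew x >= 1] measures how far the absolute values of [x] are from being all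
   equal.  Every orbit of the units contains an element with [skew x <= C1], and only
   finitely many with [skew x < 2 * C1]: [phi] is a continuous cutoff between these bounds. *)
Definition skew x := ht x ^+ n / Nm x.
Definition phi x := if x == 0 then 0 else Num.max 0 (2 * C1 - skew x).

Lemma phi_ge0 x : 0 <= phi x.
Proof. by rewrite /phi; case: ifP => // _; rewrite le_max lexx. Qed.

Lemma skew_ge0 x : 0 <= skew x.
Proof.
have [->|x0] := eqVneq x 0.
  by rewrite /skew divr_ge0 ?exprn_ge0 ?(ht_ge0 gd) // prodr_ge0 // => j _; exact: (nrm_ge0 gd).
by rewrite divr_ge0 ?exprn_ge0 ?(ht_ge0 gd) // ltW // (Nm_gt0 gd).
Qed.

Lemma phi_le x : phi x <= 2 * C1.
Proof.
have C1g := C1_ge1; have := skew_ge0 x; rewrite /phi; case: ifP => _; first by lra.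
by rewrite ge_max => h; apply/andP; split; lra.
Qed.

Lemma phi_gt0 x : x != 0 -> (0 < phi x) = (skew x < 2 * C1).
Proof. by move=> x0; rewrite /phi (negPf x0) lt_max ltxx /= subr_gt0. Qed.

Lemma phiN0 x : phi x != 0 -> x != 0 /\ skew x < 2 * C1.
Proof.
move=> h; have x0 : x != 0 by apply: contra_neq h => ->; rewrite /phi eqxx.
by split=> //; rewrite -phi_gt0 // lt_neqAle eq_sym h phi_ge0.
Qed.

Lemma NmUr u x : unit u -> Nm (u * x) = Nm x.
Proof. by move=> uu; rewrite (NmM gd) (Nm_unit dO gd uu) mul1r. Qed.

(** The norm is at most nrm j x * ht^(n-1), so when it is comparable to ht^n every single absolute
    value is comparable to [ht]. *)
Lemma good_nrm x j B : x != 0 -> 0 < B -> skew x <= B -> ht x / B <= nrm j x.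
Proof.
move=> x0 B0; rewrite /skew ler_pdivrMr ?(Nm_gt0 gd) // => h.
have hx : 0 < ht x by exact: (ht_gt0 gd).
rewrite ler_pdivrMr // mulrC.
have e : Nm x <= nrm j x * ht x ^+ n.-1.
  rewrite -[Nm x]/(\prod_i nrm i x) (bigD1 j) //= ler_wpM2l ?(nrm_ge0 gd) //.
  have -> : n.-1 = #|[pred i | i != j]|.
    by rewrite -(cardC1 j); apply: eq_card => i; rewrite !inE.
  by rewrite -prodr_const; apply: ler_prod => i _; rewrite (nrm_ge0 gd) (nrm_le_ht gd).
have hp : 0 < ht x ^+ n.-1 by rewrite exprn_gt0.
rewrite -(ler_pM2r hp) -exprS prednK //; apply: le_trans h _.
by rewrite -mulrA ler_wpM2l // ltW.
Qed.

Lemma good_Nm x B : x != 0 -> 0 < B -> skew x <= B -> ht x ^+ n / B <= Nm x.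
Proof.
by move=> x0 B0; rewrite /skew ler_pdivrMr ?(Nm_gt0 gd) // => h; rewrite ler_pdivrMr // mulrC.
Qed.

(** If [x] and [u * x] are both balanced, their heights are comparable because their norms agree;
    then all absolute values of [u] are bounded, which leaves finitely many units. *)
Lemma phi_units : exists U0 : seq K, [/\ uniq U0, forall u, u \in U0 -> unit u &
  forall u x, unit u -> phi x != 0 -> phi (u * x) != 0 -> u \in U0].
Proof.
have C1g := C1_ge1; have C1' : 0 < 2 * C1 by lra.
have [s hs] := finite_bounded gd ((2 * C1) ^+ 2).
exists (undup [seq u <- s | `[< unit u >]]); split; first exact: undup_uniq.
  by move=> u; rewrite mem_undup mem_filter => /andP[/asboolP].
move=> u x uu /phiN0[x0 tx] /phiN0[ux0 tux].
rewrite mem_undup mem_filter; apply/andP; split; first exact/asboolP.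
apply: hs => [|j]; first by case: uu.
have hx0 : 0 < ht x by exact: (ht_gt0 gd).
have hu : ht (u * x) <= 2 * C1 * ht x.
  have h : ht (u * x) ^+ n <= (2 * C1 * ht x) ^+ n.
    rewrite exprMn; move: tux; rewrite /skew NmUr // ltr_pdivrMr ?(Nm_gt0 gd) // => h.
    apply: le_trans (ltW h) _; apply: ler_pM; rewrite ?(ltW C1') ?(ltW (Nm_gt0 gd _)) //.
      by rewrite -[leLHS]expr1 ler_weXn2l //; lra.
    exact: (Nm_le_ht gd).
  rewrite leNgt; apply/negP => h'; move: h; apply/negP; rewrite -ltNge.
  have h0 : 0 <= 2 * C1 * ht x by rewrite mulr_ge0 // ltW.
  by rewrite (ltr_pXn2r n0) // nnegrE // (ht_ge0 gd).
have -> : nrm j u = nrm j (u * x) / nrm j x by rewrite (nrmM gd) mulfK // gt_eqF // (nrm_gt0 gd).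
rewrite ler_pdivrMr ?(nrm_gt0 gd) //; apply: le_trans (nrm_le_ht gd j _) _.
apply: le_trans hu _; rewrite expr2 -[leRHS]mulrA ler_wpM2l ?(ltW C1') //.
by rewrite -ler_pdivrMl // mulrC good_nrm // ltW.
Qed.

Variable U0 : seq K.
Hypotheses (uU0 : uniq U0) (unitU0 : forall u, u \in U0 -> unit u)
  (U0P : forall u x, unit u -> phi x != 0 -> phi (u * x) != 0 -> u \in U0).

Definition Phi x := \sum_(u <- U0) phi (u * x).
(* [rho] is a partition of unity on the orbits of the units, so that weighted sums over
   the elements of an ideal are sums over the principal ideals inside it. *)
Definition rho x := phi x / Phi x.
Definition zterm e x := rho x * wt e (Nm x).

Lemma Phi_ge x : O x -> phi x != 0 -> C1 <= Phi x.
Proof.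
have C1g := C1_ge1; move=> Ox hx; have [x0 tx] := phiN0 hx; have [u uu h] := C1P Ox x0.
have u0 : u != 0 by case: uu.
have ux0 : u * x != 0 by rewrite mulf_neq0.
have tu : skew (u * x) <= C1 by rewrite /skew NmUr // ler_pdivrMr ?(Nm_gt0 gd).
have pu : C1 <= phi (u * x).
  by rewrite /phi (negPf ux0) le_max; apply/orP; right; lra.
have uU : u \in U0 by apply: U0P hx _ => //; rewrite gt_eqF //; lra.
apply: le_trans pu _; rewrite /Phi (big_rem u) //= lerDl sumr_ge0 // => *.
exact: phi_ge0.
Qed.

Lemma Phi_ge0 x : 0 <= Phi x.
Proof. by apply: sumr_ge0 => *; exact: phi_ge0. Qed.

Lemma rho_ge0 x : 0 <= rho x.
Proof. by rewrite divr_ge0 ?phi_ge0 ?Phi_ge0. Qed.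

Lemma Nm_ge0 x : 0 <= Nm x.
Proof. by apply: prodr_ge0 => j _; exact: (nrm_ge0 gd). Qed.

Lemma zterm_ge0 e x : 0 <= zterm e x.
Proof. by rewrite mulr_ge0 ?rho_ge0 ?wt_ge0 ?Nm_ge0. Qed.

Lemma rho_le x : O x -> rho x <= 2.
Proof.
have C1g := C1_ge1; move=> Ox; have [h|h] := eqVneq (phi x) 0; first by rewrite /rho h mul0r.
have := Phi_ge Ox h; have := phi_le x => h1 h2.
rewrite /rho ler_pdivrMr; last by lra.
lra.
Qed.

Lemma zterm_eq0 e x : phi x = 0 -> zterm e x = 0.
Proof. by rewrite /zterm /rho => ->; rewrite !mul0r. Qed.

Lemma rho_orbit x : O x -> x != 0 -> exists s : seq K, [/\ uniq s, forall u, u \in s -> unit u,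
  \sum_(u <- s) rho (u * x) = 1 & forall u, unit u -> rho (u * x) != 0 -> u \in s].
Proof.
have C1g := C1_ge1; move=> Ox x0; have [u0 uu0 h] := C1P Ox x0.
have u00 : u0 != 0 by case: uu0.
have y0 : u0 * x != 0 by rewrite mulf_neq0.
have ph : phi (u0 * x) != 0.
  by rewrite gt_eqF // phi_gt0 // /skew NmUr // ltr_pdivrMr ?(Nm_gt0 gd) //; have := Nm_gt0 gd x0; nra.
have Oy : O (u0 * x) by apply: (dedM dO) => //; case: uu0.
have unitM := unitLM dO.
(* At a point where [phi] does not vanish, [U0] contains every unit that contributes, so [Phi] is
   there the sum over all units and is constant along the orbit. *)
have key u : unit u -> phi (u * (u0 * x)) != 0 -> Phi (u * (u0 * x)) = Phi (u0 * x).
  move=> uu phu.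
  have sumU z (s : seq K) : phi z != 0 -> uniq s -> (forall u, u \in s -> unit u) ->
      (forall u, unit u -> phi (u * z) != 0 -> u \in s) -> \sum_(u <- s) phi (u * z) = Phi z.
    move=> pz us su hs; rewrite /Phi.
    rewrite (bigID (fun u => phi (u * z) != 0)) /= [X in _ + X]big1 ?addr0; last by move=> w /negbNE/eqP.
    rewrite [RHS](bigID (fun u => phi (u * z) != 0)) /= [X in _ + X]big1 ?addr0; last by move=> w /negbNE/eqP.
    rewrite -[LHS]big_filter -[RHS]big_filter; apply: perm_big; apply: uniq_perm; rewrite ?filter_uniq //.
    move=> w; rewrite !mem_filter; case: (boolP (phi (w * z) != 0)) => //= pw; apply/idP/idP.
      by move=> /su uw; exact: U0P pw.
    by move=> /unitU0 uw; exact: hs.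
  rewrite -(sumU (u0 * x) [seq w * u | w <- U0]) //.
  - by rewrite /Phi big_map; apply: eq_bigr => w _; rewrite mulrA.
  - by rewrite map_inj_uniq //; apply: mulIf; case: uu.
  - by move=> _ /mapP[w wU ->]; apply: unitM => //; exact: unitU0.
  - move=> w uw pw; apply/mapP; exists (w / u); last by rewrite divfK //; case: uu.
    apply: U0P phu _; first by apply: unitM => //; exact: unitLV.
    by rewrite mulrA divfK //; case: uu.
exists [seq w * u0 | w <- U0]; split.
- by rewrite map_inj_uniq //; exact: mulIf.
- by move=> _ /mapP[w wU ->]; apply: unitM => //; exact: unitU0.
- rewrite big_map.
  transitivity (\sum_(w <- U0) phi (w * (u0 * x)) / Phi (u0 * x)).
    rewrite big_seq [RHS]big_seq; apply: eq_bigr => w wU; rewrite -mulrA /rho.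
    have [->|pw] := eqVneq (phi (w * (u0 * x))) 0; first by rewrite !mul0r.
    by rewrite key //; exact: unitU0.
  have P0 : 0 < Phi (u0 * x) by apply: lt_le_trans (Phi_ge Oy ph); lra.
  by rewrite -mulr_suml divff ?gt_eqF.
- move=> u uu ru; apply/mapP; exists (u / u0); last by rewrite divfK.
  apply: U0P ph _; first by apply: unitM => //; exact: unitLV.
  rewrite mulrA divfK //; apply: contra_neq ru => pu; by rewrite /rho pu mul0r.
Qed.

(** The error made by translating a term. The exponent n + 1 beats the growth of boxes, so the
    errors are summable, uniformly in [e]; the summand 1 takes care of x = 0. *)
Definition decay x : R := ((1 + ht x) ^+ n.+1)^-1.

Lemma decay_ge0 x : 0 <= decay x.
Proof. by rewrite invr_ge0 exprn_ge0 // addr_ge0 // (ht_ge0 gd). Qed.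

Lemma decay_sum : exists2 C : R, 0 < C & forall t, uniq t -> (forall x, x \in t -> O x) ->
  \sum_(x <- t) decay x <= C.
Proof.
have [C C0 hC] := inv_ht_sum; exists (C + 1) => [|t ut tO]; first by rewrite addr_gt0.
rewrite (bigID (fun x => x == 0)) /= addrC; apply: lerD.
  rewrite -big_filter; apply: le_trans (hC [seq x <- t | x != 0] _ _).
  - rewrite big_seq [leRHS]big_seq; apply: ler_sum => x; rewrite mem_filter => /andP[x0 _].
    have h := ht_gt0 gd x0; rewrite lef_pV2 ?posrE ?exprn_gt0 ?addr_gt0 //.
    by apply: lerXn2r; rewrite ?nnegrE; lra.
  - exact: filter_uniq.
  - by move=> x; rewrite mem_filter => /andP[x0 /tO].
rewrite (eq_bigr (fun=> decay 0)) => [|x /eqP -> //]; rewrite big_const_seq iter_addr_0.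
have -> : count (fun x => x == 0) t = (0 \in t) by exact: count_uniq_mem.
have h : decay 0 <= 1.
  by rewrite invf_le1 ?exprn_gt0 ?exprn_ege1 ?ltr_wpDr ?lerDl ?(ht_ge0 gd).
by case: (0 \in t); rewrite ?mulr1n ?mulr0n.
Qed.

Lemma close_near x y (B : R) j : phi x != 0 -> 0 < B -> (forall j, nrm j (x - y) <= B) ->
  8 * C1 * B <= ht x -> near (1 + 8 * C1 * B / ht x) (nrm j x) (nrm j y).
Proof.
move=> /phiN0[x0 tx] B0 hB hx; have C1g := C1_ge1.
have hp := ht_gt0 gd x0; set d := _ / ht x.
have g : ht x / (2 * C1) <= nrm j x by apply: good_nrm; rewrite ?ltW //; lra.
have a1 : nrm j x <= nrm j y + B.
  by rewrite -[x in leLHS](subrKC y); apply: le_trans (nrmD gd _ _ _) _; rewrite lerD2l.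
have a2 : nrm j y <= nrm j x + B.
  rewrite -[y in leLHS](subrKC x); apply: le_trans (nrmD gd _ _ _) _; rewrite lerD2l.
  by rewrite -(nrmN gd) opprB.
have d0 : 0 <= d by rewrite divr_ge0 ?mulr_ge0 ?ltW //; lra.
have d1 : d <= 1 by rewrite ler_pdivrMr ?mul1r.
have h1 : 4 * B <= d * nrm j x.
  apply: le_trans (ler_wpM2l d0 g); rewrite /d.
  by have -> : 8 * C1 * B / ht x * (ht x / (2 * C1)) = 4 * B by [field; rewrite !gt_eqF //; lra].
have h2 : d * (nrm j x - B) <= d * nrm j y by rewrite ler_wpM2l //; lra.
have h3 : d * B <= 1 * B by rewrite ler_wpM2r // ltW.
rewrite mulrBr in h2; split; rewrite mulrDl mul1r; lra.
Qed.

Lemma near_skew x y (d : R) : 0 <= d -> x != 0 -> y != 0 ->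
  (forall j, near (1 + d) (nrm j x) (nrm j y)) -> near ((1 + d) ^+ n ^+ 2) (skew x) (skew y).
Proof.
move=> d0 x0 y0 h; have d1 : 0 <= 1 + d by rewrite addr_ge0.
have nr0 j z : 0 <= nrm j z by exact: (nrm_ge0 gd).
rewrite expr2; apply: nearM; rewrite ?exprn_ge0 ?(ht_ge0 gd) ?invr_ge0 ?Nm_ge0 //.
  by apply: nearX; rewrite ?(ht_ge0 gd) //; exact: near_sum.
by apply: nearV; rewrite ?(Nm_gt0 gd) //; exact: near_prod.
Qed.

Lemma phi_lip x y (a : R) : 1 <= a -> x != 0 -> y != 0 -> near a (skew x) (skew y) ->
  `|phi y - phi x| <= (a - 1) * (2 * C1).
Proof.
move=> a1 x0 y0 h; have C1g := C1_ge1; have a0 : 0 <= a - 1 by lra.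
have bd z w : near a (skew z) (skew w) -> skew z < 2 * C1 ->
    `|Num.max 0 (2 * C1 - skew w) - Num.max 0 (2 * C1 - skew z)| <= (a - 1) * (2 * C1).
  move=> nzw tz; apply: le_trans (max0_lip _ _) _.
  have -> : 2 * C1 - skew w - (2 * C1 - skew z) = - (skew w - skew z) by ring.
  rewrite normrN; apply: le_trans (near_dist a1 (skew_ge0 z) nzw) _.
  by rewrite ler_wpM2l // ltW.
rewrite /phi (negPf x0) (negPf y0).
have [tx|tx] := ltP (skew x) (2 * C1); first exact: bd.
have [ty|ty] := ltP (skew y) (2 * C1); first by rewrite distrC; apply: bd => //; exact: nearC.
by rewrite !max_l ?subr_le0 // subrr normr0 mulr_ge0 //; lra.
Qed.

Lemma Phi_lip x y (a : R) : 1 <= a -> x != 0 -> y != 0 ->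
  (forall u, u != 0 -> near a (skew (u * x)) (skew (u * y))) ->
  `|Phi y - Phi x| <= (a - 1) * (2 * C1) * (size U0)%:R.
Proof.
move=> a1 x0 y0 h; rewrite /Phi -sumrB; apply: le_trans (ler_norm_sum _ _ _) _.
apply: le_trans (_ : \sum_(u <- U0) (a - 1) * (2 * C1) <= _); last first.
  by rewrite big_const_seq count_predT iter_addr_0 -[leLHS]mulr_natr.
rewrite big_seq [leRHS]big_seq; apply: ler_sum => u uU.
have u0 : u != 0 by case: (unitU0 uU).
by apply: phi_lip; rewrite ?mulf_neq0 //; exact: h.
Qed.

Lemma rho_lip x y (a : R) : O x -> O y -> 1 <= a -> x != 0 -> y != 0 -> phi x != 0 ->
  (forall u, u != 0 -> near a (skew (u * x)) (skew (u * y))) ->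
  rho x <= rho y + (a - 1) * (2 * C1) * (1 + 2 * (size U0)%:R).
Proof.
move=> Ox Oy a1 x0 y0 px h; have C1g := C1_ge1.
have hp : `|phi y - phi x| <= (a - 1) * (2 * C1).
  by apply: phi_lip => //; have := h 1; rewrite !mul1r; apply; rewrite oner_eq0.
have hP := Phi_lip a1 x0 y0 h.
have Px := Phi_ge Ox px; have ry := rho_le Oy; have ry0 := rho_ge0 y.
have b1 : 0 <= (a - 1) * (2 * C1) by rewrite mulr_ge0 //; lra.
set b := (a - 1) * (2 * C1) in hp hP b1 *; set N0 := _%:R in hP *.
have N00 : 0 <= N0 by exact: ler0n.
have bN : 0 <= b * N0 by rewrite mulr_ge0.
have e : phi y = rho y * Phi y.
  rewrite /rho; have [->|py] := eqVneq (phi y) 0; first by rewrite !mul0r.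
  by rewrite divfK // gt_eqF //; have := Phi_ge Oy py; lra.
rewrite {1}/rho ler_pdivrMr; last by lra.
move: hp hP; rewrite !ler_norml e => /andP[h1 h2] /andP[h3 h4].
have h5 : rho y * (Phi y - Phi x) <= 2 * (b * N0).
  apply: le_trans (_ : rho y * (b * N0) <= _); first by rewrite ler_wpM2l.
  by rewrite ler_wpM2r.
have h6 : b * (1 + 2 * N0) * 1 <= b * (1 + 2 * N0) * Phi x.
  by rewrite ler_wpM2l ?mulr_ge0 //; lra.
rewrite mulrDl; rewrite mulrBr in h5.
have -> : phi x = rho y * Phi y - (rho y * Phi y - phi x) by ring.
move: h6; rewrite mulr1 mulrDr mulr1; lra.
Qed.

(** A bounded translation changes the absolute values of a balanced [x] by a relative error O(1 / ht
    x), while the term itself is O(ht^-n): the change is O(ht^-(n+1)). For small [ht x] the trivial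
    bound 2 on the term suffices. *)
Lemma zterm_lip (B : R) : 0 < B -> exists2 C : R, 0 < C & forall e x y, 0 <= e <= 1 -> O x -> O y ->
  (forall j, nrm j (x - y) <= B) -> zterm e x <= zterm e y + C * decay x.
Proof.
move=> B0; have C1g := C1_ge1.
pose A : R := 3 ^+ (n * 2)%N; pose D8 : R := 8 * C1 * B; pose N0 : R := (size U0)%:R.
pose C2 := 2 * C1 * (1 + 2 * N0); pose M1 := (C2 + 2 * (1 + A)) * A * D8 * (2 * C1).
have A0 : 0 < A by rewrite exprn_gt0.
have N00 : 0 <= N0 by exact: ler0n.
have D80 : 0 < D8 by rewrite !mulr_gt0 //; lra.
have C20 : 0 <= C2 by rewrite !mulr_ge0 //; lra.
have M10 : 0 < M1 by rewrite !mulr_gt0 //; lra.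
pose P2 : R := 2 ^+ n.+1; pose PD : R := 2 * (1 + D8) ^+ n.+1.
have P20 : 0 < P2 by rewrite exprn_gt0.
have PD0 : 0 < PD by rewrite mulr_gt0 // exprn_gt0 // addr_gt0.
exists (M1 * P2 + PD) => [|e x y he Ox Oy hB]; first by rewrite addr_gt0 // mulr_gt0.
have gy := zterm_ge0 e y; have hx0 := decay_ge0 x.
have C30 : 0 <= M1 * P2 * decay x := mulr_ge0 (ltW (mulr_gt0 M10 P20)) hx0.
have C40 : 0 <= PD * decay x := mulr_ge0 (ltW PD0) hx0.
rewrite mulrDl; have [p0|p0] := eqVneq (phi x) 0; first by rewrite zterm_eq0 //; lra.
have [x0 tx] := phiN0 p0; have h1 := ht_ge1 Ox x0; have N1 := Nm_ge1 dO gd Ox x0.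
have hp : 0 < ht x by lra.
have h1' : 1 + ht x <= 2 * ht x by lra.
have h0' : 0 <= 1 + ht x by lra.
have Np : 0 < Nm x by lra.
have [e0 e1] := andP he; have wle := wt_le_inv e0 N1; have w0 := wt_ge0 e (Nm_ge0 x).
have rx := rho_le Ox; have rx0 := rho_ge0 x.
have decayE : decay x = ((1 + ht x) ^+ n.+1)^-1 by [].
have [far|nr] := leP D8 (ht x); last first.
  have g2 : zterm e x <= 2 * 1.
    by apply: ler_pM => //; apply: le_trans wle _; rewrite invf_le1.
  suff : 2 <= PD * decay x by lra.
  rewrite decayE ler_pdivlMr ?exprn_gt0 ?addr_gt0 // ler_wpM2l //.
  by apply: lerXn2r; rewrite ?nnegrE; lra.
pose d := D8 / ht x.
have d0 : 0 <= d by rewrite divr_ge0 // ltW.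
have d1 : d <= 1 by rewrite ler_pdivrMr ?mul1r.
have nn j : near (1 + d) (nrm j x) (nrm j y) by exact: close_near.
have y0 : y != 0.
  have /card_gt0P[j _] := n0; apply/eqP => y0.
  have [] := nn j; rewrite y0 (nrm0 gd) mulr0 leNgt => /negP[]; exact: (nrm_gt0 gd).
pose a := (1 + d) ^+ n ^+ 2.
have a1 : 1 <= a by rewrite /a -exprM exprn_ege1 //; lra.
have aA : a - 1 <= A * d by have := @expr1D_le R d (n * 2) ; rewrite d0 d1 /a exprM => /(_ isT); rewrite -/A; lra.
have tn u : u != 0 -> near a (skew (u * x)) (skew (u * y)).
  move=> u0; apply: near_skew => //; rewrite ?mulf_neq0 // => j.
  by rewrite !(nrmM gd); apply: near_scale => //; exact: (nrm_ge0 gd).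
have r1 := rho_lip Ox Oy a1 x0 y0 p0 tn; rewrite -/N0 in r1.
have r1' : rho x <= rho y + (a - 1) * C2 by rewrite /C2 mulrA.
have [w1 w2] : near a (wt e (Nm x)) (wt e (Nm y)).
  apply: near_wt => //; rewrite ?(Nm_gt0 gd) //; first by rewrite exprn_ege1 //; lra.
  by apply: near_prod => [|j|j|//]; rewrite ?(nrm_ge0 gd) //; lra.
have wx : wt e (Nm x) <= 2 * C1 / ht x ^+ n.
  apply: le_trans wle _; rewrite -[leRHS]invrK lef_pV2 ?posrE // ?invr_gt0 ?divr_gt0 ?exprn_gt0 //; try lra.
  by rewrite invf_div; apply: good_Nm => //; [lra|exact: ltW].
have ry := rho_le Oy; have ry0 := rho_ge0 y; have wy0 := wt_ge0 e (Nm_ge0 y).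
have hA : A * d <= A * 1 by rewrite ler_wpM2l // ltW.
have aA1 : a <= 1 + A by rewrite mulr1 in hA; lra.
have s1 : rho x * wt e (Nm x) <= (rho y + (a - 1) * C2) * wt e (Nm x) by rewrite ler_wpM2r.
have s2 : rho y * wt e (Nm x) <= rho y * (a * wt e (Nm y)) by rewrite ler_wpM2l.
have s3 : (a - 1) * (rho y * wt e (Nm y)) <= (a - 1) * (2 * ((1 + A) * wt e (Nm x))).
  rewrite ler_wpM2l ?subr_ge0 //; apply: ler_pM => //; apply: le_trans w2 _.
  by rewrite ler_wpM2r.
have s4 : (a - 1) * ((C2 + 2 * (1 + A)) * wt e (Nm x)) <= A * d * ((C2 + 2 * (1 + A)) * (2 * C1 / ht x ^+ n)).
  apply: ler_pM => //; first by rewrite subr_ge0.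
    by rewrite mulr_ge0 //; lra.
  by rewrite ler_wpM2l //; lra.
have s5 : A * d * ((C2 + 2 * (1 + A)) * (2 * C1 / ht x ^+ n)) <= M1 * P2 * decay x.
  have -> : A * d * ((C2 + 2 * (1 + A)) * (2 * C1 / ht x ^+ n)) = M1 * (ht x ^+ n.+1)^-1.
    by rewrite exprS /M1 /d; field; rewrite expf_neq0 gt_eqF.
  rewrite -[leRHS]mulrA ler_wpM2l ?(ltW M10) //.
  rewrite decayE -[leRHS]invrK lef_pV2 ?posrE ?invr_gt0 ?mulr_gt0 ?invr_gt0 ?exprn_gt0 ?addr_gt0 //.
  rewrite invfM invrK mulrC ler_pdivrMr // -exprMn; apply: lerXn2r; rewrite ?nnegrE // ?mulr_ge0 ?(ltW hp) // mulrC //.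
have -> : zterm e y = rho y * wt e (Nm y) by [].
have -> : zterm e x = rho x * wt e (Nm x) by [].
rewrite mulrDl in s1.
move: s1 s2 s3 s4 s5; set X := wt e (Nm x); set Y := wt e (Nm y).
set Z := A * d * _; set Q := M1 * P2 * _; move=> s1 s2 s3 s4 s5.
have e1' : rho y * (a * Y) = rho y * Y + (a - 1) * (rho y * Y) by ring.
have e2' : (a - 1) * (2 * ((1 + A) * X)) = (a - 1) * (2 * (1 + A) * X) by ring.
have e3' : (a - 1) * C2 * X = (a - 1) * (C2 * X) by ring.
have e4' : (a - 1) * ((C2 + 2 * (1 + A)) * X) = (a - 1) * (C2 * X) + (a - 1) * (2 * (1 + A) * X) by ring.
rewrite e1' in s2; rewrite e2' in s3; rewrite e3' in s1; rewrite e4' in s4.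
clear - s1 s2 s3 s4 s5 C40; lra.
Qed.

Lemma zterm_shell i e x : 0 <= e <= 1 -> O x -> x != 0 -> 2 ^+ i <= ht x ->
  zterm e x <= 2 * ((2 * C1) ^+ 2 * wt e ((2 ^+ i) ^+ n)).
Proof.
move=> he Ox x0 hx; have C1g := C1_ge1; have /andP[e0 e1] := he.
have p2 : 0 <= (2 ^+ i) ^+ n :> R by rewrite !exprn_ge0.
have [px|px] := eqVneq (phi x) 0.
  by rewrite zterm_eq0 // mulr_ge0 // mulr_ge0 ?sqr_ge0 // wt_ge0.
have [_ tx] := phiN0 px; rewrite /zterm; apply: ler_pM; rewrite ?rho_ge0 ?wt_ge0 ?Nm_ge0 ?rho_le //.
have c0 : 0 < 2 * C1 by lra.
apply: le_trans (_ : wt e ((2 * C1)^-1 * (2 ^+ i) ^+ n) <= _).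
  apply: wt_le => //; first by rewrite mulr_gt0 ?invr_gt0 ?exprn_gt0.
  apply: le_trans (good_Nm x0 c0 (ltW tx)); rewrite mulrC ler_wpM2r ?invr_ge0 ?(ltW c0) //.
  by apply: lerXn2r; rewrite ?nnegrE ?exprn_ge0 ?(ht_ge0 gd).
rewrite wtM ?invr_ge0 ?(ltW c0) // ler_wpM2r ?wt_ge0 // wtV_le //; lra.
Qed.

(** The dyadic shell of index i contributes O(r^i) with r = 2^-e, and the geometric series is O(1 /
    (1 - r)) = O(1 / e). *)
Lemma zterm_upper : exists2 C : R, 0 < C & forall e t, 0 < e <= 1 -> uniq t -> (forall x, x \in t -> O x) ->
  \sum_(x <- t) zterm e x <= C / e.
Proof.
have [C C0 hC] := dyadic_sum; have C1g := C1_ge1.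
pose M0 : R := 2 * (2 * C1) ^+ 2 * C.
have M00 : 0 < M0 by rewrite !mulr_gt0 ?exprn_gt0 //; lra.
exists (M0 * 2) => [|e t /andP[e0 e1] ut tO]; first by rewrite mulr_gt0.
have he : 0 <= e <= 1 by rewrite ltW.
pose t' := [seq x <- t | x != 0].
have -> : \sum_(x <- t) zterm e x = \sum_(x <- t') zterm e x.
  rewrite (bigID (fun x => x == 0)) /= big1 ?add0r ?big_filter // => x /eqP ->.
  by rewrite zterm_eq0 // /phi eqxx.
have [||||M hM] := hC t' (zterm e) (fun i => 2 * ((2 * C1) ^+ 2 * wt e ((2 ^+ i) ^+ n))).
- exact: filter_uniq.
- by move=> x; rewrite mem_filter => /andP[x0 /tO].
- move=> i; have p2 : 0 <= (2 ^+ i) ^+ n :> R by rewrite !exprn_ge0.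
  by rewrite mulr_ge0 // mulr_ge0 ?sqr_ge0 // wt_ge0.
- by move=> x i; rewrite mem_filter => /andP[x0 /tO Ox] h _; exact: zterm_shell.
apply: le_trans hM _; pose r : R := (2^-1) `^ e.
have r0 : 0 <= r by exact: powR_ge0.
have r1 : r <= 1 - e / 2.
  apply: le_trans (powR_le_affine _ he) _; rewrite ?invr_gt0 //.
  have -> : (2^-1 - 1 : R) = - (1 / 2) by field.
  lra.
apply: le_trans (_ : M0 * \sum_(i < M) r ^+ i <= _).
  rewrite mulr_sumr; apply: ler_sum => i _.
  have p0 : 0 < (2 ^+ i) ^+ n :> R by rewrite !exprn_gt0.
  have -> : C * (2 ^+ i) ^+ n * (2 * ((2 * C1) ^+ 2 * wt e ((2 ^+ i) ^+ n))) = M0 * (((2 ^+ i) ^+ n) `^ e)^-1.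
    by rewrite /M0 /wt; field; rewrite !gt_eqF ?powR_gt0.
  rewrite ler_wpM2l ?(ltW M00) //.
  have -> : r ^+ i = ((2 ^+ i) `^ e)^-1.
    rewrite powRX // -exprVn; congr (_ ^+ _).
    have h : 2 `^ e != 0 :> R by rewrite gt_eqF ?powR_gt0.
    by apply: (mulIf h); rewrite /r -powRM ?invr_ge0 // !mulVf ?pnatr_eq0 // powR1.
  rewrite lef_pV2 ?posrE ?powR_gt0 ?exprn_gt0 //; apply: ge0_ler_powR; rewrite ?nnegrE ?exprn_ge0 ?(ltW e0) //.
  by rewrite -[leLHS]expr1 ler_weXn2l // exprn_ege1 //; lra.
rewrite -mulrA ler_wpM2l ?(ltW M00) //; apply: le_trans (geom_le _ _) _; first by lra.
by rewrite -[leRHS]invrK lef_pV2 ?posrE ?invr_gt0 ?divr_gt0 // ?invf_div; lra.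
Qed.

(** Translating a box of size T by an [a] whose absolute values all lie between 2 T and 2 Cs T gives
    elements with absolute values between T and (2 Cs + 1) T, hence of skewness at most C1 by the
    assumption on C1. On them [rho] is bounded below. *)
Lemma zterm_lower : (exists2 Cs : R, 1 <= Cs /\ (n%:R * (2 * Cs + 1)) ^+ n <= C1 &
    forall T : R, 1 <= T -> exists a, O a /\ forall j, T <= nrm j a <= Cs * T) ->
  exists2 c : R, 0 < c & forall e, 0 < e <= 1 -> exists t : seq K,
    [/\ uniq t, forall x, x \in t -> O x & c / e <= \sum_(x <- t) zterm e x].
Proof.
move=> [Cs [Cs1 CsC] hsc]; have C1g := C1_ge1; have [c c0 hc] := count_lower gd.
(* [Q] exceeds the spread 2 Cs + 1 of a shell, so the shells with T = Q^i are disjoint; the single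
   absolute value [j0] tells them apart. *)
have /card_gt0P[j0 _] := n0; pose Q : R := 2 * Cs + 2; pose N0 : R := (size U0)%:R.
have n1 : 1 <= n%:R :> R by rewrite ler1n.
have shell (e T : R) : 0 <= e <= 1 -> 1 <= T -> exists t : seq K, [/\ uniq t,
    forall z, z \in t -> O z /\ T <= nrm j0 z < Q * T &
    c * T ^+ n * ((2 * N0)^-1 * wt e ((Q * T) ^+ n)) <= \sum_(z <- t) zterm e z].
  move=> he T1; have T2 : 1 <= 2 * T by lra.
  have [a [Oa ha]] := hsc _ T2; have [s [us sO hs]] := hc T T1.
  have zP z : z \in [seq x + a | x <- s] -> O z /\ forall j, T <= nrm j z <= (2 * Cs + 1) * T.
    case/mapP => x xs ->; have [Ox hx] := sO x xs; split=> [|j]; first exact: (dedD dO).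
    have /andP[h1 h2] := ha j; have h3 := hx j; apply/andP; split.
      have : nrm j a <= nrm j (x + a) + nrm j x by rewrite -{1}[a](addKr x) addrC (nrmB gd).
      lra.
    by apply: le_trans (nrmD gd _ _ _) _; lra.
  have q0 : 0 <= Q * T by rewrite mulr_ge0 //; rewrite /Q; lra.
  have wq0 : 0 <= wt e ((Q * T) ^+ n) by rewrite wt_ge0 // exprn_ge0.
  have N00 : 0 <= (2 * N0)^-1 by rewrite invr_ge0 mulr_ge0 // ler0n.
  exists [seq x + a | x <- s]; split.
  - by rewrite map_inj_uniq //; exact: addIr.
  - move=> z /zP[Oz /(_ j0)/andP[h1 h2]]; split=> //; rewrite h1; apply: le_lt_trans h2 _.
    by rewrite ltr_pM2r ?ltrD2l //; lra.
  apply: le_trans (_ : \sum_(z <- [seq x + a | x <- s]) (2 * N0)^-1 * wt e ((Q * T) ^+ n) <= _).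
    rewrite big_const_seq count_predT iter_addr_0 size_map -[leRHS]mulr_natl ler_wpM2r //.
    exact: mulr_ge0.
  rewrite big_seq [leRHS]big_seq; apply: ler_sum => z /zP[Oz hz].
  have z0 : z != 0.
    apply/eqP => z0; have /andP[] := hz j0; rewrite z0 (nrm0 gd); lra.
  have Nz0 := Nm_gt0 gd z0.
  have hN : T ^+ n <= Nm z.
    rewrite -prodr_const; apply: ler_prod => j _; have /andP[-> _] := hz j; rewrite andbT; lra.
  have hT : ht z <= n%:R * ((2 * Cs + 1) * T) by apply: ht_le => j; have /andP[] := hz j.
  have tz : skew z <= C1.
    rewrite /skew ler_pdivrMr //; apply: le_trans (_ : (n%:R * ((2 * Cs + 1) * T)) ^+ n <= _).
      by apply: lerXn2r; rewrite ?nnegrE ?(ht_ge0 gd) ?mulr_ge0 //; lra.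
    by rewrite mulrA exprMn; apply: ler_pM; rewrite ?exprn_ge0 ?mulr_ge0 //; lra.
  have pz : C1 <= phi z by rewrite /phi (negPf z0) le_max; apply/orP; right; lra.
  have Pz : C1 <= Phi z by apply: Phi_ge => //; rewrite gt_eqF //; lra.
  have Pz' : Phi z <= 2 * C1 * N0.
    rewrite /Phi; apply: le_trans (_ : \sum_(u <- U0) 2 * C1 <= _).
      by apply: ler_sum => u _; exact: phi_le.
    by rewrite big_const_seq count_predT iter_addr_0 -[leLHS]mulr_natr.
  have N0p : 0 < N0.
    rewrite lt_neqAle ler0n andbT eq_sym; apply/eqP => N0'; rewrite N0' mulr0 in Pz'; lra.
  apply: ler_pM => //.
    rewrite /rho ler_pdivlMr; last by lra.
    rewrite mulrC ler_pdivrMr ?mulr_gt0 //.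
    have : C1 * N0 <= phi z * N0 by rewrite ler_wpM2r // ltW.
    lra.
  apply: wt_le => //; first by case/andP: he.
  rewrite -prodr_const; apply: ler_prod => j _; rewrite (nrm_ge0 gd) /=.
  by have /andP[_ h] := hz j; apply: le_trans h _; rewrite ler_wpM2r ?lerD2l //; lra.
have Q1 : 1 <= Q by rewrite /Q; lra.
have Qn1 : 1 <= Q ^+ n by rewrite exprn_ege1.
have union e M : 0 <= e <= 1 -> exists t : seq K, [/\ uniq t,
    forall z, z \in t -> O z /\ nrm j0 z < Q ^+ M &
    \sum_(i < M) c * (Q ^+ i) ^+ n * ((2 * N0)^-1 * wt e ((Q * Q ^+ i) ^+ n)) <= \sum_(z <- t) zterm e z].
  move=> he; elim: M => [|M [t [ut tP ht]]]; first by exists [::]; split=> //; rewrite !big_nil big_ord0.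
  have [|s [us sP hs]] := shell e (Q ^+ M) he; first exact: exprn_ege1.
  exists (t ++ s); split.
  - rewrite cat_uniq ut us andbT /=; apply/hasPn => z /sP[_ /andP[h _]] /=.
    by apply/negP => /tP[_]; rewrite ltNge h.
  - move=> z; rewrite mem_cat => /orP[/tP[Oz h]|/sP[Oz /andP[_ h]]]; split=> //; last by rewrite exprS.
    by apply: lt_le_trans h _; rewrite ler_weXn2l.
  - by rewrite big_ord_recr big_cat /=; apply: lerD.
have [N00|N0p] := eqVneq N0 0.
  exfalso.
  have Ux : exists x, phi x != 0.
    have [a [Oa ha]] := hsc 1 (lexx _).
    have a0 : a != 0.
      by apply/eqP => a0; have /andP[] := ha j0; rewrite a0 (nrm0 gd); lra.
    have [u uu h] := C1P Oa a0; exists (u * a).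
    have u0 : u != 0 by case: uu.
    by rewrite gt_eqF // phi_gt0 ?mulf_neq0 // /skew NmUr // ltr_pdivrMr ?(Nm_gt0 gd) //; have := Nm_gt0 gd a0; nra.
  have [x px] := Ux; have := U0P (unitL1 dO) px; rewrite mul1r => /(_ px).
  by move/eqP: N00; rewrite pnatr_eq0 size_eq0 => /eqP ->.
have N0q : 0 < N0 by rewrite lt_neqAle eq_sym N0p ler0n.
pose c1 := c * (2 * N0)^-1 * (Q ^+ n)^-1 * ((Q ^+ n) ^+ 2)^-1.
have Qn0 : 0 < Q ^+ n by lra.
have c10 : 0 < c1 by rewrite !mulr_gt0 ?invr_gt0 ?mulr_gt0 ?exprn_gt0 //; lra.
(* About 1 / e shells are used. On them the power with exponent [e] stays below (Q^n)^2, because M e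
   <= 2, so each contributes at least [c1]. *)
exists c1 => // e /andP[e0 e1]; pose M := (Num.truncn e^-1).+1.
have he : 0 <= e <= 1 by rewrite ltW.
have ei : 1 <= e^-1 by rewrite invf_ge1.
have M1 : e^-1 <= M%:R by rewrite ltW // truncnS_gt.
have M2 : M%:R * e <= 2.
  have : (Num.truncn e^-1)%:R <= e^-1 :> R by rewrite truncn_le // invr_ge0 ltW.
  rewrite -ler_pdivlMr // /M -natr1; lra.
have [t [ut tP ht]] := union e M he.
exists t; split=> //; first by move=> x /tP[].
apply: le_trans ht; apply: le_trans (_ : \sum_(i < M) c1 <= _); last first.
  apply: ler_sum => i _; have Qi : 0 < Q ^+ i by rewrite exprn_gt0 //; lra.
  have q0 : 0 < Q by lra.
  have -> : c * (Q ^+ i) ^+ n * ((2 * N0)^-1 * wt e ((Q * Q ^+ i) ^+ n)) =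
    c * (2 * N0)^-1 * (Q ^+ n)^-1 * (((Q * Q ^+ i) ^+ n) `^ e)^-1.
    rewrite /wt [(Q * _) ^+ n in X in _ * (_ * (X * _))]exprMn.
    by field; rewrite !gt_eqF ?powR_gt0 ?exprn_gt0 ?mulr_gt0.
  rewrite /c1 ler_wpM2l ?mulr_ge0 ?invr_ge0 ?(ltW c0) ?mulr_ge0 ?(ltW N0q) ?(ltW Qn0) //.
  rewrite lef_pV2 ?posrE ?powR_gt0 ?exprn_gt0 ?mulr_gt0 //.
  apply: le_trans (_ : ((Q ^+ n) ^+ M) `^ e <= _).
    apply: ge0_ler_powR; rewrite ?nnegrE ?exprn_ge0 ?mulr_ge0 ?(ltW e0) ?(ltW Qi) ?(ltW q0) ?(ltW Qn0) //.
    rewrite -exprS -!exprM ler_weXn2l // mulnC leq_mul2l; apply/orP; right; exact: ltn_ord.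
  rewrite -powR_mulrn ?(ltW Qn0) // -powRrM -[leRHS]powR_mulrn ?(ltW Qn0) //.
  exact: ler_powR.
by rewrite sumr_const card_ord -[leRHS]mulr_natr ler_wpM2l // ltW.
Qed.

Local Notation SO e := (lsup (zterm e) O).
Local Notation SD e D := (lsup (zterm e) (I_ D)).

(** [O] is the union of [Nd D] cosets of the ideal. Translating a coset back to the ideal costs a
    bounded error, by [zterm_lip] and [decay_sum], uniformly in [e]. *)
Lemma coset_sums D : eff O D -> exists2 C : R, 0 < C & forall e, 0 < e <= 1 ->
  SO e <= Nd D * SD e D + C /\ Nd D * SD e D <= SO e + C.
Proof.
move=> eD; have [m [s [szs [us sep] sO cov]] mN] := idx_idealD dO R eD.
have [_ _ _ DO] := idealD_ideal dO eD; have aD : addg (I_ D) by exact: addg_idealD.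
have [Cu Cu0 hu] := zterm_upper; have [Ch Ch0 hh1] := decay_sum.
pose B := 1 + \sum_(a <- s) ht a.
have Bs a j : a \in s -> nrm j a <= B.
  move=> as_; apply: le_trans (nrm_le_ht gd j a) _; rewrite /B (big_rem a) //=.
  have h : 0 <= \sum_(y <- rem a s) ht y by apply: sumr_ge0 => y _; exact: (ht_ge0 gd).
  lra.
have B0 : 0 < B by rewrite ltr_wpDr ?ltr01 // sumr_ge0 // => a _; exact: (ht_ge0 gd).
have [C C0 lip] := zterm_lip B0.
have m0 : 0 < m%:R :> R by rewrite mN Nd_gt0.
have m1 : 1 <= m%:R :> R by rewrite mN (Nd_ge1 dO).
exists (m%:R * (C * Ch)) => [|e he]; first by rewrite !mulr_gt0.
have he' : 0 <= e <= 1 by case/andP: he => /ltW ->.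
have CCh : 0 <= C * Ch by rewrite mulr_ge0 // ltW.
have Cm : C * Ch <= m%:R * (C * Ch) by rewrite ler_peMl.
have hOB t := hu e t he.
have hDB (t : seq K) (ut : uniq t) (tD : forall x, x \in t -> I_ D x) : \sum_(x <- t) zterm e x <= Cu / e.
  by apply: hOB => // x /tD/DO.
rewrite -mN; split.
- apply: lsup_le => t ut tO.
  have hr x : exists a, O x -> a \in s /\ I_ D (x - a).
    by have [/cov[a as_ h]|nO] := pselect (O x); [exists a|exists 0].
  have {hr} /choice[r hr] := hr.
  apply: le_trans (_ : \sum_(x <- t) (zterm e (x - r x) + C * decay x) <= _).
    rewrite big_seq [leRHS]big_seq; apply: ler_sum => x xt; have [rs rD] := hr x (tO x xt).
    apply: lip => //; [exact: tO|exact: DO|] => j.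
    by rewrite opprB addrC subrK; exact: Bs.
  rewrite big_split /= -mulr_sumr; apply: lerD; last first.
    by apply: le_trans Cm; rewrite ler_wpM2l ?(ltW C0) //; exact: hh1.
  rewrite (sum_partition (s := s) (g := r)) // => [|x /tO /hr[]//].
  apply: le_trans (_ : \sum_(a <- s) SD e D <= _); last first.
    by rewrite big_const_seq count_predT iter_addr_0 szs -[leLHS]mulr_natl.
  apply: ler_sum => a _; rewrite -big_filter.
  rewrite (eq_big_seq (fun x => zterm e (x - a))) => [|x]; last by rewrite mem_filter => /andP[/eqP ->].
  rewrite -(big_map (fun x => x - a) xpredT (zterm e)); apply: lsum_le hDB _ _.
    by rewrite map_inj_uniq ?filter_uniq //; exact: addIr.
  by move=> _ /mapP[x + ->]; rewrite mem_filter => /andP[/eqP <- /tO /hr[]].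
- rewrite mulrC -ler_pdivlMr //; apply: lsup_le => t ut tD; rewrite ler_pdivlMr // mulrC.
  have -> : m%:R * \sum_(x <- t) zterm e x = \sum_(a <- s) \sum_(x <- t) zterm e x.
    by rewrite big_const_seq count_predT iter_addr_0 szs -[RHS]mulr_natl.
  apply: le_trans (_ : \sum_(a <- s) \sum_(x <- t) (zterm e (x + a) + C * decay x) <= _).
    rewrite big_seq [leRHS]big_seq; apply: ler_sum => a as_.
    rewrite big_seq [leRHS]big_seq; apply: ler_sum => x xt.
    have Ox := DO _ (tD x xt); apply: lip => //; first by apply: (dedD dO) => //; exact: sO.
    by move=> j; rewrite opprD addNKr (nrmN gd); exact: Bs.
  under eq_bigr do rewrite big_split -mulr_sumr /=.
  rewrite big_split /=; apply: lerD; last first.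
    rewrite big_const_seq count_predT iter_addr_0 szs -[leLHS]mulr_natl.
    by rewrite ler_wpM2l ?(ltW m0) // ler_wpM2l ?(ltW C0) // hh1 // => x /tD/DO.
  have -> : \sum_(i <- s) \sum_(x <- t) zterm e (x + i) = \sum_(z <- [seq x + a | a <- s, x <- t]) zterm e z.
    by rewrite big_allpairs_dep.
  apply: lsum_le hOB _ _.
    apply: allpairs_uniq => // -[a x] [a' x'] /allpairsP[[p q] /= [ps qt [-> ->]]].
    move=> /allpairsP[[p' q'] /= [ps' qt' [-> ->]]] /= h.
    have e1 : p = p'.
      apply: sep => //; have -> : p - p' = q' - q by apply/eqP; rewrite subr_eq addrAC -h addrC addKr.
      by case: aD => _; apply; exact: tD.
    by rewrite e1 in h *; rewrite (addIr _ h).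
  by move=> _ /allpairsP[[p q] /= [ps qt ->]]; apply: (dedD dO); [apply: DO; exact: tD|exact: sO].
Qed.

Lemma rho_orbit_le x (r : seq K) : O x -> x != 0 -> uniq r -> (forall u, u \in r -> unit u) ->
  \sum_(u <- r) rho (u * x) <= 1.
Proof.
move=> Ox x0 ur ru; have [s [us su <- hs]] := rho_orbit Ox x0.
rewrite (bigID (fun u => rho (u * x) != 0)) /= [X in _ + X]big1 ?addr0; last by move=> w /negbNE/eqP.
rewrite -big_filter; set r' := filter _ r.
rewrite [leRHS](bigID (mem r')) /= -[leLHS]addr0 lerD ?sumr_ge0 // => [|u _]; last exact: rho_ge0.
rewrite -[leRHS]big_filter le_eqVlt; apply/orP; left; apply/eqP; apply: perm_big; apply: uniq_perm.
- exact: filter_uniq.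
- exact: filter_uniq.
- move=> u; apply/idP/idP => [ur'|]; last by rewrite mem_filter => /andP[].
  rewrite mem_filter; apply/andP; split=> //.
  by move: ur'; rewrite mem_filter => /andP[h /ru uu]; exact: hs.
Qed.

(** For [B] effective of class -k, the map x -> dv x - B matches unit orbits of nonzero elements of
    the ideal of [B] with effective divisors of class k, and [rho] adds up to 1 on an orbit. So the
    sum over the class is N^(1+e) T for N the norm of [B] and T the sum over its ideal. Here N T = S
    + O(1) by [coset_sums], and replacing N^e by 1 costs O(e) times T = O(1 / e). *)
Lemma class_sum k : exists2 C : R, 0 < C & forall e, 0 < e <= 1 ->
  (forall t : seq (divisor K), uniq t -> (forall D, D \in t -> eff O D /\ cls D = k) ->
     \sum_(D <- t) wt e (Nd D) <= SO e + C) /\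
  exists t : seq (divisor K), [/\ uniq t, forall D, D \in t -> eff O D /\ cls D = k &
     SO e - C <= \sum_(D <- t) wt e (Nd D)].
Proof.
have [B eB cB] := eff_rep dO gd (- k); have [C C0 hC] := coset_sums eB.
have [Cu Cu0 hu] := zterm_upper; have N1 : 1 <= Nd B := Nd_ge1 dO R eB.
have [_ _ _ BO] := idealD_ideal dO eB.
set N := Nd B in N1 hC *; have N0 : 0 < N by lra.
exists (Cu * N + N * C + C + N) => [|e he]; first by rewrite !addr_gt0 ?mulr_gt0.
have he' : 0 <= e <= 1 by case/andP: he => /ltW ->.
have e0 : 0 < e by case/andP: he.
have [h1 h2] := hC e he; set S := SO e in h1 h2 *; set T := SD e B in h1 h2 *.
have NC : 0 <= N * C by rewrite mulr_ge0 // ltW.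
have CN : 0 <= Cu * N by rewrite mulr_ge0 // ltW.
have hBB (t : seq K) (ut : uniq t) (tB : forall x, x \in t -> I_ B x) : \sum_(x <- t) zterm e x <= Cu / e.
  by apply: hu => // x /tB/BO.
have wN0 : 0 < wt e N by exact: wt_gt0.
have wNV : (wt e N)^-1 = N * N `^ e by rewrite /wt invfM !invrK.
have Ne1 : 1 <= N `^ e by rewrite -(powRr0 N); apply: ler_powR => //; rewrite ltW.
have Ne2 : N `^ e <= 1 + e * (N - 1) by exact: powR_le_affine.
have wND D : wt e (Nd (D + B)) = wt e (Nd D) * wt e N.
  by rewrite (NdD dO) wtM // ltW // Nd_gt0.
split.
- move=> t ut tP.
  have ha D : exists a, D \in t -> [/\ a != 0, O a, I_ B a, dv a = D + B & Nm a = Nd (D + B)].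
    have [/tP[eD cD]|nt] := boolP (D \in t); last by exists 0.
    have [a a0 aE] : exists2 f : K, f != 0 & forall v, fin v -> coeff v (D + B) - coeff v 0 = v f.
      by apply/cls_eq; rewrite raddfD /= cD cB subrr raddf0.
    have dva : dv a = D + B.
      apply: divP => v; rewrite (dvE dO) //; case: ifP => [fv|nfv]; first by rewrite -aE // coeff0 subr0.
      have [_] := effD eD eB v; rewrite nfv; case: eqP => // _ /(_ isT) //.
    have Ba : I_ B a.
      apply/(idealDP O) => // v fv; rewrite -aE // coeff0 subr0 coeffD lerDr; by case: (eD v).
    exists a => _; split=> //; first exact: BO.
    by rewrite (NmE gd) // dva.
  have {ha} /choice[al hal] := ha.
  have hs D : exists s : seq K, D \in t -> [/\ uniq s, forall u, u \in s -> unit u & \sum_(u <- s) rho (u * al D) = 1].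
    have [Dt|] := boolP (D \in t); last by exists [::].
    have [a0 Oa _ _ _] := hal D Dt; have [s [us su es _]] := rho_orbit Oa a0.
    by exists s.
  have {hs} /choice[sl hsl] := hs.
  pose W := [seq u * al D | D <- t, u <- sl D].
  have sumW : \sum_(x <- W) zterm e x = wt e N * \sum_(D <- t) wt e (Nd D).
    rewrite big_allpairs_dep /= mulr_sumr big_seq [RHS]big_seq; apply: eq_bigr => D Dt.
    have [a0 Oa _ _ Na] := hal D Dt; have [_ su es] := hsl D Dt.
    rewrite (eq_big_seq (fun u => rho (u * al D) * (wt e N * wt e (Nd D)))).
      by rewrite -mulr_suml es mul1r.
    by move=> u /su uu; rewrite /zterm NmUr // Na wND [wt e N * _]mulrC.
  have dvW D u : D \in t -> u \in sl D -> dv (u * al D) = D + B.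
    move=> Dt uD; have [a0 _ _ <- _] := hal D Dt; have [_ su _] := hsl D Dt.
    have [u0 _ _] := su u uD.
    by rewrite (dvM dO) // (dv_unit dO (su u uD)) add0r.
  have uW : uniq W.
    apply: allpairs_uniq_dep => //; first by move=> D Dt; case: (hsl D Dt).
    move=> _ _ /allpairsPdep[D [u [Dt uD ->]]] /allpairsPdep[D' [u' [Dt' uD' ->]]] /= h.
    have e1 : D = D' by apply: (addIr B); rewrite -(dvW D u) // -(dvW D' u') // h.
    by move: uD' h; rewrite -e1 => uD' /(mulIf _) ->//; case: (hal D Dt).
  have WB x : x \in W -> I_ B x.
    case/allpairsPdep=> D [u [Dt uD ->]]; have [_ Oa Ba _ _] := hal D Dt.
    by apply: idealD_mul => //; have [_ su _] := hsl D Dt; case: (su u uD).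
  have WT : wt e N * \sum_(D <- t) wt e (Nd D) <= T by rewrite -sumW; exact: lsum_le hBB _ _.
  have T0 : 0 <= T by apply: le_trans WT; rewrite mulr_ge0 ?(ltW wN0) // sumr_ge0 // => D _; rewrite wt_ge0 // ltW // Nd_gt0.
  have S1 : S <= Cu / e by apply: lsup_le => t' ut' tO'; exact: hu.
  move: WT; rewrite mulrC -ler_pdivlMr // wNV => /le_trans; apply.
  have -> : T * (N * N `^ e) = N * T * N `^ e by ring.
  have NT0 : 0 <= N * T by rewrite mulr_ge0 // ltW.
  apply: le_trans (ler_wpM2l NT0 Ne2) _.
  have S2 : N * T * (e * (N - 1)) <= (Cu / e + C) * (e * (N - 1)).
    rewrite ler_wpM2r //; first by rewrite mulr_ge0 ?(ltW e0) //; lra.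
    lra.
  have S3 : (Cu / e + C) * (e * (N - 1)) = Cu * (N - 1) + C * (N - 1) * e by field; rewrite gt_eqF.
  have S4 : C * (N - 1) * e <= C * (N - 1) * 1.
    by rewrite ler_wpM2l ?mulr_ge0 ?(ltW C0) //; [lra|case/andP: he].
  rewrite mulrDr mulr1; lra.
(* A nearly optimal finite sum over the ideal, grouped by the divisors [dv x - B]. Each group may be
   only part of a unit orbit, so its [rho] adds up to at most 1, which is the inequality wanted
   here. *)
- have [t [ut tB ht]] := lsup_approx ltr01 hBB; rewrite -/T in ht.
  pose t' := [seq x <- t | x != 0]; pose g x := dv x - B.
  have t'P x : x \in t' -> [/\ x != 0, I_ B x & O x].
    by rewrite mem_filter => /andP[x0 /tB Bx]; split=> //; exact: BO.
  pose l := undup [seq g x | x <- t'].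
  have lP D : D \in l -> eff O D /\ cls D = k.
    rewrite mem_undup => /mapP[x /t'P[x0 Bx Ox] ->]; split.
      move=> v; rewrite coeffB (dvE dO) //; case: ifP => fv.
        by split=> //; rewrite subr_ge0; move/(idealDP O): Bx; apply.
      have [_ h] := eB v; have [z|z] := eqVneq (coeff v B) 0; first by rewrite z subr0 eqxx.
      by have := h z; rewrite fv.
    have z : cls (dv x) = cls 0.
      by apply/cls_eq; exists x => // v fv; rewrite (dvE dO) // fv coeff0 subr0.
    by rewrite raddfB /= z raddf0 cB sub0r opprK.
  exists l; split=> //; first exact: undup_uniq.
  have st : \sum_(x <- t) zterm e x = \sum_(x <- t') zterm e x.
    rewrite (bigID (fun x => x == 0)) /= big1 ?add0r ?big_filter // => x /eqP ->.
    by rewrite zterm_eq0 // /phi eqxx.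
  have key : \sum_(x <- t') zterm e x <= wt e N * \sum_(D <- l) wt e (Nd D).
    rewrite (sum_partition (s := l) (g := g)) ?undup_uniq // => [|x xt]; last by rewrite mem_undup map_f.
    rewrite mulr_sumr big_seq [leRHS]big_seq; apply: ler_sum => D Dl.
    move: (Dl); rewrite mem_undup => /mapP[x0 x0t DE]; have [x00 _ Ox0] := t'P x0 x0t.
    rewrite -big_filter; set r := filter _ t'.
    have rP x : x \in r -> [/\ x != 0, unit (x / x0) & Nm x = Nd (D + B)].
      rewrite mem_filter => /andP[/eqP gx /t'P[xn0 Bx Ox]].
      have e1 : dv x = D + B by rewrite -gx subrK.
      split=> //; first by apply: (dv_eq_unit dO) => //; rewrite e1 DE subrK.
      by rewrite (NmE gd) // e1.
    rewrite (eq_big_seq (fun x => rho (x / x0 * x0) * (wt e N * wt e (Nd D)))).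
      rewrite -mulr_suml -[leRHS]mul1r ler_wpM2r //; first by rewrite mulr_ge0 ?(ltW wN0) // wt_ge0 // ltW // Nd_gt0.
      rewrite -(big_map (fun x => x / x0) xpredT (fun u => rho (u * x0))); apply: rho_orbit_le => //.
        rewrite map_inj_uniq ?filter_uniq //; apply: mulIf; by rewrite invr_eq0.
      by move=> _ /mapP[x /rP[_ h _] ->].
    by move=> x /rP[_ _ h]; rewrite /zterm divfK // h wND [wt e N * _]mulrC.
  rewrite st in ht; have := le_trans ht key.
  have l0 : 0 <= \sum_(D <- l) wt e (Nd D) by rewrite sumr_ge0 // => D _; rewrite wt_ge0 // ltW // Nd_gt0.
  set X := \sum_(D <- l) _ in l0 *; move=> h.
  have h3 : N * (T - 1) <= X.
    apply: le_trans (_ : N * (wt e N * X) <= _); first by rewrite ler_wpM2l // ltW.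
    have -> : N * (wt e N * X) = X / N `^ e.
      by rewrite /wt; field; rewrite !gt_eqF ?powR_gt0.
    by rewrite ler_pdivrMr ?ler_peMr //; lra.
  rewrite mulrBr mulr1 in h3; lra.
Qed.

End ZetaSums.

Section ClassSums.
Local Open Scope classical_set_scope.
Variables (R : realType) (K : fieldType) (O : set K) (dO : dedekind O).
Variables (J : finType) (nrm : J -> K -> R) (gd : global_data O nrm).

(* Both bounds on [S] and the error [C] are uniform in [e], the exponent being [1 + e]. *)
Theorem class_sums : exists C c : R, [/\ 0 < c, 0 < C & forall e, 0 < e <= 1 -> exists S,
  [/\ c / e <= S, S <= C / e & forall k : Clf O,
    (forall t : seq (divisor K), uniq t -> (forall D, D \in t -> eff O D /\ cls O D = k) ->
      \sum_(D <- t) wt e (Nd O R D) <= S + C) /\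
    exists t : seq (divisor K), [/\ uniq t, forall D, D \in t -> eff O D /\ cls O D = k &
      S - C <= \sum_(D <- t) wt e (Nd O R D)]]].
Proof.
have [C0 C00 hC0] := cocompact dO gd; have [Cs Cs1 hCs] := scalings gd.
pose Cx : R := (#|J|%:R * (2 * Cs + 1)) ^+ #|J|.
have Cx0 : 0 <= Cx by rewrite exprn_ge0 // mulr_ge0 ?ler0n //; lra.
(* Large enough both for cocompactness and for the balanced elements of [zterm_lower]. *)
pose C1 := 1 + C0 + Cx.
have C1g : 1 <= C1 by rewrite /C1; lra.
have C1P x : O x -> x != 0 -> exists2 u, unitL O u & ht nrm (u * x) ^+ #|J| <= C1 * Nm nrm x.
  move=> Ox x0; have [u uu h] := hC0 x Ox x0; exists u => //; apply: le_trans h _.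
  by rewrite ler_wpM2r ?(ltW (Nm_gt0 gd x0)) // /C1; lra.
have [U0 [uU0 unU0 U0P]] := phi_units dO gd C1g.
have [Cu Cu0 hu] := zterm_upper dO gd C1g C1P U0P.
have [|c c0 hc] := zterm_lower dO gd C1g C1P U0P.
  by exists Cs => //; split=> //; rewrite -/Cx /C1; lra.
have [s hs] := class_group_finite dO gd.
have /choice[Ck hk] : forall k : Clf O, exists C : R, 0 < C /\ _ := fun k =>
  let: ex_intro2 C h1 h2 := class_sum dO gd C1g C1P uU0 unU0 U0P k in ex_intro _ C (conj h1 h2).
have sum_ge0 (r : seq (Clf O)) : 0 <= \sum_(i <- r) Ck i.
  by apply: sumr_ge0 => i _; rewrite ltW //; case: (hk i).
pose C := \sum_(i <- s) Ck i + Cu.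
have C_ge k : Ck k <= C.
  by rewrite /C (big_rem k) //= -addrA lerDl addr_ge0 ?(ltW Cu0).
exists C, c; split=> // [|e he]; first by rewrite ltr_wpDl.
have e0 : 0 < e by case/andP: he.
pose S := lsup (zterm nrm C1 U0 e) O.
have SB : S <= Cu / e by apply: lsup_le => t ut tO; exact: hu.
exists S; split.
- have [t [ut tO h]] := hc e he; apply: le_trans h _.
  by apply: (lsum_le (B := Cu / e)) => // t' ut' tO'; exact: hu.
- by apply: le_trans SB _; rewrite ler_pM2r ?invr_gt0 // /C lerDr.
- move=> k; have [_ hk2] := hk k; have [h1 h2] := hk2 e he; split.
    by move=> t ut tP; apply: le_trans (h1 t ut tP) _; rewrite lerD2l.
  have [t [ut tP h]] := h2; exists t; split=> //; apply: le_trans h; rewrite lerD2l lerN2.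
  exact: C_ge.
Qed.

End ClassSums.

(** * The index of the group of norms *)

Section EulerProduct.
Local Open Scope classical_set_scope.
Variables (R : realType) (K : fieldType) (O : set K) (dO : dedekind O).
Local Notation Cl := (Clf O).
Local Notation fin := (fin O).
Local Notation cls := (cls O).
Local Notation Nd := (Nd O R).
Variables (e B : R).
Hypotheses (e0 : 0 <= e) (boundB : forall (k : Cl) (t : seq (divisor K)), uniq t ->
  (forall D, D \in t -> eff O D /\ cls D = k) -> \sum_(D <- t) wt e (Nd D) <= B).
Implicit Types (v : place K) (D : divisor K) (P : seq (place K)) (k : Cl).

(** Restricting to divisors supported on a finite list [P] turns the Euler product into a finite
    one, while the sums remain suprema. *)
Definition esupp P k : set (divisor K) :=
  [set D | [/\ eff O D, cls D = k & forall v, coeff v D != 0 -> v \in P]].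
Definition esum P k : R := lsup (fun D => wt e (Nd D)) (esupp P k).
Definition xw v : R := wt e (Nv O v)%:R.

Lemma xw_gt0 v : 0 < xw v.
Proof. by rewrite wt_gt0 // ltr0n Nv_gt0. Qed.

Lemma xw_le v : fin v -> xw v <= 1 / 2.
Proof.
move=> fv; have h : 1 < (Nv O v)%:R :> R by rewrite ltr1n Nv_gt1.
apply: le_trans (wt_le_inv e0 (ltW h)) _; rewrite div1r lef_pV2 ?posrE ?ltr0n ?Nv_gt0 //.
by rewrite ler_nat Nv_gt1.
Qed.

Lemma esum_bound P k (t : seq (divisor K)) : uniq t -> (forall D, D \in t -> esupp P k D) ->
  \sum_(D <- t) wt e (Nd D) <= B.
Proof. by move=> ut tP; apply: (boundB (k := k)) => // D /tP[]. Qed.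

Lemma esum_le P k : esum P k <= B.
Proof. exact: lsup_le (esum_bound (P := P) (k := k)). Qed.

Lemma esum_ge P k (t : seq (divisor K)) : uniq t -> (forall D, D \in t -> esupp P k D) ->
  \sum_(D <- t) wt e (Nd D) <= esum P k.
Proof. by move=> ut tP; apply: (lsum_le (B := B)) => // t'; exact: esum_bound. Qed.

Lemma esum_ge0 P k : 0 <= esum P k.
Proof. by have := esum_ge (P := P) (k := k) (t := [::]) isT (fun _ h => False_ind _ (Bool.diff_false_true h)); rewrite big_nil. Qed.

Lemma esum_nil k : esum [::] k = (k == 0)%:R.
Proof.
have z D : esupp [::] k D -> D = 0 /\ k = 0.
  move=> [_ <- h]; have -> : D = 0.
    by apply: divP => v; rewrite coeff0; apply/eqP/negPn/negP => /h.
  by rewrite raddf0.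
apply/eqP; rewrite eq_le; apply/andP; split.
  apply: lsup_le => -[|D t] /=; first by rewrite big_nil ler0n.
  case/andP=> nD ut tP; have [D0 k0] := z D (tP D (mem_head _ _)).
  have -> : t = [::].
    case: t nD {ut} tP => // D' t nD tP.
    have D't : D' \in [:: D, D' & t] by rewrite !inE eqxx orbT.
    by have [D'0 _] := z D' (tP D' D't); move: nD; rewrite D0 D'0 mem_head.
  by rewrite big_seq1 D0 k0 eqxx Nd0 wt1.
have [->|k0] := eqVneq k 0; last exact: esum_ge0.
have := @esum_ge [::] 0 [:: 0] isT; rewrite big_seq1 Nd0 wt1; apply=> D; rewrite inE => /eqP ->.
by split=> [||v]; [exact: eff0|rewrite raddf0|rewrite coeff0 eqxx].
Qed.

(** A divisor supported on [v :: P] either avoids [v] or is [<< v >>] plus another such divisor: the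
    Euler factor at [v], class by class. *)
Lemma esum_cons v P k : fin v -> v \notin P ->
  esum (v :: P) k = esum P k + xw v * esum (v :: P) (k - cls << v >>).
Proof.
move=> fv vP; have x0 := xw_gt0 v.
have wtv D : wt e (Nd (D + << v >>)) = xw v * wt e (Nd D).
  by rewrite (NdD dO) NdU wtM ?ler0n ?(ltW (Nd_gt0 _ _ _)) // mulrC.
have coefv D w : coeff w (D + << v >>) = coeff w D + (v == w)%:Z.
  by rewrite coeffD coeffU mul1r; case: eqP.
have dn D : esupp (v :: P) k D -> coeff v D != 0 -> esupp (v :: P) (k - cls << v >>) (D - << v >>).
  move=> [eD <- sD] Dv; split; last 1 first.
  - move=> w; rewrite coeffB coeffU mul1r inE; have [->|nwv] := eqVneq w v; first by [].
    by rewrite subr0 => /sD; rewrite inE (negPf nwv).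
  - move=> w; rewrite coeffB coeffU mul1r; have [h1 h2] := eD w.
    have [E|nwv] := eqVneq v w; last by rewrite subr0; split.
    by split; [rewrite subr_ge0 -E; move: h1 Dv; rewrite E; lia|rewrite -E].
  - by rewrite raddfB.
apply/eqP; rewrite eq_le; apply/andP; split.
  apply: lsup_le => t ut tP; rewrite (bigID (fun D => coeff v D == 0)) /=; apply: lerD.
    rewrite -big_filter; apply: esum_ge; first exact: filter_uniq.
    move=> D; rewrite mem_filter => /andP[/eqP Dv /tP[eD kD sD]]; split=> // w wD.
    by have := sD w wD; rewrite inE => /orP[/eqP E|//]; move: wD; rewrite E Dv eqxx.
  rewrite -big_filter; set t2 := filter _ t.
  rewrite (eq_bigr (fun D => xw v * wt e (Nd (D - << v >>)))) => [|D _]; last by rewrite -wtv subrK.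
  rewrite -mulr_sumr ler_wpM2l ?(ltW x0) //.
  rewrite -(big_map (fun D => D - << v >>) xpredT (fun D => wt e (Nd D))); apply: esum_ge.
    by rewrite map_inj_uniq ?filter_uniq //; exact: addIr.
  by move=> _ /mapP[D + ->]; rewrite mem_filter => /andP[Dv /tP Dk]; exact: dn.
rewrite -lerBrDr; apply: lsup_le => t1 u1 t1P; rewrite lerBrDr addrC -lerBrDr mulrC -ler_pdivlMr //.
apply: lsup_le => t2 u2 t2P; rewrite ler_pdivlMr // mulrC lerBrDr addrC.
have -> : xw v * \sum_(D <- t2) wt e (Nd D) = \sum_(D <- [seq D + << v >> | D <- t2]) wt e (Nd D).
  by rewrite mulr_sumr big_map; apply: eq_bigr => D _; rewrite wtv.
rewrite -big_cat; apply: esum_ge.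
  rewrite cat_uniq u1 map_inj_uniq ?u2 ?andbT /=; last exact: addIr.
  apply/hasPn => _ /mapP[D /t2P[eD _ _] ->] /=; apply/negP => /t1P[_ _ h].
  move: vP; apply/negP; rewrite negbK; apply: h; rewrite coefv eqxx.
  by have [h _] := eD v; move: h; lia.
move=> D; rewrite mem_cat => /orP[/t1P[eD kD sD]|/mapP[D' /t2P[eD kD sD] ->]].
  by split=> // w /sD wP; rewrite inE wP orbT.
split; first by apply: effD => //; exact: effU.
  by rewrite raddfD /= kD subrK.
move=> w; rewrite coefv inE; have [->|nwv] := eqVneq w v; first by [].
by rewrite addr0 => /sD; rewrite inE (negPf nwv).
Qed.

Variables (s : seq Cl) (us : uniq s) (cs : forall k, k \in s).
Variables (F : fieldType) (f : {rmorphism R -> F}) (chi : Cl -> F).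
Hypotheses (chi0 : chi 0 = 1) (chiD : forall k k', chi (k + k') = chi k * chi k').

Lemma sum_shift (g : Cl -> F) c : \sum_(k <- s) g (k + c) = \sum_(k <- s) g k.
Proof.
rewrite -(big_map (fun k => k + c) xpredT g); apply: perm_big; apply: uniq_perm => //.
  by rewrite map_inj_uniq //; exact: addIr.
by move=> k; rewrite cs; apply/mapP; exists (k - c) => //; rewrite subrK.
Qed.

Definition Lam P := \sum_(k <- s) chi k * f (esum P k).

(** After twisting by the multiplicative [chi] and summing over all classes, the class shift in
    [esum_cons] becomes the scalar [chi (cls << v >>)], and the recursion divides [Lam] by one Euler
    factor. *)
Lemma euler P : uniq P -> (forall v, v \in P -> fin v) ->
  \prod_(v <- P) (1 - chi (cls << v >>) * f (xw v)) * Lam P = 1.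
Proof.
elim: P => [|v P IH] /=.
  move=> _ _; rewrite big_nil mul1r /Lam (bigD1_seq 0) //= esum_nil eqxx chi0 rmorph1 mulr1.
  by rewrite big1 ?addr0 // => k /negPf k0; rewrite esum_nil k0 rmorph0 mulr0.
case/andP=> vP uP fP; have fv : fin v by apply: fP; rewrite mem_head.
have {}IH := IH uP (fun w wP => fP w (mem_behead (s := v :: P) wP)).
suff h : (1 - chi (cls << v >>) * f (xw v)) * Lam (v :: P) = Lam P.
  by rewrite big_cons mulrAC h mulrC.
rewrite mulrBl mul1r; apply/eqP; rewrite subr_eq; apply/eqP.
rewrite {1}/Lam (eq_bigr (fun k => chi k * f (esum P k) +
   chi (cls << v >>) * f (xw v) * (chi (k - cls << v >>) * f (esum (v :: P) (k - cls << v >>))))) => [|k _].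
  rewrite big_split /= -mulr_sumr; congr (_ + _ * _).
  exact: (sum_shift (fun k => chi k * f (esum (v :: P) k))).
rewrite (esum_cons k fv vP) rmorphD rmorphM mulrDr; congr (_ + _).
by rewrite -{1}[k](subrK (cls << v >>)) chiD; ring.
Qed.

End EulerProduct.

(** * Functionals and additive characters *)

Section Functional.
Local Open Scope classical_set_scope.
Variables (A : zmodType) (s : seq A) (cs : forall x, x \in s).
Variables (l : nat) (lpr : prime l).

Lemma Fp_nat (z : 'F_l) : (z : nat)%:R = z.
Proof. by rewrite natr_Zp. Qed.

Lemma Fp_natE (a b : nat) : (a%:R == b%:R :> 'F_l) = (a == b %[mod l]).
Proof. by rewrite -val_eqE /= !val_Fp_nat. Qed.

Lemma mulrn_mod (x : A) (N : set A) (a b : nat) : addg N -> N (x *+ l) -> a = b %[mod l] ->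
  N (x *+ a - x *+ b).
Proof.
move=> aN Nx e; have Nk k : N (x *+ (k * l)%N).
  elim: k => [|k IH]; first by rewrite mul0n mulr0n; case: aN.
  by rewrite mulSn mulrnDr; apply: addgD.
rewrite (divn_eq a l) (divn_eq b l) e !mulrnDr opprD addrACA subrr addr0.
by case: aN => _; apply; exact: Nk.
Qed.

(** Running through the list of all elements, [N] is enlarged by each [c] unless that would capture
    [y]. For the resulting [M] every element is congruent to a unique multiple of [y] with
    coefficient in 'F_l, and the coefficient is the functional. *)
Lemma functional (N : set A) (y : A) : addg N -> (forall x, N (x *+ l)) -> ~ N y ->
  exists f : A -> 'F_l, [/\ forall x x', f (x + x') = f x + f x', forall x, N x -> f x = 0 & f y = 1].
Proof.
move=> aN Nl Ny.
have [M [aM NM My hM]] : exists M : set A, [/\ addg M, N `<=` M, ~ M y &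
    forall z, z \in s -> M z \/ exists i : nat, M (y - z *+ i)].
  elim: s => [|c t [M [aM NM My hM]]]; first by exists N; split.
  have [[i hi]|h] := pselect (exists i : nat, M (y - c *+ i)).
    exists M; split=> // z; rewrite inE => /orP[/eqP ->|/hM //]; by right; exists i.
  pose M' := [set x | exists i : nat, M (x - c *+ i)].
  have lM x : M (x *+ l) by exact: NM.
  have MM' : M `<=` M' by move=> x Mx; exists 0%N; rewrite mulr0n subr0.
  exists M'; split.
  - split; first by apply: MM'; case: aM.
    move=> x x' [i hi] [j hj]; exists (i + l.-1 * j)%N.
    have -> : x - x' - c *+ (i + l.-1 * j) = x - c *+ i - (x' - c *+ j) - c *+ j *+ l.
      rewrite mulrnDr -[in RHS](prednK (prime_gt0 lpr)) mulrS mulnC mulrnA.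
      by rewrite !opprD opprK !addrA addrK [x - _ - x']addrAC.
    by case: aM => _ h'; apply: (h') => //; apply: h'.
  - by move=> x /NM /MM'.
  - by move=> [i hi]; apply: h; exists i.
  - move=> z; rewrite inE => /orP[/eqP ->|/hM[/MM'|[i hi]]].
    + by left; exists 1%N; rewrite mulr1n subrr; case: aM.
    + by left.
    + by right; exists i; exact: MM'.
have lM x : M (x *+ l) by exact: NM.
have ex x : exists z : 'F_l, M (x - y *+ z).
  have [Mx|[i hi]] := hM x (cs x); first by exists 0; rewrite mulr0n subr0.
  have i0 : i%:R != 0 :> 'F_l.
    rewrite -[0]/(0%:R) Fp_natE; apply/eqP => i0; apply: My.
    have := mulrn_mod aM (lM x) i0; rewrite mulr0n subr0 => h.
    by rewrite -(subrK (x *+ i) y); exact: addgD.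
  pose j : nat := (i%:R^-1 : 'F_l); exists (i%:R^-1); rewrite -/j; have ij : (j * i = 1 %[mod l])%N.
    by apply/eqP; rewrite -Fp_natE natrM /j Fp_nat mulVf.
  have h1 : M (y *+ j - x *+ (i * j)).
    rewrite mulrnA -mulrnBl; elim: j {ij} => [|j IH]; first by rewrite mulr0n; case: aM.
    by rewrite mulrS; exact: addgD.
  rewrite mulnC in h1; have h2 := mulrn_mod aM (lM x) ij; rewrite mulr1n in h2.
  have h3 := addgD aM h1 h2; rewrite addrA subrK in h3.
  by have := addgN aM h3; rewrite opprB.
have uq (x : A) (z z' : 'F_l) : M (x - y *+ z) -> M (x - y *+ z') -> z = z'.
  move=> h1 h2; apply/eqP; apply: contraT => nz; case: My.
  have h3 : M (y *+ z - y *+ z').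
    have := (proj2 aM) _ _ h2 h1; by rewrite opprB addrC addrA subrK.
  have d0 : z - z' != 0 by rewrite subr_eq0.
  pose j : nat := (z - z')^-1.
  have h4 k : M (y *+ (z * k)%N - y *+ (z' * k)%N).
    elim: k => [|k IH]; first by rewrite !muln0 subrr; case: aM.
    by rewrite !mulnS !mulrnDr opprD addrACA; exact: addgD.
  have e : (z * j = z' * j + 1 %[mod l])%N.
    apply/eqP; rewrite -Fp_natE natrD !natrM !Fp_nat -subr_eq0 -[1%:R]/1 opprD addrA -mulrBl /j.
    by rewrite mulfV // subrr.
  have h5 := mulrn_mod aM (lM y) e; rewrite mulrnDr mulr1n in h5.
  have h6 := (proj2 aM) _ _ (h4 j) h5.
  by rewrite opprB addrC addrA subrK addrAC subrr add0r in h6.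
have /choice[f hf] := ex.
exists f; split.
- move=> x x'; apply: uq (hf _) _; have h := addgD aM (hf x) (hf x').
  rewrite addrACA -opprD -mulrnDr in h.
  pose z : 'F_l := f x + f x'.
  have e : (f x + f x' = z %[mod l])%N by apply/eqP; rewrite -Fp_natE natrD !Fp_nat.
  have h' := addgD aM h (mulrn_mod aM (lM y) e).
  by rewrite addrA subrK in h'.
- by move=> x Nx; apply: uq (hf _) _; rewrite mulr0n subr0; exact: NM.
- apply: uq (hf _) _; pose z : 'F_l := 1.
  have e : (1 = z %[mod l])%N by apply/eqP; rewrite -Fp_natE Fp_nat.
  by have := mulrn_mod aM (lM y) e; rewrite mulr1n.
Qed.

End Functional.

Section Characters.
Variables (R : realType) (l : nat) (lpr : prime l).
Local Notation C := R[i].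
Local Notation "x %:C" := (real_complex R x) : ring_scope.

Lemma ex_root_unity : exists w : C, l.-primitive_root w.
Proof.
have l1 := prime_gt1 lpr.
have sz : size (\sum_(i < l) 'X^i : {poly C}) = l.
  have -> : \sum_(i < l) 'X^i = \poly_(i < l) (1 : C).
    by rewrite poly_def; apply: eq_bigr => i _; rewrite scale1r.
  rewrite size_poly_eq ?oner_neq0 //.
have [|w /rootP] := closed_rootP (\sum_(i < l) 'X^i : {poly C}) _.
  by rewrite sz; case: (l) l1 => [|[]].
rewrite horner_sum; under eq_bigr do rewrite hornerXn.
move=> h; have wl : w ^+ l = 1.
  by apply/eqP; rewrite -subr_eq0 subrX1 h mulr0.
have [m mP ml] := prim_order_exists (prime_gt0 lpr) wl.
have [m1|m1] := eqVneq m 1%N; last first.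
  by exists w; case/primeP: lpr => _ /(_ m ml); rewrite (negPf m1) /= => /eqP <-.
move: h; have -> : w = 1 by have := prim_expr_order mP; rewrite m1 expr1.
rewrite (eq_bigr (fun=> 1)) => [|i _]; last by rewrite expr1n.
rewrite sumr_const card_ord => /eqP; rewrite pnatr_eq0 => /eqP l0.
by move: l1; rewrite l0.
Qed.

Lemma norm_real (y : R) : 0 <= y -> `|y%:C| = y%:C.
Proof. by move=> y0; rewrite ger0_norm // -(rmorph0 (real_complex R)) lecR. Qed.

Lemma norm_real_le (y c : R) : - c <= y <= c -> `|y%:C| <= c%:C.
Proof.
case/andP=> h1 h2; have [y0|y0] := leP 0 y; first by rewrite norm_real // lecR.
by rewrite -normrN -rmorphN norm_real ?lecR; lra.
Qed.

Lemma sub1_gt0 (x : R) : x <= 1 / 2 -> 0 < 1 - x. Proof. lra. Qed.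

Lemma sub1_le1 (x : R) : 0 < x -> 1 - x <= 1. Proof. lra. Qed.

Lemma le_half_1 (x : R) : x <= 1 / 2 -> x <= 1. Proof. lra. Qed.

Lemma ler_addgt1 (x : R) : 0 < x -> 1 <= 1 + x. Proof. lra. Qed.

Lemma half_sub (a b : R) : b * 2 <= a -> a / 2 <= a - b. Proof. lra. Qed.

Lemma lt_half_absurd (a : R) : 0 < a -> a <= a * (1 / 2) -> False. Proof. lra. Qed.

Lemma ler_dist_interval (S c x : R) : S - c <= x <= S + c -> - c <= x - S <= c.
Proof. by case/andP=> h1 h2; apply/andP; split; lra. Qed.

(** The character is a -> w^a for a primitive root of unity. In the last clause the product is 1 -
    x^l, by the factorisation of X^l - 1. *)
Lemma ex_ee : exists ee : 'F_l -> C, [/\ ee 0 = 1, forall a b, ee (a + b) = ee a * ee b,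
  forall a, a != 0 -> ee a != 1, forall a, `|ee a| = 1 & forall x : R, 0 < x <= 1 -> `|\prod_a (1 - ee a * x%:C)| <= 1].
Proof.
have [w wP] := ex_root_unity; have l1 := prime_gt1 lpr.
have wl := prim_expr_order wP.
pose ee (a : 'F_l) := w ^+ a.
have nw : `|w| = 1.
  apply/eqP; rewrite -(@pexpr_eq1 _ _ l) ?normr_ge0 ?prime_gt0 //.
  by rewrite -normrX wl normr1.
exists ee; split.
- by rewrite /ee expr0.
- move=> a b; rewrite /ee -exprD; apply/eqP; rewrite (eq_prim_root_expr wP).
  by rewrite -(Fp_natE lpr) natrD !Fp_nat.
- move=> a a0; have -> : (ee a == 1) = (ee a == w ^+ 0) by rewrite expr0.
  by rewrite /ee (eq_prim_root_expr wP) -(Fp_natE lpr) Fp_nat.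
- by move=> a; rewrite /ee normrX nw expr1n.
- move=> x /andP[x0 x1]; have xC : x%:C != 0 by rewrite fmorph_eq0 gt_eqF.
  pose q := (Zp_trunc (pdiv l)).+2.
  suff -> : \prod_a (1 - ee a * x%:C) = (1 - x ^+ q)%:C.
    have h : 0 <= 1 - x ^+ q <= 1.
      by rewrite subr_ge0 exprn_ile1 ?(ltW x0) //= gerBl exprn_ge0 // ltW.
    case/andP: h => h0 h1; rewrite norm_real //.
    by rewrite -(rmorph1 (real_complex R)) lecR.
  have wq : q.-primitive_root w by rewrite /q Fp_cast.
  have h : \prod_(i < q) ((x%:C)^-1 - w ^+ i) = (x%:C)^-1 ^+ q - 1.
    have -> : (x%:C)^-1 ^+ q - 1 = ('X^q - 1 : {poly C}).[(x%:C)^-1] by rewrite hornerD hornerN hornerXn hornerC.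
    rewrite -(factor_Xn_sub_1 wq) big_mkord [RHS]horner_prod; apply: eq_bigr => i _.
    by rewrite hornerD hornerN hornerX hornerC.
  transitivity (\prod_(a : 'F_l) (x%:C * ((x%:C)^-1 - ee a))).
    by apply: eq_bigr => a _; rewrite mulrBr divff // mulrC.
  rewrite big_split /= prodr_const card_ord -/q.
  have -> : \prod_(a : 'F_l) ((x%:C)^-1 - ee a) = (x%:C)^-1 ^+ q - 1.
    exact: h.
  by rewrite mulrBr mulr1 -exprMn divff // expr1n rmorphB rmorph1 rmorphXn.
Qed.

End Characters.

(** * The analytic bound *)

Section NormIndex.
Local Open Scope classical_set_scope.
Variables (R : realType) (K L : fieldType) (OK : set K) (OL : set L).
Variables (dK : dedekind OK) (dL : dedekind OL).
Variables (JK JL : finType) (nrmK : JK -> K -> R) (nrmL : JL -> L -> R).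
Variables (gdK : global_data OK nrmK) (gdL : global_data OL nrmL).
Variables (l : nat) (lpr : prime l) (N : set (Clf OK)) (res : place L -> place K).
Hypotheses (addN : addg N) (Nl : forall c, N (c *+ l)).
Hypotheses (fin_res : forall w, fin OL w -> fin OK (res w)).
Hypotheses (res_fiber : forall (t : seq (place L)) v, uniq t ->
  (forall w, w \in t -> fin OL w /\ res w = v) -> (size t <= l)%N).
Hypotheses (res_split : forall w, fin OL w -> (Nv OK (res w) <= Nv OL w)%N).
Hypotheses (res_inert : forall w, fin OL w -> ~ N (cls OK << res w >>) ->
  (Nv OK (res w) * Nv OK (res w) <= Nv OL w)%N).
Local Notation C := R[i].
Local Notation xK e v := (xw OK e v).
Local Notation xL e w := (xw OL e w).

(** The Euler factor at one place, over all l^2 characters. If the pair (i, j) is not zero, one of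
    the two products runs over all values of a single character and is at most 1; otherwise all
    factors are 1 - x. *)
Lemma char_product (ee : 'F_l -> C) (x : R) (i j : 'F_l) : ee 0 = 1 -> (forall a, `|ee a| = 1) ->
  `|\prod_a (1 - ee a * real_complex R x)| <= 1 -> 0 < x <= 1 ->
  \prod_a \prod_b `|1 - ee (a * i + b * j) * real_complex R x| <= 1.
Proof.
move=> ee0 ee1 h /andP[x0 x1]; rewrite normr_prod in h.
set G := fun c => `|1 - ee c * real_complex R x| in h *.
have G0 c : 0 <= G c by exact: normr_ge0.
have prodle1 (f : 'F_l -> C) : (forall a, 0 <= f a <= 1) -> \prod_a f a <= 1.
  move=> hf; rewrite -[leRHS](expr1n _ #|'F_l|) -prodr_const; apply: ler_prod => a _; exact: hf.
have shift c k : k != 0 -> \prod_a G (c + a * k) <= 1.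
  move=> k0; rewrite -(@reindex_inj _ _ _ _ (fun a => c + a * k) xpredT G) //.
  by move=> a b /addrI /(mulIf k0).
have [j0|j0] := eqVneq j 0; last first.
  by apply: (prodle1) => a; rewrite prodr_ge0 => [|b _]; [exact: shift|exact: G0].
rewrite exchange_big /=; apply: (prodle1) => b; rewrite prodr_ge0 => [|a _]; last exact: G0.
rewrite j0 mulr0 andTb; have [i0|i0] := eqVneq i 0; last first.
  by rewrite (eq_bigr (fun a => G (0 + a * i))) ?shift // => a _; rewrite add0r addr0.
apply: (prodle1) => a; rewrite G0 i0 mulr0 addr0 /G ee0 mul1r -(rmorph1 (real_complex R)) -rmorphB.
by rewrite norm_real ?lecR ?gerBl ?subr_ge0 // ltW.
Qed.

Lemma euler_trivial (K' : fieldType) (O : set K') (dO : dedekind O) (e B : R) (s : seq (Clf O))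
    (P : seq (place K')) : 0 <= e ->
  (forall (k : Clf O) t, uniq t -> (forall D, D \in t -> eff O D /\ cls O D = k) ->
     \sum_(D <- t) wt e (Nd O R D) <= B) -> uniq s -> (forall k, k \in s) -> uniq P ->
  (forall v, v \in P -> fin O v) ->
  \prod_(v <- P) (1 - xw O e v) * \sum_(k <- s) @esum R _ O e P k = 1.
Proof.
move=> e0 hB us cs uP fP.
have := @euler R K' O dO e B e0 hB s us cs R idfun (fun=> 1) erefl (fun _ _ => esym (mulr1 1)) P uP fP.
rewrite /Lam; under eq_bigr do rewrite mul1r.
by under [X in _ * X]eq_bigr do rewrite mul1r.
Qed.

Lemma norm_index (s : seq (Clf OK)) : uniq s ->
  (forall c d, c \in s -> d \in s -> N (c - d) -> c = d) -> (size s <= l)%N.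
Proof.
move=> us sN; rewrite leqNgt; apply/negP => big.
have l1 := prime_gt1 lpr; have l0 : (0 < l)%N := prime_gt0 lpr.
have [clK0 clKP0] := class_group_finite dK gdK.
pose clK := undup clK0; have uclK : uniq clK by exact: undup_uniq.
have clKP k : k \in clK by rewrite mem_undup.
have [clL0 clLP0] := class_group_finite dL gdL.
pose clL := undup clL0; have uclL : uniq clL by exact: undup_uniq.
have clLP k : k \in clL by rewrite mem_undup.
have noncong c d : c \in s -> d \in s -> c != d -> ~ N (c - d).
  by move=> cs ds cd /(sN c d cs ds) E; rewrite E eqxx in cd.
have pig (f : Clf OK -> 'F_l) : exists c d, [/\ c \in s, d \in s, c != d & f c = f d].
  apply: contrapT => h; move: big; apply/negP; rewrite -leqNgt.
  rewrite -(card_Fp lpr) -(size_map f) cardE; apply: uniq_leq_size => [|x _]; last exact: mem_enum.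
  rewrite map_inj_in_uniq // => c d cs ds E; apply/eqP/negP => /negP cd; apply: h.
  by exists c, d.
(* Two independent functionals vanishing on [N]: with more than [l] inequivalent classes, [f1]
   agrees on two of them, and [f2] is taken to be 1 on their difference [y2]. *)
have [f1 [y1 [f1D f1N f1y]]] : exists (f : Clf OK -> 'F_l) y1, [/\ forall x x', f (x + x') = f x + f x', forall x, N x -> f x = 0 & f y1 = 1].
  have [c [d [cs ds cd _]]] := pig (fun=> 0).
  have [f hf] := functional clKP lpr addN Nl (noncong c d cs ds cd).
  by exists f, (c - d).
have [y2 y2N f1y2] : exists2 y2, ~ N y2 & f1 y2 = 0.
  have [c [d [cs ds cd E]]] := pig f1; exists (c - d); first exact: noncong.
  by apply: (addIr (f1 d)); rewrite -f1D subrK E add0r.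
have [f2 [f2D f2N f2y]] := functional clKP lpr addN Nl y2N.
have [ee [ee0 eeD eeN1 ee1 eeP]] := ex_ee R lpr.
pose chi (p : 'F_l * 'F_l) k := ee (p.1 * f1 k + p.2 * f2 k).
have f10 : f1 0 = 0 by apply: (addrI (f1 0)); rewrite -f1D !addr0.
have f20 : f2 0 = 0 by apply: (addrI (f2 0)); rewrite -f2D !addr0.
have chi0 p : chi p 0 = 1 by rewrite /chi f10 f20 !mulr0 addr0.
have chiD p k k' : chi p (k + k') = chi p k * chi p k'.
  by rewrite /chi f1D f2D !mulrDr addrACA eeD.
have chi1 p k : `|chi p k| = 1 by exact: ee1.
have chi_sum p : p != (0, 0) -> \sum_(k <- clK) chi p k = 0.
  move=> p0; have [y hy] : exists y, chi p y != 1.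
    have [p2|p2] := eqVneq p.2 0; last by exists y2; rewrite /chi f1y2 f2y mulr0 add0r mulr1 eeN1.
    exists y1; rewrite /chi f1y p2 mul0r addr0 mulr1 eeN1 //.
    by apply: contra p0 => /eqP p1; rewrite [p]surjective_pairing p1 p2.
  have := sum_shift uclK clKP (chi p) y; under eq_bigr do rewrite chiD.
  rewrite -mulr_suml => E; apply/eqP.
  have : (\sum_(k <- clK) chi p k) * (chi p y - 1) = 0 by rewrite mulrBr mulr1 E subrr.
  by move/eqP; rewrite mulf_eq0 subr_eq0 (negPf hy) orbF.
have [CK [cK [cK0 CK0 hK]]] := class_sums dK gdK.
have [CL [cL [cL0 CL0 hL]]] := class_sums dL gdL.
pose h : R := (size clK)%:R.
have h1 : 1 <= h.
  by rewrite ler1n; have := clKP 0; case: (clK).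
pose M := (2 * h * CK) * (1 + h * CK) ^+ (l * l).
have hCK : 0 < h * CK by rewrite mulr_gt0 //; lra.
have M0 : 0 < M by rewrite mulr_gt0 ?exprn_gt0 //; lra.
pose k0 := (h * (CK + CK))^-1.
have k00 : 0 < k0 by rewrite invr_gt0 mulr_gt0 //; lra.
pose G := 2 / (cL * k0 ^+ l).
have G0 : 0 < G by rewrite divr_gt0 // mulr_gt0 // exprn_gt0.
pose MG := M * G ^+ l; have MG0 : 0 < MG by rewrite mulr_gt0 // exprn_gt0.
(* Small enough for two purposes: the pole term cL / e is at least twice the error [CL], and e * MG
   <= 1/2, which contradicts [key6]. *)
pose e := (1 + 2 * CL / cL + 2 * MG)^-1.
have A0 : 0 < 2 * CL / cL by rewrite divr_gt0 // mulr_gt0.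
have e0 : 0 < e by rewrite invr_gt0; lra.
have eV : e * (1 + 2 * CL / cL + 2 * MG) = 1 by rewrite mulVf // gt_eqF //; lra.
have eV' : e + e * (2 * CL / cL) + 2 * (e * MG) = 1 by rewrite -[RHS]eV; ring.
clearbody e; have eA0 : 0 < e * (2 * CL / cL) by exact: mulr_gt0.
have eM0 : 0 < e * MG by exact: mulr_gt0.
have e1 : e <= 1 by lra.
have eA : e * (2 * CL / cL) <= 1 by lra.
have eMG : e * MG <= 1 / 2 by lra.
have CLe : CL * 2 <= cL / e.
  rewrite ler_pdivlMr // -[leRHS]mul1r -ler_pdivrMr //.
  by have -> : CL * 2 * e / cL = e * (2 * CL / cL) by ring.
have he : 0 < e <= 1 by rewrite e0.
have [SK [SK1 SK2 SKP]] := hK e he.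
have [SL [SL1 SL2 SLP]] := hL e he.
have bK (k : Clf OK) t : uniq t -> (forall D, D \in t -> eff OK D /\ cls OK D = k) ->
  \sum_(D <- t) wt e (Nd OK R D) <= SK + CK by have [h' _] := SKP k; exact: h'.
have bL (k : Clf OL) t : uniq t -> (forall D, D \in t -> eff OL D /\ cls OL D = k) ->
  \sum_(D <- t) wt e (Nd OL R D) <= SL + CL by have [h' _] := SLP k; exact: h'.
have [tL [utL tLP tLS]] := proj2 (SLP 0).
have /choice[tK tKP] := fun k => proj2 (SKP k).
pose Q := undup (flatten [seq dom D | D <- tL]).
(* [P] contains the places below [Q] and, for every class, the support of a finite sum within [CK]
   of the main term [SK]. *)
pose P := undup ([seq res w | w <- Q] ++ flatten [seq flatten [seq dom D | D <- tK k] | k <- clK]).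
have domE (K' : fieldType) (D : divisor K') v : coeff v D != 0 -> v \in dom D.
  by rewrite mem_dom.
have fQ w : w \in Q -> fin OL w.
  rewrite mem_undup => /flatten_mapP[D /tLP[eD _]]; rewrite mem_dom => hw.
  by have [_] := eD w; apply.
have QP w : w \in Q -> res w \in P.
  by move=> wQ; rewrite mem_undup mem_cat map_f.
have fP v : v \in P -> fin OK v.
  rewrite mem_undup mem_cat => /orP[/mapP[w /fQ fw ->]|/flatten_mapP[k _ /flatten_mapP[D Dt]]].
    exact: fin_res.
  have [_ tP _] := tKP k; have [eD _] := tP D Dt.
  by rewrite mem_dom => hv; have [_] := eD v; apply.
have uP : uniq P by exact: undup_uniq.
have uQ : uniq Q by exact: undup_uniq.
have e0' := ltW e0.
have xK0 v : 0 < xK e v by exact: xw_gt0.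
have xK1 v : v \in P -> xK e v <= 1 / 2 by move/fP; exact: xw_le.
have esK k : SK - CK <= @esum R _ OK e P k <= SK + CK.
  have [utk tP tS] := tKP k; apply/andP; split; last exact: (esum_le bK).
  apply: le_trans tS _; apply: (esum_ge bK) => // D Dt; have [eD kD] := tP D Dt; split=> // v hv.
  rewrite mem_undup mem_cat; apply/orP; right; apply/flatten_mapP; exists k; first exact: clKP.
  by apply/flatten_mapP; exists D => //; exact: domE.
pose inN v := `[< N (cls OK << v >>) >].
pose pi := \prod_(v <- P) (if inN v then 1 - xK e v else 1).
have pi0 : 0 < pi.
  by rewrite /pi big_seq; apply: prodr_gt0 => v vP; case: ifP => // _; exact: sub1_gt0 (xK1 v vP).
(* The main term [SK] is the same for all classes, so a nontrivial character annihilates it and only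
   the bounded errors remain. *)
have Lb p : p != (0, 0) -> `|@Lam R _ OK e clK C (real_complex R) (chi p) P| <= real_complex R (1 + h * CK).
  move=> p0; have -> : @Lam R _ OK e clK C (real_complex R) (chi p) P =
      \sum_(k <- clK) chi p k * real_complex R (@esum R _ OK e P k - SK).
    under [RHS]eq_bigr do rewrite rmorphB mulrBr.
    by rewrite sumrB -mulr_suml chi_sum // mul0r subr0.
  apply: le_trans (ler_norm_sum _ _ _) _.
  apply: le_trans (_ : \sum_(k <- clK) real_complex R CK <= _).
    apply: ler_sum => k _; rewrite normrM chi1 mul1r.
    exact/norm_real_le/ler_dist_interval.
  by rewrite -rmorph_sum lecR big_const_seq count_predT iter_addr_0 -[leLHS]mulr_natl -/h lerDr.
have L0 : `|@Lam R _ OK e clK C (real_complex R) (chi (0, 0)) P| <= real_complex R (2 * h * CK / e).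
  apply: le_trans (ler_norm_sum _ _ _) _.
  apply: le_trans (_ : \sum_(k <- clK) real_complex R (2 * CK / e) <= _).
    apply: ler_sum => k _; rewrite normrM chi1 mul1r norm_real ?(esum_ge0 bK) // lecR.
    have /andP[_ a2] := esK k; apply: le_trans a2 _.
    have : CK * 1 <= CK * e^-1 by rewrite ler_wpM2l ?(ltW CK0) // invf_ge1.
    rewrite mulr1 => hCe; have -> : 2 * CK / e = CK / e + CK / e by ring.
    exact: lerD.
  rewrite -rmorph_sum lecR big_const_seq count_predT iter_addr_0 -[leLHS]mulr_natl -/h.
  by have -> : h * (2 * CK / e) = 2 * h * CK / e by ring.
(* The Euler identities of all l^2 characters are multiplied. At a place with class outside [N] the
   factors multiply to at most 1; at the others every character is trivial. *)
have key1 : e <= M * pi ^+ (l * l).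
  have E1 : \prod_p `|\prod_(v <- P) (1 - chi p (cls OK << v >>) * real_complex R (xK e v)) *
       @Lam R _ OK e clK C (real_complex R) (chi p) P| = 1.
    by apply: big1 => p _; rewrite (euler dK (ltW e0) bK uclK clKP) ?normr1.
  have E2 : \prod_p `|\prod_(v <- P) (1 - chi p (cls OK << v >>) * real_complex R (xK e v))| <=
      real_complex R (pi ^+ (l * l)).
    under eq_bigr do rewrite normr_prod; rewrite exchange_big /=.
    rewrite -prodrXl rmorph_prod /= big_seq [leRHS]big_seq; apply: ler_prod => v vP.
    rewrite prodr_ge0 //=; case: ifP => [/asboolP Nv|_].
      rewrite (eq_bigr (fun=> real_complex R (1 - xK e v))) => [|p _].
        by rewrite prodr_const card_prod !card_Fp // rmorphXn.
      rewrite /chi (f1N _ Nv) (f2N _ Nv) !mulr0 addr0 ee0 mul1r -(rmorph1 (real_complex R)) -rmorphB.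
      by rewrite norm_real //; exact: ltW (sub1_gt0 (xK1 v vP)).
    rewrite expr1n rmorph1 -(pair_bigA _ (fun a b => `|1 - ee (a * f1 (cls OK << v >>) + b * f2 (cls OK << v >>)) * real_complex R (xK e v)|)) /=.
    have x01 : 0 < xK e v <= 1 by rewrite xK0 /=; exact: le_half_1 (xK1 v vP).
    by apply: char_product => //; exact: eeP.
  have E3 : \prod_p `|@Lam R _ OK e clK C (real_complex R) (chi p) P| <= real_complex R (M / e).
    rewrite (bigD1 (0, 0)) //= /M.
    have -> : 2 * h * CK * (1 + h * CK) ^+ (l * l) / e = (2 * h * CK / e) * (1 + h * CK) ^+ (l * l) by ring.
    rewrite rmorphM; apply: ler_pM => //; first by apply: prodr_ge0.
    apply: le_trans (_ : real_complex R ((1 + h * CK) ^+ #|[pred p : 'F_l * 'F_l | p != (0, 0)]|) <= _).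
      by rewrite rmorphXn -prodr_const; apply: ler_prod => p p0; rewrite normr_ge0 Lb.
    rewrite lecR ler_weXn2l //; first exact: ler_addgt1.
    by apply: leq_trans (max_card _) _; rewrite card_prod !card_Fp.
  have : 1 <= real_complex R (pi ^+ (l * l) * (M / e)).
    rewrite -[leLHS]E1; under eq_bigr do rewrite normrM; rewrite big_split rmorphM /=.
    by apply: ler_pM => //; apply: prodr_ge0.
  rewrite -(rmorph1 (real_complex R)) lecR mulrA ler_pdivlMr // mul1r => /le_trans; apply.
  by rewrite mulrC.
(* The weights N(v)^-2, whose Euler product is bounded. They dominate the weights of the places of L
   above a place with class outside [N], where N(w) >= N(v)^2. *)
pose y v : R := xw OK 1 v.
have y0 v : 0 < y v by exact: xw_gt0.
have yle v : v \in P -> y v <= 1 / 2 by move/fP => fv; exact: (xw_le dK ler01 fv).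
have key2 : k0 <= \prod_(v <- P) (1 - y v).
  have [|S1 [S11 S12 S1P]] := hK 1; first by rewrite ltr01 lexx.
  have b1 (k : Clf OK) t : uniq t -> (forall D, D \in t -> eff OK D /\ cls OK D = k) ->
    \sum_(D <- t) wt 1 (Nd OK R D) <= CK + CK.
    move=> ut tP; have [h' _] := S1P k; apply: le_trans (h' t ut tP) _; rewrite lerD2r.
    by move: S12; rewrite divr1.
  have E := euler_trivial dK ler01 b1 uclK clKP uP fP.
  have Sp : 0 < \sum_(k <- clK) @esum R _ OK 1 P k.
    have S0 : 0 <= \sum_(k <- clK) @esum R _ OK 1 P k by apply: sumr_ge0 => k _; exact: (esum_ge0 b1).
    rewrite lt_neqAle S0 andbT eq_sym; apply/eqP => z; move: E; rewrite z mulr0 => /eqP.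
    by rewrite eq_sym oner_eq0.
  have -> : \prod_(v <- P) (1 - y v) = (\sum_(k <- clK) @esum R _ OK 1 P k)^-1.
    by apply: (mulIf (lt0r_neq0 Sp)); rewrite mulVf ?gt_eqF.
  rewrite lef_pV2 ?posrE //; last by rewrite mulr_gt0 ?addr_gt0 // (lt_le_trans ltr01 h1).
  apply: le_trans (_ : \sum_(k <- clK) (CK + CK) <= _); first by apply: ler_sum => k _; exact: (esum_le b1).
  by rewrite big_const_seq count_predT iter_addr_0 -[leLHS]mulr_natl.
pose g v := if inN v then 1 - xK e v else 1 - y v.
have g01 v : v \in P -> 0 < g v <= 1.
  move=> vP; rewrite /g; case: ifP => _.
    by rewrite (sub1_gt0 (xK1 v vP)) (sub1_le1 (xK0 v)).
  by rewrite (sub1_gt0 (yle v vP)) (sub1_le1 (y0 v)).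
have gw w : w \in Q -> g (res w) <= 1 - xL e w.
  move=> wQ; have fw := fQ w wQ; have fr := fin_res fw.
  have n0 : 0 < (Nv OK (res w))%:R :> R by rewrite ltr0n Nv_gt0.
  rewrite /g; case: ifP => [_|/negbT/asboolP nN]; rewrite lerD2l lerN2.
    by apply: wt_le => //; rewrite ler_nat res_split.
  have n1 : 1 <= (Nv OK (res w))%:R :> R by rewrite ler1n Nv_gt0.
  apply: le_trans (_ : wt e ((Nv OK (res w))%:R * (Nv OK (res w))%:R) <= _).
    by apply: wt_le => //; rewrite ?mulr_gt0 // -natrM ler_nat; exact: res_inert.
  apply: le_trans (wt_le_inv e0' _) _; first by rewrite mulr_ege1.
  by rewrite /y /xw /wt powRr1 ?invfM // ltW.
have key3 : (k0 * pi) ^+ l <= \prod_(w <- Q) (1 - xL e w).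
  apply: le_trans (_ : \prod_(w <- Q) g (res w) <= _); last first.
    rewrite big_seq [leRHS]big_seq; apply: ler_prod => w wQ; rewrite gw // andbT.
    by have /andP[a _] := g01 _ (QP w wQ); exact: ltW.
  have -> : \prod_(w <- Q) g (res w) = \prod_(v <- P) \prod_(w <- Q | res w == v) g (res w).
    rewrite (exchange_big_dep xpredT) //= big_seq [RHS]big_seq; apply: eq_bigr => w wQ.
    rewrite -big_filter (eq_filter (a2 := pred1 (res w))) => [|a]; last by rewrite /= eq_sym.
    by rewrite filter_pred1_uniq ?QP // big_seq1.
  apply: le_trans (_ : \prod_(v <- P) g v ^+ l <= _).
    rewrite prodrXl; apply: lerXn2r; rewrite ?nnegrE ?mulr_ge0 ?(ltW k00) ?(ltW pi0) //.
      by rewrite big_seq; apply: prodr_ge0 => v /g01/andP[a _]; exact: ltW.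
    apply: le_trans (_ : (\prod_(v <- P) (1 - y v)) * pi <= _); first by rewrite ler_wpM2r // ltW.
    rewrite /pi -big_split big_seq [leRHS]big_seq; apply: ler_prod => v vP /=.
    have a1 := ltW (sub1_gt0 (xK1 v vP)); have a2 := ltW (sub1_gt0 (yle v vP)).
    rewrite /g; case: ifP => _; last by rewrite mulr1 lexx andbT.
    by rewrite mulr_ge0 //= ler_piMl // sub1_le1.
  rewrite big_seq [leRHS]big_seq; apply: ler_prod => v vP; have /andP[a1 a2] := g01 v vP.
  rewrite exprn_ge0 ?(ltW a1) //=.
  rewrite (eq_bigr (fun=> g v)) => [|w /eqP -> //]; rewrite -big_filter big_const_seq count_predT iter_mulr_1.
  apply: ler_wiXn2l; rewrite ?(ltW a1) //; apply: (res_fiber (v := v)); first exact: filter_uniq.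
  by move=> w; rewrite mem_filter => /andP[/eqP -> /fQ].
have key4 : (cL / e - CL) * (k0 * pi) ^+ l <= 1.
  have E := euler_trivial dL (ltW e0) bL uclL clLP uQ fQ.
  rewrite -[leRHS]E [leRHS]mulrC; apply: ler_pM => //.
  - by rewrite subr_ge0; apply: le_trans CLe; rewrite ler_peMr ?(ltW CL0) // ler1n.
  - by rewrite exprn_ge0 // mulr_ge0 // ltW.
  - apply: le_trans (_ : @esum R _ OL e Q 0 <= _).
      apply: le_trans (_ : SL - CL <= _); first by rewrite lerD2r.
      apply: le_trans tLS _; apply: (esum_ge bL) => // D Dt; have [eD kD] := tLP D Dt; split=> // v hv.
      by rewrite mem_undup; apply/flatten_mapP; exists D => //; exact: domE.
    rewrite (bigD1_seq 0) //= lerDl; apply: sumr_ge0 => k _; exact: (esum_ge0 bL).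
have key5 : pi ^+ l <= G * e.
  have a1 : cL / (2 * e) <= cL / e - CL.
    have -> : cL / (2 * e) = cL / e / 2 by field; rewrite gt_eqF.
    exact: half_sub.
  have a3 : cL / (2 * e) * (k0 * pi) ^+ l <= 1.
    by apply: le_trans key4; rewrite ler_wpM2r // exprn_ge0 // mulr_ge0 // ltW.
  have -> : pi ^+ l = G * e * (cL / (2 * e) * (k0 * pi) ^+ l).
    by rewrite exprMn /G; field; rewrite !gt_eqF ?exprn_gt0.
  by rewrite -[leRHS]mulr1 ler_wpM2l // mulr_ge0 // ltW.
have key6 : e <= MG * (e * e).
  apply: le_trans key1 _; rewrite exprM /MG -mulrA ler_wpM2l ?(ltW M0) //.
  apply: le_trans (_ : (G * e) ^+ l <= _).
    by apply: lerXn2r; rewrite ?nnegrE //; [exact: exprn_ge0 (ltW pi0)|exact: mulr_ge0 (ltW G0) e0'].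
  rewrite exprMn ler_wpM2l ?exprn_ge0 ?(ltW G0) // -expr2.
  exact: ler_wiXn2l.
have : e * (e * MG) <= e * (1 / 2) by rewrite ler_wpM2l.
have -> : e * (e * MG) = MG * (e * e) by ring.
move=> /(le_trans key6); exact: lt_half_absurd.
Qed.

End NormIndex.

(** * Modules over the metacyclic group *)

Section FiniteSubgroups.
Variable A : finZmodType.
Implicit Types (X Y Z W : {set A}) (f : A -> A).

Definition sg X := 0 \in X /\ forall x y, x \in X -> y \in X -> x - y \in X.

Lemma sgN X x : sg X -> x \in X -> - x \in X.
Proof. by move=> [X0 XB] Xx; rewrite -sub0r; exact: XB. Qed.

Lemma sgD X x y : sg X -> x \in X -> y \in X -> x + y \in X.
Proof. by move=> sX Xx Xy; rewrite -[y]opprK; case: (sX) => _; apply => //; exact: sgN. Qed.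

Lemma sgMn X x k : sg X -> x \in X -> x *+ k \in X.
Proof.
by move=> sX Xx; elim: k => [|k IH]; rewrite ?mulr0n ?mulrS; [case: sX|exact: sgD].
Qed.

Lemma sgI X Y : sg X -> sg Y -> sg (X :&: Y).
Proof.
move=> [X0 XB] [Y0 YB]; split; first by rewrite inE X0.
by move=> x y; rewrite !inE => /andP[Xx Yx] /andP[Xy Yy]; rewrite XB // YB.
Qed.

Lemma sg_card_gt0 X : sg X -> (0 < #|X|)%N.
Proof. by case=> X0 _; apply/card_gt0P; exists 0. Qed.

Lemma transversal_ex X Y : sg X -> sg Y -> exists T : {set A}, [/\ T \subset X,
  forall x y, x \in T -> y \in T -> x - y \in Y -> x = y &
  forall x, x \in X -> exists2 t, t \in T & x - t \in Y].
Proof.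
move=> sX sY; pose rp x := odflt x [pick y in X | x - y \in Y].
have rpP x : x \in X -> rp x \in X /\ x - rp x \in Y.
  move=> Xx; rewrite /rp; case: pickP => [y /andP[]//|/(_ x)].
  by rewrite Xx subrr; case: (sY) => ->.
have rpE x y : x \in X -> y \in X -> x - y \in Y -> rp x = rp y.
  move=> Xx Xy xy; rewrite /rp.
  have -> : [pick z in X | x - z \in Y] = [pick z in X | y - z \in Y].
    apply: eq_pick => z /=; congr (_ && _); apply/idP/idP => h.
      by have := sgD sY (sgN sY xy) h; rewrite opprB addrA subrK.
    by have := sgD sY xy h; rewrite addrA subrK.
  case: pickP => // /(_ y); rewrite Xy subrr; by case: (sY) => ->.
exists [set x in X | rp x == x]; split.
- by apply/fintype.subsetP => x; rewrite inE => /andP[].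
- move=> x y; rewrite !inE => /andP[Xx /eqP ex] /andP[Xy /eqP ey] h.
  by rewrite -ex -ey; exact: rpE.
- move=> x Xx; have [Xr xr] := rpP x Xx; exists (rp x) => //; rewrite inE Xr /=; apply/eqP.
  apply: rpE => //; by have := sgN sY xr; rewrite opprB.
Qed.

(** Y modulo its intersection with W embeds in Z / W. *)
Lemma card_cap (c : nat) Y Z W : sg Y -> sg Z -> sg W -> Y \subset Z -> W \subset Z ->
  (#|Z| <= c * #|W|)%N -> (#|Y| <= c * #|Y :&: W|)%N.
Proof.
move=> sY sZ sW /fintype.subsetP YZ /fintype.subsetP WZ h.
have [T [/fintype.subsetP TY Tinj Tcov]] := transversal_ex sY sW.
have Tc : (#|T| <= c)%N.
  rewrite -(leq_pmul2r (sg_card_gt0 sW)); apply: leq_trans h; rewrite -cardsX.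
  pose g (p : A * A) := p.1 + p.2.
  have gi : {in finset.setX T W &, injective g}.
    move=> [t w] [t' w'] /setXP[/= Tt Ww] /setXP[/= Tt' Ww'] e; rewrite /g /= in e.
    have tt' : t = t'.
      apply: Tinj => //; have -> : t - t' = w' - w; last by case: sW => _; apply.
      by apply/eqP; rewrite subr_eq addrAC [w' + t']addrC -e addrK.
    by congr (_, _) => //; apply: (addrI t); rewrite e tt'.
  rewrite -(card_in_imset gi); apply: subset_leq_card; apply/fintype.subsetP => _ /imsetP[[t w] /setXP[/= Tt Ww] ->].
  by apply: sgD => //; [exact/YZ/TY|exact: WZ].
apply: leq_trans (_ : #|T| * #|Y :&: W| <= _)%N; last by rewrite leq_mul2r Tc orbT.
have cov : Y \subset [set p.1 + p.2 | p in finset.setX T (Y :&: W)].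
  apply/fintype.subsetP => y Yy; have [t Tt yt] := Tcov y Yy; apply/imsetP; exists (t, y - t); last by rewrite /= addrC subrK.
  by rewrite !inE Tt yt andbT; case: sY => _ -> //; exact: TY.
by rewrite -cardsX; apply: leq_trans (subset_leq_card cov) _; exact: leq_imset_card.
Qed.

Lemma card_transversal (c : nat) X Y : sg X -> sg Y ->
  (forall s : seq A, uniq s -> (forall x, x \in s -> x \in X) ->
    (forall x y, x \in s -> y \in s -> x - y \in Y -> x = y) -> (size s <= c)%N) ->
  (#|X| <= c * #|Y|)%N.
Proof.
move=> sX sY h; have [T [/fintype.subsetP TX Tinj Tcov]] := transversal_ex sX sY.
have Tc : (#|T| <= c)%N.
  rewrite cardE; apply: h; first exact: enum_uniq.
    by move=> x; rewrite mem_enum => /TX.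
  by move=> x y; rewrite !mem_enum; exact: Tinj.
apply: leq_trans (_ : #|T| * #|Y| <= _)%N; last by rewrite leq_mul2r Tc orbT.
rewrite -cardsX; apply: leq_trans (leq_imset_card (fun p : A * A => p.1 + p.2) _).
apply: subset_leq_card; apply/fintype.subsetP => x Xx; have [t Tt xt] := Tcov x Xx.
by apply/imsetP; exists (t, x - t); [rewrite !inE Tt|rewrite /= addrC subrK].
Qed.

End FiniteSubgroups.

Section AdditiveMaps.
Variables A B : finZmodType.
Implicit Types (X Y : {set A}).

Lemma sg_im X (f : {additive A -> B}) : sg X -> sg (f @: X).
Proof.
move=> [X0 XB]; split; first by rewrite -(raddf0 f); exact: imset_f.
by move=> _ _ /imsetP[x Xx ->] /imsetP[y Xy ->]; rewrite -raddfB imset_f // XB.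
Qed.

Lemma sg_pre X (Y : {set B}) (f : {additive A -> B}) : sg X -> sg Y -> sg [set x in X | f x \in Y].
Proof.
move=> [X0 XB] [Y0 YB]; split; first by rewrite inE X0 raddf0.
by move=> x y; rewrite !inE => /andP[Xx Yx] /andP[Xy Yy]; rewrite XB // raddfB YB.
Qed.

Lemma sg_ker X (f : {additive A -> B}) : sg X -> sg [set x in X | f x == 0].
Proof.
move=> [X0 XB]; split; first by rewrite inE X0 raddf0 eqxx.
move=> x y; rewrite !inE => /andP[Xx /eqP fx] /andP[Xy /eqP fy].
by rewrite XB // raddfB fx fy subrr eqxx.
Qed.

Lemma card_im X (f : {additive A -> B}) : sg X -> #|X| = (#|f @: X| * #|[set x in X | f x == 0%R]|)%N.
Proof.
move=> sX; rewrite -sum1_card (partition_big_imset f) /= -sum_nat_const; apply: eq_bigr => _ /imsetP[y Xy ->].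
rewrite sum1_card -[RHS](card_imset _ (addIr y)); apply: eq_card => x; rewrite unfold_in.
apply/andP/imsetP => [[Xx /eqP fx]|[z]].
  exists (x - y); rewrite ?subrK // inE raddfB fx subrr eqxx andbT.
  by case: sX => _; apply.
by rewrite inE => /andP[Xz /eqP fz] ->; rewrite sgD // raddfD fz add0r.
Qed.

Lemma card_im_le (c : nat) X Y (f : {additive A -> B}) : sg X -> sg Y -> Y \subset X ->
  (#|X| <= c * #|Y|)%N -> (#|f @: X| <= c * #|f @: Y|)%N.
Proof.
move=> sX sY /fintype.subsetP YX; rewrite (card_im f sX) (card_im f sY) => h.
have k0 := sg_card_gt0 (sg_ker f sX); rewrite -(leq_pmul2r k0); apply: leq_trans h _.
rewrite -mulnA leq_mul2l leq_mul2l; apply/orP; right; apply/orP; right; apply: subset_leq_card.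
by apply/fintype.subsetP => x; rewrite !inE => /andP[/YX -> ->].
Qed.

(** The quotient of [X] by the preimage of [W] embeds in Z / W. *)
Lemma card_pre (c : nat) X (Z W : {set B}) (f : {additive A -> B}) : sg X -> sg Z -> sg W ->
  f @: X \subset Z -> W \subset Z -> (#|Z| <= c * #|W|)%N ->
  (#|X| <= c * #|[set x in X | f x \in W]|)%N.
Proof.
move=> sX sZ sW fX WZ h; have := card_cap (sg_im f sX) sZ sW fX WZ h.
rewrite (card_im f sX) (card_im f (sg_pre f sX sW)).
have -> : f @: [set x in X | f x \in W] = f @: X :&: W.
  apply/setP => y; rewrite !inE; apply/imsetP/andP => [[x + ->]|[/imsetP[x Xx ->] Wf]].
    by rewrite inE => /andP[Xx Wf]; rewrite imset_f.
  by exists x => //; rewrite inE Xx.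
have -> : [set x in [set x in X | f x \in W] | f x == 0] = [set x in X | f x == 0].
  apply/setP => x; rewrite !inE -andbA; congr (_ && _); case: eqP => [->|]; rewrite ?andbF ?andbT //.
  by case: sW => ->.
by move=> h'; rewrite mulnA leq_mul2r h' orbT.
Qed.

End AdditiveMaps.

(** * Powers of tau - 1 and eigenspaces of sigma *)

Section ClassModule.
Variables (A : finZmodType) (sigma tau : {additive A -> A}).
Variables (l r z m q : nat).
Hypotheses (lpr : prime l) (r_gt0 : (0 < r)%N) (rl : (r < l)%N).
Hypotheses (tau_l : forall x, iter l tau x = x) (sigma_r : forall x, iter r sigma x = x).
Hypotheses (tau_sigma : forall x, tau (sigma x) = sigma (iter z tau x)).
Hypotheses (zr : (z ^ r = 1 %[mod l])%N) (zi : forall i, (0 < i < r)%N -> (z ^ i != 1 %[mod l])%N).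
Implicit Types (x y b : A) (i j k t : nat).

Definition D x := tau x - x.

Fact D_is_additive : zmod_morphism D.
Proof. by move=> x y; rewrite /D raddfB !opprB [y - x]addrC addrACA [- tau y + y]addrC. Qed.
HB.instance Definition _ := GRing.isZmodMorphism.Build A A D D_is_additive.

Lemma iter_additive (f : {additive A -> A}) k : zmod_morphism (iter k f).
Proof. by elim: k => [|k IH] x y //=; rewrite IH raddfB. Qed.
HB.instance Definition _ (f : {additive A -> A}) k :=
  GRing.isZmodMorphism.Build A A (iter k f) (iter_additive f k).

Lemma iter_comm (f g : A -> A) k x : (forall y, f (g y) = g (f y)) -> iter k f (g x) = g (iter k f x).
Proof. by move=> h; elim: k => //= k ->; rewrite h. Qed.

Lemma tau_D x : tau (D x) = D (tau x).
Proof. by rewrite /D raddfB. Qed.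

Lemma iter_tau k x : iter k tau x = \sum_(j < k.+1) iter j D x *+ 'C(k, j).
Proof.
elim: k => [|k IH]; first by rewrite big_ord_recr big_ord0 /= add0r.
have tauE y : tau y = y + D y by rewrite /D addrC subrK.
rewrite iterS IH tauE raddf_sum /= [X in X + _]big_ord_recl [X in _ + X]big_ord_recr /=.
rewrite !bin0 binn !mulr1n [RHS]big_ord_recl [X in _ = _ + X]big_ord_recr /= bin0 binn !mulr1n.
rewrite -addrA; congr (_ + _); rewrite addrA -big_split /=; congr (_ + _).
by apply: eq_bigr => i _; rewrite /bump /= add1n binS mulrnDr raddfMn.
Qed.

Lemma sum_iter_tau k x : \sum_(i < k) iter i tau x = \sum_(j < k) iter j D x *+ 'C(k, j.+1).
Proof.
elim: k => [|k IH]; first by rewrite !big_ord0.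
rewrite big_ord_recr IH iter_tau /= [in RHS]big_ord_recr /= binn.
rewrite [X in _ + X]big_ord_recr /= binn addrA -big_split /=; congr (_ + _).
by apply: eq_bigr => i _; rewrite binS mulrnDr.
Qed.

Lemma iterD_Mn j x k : iter j D x *+ k = iter j D (x *+ k).
Proof. by rewrite raddfMn. Qed.

(** Expanding (1 + D)^l = 1: the inner binomial coefficients are divisible by l and vanish on
    l-torsion. *)
Lemma D_l x : x *+ l = 0 -> iter l D x = 0.
Proof.
move: (iter_tau l x) lpr; rewrite tau_l; case: (l) => // l' tl pr lx; move: tl.
rewrite big_ord_recl big_ord_recr /= bin0 binn !mulr1n big1 ?add0r => [h|i _].
  by apply: (addrI x); rewrite addr0 -h.
rewrite /bump add1n; have /dvdnP[c ->] : (l'.+1 %| 'C(l'.+1, i.+1))%N.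
  by apply: prime_dvd_bin => //=; exact: ltn_ord.
by rewrite -[D _]/(iter (0 + i).+1 D x) mulnC mulrnA iterD_Mn lx raddf0 mul0rn.
Qed.

(** The norm is the sum of the binomials C(l, j + 1) times D^j. On l-torsion only D^(l-1) survives,
    and it vanishes because k < l. *)
Lemma N_l x k : (k < l)%N -> x *+ l = 0 -> iter k D x = 0 -> \sum_(i < l) iter i tau x = 0.
Proof.
move=> kl lx kx; rewrite sum_iter_tau big1 // => j _.
have [jk|jk] := leqP k j.
  by rewrite -(subnK jk) iterD kx raddf0 mul0rn.
have /dvdnP[c ->] : (l %| 'C(l, j.+1))%N by apply: prime_dvd_bin => //; apply: leq_trans kl.
by rewrite mulnC mulrnA iterD_Mn lx raddf0 mul0rn.
Qed.

Definition mulk k x := x *+ k.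

Fact mulk_additive k : zmod_morphism (mulk k).
Proof. by move=> x y; rewrite /mulk mulrnBl. Qed.
HB.instance Definition _ k := GRing.isZmodMorphism.Build A A (mulk k) (mulk_additive k).

Definition Dm j x := iter j tau x - x.

Lemma D_Dm j x : D (Dm j x) = Dm j (D x).
Proof.
rewrite /Dm raddfB; congr (_ - _); elim: j => //= j <-; by rewrite tau_D.
Qed.

Lemma Dm_fix j x : D (D x) = 0 -> Dm j x = D x *+ j.
Proof.
move=> h; have tD : tau (D x) = D x by apply/eqP; rewrite -subr_eq0; exact/eqP.
elim: j => [|j IH]; first by rewrite /Dm /= subrr mulr0n.
have -> : Dm j.+1 x = tau (Dm j x) + D x by rewrite /Dm /= raddfB /D addrA subrK.
by rewrite IH raddfMn tD mulrSr.
Qed.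

(** To leading order, tau^j - 1 is j (tau - 1). *)
Lemma Dm_iter j k x : iter k.+1 D x = 0 -> iter k (Dm j) x = iter k D x *+ (j ^ k)%N.
Proof.
elim: k x => [|k IH] x h; first by rewrite expn0 mulr1n.
rewrite iterSr IH.
  rewrite (iter_comm _ _ (D_Dm j)) Dm_fix; last by rewrite -!iterS.
  by rewrite -iterS -mulrnA expnS.
have h2 : D (iter k.+1 D x) = 0 by exact: h.
by rewrite (iter_comm _ _ (D_Dm j)) Dm_fix h2 ?mul0rn ?raddf0.
Qed.

Lemma D_sigma x : D (sigma x) = sigma (Dm z x).
Proof. by rewrite /D tau_sigma raddfB. Qed.

(** As (tau - 1) sigma = sigma (tau^z - 1), moving one D past sigma costs a factor z to leading
    order. This is the shift of eigenspaces. *)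
Lemma iterD_sigma k x : iter k.+1 D x = 0 ->
  iter k D (sigma x) = sigma (iter k D x) *+ (z ^ k)%N /\ iter k.+1 D (sigma x) = 0.
Proof.
have E j y : iter j D (sigma y) = sigma (iter j (Dm z) y).
  by elim: j y => //= j IH y; rewrite IH D_sigma.
move=> h; split; first by rewrite E Dm_iter // raddfMn.
by rewrite E Dm_iter ?h ?mul0rn ?raddf0 // iterS h raddf0.
Qed.

(* Unlike [z], this power has order [r] modulo [l ^ m.+1]. *)
Let Z := (z ^ (l ^ m))%N.

(** If c = 1 modulo l^(i+1), then c^l - 1 is c - 1 times a sum of l powers of c, which is divisible
    by l: each l-th power gains one factor. *)
Lemma expn_lift a i : (a = 1 %[mod l])%N -> (a ^ (l ^ i) = 1 %[mod l ^ i.+1])%N.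
Proof.
have l1 := prime_gt1 lpr; have l0 := prime_gt0 lpr.
have pos c k : (0 < k)%N -> (c = 1 %[mod l ^ k])%N -> (0 < c)%N.
  move=> k0; case: c => // /eqP; rewrite mod0n modn_small // -(exp1n k) ltn_exp2r //.
move=> h; elim: i => [|i IH]; first by rewrite expn0 !expn1.
rewrite expnSr expnM; set c := (a ^ _)%N in IH *; have c0 := pos c i.+1 isT IH.
have d1 : (l ^ i.+1 %| c.-1)%N by rewrite -subn1 -eqn_mod_dvd //; apply/eqP.
have d2 : (l %| \sum_(t < l) c ^ t)%N.
  have cl : (c = 1 %[mod l])%N.
    apply/eqP; rewrite eqn_mod_dvd // subn1; apply: dvdn_trans d1.
    by rewrite expnS dvdn_mulr.
  rewrite /dvdn -modn_summ (eq_bigr (fun=> (1 %% l)%N)) => [|t _]; last by rewrite -modnXm cl modnXm exp1n.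
  by rewrite modn_summ sum1_card card_ord modnn.
have cl0 : (1 <= c ^ l)%N by rewrite expn_gt0 c0.
apply/eqP; rewrite (eqn_mod_dvd _ cl0) subn1 predn_exp [(l ^ _)%N]expnSr.
exact: dvdn_mul.
Qed.

Lemma Z_modl : (Z = z %[mod l])%N.
Proof.
rewrite /Z; elim: m => [|i IH]; first by rewrite expn0 expn1.
by rewrite expnSr expnM fermat_little.
Qed.

Lemma Zr_mod j : (Z ^ (j * r) = 1 %[mod l ^ m.+1])%N.
Proof.
rewrite mulnC expnM -modnXm /Z -expnM mulnC expnM (expn_lift m zr) modnXm.
by rewrite exp1n.
Qed.

Let P := [set x : A | x *+ (l ^ m.+1) == 0].
Let Al := [set x : A | x *+ l == 0].

Lemma PP x : reflect (x *+ (l ^ m.+1) = 0) (x \in P).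
Proof. by rewrite inE; exact: eqP. Qed.

Lemma AlP x : reflect (x *+ l = 0) (x \in Al).
Proof. by rewrite inE; exact: eqP. Qed.

Lemma sgP : sg P.
Proof. by split=> [|x y]; rewrite !inE ?mul0rn // mulrnBl => /eqP -> /eqP ->; rewrite subrr. Qed.

Lemma sgAl : sg Al.
Proof. by split=> [|x y]; rewrite !inE ?mul0rn // mulrnBl => /eqP -> /eqP ->; rewrite subrr. Qed.

Lemma Al_P x : x \in Al -> x \in P.
Proof. by rewrite !inE expnS mulrnA => /eqP ->; rewrite mul0rn. Qed.

Lemma P_stable (f : {additive A -> A}) x : x \in P -> f x \in P.
Proof. by rewrite !inE => /eqP h; rewrite -raddfMn h raddf0. Qed.

Lemma mulrn_modn x n i j : x *+ n = 0 -> (i = j %[mod n])%N -> x *+ i = x *+ j.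
Proof.
move=> h e; rewrite (divn_eq i n) (divn_eq j n) e !mulrnDr; congr (_ + _).
by rewrite mulnC mulrnA h mul0rn mulnC mulrnA h mul0rn.
Qed.

(** r times the projector on the eigenspace of sigma for the eigenvalue Z^-j. The factor r is left
    in and inverted modulo l where necessary. *)
Definition Ej j x := \sum_(t < r) iter t sigma x *+ (Z ^ (j * t))%N.

Fact Ej_additive j : zmod_morphism (Ej j).
Proof.
move=> x y; rewrite /Ej -sumrB; apply: eq_bigr => t _.
by rewrite raddfB mulrnBl.
Qed.
HB.instance Definition _ j := GRing.isZmodMorphism.Build A A (Ej j) (Ej_additive j).

Lemma Ej_eig j x : x \in P -> sigma (Ej j x) *+ (Z ^ j)%N = Ej j x.
Proof.
move=> /PP Px; pose F t := iter t sigma x *+ (Z ^ (j * t))%N.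
have Fr : F r = F 0%N.
  rewrite /F sigma_r /= muln0 expn0; apply: mulrn_modn Px _; exact: Zr_mod.
have -> : sigma (Ej j x) *+ (Z ^ j)%N = \sum_(t < r) F t.+1.
  rewrite /Ej raddf_sum -sumrMnl; apply: eq_bigr => t _.
  by rewrite raddfMn -mulrnA /F -expnD mulnS addnC.
apply: (addrI (F 0%N)); rewrite -(big_ord_recl r (fun t : 'I_r.+1 => F t)) -{1}Fr.
by rewrite addrC -(big_ord_recr r (fun t : 'I_r.+1 => F t)).
Qed.

(* The kernel of [(tau - 1) ^ k] in the eigenspace of [sigma] for the eigenvalue [Z ^ (- i)];
   [tau - 1] maps the eigenspace of index [i] to that of index [i.+1] up to higher order. *)
Definition Xk k i := [set x in Al | (iter k D x == 0) && (sigma x *+ (Z ^ i)%N == x)].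

Lemma XkP k i x : reflect [/\ x *+ l = 0, iter k D x = 0 & sigma x *+ (Z ^ i)%N = x] (x \in Xk k i).
Proof.
rewrite !inE; apply: (iffP and3P) => [[/eqP h1 /eqP h2 /eqP h3]|[-> -> ->]]; split=> //; exact: eqxx.
Qed.

Lemma sg_Xk k i : sg (Xk k i).
Proof.
split; first by apply/XkP; split; rewrite ?raddf0 ?mul0rn.
move=> x y /XkP[h1 h2 h3] /XkP[h4 h5 h6]; apply/XkP; split.
- by rewrite mulrnBl h1 h4 subrr.
- by rewrite raddfB /= h2 h5 subrr.
- by rewrite raddfB mulrnBl h3 h6.
Qed.

(** The graded piece of level [k], carried by D^k into the kernel of D. By the shift it lies in the
    eigenspace of index [i], whatever [k] is; the subtraction is meant for k <= i. *)
Definition Sk k i := iter k D @: Xk k.+1 (i - k).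

Let N x := \sum_(t < l) iter t tau x.

Fact N_additive : zmod_morphism N.
Proof. by move=> x y; rewrite /N -sumrB; apply: eq_bigr => t _; rewrite raddfB. Qed.
HB.instance Definition _ := GRing.isZmodMorphism.Build A A N N_additive.

Hypothesis Hq : (#|[set x in P | tau x == x]| <= q * #|N @: P|)%N.

Lemma N_D x : N (D x) = 0.
Proof.
rewrite /N /D; have -> : \sum_(t < l) iter t tau (tau x - x) = \sum_(t < l) (iter t.+1 tau x - iter t tau x).
  by apply: eq_bigr => t _; rewrite raddfB /= -iterSr.
by rewrite -(big_mkord xpredT (fun t => iter t.+1 tau x - iter t tau x)) telescope_sumr // tau_l subrr.
Qed.

(** The order of [P] is computed through N and through D: for a finite module the kernel of one map
    modulo the image of the other has the same order both ways (trivial Herbrand quotient). *)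
Lemma kerN_card : (#|[set x in P | N x == 0%R]| <= q * #|D @: P|)%N.
Proof.
have e1 := card_im N sgP; have e2 := card_im D sgP.
have e3 : [set x in P | D x == 0%R] = [set x in P | tau x == x].
  by apply/setP => x; rewrite !inE subr_eq0.
have n0 : (0 < #|N @: P|)%N by apply: sg_card_gt0; exact: sg_im sgP.
rewrite -(leq_pmul2l n0) -e1 e2 e3; apply: leq_trans (leq_mul (leqnn _) Hq) _.
by rewrite mulnCA [leqRHS]mulnCA [(#|D @: P| * _)%N]mulnC.
Qed.

Lemma Xk_kerN k i : (k < l)%N -> Xk k i \subset [set x in P | N x == 0%R].
Proof.
move=> kl; apply/fintype.subsetP => x /XkP[lx kx _]; rewrite inE Al_P /=; last exact/AlP.
by rewrite /N (N_l kl).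
Qed.

Lemma iterD_iter_sigma k t x : iter k.+1 D x = 0 ->
  iter k D (iter t sigma x) = iter t sigma (iter k D x) *+ (z ^ (k * t))%N /\
  iter k.+1 D (iter t sigma x) = 0.
Proof.
move=> h; elim: t => [|t [IH1 IH2]]; first by rewrite muln0 expn0 mulr1n.
have [h1 h2] := iterD_sigma IH2; split; last exact: h2.
by rewrite iterS h1 IH1 raddfMn -mulrnA -expnD mulnS addnC.
Qed.

Lemma modZz i : (Z ^ i = z ^ i %[mod l])%N.
Proof. by rewrite -modnXm Z_modl modnXm. Qed.

Lemma eig_iter i t x : sigma x *+ (Z ^ i)%N = x -> iter t sigma x *+ (Z ^ (i * t))%N = x.
Proof.
move=> h; elim: t => [|t IH]; first by rewrite muln0 expn0 mulr1n.
by rewrite mulnS expnD mulnC mulrnA iterS -(raddfMn sigma) IH.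
Qed.

(* The key step: [Y] is the image of [D] up to index [q] because the norm kills it, and an [e]
   with [D e] in [Y] can be made [l]-torsion up to the index of [l B] in [B], [B] the eigenspace. *)
Lemma Sk_step k i : (k < i < r)%N -> (#|Sk k i| <= q * #|Xk 1 (i - k.+1)| * #|Sk k.+1 i|)%N.
Proof.
case/andP=> ki ir; pose j := (i - k.+1)%N; have jE : (i - k = j.+1)%N by rewrite /j; lia.
have kl : (k.+1 < l)%N by lia.
pose Y := Xk k.+1 (i - k); have sY : sg Y := sg_Xk _ _.
pose DP := D @: P; have sDP : sg DP := sg_im D sgP.
have sK := sg_ker N sgP.
have DPK : DP \subset [set x in P | N x == 0%R].
  by apply/fintype.subsetP => _ /imsetP[x Px ->]; rewrite inE N_D eqxx andbT P_stable.
have YK := Xk_kerN (i - k) kl; have c1 := card_cap sY sK sDP YK DPK kerN_card.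
have sYD := sgI sY sDP.
have c2 := card_im_le (iter k D) sY sYD (subsetIl _ _) c1.
pose Om := [set b in P | D b \in Y]; have sOm : sg Om := sg_pre D sgP sY.
have DOm : D @: Om = Y :&: DP.
  apply/setP => y; rewrite inE; apply/imsetP/andP => [[b + ->]|[Yy /imsetP[b Pb e]]].
    by rewrite inE => /andP[Pb Yb]; rewrite Yb; split=> //; apply/imsetP; exists b.
  by exists b => //; rewrite inE Pb -e.
pose B := [set x in P | (D x == 0) && (sigma x *+ (Z ^ j)%N == x)].
have BP x : reflect [/\ x \in P, D x = 0 & sigma x *+ (Z ^ j)%N = x] (x \in B).
  apply: (iffP idP) => [|[h1 h2 h3]]; last by rewrite inE h1 h2 h3 !eqxx.
  by rewrite inE => /and3P[h1 /eqP h2 /eqP h3].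
have sB : sg B.
  have [P0 PB] := sgP; split; first by apply/BP; split; rewrite ?raddf0 ?mul0rn.
  move=> x y /BP[h1 h2 h3] /BP[h4 h5 h6]; apply/BP; split; first exact: PB.
    by rewrite raddfB /= h2 h5 subrr.
  by rewrite raddfB mulrnBl h3 h6.
pose lB := (mulk l) @: B; have slB : sg lB := sg_im (mulk l) sB.
have lBB : lB \subset B.
  by apply/fintype.subsetP => _ /imsetP[x Bx ->]; rewrite /mulk; exact: sgMn.
have cB : (#|B| <= #|Xk 1 j| * #|lB|)%N.
  rewrite (card_im (mulk l) sB) mulnC leq_mul2r; apply/orP; right; apply: subset_leq_card.
  apply/fintype.subsetP => x; rewrite inE => /andP[/BP[h1 h2 h3] /eqP h4].
  by apply/XkP; split.
(* D b is l-torsion, so l b is fixed by tau and its projection lies in [B]. Whenever this projection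
   is l b0 with b0 in [B], the difference Ej j b - b0 is l-torsion and still has the same leading
   term. *)
pose thA : {additive A -> A} := Ej j \o mulk l.
have OmP b : b \in Om -> [/\ b \in P, D b *+ l = 0, iter k.+1 D (D b) = 0 & sigma (D b) *+ (Z ^ (i - k))%N = D b].
  by rewrite inE => /andP[Pb /XkP[h1 h2 h3]]; split.
have thB : thA @: Om \subset B.
  apply/fintype.subsetP => _ /imsetP[b /OmP[Pb h1 h2 h3] ->].
  have Pl : mulk l b \in P by rewrite /mulk; exact: sgMn sgP Pb.
  have Dl : D (mulk l b) = 0 by rewrite /mulk raddfMn.
  apply/BP; split; [exact: P_stable|rewrite /=|exact: Ej_eig].
  rewrite raddf_sum big1 // => t _; rewrite raddfMn.
  have [|_ e] := @iterD_iter_sigma 0 t (mulk l b); first exact: Dl.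
  by move: e; rewrite /= => ->; rewrite mul0rn.
have c3 := card_pre sOm sB slB thB lBB cB.
set Om0 := [set b in Om | thA b \in lB] in c3; have sOm0 : sg Om0 := sg_pre thA sOm slB.
have Om0s : Om0 \subset Om by apply/fintype.subsetP => b; rewrite inE => /andP[].
have c4 := card_im_le (iter k.+1 D) sOm sOm0 Om0s c3.
have im1 : iter k.+1 D @: Om = iter k D @: (Y :&: DP).
  by rewrite -DOm -imset_comp; apply: eq_imset => x /=; rewrite -iterSr.
have sub : iter k.+1 D @: Om0 \subset Sk k.+1 i.
  apply/fintype.subsetP => _ /imsetP[b + ->]; rewrite inE => /andP[/OmP[Pb h1 h2 h3] /imsetP[b0 /BP[Pb0 Db0 sb0] eb0]].
  have eb1 : Ej j b *+ l = b0 *+ l by move: eb0; rewrite /= /mulk raddfMn.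
  pose y := iter k.+1 D b.
  have ly : y *+ l = 0 by rewrite /y iterSr iterD_Mn h1 raddf0.
  have sy : sigma y *+ (Z ^ i)%N = y.
    have [e _] := @iterD_sigma k (D b) h2.
    have e2 : iter k D (sigma (D b) *+ (Z ^ (i - k))%N) = y by rewrite h3 /y iterSr.
    rewrite -{2}e2 -iterD_Mn e -mulrnA -iterSr -/y.
    have ly' : sigma y *+ l = 0 by rewrite -raddfMn ly raddf0.
    apply: mulrn_modn ly' _; transitivity ((Z ^ k * Z ^ (i - k)) %% l)%N.
      by rewrite -expnD subnKC ?(ltnW ki).
    by rewrite -modnMml modZz modnMml.
  have h2' : iter k.+2 D b = 0 by rewrite iterSr.
  have DE : iter k.+1 D (Ej j b) = y *+ r.
    rewrite /Ej raddf_sum (eq_bigr (fun=> y)) => [|t _]; first by rewrite sumr_const card_ord.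
    rewrite raddfMn /=; have [e _] := iterD_iter_sigma t h2'.
    rewrite -[D (iter k D _)]/(iter k.+1 D (iter t sigma b)) e -/y -mulrnA -[RHS](eig_iter t sy).
    have ly' : iter t sigma y *+ l = 0 by rewrite -raddfMn ly raddf0.
    apply: mulrn_modn ly' _; transitivity ((Z ^ (k.+1 * t) * Z ^ (j * t)) %% l)%N.
      by rewrite -modnMml -modZz modnMml.
    by rewrite -expnD -mulnDl /j subnKC.
  have DE2 : iter k.+2 D (Ej j b) = 0.
    by rewrite iterS DE raddfMn /y -iterS h2' mul0rn.
  pose w := Ej j b - b0.
  have lw : w *+ l = 0 by rewrite mulrnBl eb1 subrr.
  have zb k' : iter k'.+1 D b0 = 0 by rewrite iterSr Db0 raddf0.
  have sw : sigma w *+ (Z ^ j)%N = w by rewrite raddfB mulrnBl Ej_eig // sb0.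
  (* Ej multiplied the leading term [y] by r, which is divided out modulo l. *)
  have [r' r'E] : exists r', (r * r' = 1 %[mod l])%N.
    have cp : coprime r l by rewrite coprime_sym prime_coprime // gtnNdvd.
    have [u v uv _] := egcdnP l r_gt0; exists u.
    by rewrite mulnC uv (eqP cp) modnMDl.
  apply/imsetP; exists (w *+ r').
    apply/XkP; split; first by rewrite mulrnAC lw mul0rn.
      by rewrite -iterD_Mn raddfB /= -!iterS DE2 zb subrr mul0rn.
    by rewrite raddfMn mulrnAC sw.
  rewrite -iterD_Mn raddfB /= -!iterS DE zb subr0 -mulrnA -/y -[LHS]mulr1n.
  by apply: mulrn_modn ly _.
apply: leq_trans c2 _; rewrite -im1 -mulnA leq_mul2l; apply/orP; right.
by apply: leq_trans c4 _; rewrite leq_mul2l subset_leq_card ?orbT.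
Qed.

Let V := #|[set x in Al | sigma x == x]|.

Let nn i := #|Xk 1 i|.

Lemma Sk_chain i k : (i < r)%N -> (k <= i)%N ->
  (nn i <= q ^ k * \prod_(t < k) nn (i - t.+1) * #|Sk k i|)%N.
Proof.
move=> ir; elim: k => [|k IH] ki.
  rewrite big_ord0 !mul1n /Sk subn0 /=; apply: eq_leq; rewrite -[LHS](card_imset _ (@inj_id A)).
  by [].
apply: leq_trans (IH (ltnW ki)) _; rewrite big_ord_recr /= expnSr.
have st : (#|Sk k i| <= q * nn (i - k.+1) * #|Sk k.+1 i|)%N by apply: Sk_step; rewrite ki.
apply: leq_trans (leq_mul (leqnn _) st) _.
by rewrite mulnA [(q ^ k * _ * _)%N]mulnACA.
Qed.

(** With k = i the chain ends in the eigenspace of index 0, which consists of elements fixed by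
    sigma and so has at most [V] elements. *)
Lemma nn_bound i : (i < r)%N -> (nn i <= q ^ r * (\prod_(j < i) nn j) * V)%N.
Proof.
move=> ir; apply: leq_trans (Sk_chain ir (leqnn i)) _.
have q0 : (0 < q)%N.
  have h := sg_card_gt0 (sg_im N sgP); move: Hq; case: (q) => //; rewrite mul0n leqn0 => /eqP z0.
  have : (0 < #|[set x in P | tau x == x]|)%N.
    by apply/card_gt0P; exists 0; rewrite !inE mul0rn raddf0 !eqxx.
  by rewrite z0.
apply: leq_mul; last first.
  apply: leq_trans (leq_imset_card _ _) _; apply: subset_leq_card; rewrite subnn.
  by apply/fintype.subsetP => x /XkP[h1 _]; rewrite expn0 mulr1n !inE h1 eqxx => ->; rewrite eqxx.
apply: leq_mul; first by rewrite leq_pexp2l // ltnW.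
apply: eq_leq; rewrite (reindex_inj rev_ord_inj) /=; apply: eq_bigr => t _.
by congr nn; rewrite subnSK // subKn // ltnW.
Qed.

Lemma nn_gt0 i : (0 < nn i)%N.
Proof. exact: sg_card_gt0 (sg_Xk _ _). Qed.

Let U := (q ^ r * V)%N.

(** The recursion nn_i <= U * nn_0 ... nn_(i-1) gives the exponents 1, 2, 4, ..., whose partial sums
    are 2^(i+1) - 1. *)
Lemma nn_le i : (i < r)%N -> (nn i <= U ^ (2 ^ i))%N /\ (\prod_(j < i.+1) nn j <= U ^ (2 ^ i.+1).-1)%N.
Proof.
elim/ltn_ind: i => i IH ir.
have pr : (\prod_(j < i) nn j <= U ^ (2 ^ i).-1)%N.
  by case: i IH ir => [|i] IH ir; [rewrite big_ord0|have [] := IH i (ltnSn i) (ltnW ir)].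
have U1 : (nn i <= U * U ^ (2 ^ i).-1)%N.
  by apply: leq_trans (nn_bound ir) _; rewrite mulnAC leq_mul2l pr orbT.
have e2 : (0 < 2 ^ i)%N by rewrite expn_gt0.
rewrite -expnS prednK // in U1; split=> //; rewrite big_ord_recr /=.
apply: leq_trans (leq_mul pr U1) _; rewrite -expnD; apply: eq_leq; congr (_ ^ _)%N.
by rewrite expnS mul2n -addnn; case: (2 ^ i)%N e2 => // c _; rewrite addSn.
Qed.

(** The maps Ej are applied one after another to the common kernel of the previous ones; each image
    lies in one eigenspace. An element killed by all of them is 0, because their sum is
    multiplication by r, which is prime to l. *)
Lemma Al_tau_le : (#|[set x in Al | tau x == x]| <= \prod_(i < r) nn i)%N.
Proof.
pose X := [set x in Al | D x == 0%R]; have sX : sg X := sg_ker D sgAl.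
have -> : [set x in Al | tau x == x] = X by apply/setP => x; rewrite !inE subr_eq0.
pose K k := [set x in X | [forall j : 'I_r, (j < k)%N ==> (Ej j x == 0)]].
have KP k x : reflect (x \in X /\ forall j, (j < r)%N -> (j < k)%N -> Ej j x = 0) (x \in K k).
  apply: (iffP idP) => [|[h1 h2]].
    rewrite inE => /andP[h1 h2]; split=> // j jr jk.
    by have := forallP h2 (Ordinal jr); rewrite /= jk => /eqP.
  by rewrite inE h1 /=; apply/forallP => j; apply/implyP => jk; rewrite h2.
have sK k : sg (K k).
  have [X0 XB] := sX; split; first by apply/KP; split=> // j _ _; rewrite raddf0.
  move=> x y /KP[h1 h2] /KP[h3 h4]; apply/KP; split; first exact: XB.
  by move=> j jr jk; rewrite raddfB /= h2 // h4 // subrr.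
have XP x : x \in X -> [/\ x *+ l = 0 & D x = 0].
  by rewrite !inE => /andP[/eqP h1 /eqP h2].
have step k : (k <= r)%N -> (#|X| <= (\prod_(i < k) nn i) * #|K k|)%N.
  elim: k => [|k IH] kr.
    by rewrite big_ord0 mul1n; apply: subset_leq_card; apply/fintype.subsetP => x Xx; apply/KP.
  apply: leq_trans (IH (ltnW kr)) _; rewrite big_ord_recr /= -mulnA leq_mul2l; apply/orP; right.
  rewrite (card_im (Ej k) (sK k)); apply: leq_mul; apply: subset_leq_card.
    apply/fintype.subsetP => _ /imsetP[x /KP[/XP[h1 h2] _] ->]; apply/XkP; split.
    - by rewrite -raddfMn h1 raddf0.
    - rewrite /= /Ej raddf_sum big1 // => t _; rewrite raddfMn.
      by have [_] := @iterD_iter_sigma 0 t x h2; rewrite /= => ->; rewrite mul0rn.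
    - by apply: Ej_eig; apply: Al_P; apply/AlP.
  apply/fintype.subsetP => x; rewrite inE => /andP[/KP[h1 h2] /eqP h3]; apply/KP; split=> // j jr.
  by rewrite ltnS leq_eqVlt => /orP[/eqP ->|]; [|exact: h2].
apply: leq_trans (step r (leqnn r)) _; rewrite -[leqRHS]muln1 leq_mul2l; apply/orP; right.
rewrite -(cards1 (0 : A)); apply: subset_leq_card; apply/fintype.subsetP => x /KP[/XP[lx _] h].
have sumE : \sum_(j < r) Ej j x = x *+ r.
  rewrite /Ej exchange_big /=; case: (r) r_gt0 rl zi sigma_r Zr_mod h => // r' _ r'l zi' sr zrm h.
  rewrite big_ord_recl /= [X in _ + X]big1 => [|t _]; last first.
    transitivity (\sum_(i < r'.+1) iter t.+1 sigma x *+ (Z ^ (i * t.+1))%N).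
      by apply: eq_bigr => i _; rewrite /bump add1n.
    rewrite sumrMnr.
    (* The power w of Z is not 1 modulo l but its r-th power is, so this geometric sum vanishes
       modulo l. *)
    pose c := (\sum_(j < r'.+1) Z ^ (j * t.+1))%N.
    suff /dvdnP[d dE] : (l %| c)%N.
      have lx' : iter t.+1 sigma x *+ l = 0 by rewrite -raddfMn lx raddf0.
      by rewrite -[LHS]/(iter t.+1 sigma x *+ c) dE mulnC mulrnA lx' mul0rn.
    pose w := (Z ^ t.+1)%N.
    have cE : c = (\sum_(j < r'.+1) w ^ j)%N by apply: eq_bigr => j _; rewrite /w -expnM mulnC.
    have w1 : (w != 1 %[mod l])%N by rewrite /w modZz zi' //= ltnS ltn_ord.
    have wr : (w ^ r'.+1 = 1 %[mod l])%N.
      rewrite /w -expnM; have := zrm t.+1; move/eqP => e; apply/eqP; move: e.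
      have pos : (0 < Z ^ (t.+1 * r'.+1))%N.
        rewrite expn_gt0; apply/orP; left; rewrite lt0n; apply/eqP => Z0; move: w1.
        move: (zrm 1%N); rewrite mul1n Z0 exp0n // mod0n modn_small.
          by [].
        by rewrite -(exp1n m.+1) ltn_exp2r // prime_gt1.
      by rewrite !eqn_mod_dvd // => e; apply: dvdn_trans e; rewrite expnS dvdn_mulr.
    have w0 : (0 < w)%N.
      rewrite lt0n; apply/eqP => w0; move: wr; rewrite w0 exp0n // mod0n modn_small ?prime_gt1 //.
    have wr0 : (1 <= w ^ r'.+1)%N by rewrite expn_gt0 w0.
    have := wr => /eqP; rewrite (eqn_mod_dvd _ wr0) subn1 predn_exp Euclid_dvdM // -cE.
    by case/orP => // h1; move: w1; rewrite (eqn_mod_dvd _ w0) subn1 h1.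
  by rewrite addr0 (eq_bigr (fun=> x)) ?sumr_const ?card_ord // => j _; rewrite muln0 expn0 mulr1n.
have xr : x *+ r = 0 by rewrite -sumE big1 // => j _; exact: h.
have cp : coprime l r by rewrite prime_coprime // gtnNdvd.
have [u v uv _] := egcdnP r (prime_gt0 lpr).
have : x *+ (u * l) = x by rewrite uv (eqP cp) mulrnDr mulr1n mulnC mulrnA xr mul0rn add0r.
by rewrite mulnC mulrnA lx mul0rn inE => <-.
Qed.

Lemma fixed_bound : (#|[set x in Al | tau x == x]| <= U ^ (2 ^ r))%N.
Proof.
apply: leq_trans Al_tau_le _; case: (r) r_gt0 nn_le => // r' _ h.
have [_ h2] := h r' (ltnSn r'); apply: leq_trans h2 _.
have U0 : (0 < U)%N.
  have := nn_bound r_gt0; rewrite big_ord0 muln1 /U => h'.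
  exact: leq_trans (nn_gt0 0) h'.
by rewrite leq_pexp2l // leq_pred.
Qed.

(** D^l = 0 on the l-torsion, and D^k sends each of the l graded pieces injectively into the kernel
    of D. *)
Lemma torsion_bound : (#|Al| <= #|[set x in Al | tau x == x]| ^ l)%N.
Proof.
pose Y k := [set x in Al | iter k D x == 0%R].
have sY k : sg (Y k) := sg_ker (iter k D) sgAl.
have Y1 : [set x in Al | tau x == x] = Y 1%N by apply/setP => x; rewrite !inE subr_eq0.
have step k : (#|Y k| <= #|Y 1%N| ^ k)%N.
  elim: k => [|k IH].
    rewrite expn0 -(cards1 (0 : A)); apply: subset_leq_card.
    by apply/fintype.subsetP => x; rewrite !inE => /andP[].
  rewrite (card_im (iter k D) (sY k.+1)) expnS; apply: leq_mul.
    apply: subset_leq_card; apply/fintype.subsetP => _ /imsetP[x + ->].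
    rewrite inE => /andP[/AlP lx /eqP h]; rewrite !inE -raddfMn lx raddf0 eqxx /=.
    by move: h => /= ->.
  apply: leq_trans IH; apply: subset_leq_card; apply/fintype.subsetP => x.
  by rewrite inE => /andP[]; rewrite inE => /andP[h1 _] h2; rewrite inE h1.
rewrite Y1; apply: leq_trans (step l); apply: subset_leq_card; apply/fintype.subsetP => x xA.
by have lx := elimT (AlP x) xA; rewrite inE xA /= D_l // eqxx.
Qed.

End ClassModule.

(** * Integral closures as lattices *)

Lemma le_1Dsum (R : numDomainType) (I : finType) (f : I -> R) (i : I) :
  (forall k, 0 <= f k) -> f i <= 1 + \sum_k f k.
Proof.
move=> f0; rewrite (bigD1 i) //= addrCA lerDl; apply: addr_ge0 => //; exact: sumr_ge0.
Qed.

Section IntegralClosure.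
Local Open Scope classical_set_scope.
Variables (A0 : comNzRingType) (F E : fieldType) (j : {rmorphism A0 -> F}) (iota : {rmorphism F -> E}).

Definition icl : set E := [set x | integralOver (iota \o j) x].

Lemma icl_base a : icl (iota (j a)).
Proof. exact: (integral_id (iota \o j) a). Qed.

Lemma iclD x y : icl x -> icl y -> icl (x + y). Proof. exact: integral_add. Qed.
Lemma iclB x y : icl x -> icl y -> icl (x - y). Proof. exact: integral_sub. Qed.
Lemma iclM x y : icl x -> icl y -> icl (x * y). Proof. exact: integral_mul. Qed.
Lemma icl1 : icl 1. Proof. exact: integral1. Qed.
Lemma icl0 : icl 0. Proof. exact: integral0. Qed.

Lemma icl_sum (I : Type) (r : seq I) (P : pred I) (f : I -> E) :
  (forall i, P i -> icl (f i)) -> icl (\sum_(i <- r | P i) f i).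
Proof. by move=> h; elim/big_ind: _ => //; [exact: icl0|exact: iclD]. Qed.

Lemma icl_prod (I : Type) (r : seq I) (P : pred I) (f : I -> E) :
  (forall i, P i -> icl (f i)) -> icl (\prod_(i <- r | P i) f i).
Proof. by move=> h; elim/big_ind: _ => //; [exact: icl1|exact: iclM]. Qed.

Lemma iclX x n : icl x -> icl (x ^+ n).
Proof. by move=> h; elim: n => [|n IH]; rewrite ?expr0 ?exprS; [exact: icl1|exact: iclM]. Qed.

Lemma icl_poly (p : {poly E}) : (forall i, icl p`_i) -> {in p : seq E, integralRange (iota \o j)}.
Proof. by move=> h; apply/integral_poly. Qed.

Lemma icl_int x m k : (m < k)%N -> icl (x ^+ k - x ^+ m) -> icl x.
Proof.
move=> mk h; pose c := x ^+ k - x ^+ m; pose p : {poly E} := 'X^k - 'X^m - c%:P.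
have sz : (size ('X^m + c%:P : {poly E})%R < k.+1)%N.
  apply: leq_ltn_trans (size_polyD _ _) _; rewrite gtn_max size_polyXn ltnS mk /=.
  apply: leq_ltn_trans (size_polyC_leq1 _) _; lia.
have pm : p \is monic.
  by rewrite /p -addrA -opprD monicE lead_coefDl ?size_polyN ?size_polyXn ?lead_coefXn.
apply: (integral_root_monic pm).
  by rewrite /root /p !hornerE subrr.
apply: icl_poly => i; rewrite /p !coefB !coefXn coefC.
have nat_icl (b : bool) : icl (b%:R) by case: b; [exact: icl1|exact: icl0].
by apply: iclB; [exact: iclB|case: ifP => _; [exact: h|exact: icl0]].
Qed.

Lemma icl_morph (f : {rmorphism E -> E}) x : (forall y, f (iota y) = iota y) -> icl x -> icl (f x).
Proof.
move=> fi [p pm rp]; exists p => //; have := rp; rewrite -(fmorph_root f) -map_poly_comp.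
by rewrite (eq_map_poly (g := iota \o j)) // => a /=; rewrite fi.
Qed.

(* If [w^-1] lies in the base ring, dividing the equation of [w] by a power of [w] expresses [w]. *)
Lemma integral_inv_base (b : A0) : j b != 0 -> integralOver j (j b)^-1 -> exists a, (j b)^-1 = j a.
Proof.
set w := (j b)^-1; move=> b0 [p pm rp].
have w0 : w != 0 by rewrite invr_eq0.
case sz: (size p) => [|m].
  by move: pm; rewrite monicE; have /eqP := sz; rewrite size_poly_eq0 => /eqP ->; rewrite lead_coef0 eq_sym oner_eq0.
have lp : p`_m = 1 by move: pm; rewrite monicE lead_coefE sz => /eqP.
exists (- \sum_(i < m) p`_i * b ^+ (m.-1 - i)).
case: m sz lp => [|m] sz lp.
  move: rp; rewrite /root horner_coef size_map_poly_id0; last by rewrite (monicP pm) rmorph1 oner_eq0.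
  by rewrite sz big_ord1 /= coef_map /= lp rmorph1 expr0 mulr1 oner_eq0.
have e : w ^+ m.+1 = - \sum_(i < m.+1) j p`_i * w ^+ i.
  apply/eqP; rewrite -subr_eq0 opprK addrC; move: rp.
  rewrite /root horner_coef size_map_poly_id0; last by rewrite (monicP pm) rmorph1 oner_eq0.
  rewrite sz big_ord_recr /= coef_map /= lp rmorph1 mul1r.
  by under eq_bigr do rewrite coef_map.
have wm : w ^+ m != 0 by rewrite expf_neq0.
apply: (mulIf wm); rewrite -exprS e rmorphN mulNr; congr (- _).
rewrite rmorph_sum mulr_suml; apply: eq_bigr => i _ /=.
rewrite rmorphM rmorphXn -mulrA; congr (_ * _).
have im : (i <= m)%N by rewrite -ltnS.
have -> : w ^+ m = w ^+ (m - i) * w ^+ i by rewrite -exprD subnK.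
by rewrite mulrA -exprMn mulfV // expr1n mul1r.
Qed.

Hypothesis bezout : forall x : F, exists a b u v : A0,
  [/\ j b != 0, x = j a / j b & u * a + v * b = 1].

(** For x = a / b in lowest terms, the Bezout relation gives 1 / b = u x + v, so 1 / b is integral
    as well and [integral_inv_base] applies. *)
Lemma integral_base (x : F) : integralOver j x -> exists a, x = j a.
Proof.
have [a [b [u [v [b0 -> uv]]]]] := bezout x; move=> h.
have e : (j b)^-1 = j u * (j a / j b) + j v.
  by apply: (mulIf b0); rewrite mulVf // mulrDl -!mulrA mulVf // mulr1 -!rmorphM -rmorphD uv rmorph1.
have [|c cE] := integral_inv_base b0.
  by rewrite e; apply: integral_add; [apply: integral_mul => //; exact: integral_id|exact: integral_id].
by exists (a * c); rewrite cE rmorphM.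
Qed.

Lemma icl_fix (x : F) : icl (iota x) -> exists a, x = j a.
Proof.
move=> [p pm rp]; apply: integral_base; exists p => //.
by rewrite -(fmorph_root iota) -map_poly_comp.
Qed.

Lemma base_denominator (f : F) : exists b, j b != 0 /\ exists a, j b * f = j a.
Proof.
have [a [b [_ [_ [b0 -> _]]]]] := bezout f.
by exists b; split=> //; exists a; rewrite mulrC divfK.
Qed.

Lemma common_denominator (s : seq F) : exists b, j b != 0 /\ forall f, f \in s -> exists a, j b * f = j a.
Proof.
elim: s => [|f s [b [b0 hb]]]; first by exists 1; rewrite rmorph1 oner_eq0.
have [c [c0 [a ca]]] := base_denominator f; exists (b * c); rewrite rmorphM mulf_neq0 //; split=> // g.
rewrite inE => /orP[/eqP ->|/hb[d dE]].
  by exists (b * a); rewrite -mulrA ca rmorphM.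
by exists (c * d); rewrite mulrAC dE -rmorphM mulrC.
Qed.

Lemma icl_den_alg (x : E) : algebraicOver iota x -> exists b, j b != 0 /\ icl (iota (j b) * x).
Proof.
move=> [p p0 rp]; have [d [d0 hd]] := common_denominator p.
pose m := (size p).-1; have szp : size p = m.+1 by rewrite prednK // lt0n size_poly_eq0.
have /choice[a ha] : forall i, exists a, j d * p`_i = j a.
  move=> i; have [im|im] := ltnP i (size p); first by apply: hd; exact: mem_nth.
  by exists 0; rewrite nth_default // mulr0 rmorph0.
have am0 : j (a m) != 0.
  by rewrite -ha mulf_neq0 // -lead_coefE lead_coef_eq0.
have rel : \sum_(i < m.+1) iota (j (a i)) * x ^+ i = 0.
  move: rp; rewrite /root horner_coef size_map_poly szp => /eqP h.
  transitivity (iota (j d) * \sum_(i < m.+1) (map_poly iota p)`_i * x ^+ i); last by rewrite h mulr0.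
  rewrite mulr_sumr; apply: eq_bigr => i _.
  by rewrite coef_map /= mulrA -rmorphM ha.
exists (a m); split=> //; set y := iota (j (a m)) * x.
have [m0|m0] := posnP m.
  move: rel; rewrite m0 big_ord1 expr0 mulr1 => /eqP; rewrite fmorph_eq0 => /eqP a00.
  by move: am0; rewrite m0 a00 eqxx.
(* The equation of x multiplied by a_m^(m-1), read as a monic equation for y = a_m x. *)
pose q : {poly E} := 'X^m + \poly_(i < m) (iota (j (a i)) * iota (j (a m)) ^+ (m.-1 - i)).
have qm : q \is monic.
  by rewrite monicE lead_coefDl ?lead_coefXn // size_polyXn ltnS size_poly.
apply: (integral_root_monic qm).
  rewrite /root /q hornerD hornerXn horner_poly -[m in y ^+ m](prednK m0).
  apply/eqP; transitivity (iota (j (a m)) ^+ m.-1 * \sum_(i < m.+1) iota (j (a i)) * x ^+ i).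
    2: by rewrite rel mulr0.
  rewrite big_ord_recr /= mulrDr mulr_sumr addrC; congr (_ + _); last first.
    by have mE := prednK m0; rewrite exprMn mE mulrA -exprSr mE.
  apply: eq_bigr => i _; rewrite exprMn.
  have im : (i <= m.-1)%N by rewrite -ltnS prednK.
  have -> : iota (j (a m)) ^+ m.-1 = iota (j (a m)) ^+ (m.-1 - i) * iota (j (a m)) ^+ i by rewrite -exprD subnK.
  ring.
apply: icl_poly => i; rewrite /q coefD coefXn coef_poly; apply: iclD.
  by case: eqP => _; [exact: icl1|exact: icl0].
case: ifP => _; last exact: icl0.
by apply: iclM; [exact: icl_base|apply: iclX; exact: icl_base].
Qed.

End IntegralClosure.

Lemma idealD_dv (K : fieldType) (O : set K) (dO : dedekind O) x : x != 0 ->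
  idealD_ O (dv O x) = [set y | O (y / x)]%classic.
Proof.
move=> x0; apply/seteqP; split=> y.
  move=> h; rewrite /=; apply: (ded_place dO) => v fv; have := h v fv; rewrite (dvE dO) // fv.
  have [->|y0] := eqVneq y 0; first by rewrite mul0r => _; exact: vge0.
  by rewrite !vgeE ?mulf_neq0 ?invr_eq0 // valf // subr_ge0.
move=> /= h v fv; rewrite (dvE dO) // fv.
have [->|y0] := eqVneq y 0; first exact: vge0.
have := fin_vge fv h; rewrite !vgeE ?mulf_neq0 ?invr_eq0 // valf // subr_ge0.
by [].
Qed.

(** * Integral closure in a Galois extension *)

Section Lattice.
Local Open Scope classical_set_scope.
Variables (A0 : comNzRingType) (F E : fieldType) (j : {rmorphism A0 -> F}) (iota : {rmorphism F -> E}).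
Variables (gT : finGroupType) (G : {group gT}) (act : gT -> {rmorphism E -> E}).
Hypothesis act1 : forall x, act 1%g x = x.
Hypothesis actM : forall g h x, act (g * h)%g x = act h (act g x).
Hypothesis actK : forall g y, g \in G -> act g (iota y) = iota y.
Hypothesis act_fix : forall x, (forall g, g \in G -> act g x = x) -> exists y, x = iota y.
Hypothesis faithful : forall g h, g \in G -> h \in G -> (forall x, act g x = act h x) -> g = h.
Hypothesis bezout : forall x : F, exists a b u v : A0,
  [/\ j b != 0, x = j a / j b & u * a + v * b = 1].
Local Notation O := (icl j iota).
Local Notation n := #|G|.
Implicit Types (x y : E) (g h : gT).

Lemma icl_act g x : g \in G -> O x -> O (act g x).
Proof. by move=> gG; apply: icl_morph => y; exact: actK. Qed.

Lemma norm_icl x : O x -> exists a, \prod_(g in G) act g x = iota (j a).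
Proof.
move=> Ox; have [f fE] : exists f, \prod_(g in G) act g x = iota f.
  apply: act_fix => h hG; rewrite rmorph_prod /=.
  rewrite [RHS](reindex_inj (mulIg h)) /=; apply: eq_big => g; first by rewrite groupMr.
  by move=> gG; rewrite actM.
have [|a aE] := icl_fix (iota := iota) bezout (x := f); last by exists a; rewrite fE aE.
by rewrite -fE; apply: icl_prod => g gG; exact: icl_act.
Qed.

Lemma act_alg x : algebraicOver iota x.
Proof.
pose p : {poly E} := \prod_(g in G) ('X - (act g x)%:P).
have pE h : h \in G -> map_poly (act h) p = p.
  move=> hG; rewrite /p rmorph_prod /= [RHS](reindex_inj (mulIg h)) /=; apply: eq_big => g; first by rewrite groupMr.
  by move=> gG; rewrite rmorphB /= map_polyX map_polyC /= -actM.
have /choice[q qE] : forall i, exists f, p`_i = iota f.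
  by move=> i; apply: act_fix => g gG; rewrite -coef_map pE.
exists (\poly_(i < size p) q i); last first.
  have -> : map_poly iota (\poly_(i < size p) q i) = p.
    apply/polyP => i; rewrite coef_map coef_poly; case: ltnP => h; first by rewrite qE.
    by rewrite /= rmorph0 nth_default.
  rewrite /root /p horner_prod (bigD1 1%g) //= act1 !hornerE subrr mul0r //.
have pn0 : p != 0 by rewrite /p; apply/prodf_neq0 => g _; rewrite polyXsubC_eq0.
apply: contra pn0 => /eqP q0; apply/eqP/polyP => i; rewrite coef0.
have := congr1 (fun r : {poly F} => r`_i) q0; rewrite coef0 coef_poly.
case: ltnP => h; last by rewrite nth_default.
by rewrite qE => ->; rewrite /= rmorph0.
Qed.

Lemma icl_den x : exists b, j b != 0 /\ O (iota (j b) * x).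
Proof. by apply: (icl_den_alg bezout); exact: act_alg. Qed.

Lemma dedekind_independence (s : seq gT) (c : gT -> E) : uniq s -> {subset s <= G} ->
  (forall x, O x -> \sum_(g <- s) c g * act g x = 0) -> forall g, g \in s -> c g = 0.
Proof.
move=> us sG hO; have {hO} : forall x, \sum_(g <- s) c g * act g x = 0.
  move=> x; have [b [b0 Ob]] := icl_den x; have := hO _ Ob.
  have ib : iota (j b) != 0 by rewrite fmorph_eq0.
  have -> : \sum_(g <- s) c g * act g (iota (j b) * x) = iota (j b) * \sum_(g <- s) c g * act g x.
    rewrite mulr_sumr big_seq [RHS]big_seq; apply: eq_bigr => g /sG gG.
    by rewrite rmorphM actK // mulrCA.
  by move/eqP; rewrite mulf_eq0 (negPf ib) => /eqP.
elim: s c us sG => [//|g0 s IH] c /= /andP[g0s us] sG hc.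
have cs g : g \in s -> c g = 0.
  move=> gs; apply/eqP; apply: contraT => cg.
  have g0G : g0 \in G by apply: sG; rewrite mem_head.
  have gG : g \in G by apply: sG; rewrite inE gs orbT.
  have [y hy] : exists y, act g y != act g0 y.
    apply: contrapT => hn; move: g0s; apply/negP; rewrite negbK.
    suff <- : g = g0 by [].
    apply: faithful => // y; apply/eqP/negP => /negP hy; by apply: hn; exists y.
  have := IH (fun h => c h * (act h y - act g0 y)) us (fun h hs => sG h (mem_behead (s := g0 :: s) hs)) _ g gs.
  move=> /(_ _)/eqP; rewrite mulf_eq0 (negPf cg) subr_eq0 (negPf hy); apply=> x.
  have h1 := hc (y * x); have h2 := hc x; rewrite big_cons in h1; rewrite big_cons in h2.
  have h3 : \sum_(h <- s) c h * act h x = - (c g0 * act g0 x).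
    by apply/eqP; rewrite -addr_eq0 addrC h2.
  have h4 : \sum_(h <- s) c h * act h (y * x) = - (c g0 * act g0 (y * x)).
    by apply/eqP; rewrite -addr_eq0 addrC h1.
  transitivity (\sum_(h <- s) c h * act h (y * x) - act g0 y * \sum_(h <- s) c h * act h x).
    rewrite mulr_sumr -sumrB; apply: eq_bigr => h _; rewrite rmorphM; ring.
  rewrite h3 h4 rmorphM; ring.
move=> g; rewrite inE => /orP[/eqP ->|]; last exact: cs.
have := hc 1; rewrite big_cons big_seq big1 => [|h /cs ->]; last by rewrite mul0r.
by rewrite addr0 rmorph1 mulr1.
Qed.

(** Expanding along a first column with variable entry [x] gives a combination of the conjugations
    whose coefficient at [s ord0] is a minor that is nonzero by induction. By
    [dedekind_independence] some integral [x] makes the determinant nonzero. *)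
Lemma basis_minor (k : nat) (s : 'I_k -> gT) : injective s -> (forall i, s i \in G) ->
  exists b : 'I_k -> E, (forall i, O (b i)) /\ \det (\matrix_(i, i') act (s i) (b i')) != 0.
Proof.
elim: k s => [|k IH] s inj sG.
  by exists (fun=> 0); split; [case|rewrite det_mx00 oner_eq0].
have [|i|b [Ob db]] := IH (fun i => s (fintype.lift (ord0 : 'I_k.+1) i)).
- by move=> i i' /inj /lift_inj.
- exact: sG.
pose bx x (i : 'I_k.+1) := if unlift ord0 i is Some i' then b i' else x.
apply: contrapT => hn.
pose Mx x := \matrix_(i, i') act (s i) (bx x i').
have dM x : O x -> \det (Mx x) = 0.
  move=> Ox; apply/eqP/negP => /negP h; apply: hn; exists (bx x); split=> // i.
  by rewrite /bx; case: unliftP.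
have co x i : cofactor (Mx x) i ord0 = cofactor (Mx 0) i ord0.
  by rewrite /cofactor; congr (_ * \det _); apply/matrixP => a c; rewrite !mxE /bx !liftK.
pose c g := \sum_(i | s i == g) cofactor (Mx 0) i ord0.
have us : uniq [seq s i | i <- enum 'I_k.+1] by rewrite map_inj_uniq ?enum_uniq.
have := @dedekind_independence [seq s i | i <- enum 'I_k.+1] c us.
move=> /(_ _ _ (s ord0)); rewrite map_f ?mem_enum //.
have -> : c (s ord0) = cofactor (Mx 0) ord0 ord0.
  by rewrite /c (eq_bigl (pred1 ord0)) ?big_pred1_eq // => i; rewrite inj_eq.
move=> h; move: db; apply/negP; rewrite negbK; apply/eqP.
have <- : cofactor (Mx 0) ord0 ord0 = \det (\matrix_(i, i') act (s (fintype.lift ord0 i)) (b i')).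
  rewrite /cofactor addn0 expr0 mul1r; congr (\det _); apply/matrixP => a a'.
  by rewrite !mxE /bx liftK.
apply: h => // [g /mapP[i _ ->]|x Ox]; first exact: sG.
rewrite big_map big_enum /= -[RHS](dM x Ox) (expand_det_col _ ord0); apply: eq_bigr => i _.
rewrite mxE /bx unlift_none co mulrC; congr (_ * _).
by rewrite /c (eq_bigl (pred1 i)) ?big_pred1_eq // => i'; rewrite inj_eq.
Qed.

Local Notation ev := (fun i : 'I_n => enum_val i : gT).

Lemma basis_exists : exists b : 'I_n -> E, (forall i, O (b i)) /\
  \det (\matrix_(i, i') act (enum_val i) (b i')) != 0.
Proof. by apply: basis_minor => [|i]; [exact: enum_val_inj|exact: enum_valP]. Qed.

Lemma icl_det k (M : 'M[E]_k) : (forall i i', O (M i i')) -> O (\det M).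
Proof.
move=> h; apply: icl_sum => s _; apply: iclM; last by apply: icl_prod.
by apply: iclX; rewrite -sub0r; apply: iclB; [exact: icl0|exact: icl1].
Qed.

Variable b : 'I_n -> E.
Hypotheses (Ob : forall i, O (b i)) (db : \det (\matrix_(i, i') act (enum_val i) (b i')) != 0).
Let Mb := \matrix_(i < n, i' < n) act (enum_val i) (b i').

Lemma Mb_unit : Mb \in unitmx.
Proof. by rewrite unitmxE unitfE. Qed.

Lemma Mb_int i i' : O (Mb i i').
Proof. by rewrite mxE; apply: icl_act => //; exact: enum_valP. Qed.

Lemma coordsP (c : 'I_n -> E) x : (forall g, g \in G -> act g x = \sum_k c k * act g (b k)) ->
  \col_k c k = invmx Mb *m \col_i act (enum_val i) x.
Proof.
move=> h; have -> : \col_i act (enum_val i) x = Mb *m \col_k c k.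
  apply/matrixP => i z; rewrite !mxE h ?enum_valP //; apply: eq_bigr => k _.
  by rewrite !mxE mulrC.
by rewrite mulKmx ?Mb_unit.
Qed.

Lemma coords x : exists f : 'I_n -> F, x = \sum_k iota (f k) * b k.
Proof.
pose v : 'cV_n := \col_i act (enum_val i) x; pose c := invmx Mb *m v.
have cE : Mb *m c = v by rewrite mulKVmx ?Mb_unit.
have ceq g : g \in G -> act g x = \sum_k c k 0 * act g (b k).
  move=> gG; have := congr1 (fun M : 'cV_n => M (enum_rank_in gG g) 0) cE.
  rewrite /v !mxE enum_rankK_in // => <-; apply: eq_bigr => k _.
  by rewrite mxE enum_rankK_in // mulrC.
have cfix k h : h \in G -> act h (c k 0) = c k 0.
  move=> hG; have e : \col_k act h (c k 0) = invmx Mb *m v.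
    apply: coordsP => g gG; have gh : (g * h^-1)%g \in G by rewrite groupM ?groupV.
    have a1 y : act h (act (g * h^-1)%g y) = act g y by rewrite -actM mulgKV.
    rewrite -a1 (ceq _ gh) rmorph_sum; apply: eq_bigr => k' _.
    by rewrite rmorphM /= a1.
  by have := congr1 (fun M : 'cV_n => M k 0) e; rewrite mxE.
have /choice[f hf] : forall k, exists f, c k 0 = iota f.
  by move=> k; apply: act_fix => h hG; exact: cfix.
exists f; have := ceq 1%g (group1 G); rewrite act1 => e.
by rewrite {1}e; apply: eq_bigr => k _; rewrite hf act1.
Qed.

Lemma coords_act (f : 'I_n -> F) g : g \in G ->
  act g (\sum_k iota (f k) * b k) = \sum_k iota (f k) * act g (b k).
Proof. by move=> gG; rewrite rmorph_sum; apply: eq_bigr => k _; rewrite rmorphM /= actK. Qed.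

Lemma coordsE (f : 'I_n -> F) k :
  iota (f k) = \sum_i invmx Mb k i * act (enum_val i) (\sum_k iota (f k) * b k).
Proof.
have e := @coordsP (fun k => iota (f k)) (\sum_k iota (f k) * b k) (fun g gG => coords_act f gG).
have := congr1 (fun M : 'cV_n => M k 0) e; rewrite mxE => ->; rewrite mxE.
by apply: eq_bigr => i _; rewrite mxE.
Qed.

Lemma coords_inj (f f' : 'I_n -> F) : \sum_k iota (f k) * b k = \sum_k iota (f' k) * b k -> f =1 f'.
Proof. by move=> e k; apply: (fmorph_inj iota); rewrite !coordsE e. Qed.

(** Cramer's rule: the determinant times a coordinate is integral. Completing the determinant to its
    norm [d] makes the multiplier an element of the base. *)
Lemma coords_den : exists d, j d != 0 /\ forall (f : 'I_n -> F),
  O (\sum_k iota (f k) * b k) -> forall k, exists a, j d * f k = j a.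
Proof.
have Od : O (\det Mb) := icl_det Mb_int.
have [d dE] := norm_icl Od.
pose d' := \prod_(g in G | g != 1%g) act g (\det Mb).
have dd' : iota (j d) = \det Mb * d' by rewrite -dE (bigD1 1%g) //= act1.
have Od' : O d' by apply: icl_prod => g /andP[gG _]; exact: icl_act.
exists d; split.
  rewrite -(fmorph_eq0 iota) -dE prodf_seq_neq0; apply/allP => g _; apply/implyP => _.
  by rewrite fmorph_eq0.
move=> f Of k; apply: (icl_fix (iota := iota) bezout); set x := \sum_k _ in Of.
rewrite rmorphM dd' mulrAC mulrC; apply: iclM => //.
have -> : \det Mb * iota (f k) = \sum_i (\adj Mb) k i * act (enum_val i) x.
  have e : \adj Mb *m \col_i act (enum_val i) x = \det Mb *: \col_k iota (f k).
    have -> : \col_i act (enum_val i) x = Mb *m \col_k iota (f k).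
      apply/matrixP => i z; rewrite !mxE /x coords_act ?enum_valP //; apply: eq_bigr => k' _.
      by rewrite !mxE mulrC.
    by rewrite mulmxA mul_adj_mx mul_scalar_mx.
  have := congr1 (fun M : 'cV_n => M k 0) e; rewrite !mxE => <-.
  by apply: eq_bigr => i _; rewrite [in RHS]mxE !mxE.
apply: icl_sum => i _; apply: iclM; last by apply: icl_act => //; exact: enum_valP.
rewrite mxE /cofactor; apply: iclM.
  by apply: iclX; rewrite -sub0r; apply: iclB; [exact: icl0|exact: icl1].
by apply: icl_det => i1 i2; rewrite mxE [X in O X]mxE; exact: Mb_int.
Qed.

Definition rgA : set F := [set f | exists a, f = j a].

Definition scl (K : fieldType) (c : K) (X : set K) : set K := [set x | X (x / c)].

(** The free sublattice spanned by [b] over the base ring; the integral closure lies between it and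
    a multiple of it by 1 / d. *)
Definition Lam_ : set E := [set x | exists a : 'I_n -> A0, x = \sum_k iota (j (a k)) * b k].

Hypothesis base_idx : forall a, j a != 0 -> exists m, idx rgA (scl (j a) rgA) m.

Lemma addg_scl (K : fieldType) (c : K) (X : set K) : addg X -> addg (scl c X).
Proof. by move=> [X0 XB]; split=> [|x y]; rewrite /scl /= ?mul0r // mulrBl; exact: XB. Qed.

Lemma addg_icl : addg O. Proof. by split; [exact: icl0|exact: iclB]. Qed.

Lemma addg_Lam : addg Lam_.
Proof.
split; first by exists (fun=> 0); rewrite big1 // => k _; rewrite !rmorph0 mul0r.
move=> _ _ [a ->] [c ->]; exists (fun k => a k - c k); rewrite -sumrB; apply: eq_bigr => k _.
by rewrite !rmorphB mulrBl.
Qed.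

Lemma Lam_icl : Lam_ `<=` O.
Proof. by move=> _ [a ->]; apply: icl_sum => k _; apply: iclM => //; exact: icl_base. Qed.

Lemma icl_scl_Lam : exists d, j d != 0 /\ forall x, O x -> Lam_ (iota (j d) * x).
Proof.
have [d [d0 hd]] := coords_den; exists d; split=> // x; have [f ->] := coords x.
move=> /hd /choice[a ha]; exists a; rewrite mulr_sumr; apply: eq_bigr => k _.
by rewrite mulrA -rmorphM ha.
Qed.

Lemma idx_Lam a m : j a != 0 -> idx rgA (scl (j a) rgA) m -> idx Lam_ (scl (iota (j a)) Lam_) (m ^ n).
Proof.
move=> a0 [s [szs [us sep] sA cov]].
have ia : iota (j a) != 0 by rewrite fmorph_eq0.
pose el (f : {ffun 'I_n -> 'I_m}) := \sum_k iota (nth 0 s (f k)) * b k.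
have key f f' : scl (iota (j a)) Lam_ (el f - el f') -> f = f'.
  rewrite /scl /= => -[c cE]; apply/ffunP => k; apply/val_inj/eqP.
  rewrite -(nth_uniq 0 _ _ us) ?szs ?ltn_ord //; apply/eqP; apply: sep; rewrite ?mem_nth ?szs ?ltn_ord //.
  exists (c k); apply: (mulIf a0); rewrite divfK //.
  have : \sum_k iota (nth 0 s (f k) - nth 0 s (f' k)) * b k = \sum_k iota (j (c k) * j a) * b k.
    transitivity (el f - el f').
      by rewrite /el -sumrB; apply: eq_bigr => k' _; rewrite rmorphB mulrBl.
    apply: (mulIf (invr_neq0 ia)); rewrite cE mulr_suml; apply: eq_bigr => k' _.
    by rewrite rmorphM mulrAC mulfK.
  by move/coords_inj => /(_ k).
have eli : injective el.
  by move=> f f' e; apply: key; rewrite e subrr; case: (addg_scl (iota (j a)) addg_Lam).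
exists [seq el f | f : {ffun 'I_n -> 'I_m}]; split.
- by rewrite size_map -cardT card_ffun !card_ord.
- split; first by rewrite map_inj_uniq // enum_uniq.
  by move=> _ _ /mapP[f _ ->] /mapP[f' _ ->] /key ->.
- move=> _ /mapP[f _ ->].
  have /choice[c hc] : forall k, exists c, nth 0 s (f k) = j c.
    by move=> k; apply: sA; rewrite mem_nth // szs ltn_ord.
  by exists c; apply: eq_bigr => k _; rewrite hc.
- move=> _ [c ->].
  have /choice[t ht] : forall k, exists t : 'I_m, scl (j a) rgA (j (c k) - nth 0 s t).
    move=> k; have [|y ys h] := cov (j (c k)); first by exists (c k).
    have it : (index y s < m)%N by rewrite -szs index_mem.
    by exists (Ordinal it); rewrite /= nth_index.
  have /choice[u hu] : forall k, exists u, (j (c k) - nth 0 s (t k)) / j a = j u by move=> k; exact: ht.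
  exists (el [ffun k => t k]); first by apply: map_f; exact: mem_enum.
  exists u; rewrite /el -sumrB mulr_suml; apply: eq_bigr => k _.
  by rewrite ffunE -mulrBl -rmorphB mulrAC -fmorphV -rmorphM hu.
Qed.

Lemma idx_icl_Lam : exists m, idx O Lam_ m.
Proof.
have [d [d0 hd]] := icl_scl_Lam; have [m hm] := base_idx d0.
have [s [_ _ _ cov]] := idx_Lam d0 hm.
have id0 : iota (j d) != 0 by rewrite fmorph_eq0.
have [|k [_ hk]] := idx_cover (r := [seq y / iota (j d) | y <- s]) addg_icl addg_Lam Lam_icl.
  move=> x /hd /cov[y ys h]; exists (y / iota (j d)); first by apply: map_f.
  by move: h; rewrite /scl /= mulrBl mulrAC divff // mul1r.
by exists k.
Qed.

Lemma idx_map (f : E -> E) (X Y X' Y' : set E) m : injective f -> (forall x y, f (x - y) = f x - f y) ->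
  (forall x, X x -> X' (f x)) -> (forall x', X' x' -> exists2 x, X x & x' = f x) ->
  (forall x, Y x <-> Y' (f x)) -> idx X Y m -> idx X' Y' m.
Proof.
move=> fi fB h1 h2 h3 [s [szs [us sep] sX cov]]; exists [seq f x | x <- s]; split.
- by rewrite size_map.
- split; first by rewrite map_inj_uniq.
  move=> _ _ /mapP[x xs ->] /mapP[y ys ->]; rewrite -fB => /h3 h; by rewrite (sep x y).
- by move=> _ /mapP[x xs ->]; apply: h1; exact: sX.
- move=> _ /h2[x Xx ->]; have [y ys h] := cov x Xx; exists (f y); first exact: map_f.
  by rewrite -fB; apply/h3.
Qed.

(** The index of a Lam in O is computed through Lam and through a O. As O / Lam and a O / a Lam have
    the same order, the index of a O in O equals that of a Lam in Lam. *)
Lemma idx_icl_base a m : j a != 0 -> idx rgA (scl (j a) rgA) m -> idx O (scl (iota (j a)) O) (m ^ n).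
Proof.
move=> a0 hm; have ia : iota (j a) != 0 by rewrite fmorph_eq0.
have hL := idx_Lam a0 hm; have [m0 h0] := idx_icl_Lam.
have aO := addg_icl; have aL := addg_Lam; have aaL := addg_scl (iota (j a)) aL; have aaO := addg_scl (iota (j a)) aO.
have LaL : scl (iota (j a)) Lam_ `<=` Lam_.
  move=> x [c cE]; exists (fun k => a * c k); apply: (mulIf (invr_neq0 ia)); rewrite cE mulr_suml.
  by apply: eq_bigr => k _; rewrite !rmorphM; field.
have OaO : scl (iota (j a)) O `<=` O.
  by move=> x; rewrite /scl /= => h; rewrite -[x](divfK ia); apply: iclM => //; exact: icl_base.
have aLaO : scl (iota (j a)) Lam_ `<=` scl (iota (j a)) O by move=> x; exact: Lam_icl.
have e1 := idx_trans aO aL aaL Lam_icl LaL h0 hL.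
have h0' : idx (scl (iota (j a)) O) (scl (iota (j a)) Lam_) m0.
  apply: (idx_map (f := fun x => iota (j a) * x)) h0.
  - exact: mulfI.
  - by move=> x y; rewrite mulrBr.
  - by move=> x Ox; rewrite /scl /= mulrAC divff // mul1r.
  - by move=> x Ox; exists (x / iota (j a)) => //; rewrite mulrC divfK.
  - by move=> x; rewrite /scl /= mulrAC divff // mul1r.
have [s [szs _ _ cov]] := e1.
have [|N [_ hN]] := idx_cover (r := s) aO aaO OaO.
  by move=> x /cov[y ys h]; exists y => //; exact: aLaO.
have e2 := idx_trans aO aaO aaL OaO aLaO hN h0'.
have e := idx_uniq aaL e1 e2.
have m0p : (0 < m0)%N.
  case: h0 => s0 [<- _ _ cov0]; have [y ys _] := cov0 0 (icl0 _ _).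
  by case: (s0) ys.
have -> // : (m ^ n)%N = N.
by apply/eqP; rewrite -(eqn_pmul2l m0p) e mulnC.
Qed.

Theorem icl_dedekind : dedekind O.
Proof.
split; [exact: icl1|exact: iclB|exact: iclM|..].
- move=> x; have [a [a0 Oa]] := icl_den x; exists (iota (j a) * x), (iota (j a)).
  have ia : iota (j a) != 0 by rewrite fmorph_eq0.
  by split=> //; [exact: icl_base|rewrite mulrC mulKf].
- exact: icl_int.
(* Finite quotients: [x] divides its norm, which comes from the base ring, so representatives modulo
   the norm serve modulo [x]. *)
- move=> x Ox x0; have [a aE] := norm_icl Ox.
  pose x' := \prod_(g in G | g != 1%g) act g x.
  have xx' : iota (j a) = x * x' by rewrite -aE (bigD1 1%g) //= act1.
  have Ox' : O x' by apply: icl_prod => g /andP[gG _]; exact: icl_act.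
  have a0 : j a != 0.
    rewrite -(fmorph_eq0 iota) -aE prodf_seq_neq0; apply/allP => g _; apply/implyP => _.
    by rewrite fmorph_eq0.
  have x'0 : x' != 0 by apply: contra_neq a0 => e; apply: (fmorph_inj iota); rewrite xx' e mulr0 rmorph0.
  have [m hm] := base_idx a0; have [s [_ _ _ cov]] := idx_icl_base a0 hm.
  exists s => y /cov[z zs h]; exists z => //; move: h; rewrite /scl /= xx' => h.
  have -> : (y - z) / x = (y - z) / (x * x') * x' by field; rewrite x0 x'0.
  exact: iclM.
Qed.

Variables (R : realType) (abs : E -> R).
Hypotheses (abs0 : abs 0 = 0) (abs_gt0 : forall x, x != 0 -> 0 < abs x).
Hypotheses (absM : forall x y, abs (x * y) = abs x * abs y) (absD : forall x y, abs (x + y) <= abs x + abs y).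
Local Notation absA a := (abs (iota (j a))).
Hypothesis j_inj : injective j.
Hypothesis base_norm : forall a m, j a != 0 -> idx rgA (scl (j a) rgA) m -> m%:R = absA a.
Hypothesis base_upper : exists2 C : R, 0 < C & forall T : R, 1 <= T -> forall s : seq A0, uniq s ->
  (forall a, a \in s -> absA a <= T) -> (size s)%:R <= C * T.
Hypothesis base_lower : exists2 c : R, 0 < c & forall T : R, 1 <= T -> exists s : seq A0,
  [/\ uniq s, forall a, a \in s -> absA a <= T & c * T <= (size s)%:R].
Hypothesis base_scale : exists2 C : R, 1 <= C & forall T : R, 1 <= T -> exists a, T <= absA a <= C * T.
Local Notation nrm := (fun (i : 'I_n) x => abs (act (enum_val i) x)).
Let dO : dedekind O := icl_dedekind.

Lemma abs_ge0 x : 0 <= abs x.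
Proof. by have [->|/abs_gt0/ltW //] := eqVneq x 0; rewrite abs0. Qed.

Lemma abs1 : abs 1 = 1.
Proof. by apply: (mulIf (lt0r_neq0 (abs_gt0 (oner_neq0 E)))); rewrite -absM !mul1r. Qed.

Lemma abs_prod (I : Type) (r : seq I) (P : pred I) (f : I -> E) :
  abs (\prod_(i <- r | P i) f i) = \prod_(i <- r | P i) abs (f i).
Proof. by rewrite (big_morph abs absM abs1). Qed.

Lemma abs_sum (I : Type) (r : seq I) (P : pred I) (f : I -> E) :
  abs (\sum_(i <- r | P i) f i) <= \sum_(i <- r | P i) abs (f i).
Proof.
elim/big_rec2: _ => [|i y x _ h]; first by rewrite abs0.
by apply: le_trans (absD _ _) _; rewrite lerD2l.
Qed.

Lemma gt0_cardG : (0 < n)%N. Proof. exact: cardG_gt0. Qed.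

(** The inverse of the matrix of conjugates bounds the coordinates of [d * x] linearly in T, and
    each of the n coordinates then has O(T) possible values. *)
Lemma lattice_upper : exists2 C : R, 0 < C & forall T : R, 1 <= T -> forall s : seq E, uniq s ->
  (forall x, x \in s -> O x /\ forall i, nrm i x <= T) -> (size s)%:R <= C * T ^+ n.
Proof.
have [C C0 hC] := base_upper; have [d [d0 hd]] := coords_den.
pose BW := 1 + \sum_k \sum_i abs (invmx Mb k i).
have BW1 : 1 <= BW by rewrite lerDl sumr_ge0 // => k _; apply: sumr_ge0 => i _; exact: abs_ge0.
pose C1 := 1 + absA d * BW.
have C11 : 1 <= C1 by rewrite lerDl mulr_ge0 ?abs_ge0 // (le_trans _ BW1).
exists ((C * C1) ^+ n) => [|T T1 s us sP].
  by rewrite exprn_gt0 // mulr_gt0 // (lt_le_trans ltr01 C11).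
have T0 : 0 < T by exact: lt_le_trans T1.
have CT : 1 <= C1 * T by rewrite mulr_ege1.
have hU (t : seq A0) : uniq t -> (forall a, a \in t -> absA a <= C1 * T) -> (size t <= Num.truncn (C * (C1 * T)))%N.
  by move=> ut tP; rewrite truncn_ge_nat ?hC // mulr_ge0 ?ltW // mulr_gt0 // (lt_le_trans ltr01 C11).
have [U [uU UP Uc]] := finite_of_bound (X := [set a | absA a <= C1 * T]) hU.
have sU : (size U)%:R <= C * (C1 * T) by exact: hC.
have ha x : exists a : 'I_n -> A0, x \in s -> (iota (j d) * x = \sum_k iota (j (a k)) * b k) /\ forall k, a k \in U.
  have [xs|] := boolP (x \in s); last by exists (fun=> 0).
  have [Ox hx] := sP x xs; have [f fE] := coords x; move: (Ox); rewrite {1}fE => /hd /choice[a aE].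
  exists a => _; split; first by rewrite {1}fE mulr_sumr; apply: eq_bigr => k _; rewrite mulrA -rmorphM aE.
  move=> k; apply: Uc; rewrite /= -aE rmorphM absM; apply: le_trans (_ : absA d * (BW * T) <= _); last first.
    by rewrite mulrA /C1 mulrDl mul1r lerDr ltW.
  rewrite ler_wpM2l ?abs_ge0 // coordsE -fE; apply: le_trans (abs_sum _ _ _) _.
  apply: le_trans (_ : (\sum_i abs (invmx Mb k i)) * T <= _).
    rewrite mulr_suml; apply: ler_sum => i _; rewrite absM ler_wpM2l ?abs_ge0 //; exact: hx.
  apply: ler_wpM2r; first exact: ltW.
  apply: (le_1Dsum (f := fun k => \sum_i abs (invmx Mb k i)) k) => k'.
  by apply: sumr_ge0 => i _; exact: abs_ge0.
have {ha} /choice[a ha] := ha.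
have U0 : (0 < size U)%N.
  by have := Uc 0; rewrite /= !rmorph0 abs0 mulr_ge0 ?(ltW T0) ?(le_trans ler01 C11) // => /(_ isT); case: (U).
pose N := (size U).-1; have NE : N.+1 = size U by rewrite prednK.
pose g x : {ffun 'I_n -> 'I_N.+1} := [ffun k => inord (index (a x k) U)].
have gi : {in s &, injective g}.
  move=> x y xs ys /ffunP e; have [ex hx] := ha x xs; have [ey hy] := ha y ys.
  have id0 : iota (j d) != 0 by rewrite fmorph_eq0.
  apply: (mulfI id0); rewrite ex ey; apply: eq_bigr => k _; congr (iota (j _) * _).
  have := e k; rewrite !ffunE => /(congr1 val); rewrite /= !inordK ?NE ?index_mem //.
  by move/(congr1 (nth 0 U)); rewrite !nth_index.
apply: le_trans (_ : (size U)%:R ^+ n <= _); last first.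
  rewrite -exprMn; apply: lerXn2r; rewrite ?nnegrE ?ler0n //; last by rewrite -mulrA.
  by rewrite mulr_ge0 ?(ltW T0) // mulr_ge0 ?(ltW C0) // (le_trans ler01 C11).
rewrite -natrX ler_nat -(size_map g) -NE; have -> : (N.+1 ^ n)%N = #|{ffun 'I_n -> 'I_N.+1}|.
  by rewrite card_ffun !card_ord.
by rewrite -(card_uniqP _) ?max_card // map_inj_in_uniq.
Qed.

Lemma lattice_lower : exists2 c : R, 0 < c & forall T : R, 1 <= T -> exists s : seq E, [/\ uniq s,
  forall x, x \in s -> O x /\ forall i, nrm i x <= T & c * T ^+ n <= (size s)%:R].
Proof.
have [c c0 hc] := base_lower.
pose B := 1 + \sum_i \sum_k nrm i (b k).
have B1 : 1 <= B by rewrite lerDl sumr_ge0 // => i _; apply: sumr_ge0 => k _; exact: abs_ge0.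
have B0 : 0 < B by exact: lt_le_trans B1.
pose c1 := Num.min c 1 / B.
have m0 : 0 < Num.min c 1 by rewrite lt_min c0 ltr01.
have c10 : 0 < c1 by rewrite divr_gt0.
exists (c1 ^+ n) => [|T T1]; first by rewrite exprn_gt0.
have T0 : 0 < T by exact: lt_le_trans T1.
have [TB|TB] := leP 1 (T / B); last first.
  (* For T < B the element 0 alone is enough, since [c1] is at most 1 / B. *)
  exists [:: 0]; split=> //.
    move=> x; rewrite inE => /eqP ->; split; first exact: icl0.
    by move=> i; rewrite rmorph0 abs0 ltW.
  have T0' := ltW T0; have B0' := ltW B0; have c10' := ltW c10; have m0' := ltW m0.
  rewrite -exprMn; apply: exprn_ile1; first exact: mulr_ge0.
  rewrite /c1 mulrAC -mulrA; apply: mulr_ile1; rewrite ?(ltW TB) //; first exact: divr_ge0.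
  by rewrite ge_min lexx orbT.
have [s [us sP hs]] := hc _ TB; pose N := size s.
pose el (f : {ffun 'I_n -> 'I_N}) := \sum_k iota (j (nth 0 s (f k))) * b k.
have eli : injective el.
  move=> f f' /(coords_inj (f := fun k => j (nth 0 s (f k))) (f' := fun k => j (nth 0 s (f' k)))) e.
  apply/ffunP => k; apply/val_inj/eqP; rewrite -(nth_uniq 0 _ _ us) ?ltn_ord //; apply/eqP.
  exact: j_inj (e k).
exists [seq el f | f : {ffun 'I_n -> 'I_N}]; split.
- by rewrite map_inj_uniq // enum_uniq.
- move=> _ /mapP[f _ ->]; split; first by apply: icl_sum => k _; apply: iclM => //; exact: icl_base.
  move=> i; rewrite coords_act ?enum_valP //; apply: le_trans (abs_sum _ _ _) _.
  apply: le_trans (_ : \sum_k (T / B) * nrm i (b k) <= _).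
    by apply: ler_sum => k _; rewrite absM ler_wpM2r ?abs_ge0 // sP // mem_nth // ltn_ord.
  rewrite -mulr_sumr -[leRHS](divfK (lt0r_neq0 B0)) ler_wpM2l ?divr_ge0 ?(ltW T0) ?(ltW B0) //.
  apply: (le_1Dsum (f := fun i => \sum_k nrm i (b k)) i) => i'.
  by apply: sumr_ge0 => k' _; exact: abs_ge0.
- rewrite size_map -cardT card_ffun !card_ord natrX -exprMn; apply: lerXn2r; rewrite ?nnegrE ?ler0n //.
    by rewrite mulr_ge0 ?ltW.
  apply: le_trans hs; rewrite /c1 mulrAC -mulrA ler_wpM2r ?divr_ge0 ?(ltW T0) ?(ltW B0) //.
  by rewrite ge_min lexx.
Qed.

Lemma idealD_scl x : x != 0 -> idealD_ O (dv O x) = scl x O.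
Proof. exact: (idealD_dv dO). Qed.

Lemma Nd_idx x m : O x -> x != 0 -> idx O (scl x O) m -> Nd O R (dv O x) = m%:R.
Proof.
move=> Ox x0 hm; have [m' hm' <-] := idx_idealD dO R (eff_dv dO Ox).
rewrite idealD_scl // in hm'; congr _%:R; exact: idx_uniq (addg_scl x addg_icl) hm' hm.
Qed.

Lemma Nd_base a : j a != 0 -> Nd O R (dv O (iota (j a))) = absA a ^+ n.
Proof.
move=> a0; have ia : iota (j a) != 0 by rewrite fmorph_eq0.
have [m hm] := base_idx a0; rewrite (Nd_idx (icl_base _ _ _) ia (idx_icl_base a0 hm)).
by rewrite natrX (base_norm a0 hm).
Qed.

Lemma Nd_act g x : g \in G -> O x -> x != 0 -> Nd O R (dv O (act g x)) = Nd O R (dv O x).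
Proof.
move=> gG Ox x0; have [m hm mE] := idx_idealD dO R (eff_dv dO Ox).
rewrite -mE; rewrite idealD_scl // in hm.
have gx0 : act g x != 0 by rewrite fmorph_eq0.
have actgK y : act g (act g^-1%g y) = y by rewrite -actM mulVg act1.
have actKg y : act g^-1%g (act g y) = y by rewrite -actM mulgV act1.
apply: Nd_idx => //; first exact: icl_act.
apply: (idx_map (f := act g)) hm.
- exact: fmorph_inj.
- exact: rmorphB.
- by move=> y; exact: icl_act.
- by move=> y Oy; exists (act g^-1%g y) => //; apply: icl_act; rewrite ?groupV.
- move=> y; rewrite /scl /= -fmorph_div; split; first exact: icl_act.
  by move=> /(icl_act (groupVr gG)); rewrite actKg.
Qed.

(** Conjugate elements have equal norms, so the n-th power of the norm of an integral [y] is the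
    norm of an element of the base, known from [idx_icl_base]. The n-th root is then extracted among
    non-negative reals. *)
Lemma lattice_product x : x != 0 -> Nd O R (dv O x) = \prod_i nrm i x.
Proof.
have intg y : O y -> y != 0 -> Nd O R (dv O y) = \prod_i nrm i y.
  move=> Oy y0; have [a aE] := norm_icl Oy.
  have a0 : j a != 0.
    rewrite -(fmorph_eq0 iota) -aE prodf_seq_neq0; apply/allP => g _; apply/implyP => _.
    by rewrite fmorph_eq0.
  have p0 : 0 <= \prod_i nrm i y by apply: prodr_ge0 => i _; exact: abs_ge0.
  apply/eqP; rewrite -(eqrXn2 gt0_cardG) ?(ltW (Nd_gt0 _ _ _)) //; apply/eqP.
  transitivity (Nd O R (dv O (iota (j a)))).
    rewrite -aE; transitivity (Nd O R (\sum_(g in G) dv O (act g y))).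
      transitivity (\prod_(g in G) Nd O R (dv O (act g y))).
        by rewrite -[LHS]prodr_const; apply: eq_bigr => g gG; rewrite Nd_act.
      by rewrite (big_morph (Nd O R) (NdD dO R) (Nd0 O R)).
    congr (Nd O R _); rewrite -!big_enum dv_prod // => g _.
    by rewrite fmorph_eq0.
  by rewrite Nd_base // -aE abs_prod big_enum_val.
move=> x0; have [d [d0 Od]] := icl_den x.
have id0 : iota (j d) != 0 by rewrite fmorph_eq0.
have := intg _ Od (mulf_neq0 id0 x0); rewrite (dvM dO) // (NdD dO R) intg //; last exact: icl_base.
rewrite -[X in _ * X = _]/(Nd O R (dv O x)).
have -> : \prod_i nrm i (iota (j d) * x) = (\prod_i nrm i (iota (j d))) * \prod_i nrm i x.
  by rewrite -big_split /=; apply: eq_bigr => i _; rewrite rmorphM absM.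
apply: mulfI; apply: lt0r_neq0; apply: prodr_gt0 => i _; apply: abs_gt0; by rewrite fmorph_eq0.
Qed.

Theorem lattice_global_data : global_data O nrm.
Proof.
split.
- by rewrite card_ord gt0_cardG.
- by move=> i; rewrite rmorph0.
- by move=> i x x0; apply: abs_gt0; rewrite fmorph_eq0.
- by move=> i x y; rewrite rmorphM absM.
- by move=> i x y; rewrite rmorphD absD.
- by rewrite card_ord; exact: lattice_upper.
- by rewrite card_ord; exact: lattice_lower.
- exact: lattice_product.
- have [C C1 hC] := base_scale; exists C => // T /hC[a ha]; exists (iota (j a)); split; first exact: icl_base.
  by move=> i; rewrite actK ?enum_valP.
Qed.

End Lattice.

(** * Absolute values over the integers *)

Section Embedding.
Variables (F0 : fieldType) (L : fieldExtType F0) (C : closedFieldType) (nu : {rmorphism F0 -> C}).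

Lemma field_embedding : separable 1 {:L} -> exists phi : {rmorphism L -> C}, forall a, phi a%:A = nu a.
Proof.
move=> sep; pose t := separable_generator 1 {:L}.
have tE x : exists q : {poly F0}, x = (map_poly (in_alg L) q).[t].
  have: x \in <<1; t>>%VS by rewrite -eq_adjoin_separable_generator ?sub1v ?memvf.
  by case/Fadjoin_polyP=> _ /polyOver1P[q ->] ->; exists q.
have [P PE] : exists P, minPoly 1 t = map_poly (in_alg L) P by apply/polyOver1P; exact: minPolyOver.
have [z Pz] : exists z, root (map_poly nu P) z.
  apply/closed_rootP; rewrite size_map_poly -(size_map_poly (in_alg L)) -PE size_minPoly.
  by rewrite eqSS adjoin_degreeE -lt0n divn_gt0 ?adim_gt0 // dimvS // subv_adjoin.
have wd q : (map_poly (in_alg L) q).[t] = 0 -> (map_poly nu q).[z] = 0.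
  move=> q0; have : minPoly 1 t %| map_poly (in_alg L) q.
    by apply: minPoly_dvdp; [apply/polyOver1P; exists q|rewrite rootE q0].
  by rewrite PE dvdp_map => /dvdpP[r ->]; rewrite rmorphM hornerM (rootP Pz) mulr0.
have [f fE] := choice tE.
pose phi x := (map_poly nu (f x)).[z].
have phiE q : phi (map_poly (in_alg L) q).[t] = (map_poly nu q).[z].
  apply/eqP; rewrite -subr_eq0 /phi -hornerN -hornerD -rmorphB; apply/eqP/wd.
  by rewrite rmorphB hornerD hornerN -fE subrr.
have phiB : zmod_morphism phi.
  by move=> x y; rewrite (fE x) (fE y) -hornerN -hornerD -rmorphB !phiE rmorphB hornerD hornerN.
have phiM : monoid_morphism phi.
  split; first by have := phiE 1; rewrite !rmorph1 !hornerC.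
  by move=> x y; rewrite (fE x) (fE y) -hornerM -rmorphM !phiE rmorphM hornerM.
pose m1 := GRing.isZmodMorphism.Build L C phi phiB.
pose m2 := GRing.isMonoidMorphism.Build L C phi phiM.
pose phi' : {rmorphism L -> C} := HB.pack phi m1 m2.
exists phi' => a; rewrite -[phi' _]/(phi _).
by rewrite -(hornerC (a%:A) t) -(map_polyC (in_alg L)) phiE map_polyC hornerC.
Qed.

End Embedding.

Section BaseRings.
Local Open Scope classical_set_scope.

Record absolute_value (R : realType) (E : fieldType) (abs : E -> R) : Prop := AbsoluteValue {
  abs_zero : abs 0 = 0;
  abs_pos : forall x, x != 0 -> 0 < abs x;
  abs_mul : forall x y, abs (x * y) = abs x * abs y;
  abs_add : forall x y, abs (x + y) <= abs x + abs y }.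

(** What the integers and the polynomials over a finite field have in common: the one-dimensional
    form of [global_data], ready to be carried to a Galois extension. *)
Record base_data (A0 : comNzRingType) (F : fieldType) (j : {rmorphism A0 -> F}) (R : realType)
    (absF : F -> R) : Prop := BaseData {
  base_inj : injective j;
  base_bezout : forall x : F, exists a b u v : A0, [/\ j b != 0, x = j a / j b & u * a + v * b = 1];
  base_index : forall a, j a != 0 -> exists2 m, idx (rgA j) (scl (j a) (rgA j)) m & m%:R = absF (j a);
  base_upper : exists2 C : R, 0 < C & forall T : R, 1 <= T -> forall s : seq A0, uniq s ->
    (forall a, a \in s -> absF (j a) <= T) -> (size s)%:R <= C * T;
  base_lower : exists2 c : R, 0 < c & forall T : R, 1 <= T -> exists s : seq A0,
    [/\ uniq s, forall a, a \in s -> absF (j a) <= T & c * T <= (size s)%:R];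
  base_scale : exists2 C : R, 1 <= C & forall T : R, 1 <= T -> exists a, T <= absF (j a) <= C * T }.

Lemma addg_rgA (A0 : comNzRingType) (F : fieldType) (j : {rmorphism A0 -> F}) : addg (rgA j).
Proof.
split; first by exists 0; rewrite rmorph0.
by move=> _ _ [a ->] [b ->]; exists (a - b); rewrite rmorphB.
Qed.

Theorem lattice_data (A0 : comNzRingType) (F E : fieldType) (j : {rmorphism A0 -> F}) (iota : {rmorphism F -> E})
    (gT : finGroupType) (G : {group gT}) (act : gT -> {rmorphism E -> E}) (R : realType)
    (absF : F -> R) (abs : E -> R) : base_data j absF -> absolute_value abs ->
  (forall y, abs (iota y) = absF y) ->
  (forall x, act 1%g x = x) -> (forall g h x, act (g * h)%g x = act h (act g x)) ->
  (forall g y, g \in G -> act g (iota y) = iota y) ->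
  (forall x, (forall g, g \in G -> act g x = x) -> exists y, x = iota y) ->
  (forall g h, g \in G -> h \in G -> (forall x, act g x = act h x) -> g = h) ->
  dedekind (icl j iota) /\
  global_data (icl j iota) (fun (i : 'I_#|G|) (x : E) => abs (act (enum_val i) x)).
Proof.
move=> [j_inj bez idxA up lo sc] [a0 ap aM aD] ext act1 actM actK act_fix faithful.
have [b [Ob db]] := basis_exists act1 actM actK act_fix faithful bez.
have bi a : j a != 0 -> exists m, idx (rgA j) (scl (j a) (rgA j)) m by move/idxA => [m]; exists m.
split; first exact: icl_dedekind act1 actM actK act_fix bez _ Ob db bi.
apply: (lattice_global_data act1 actM actK act_fix bez Ob db bi a0 ap aM aD j_inj).
- move=> a m ja0 hm; rewrite ext; have [m' hm' <-] := idxA _ ja0.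
  congr _%:R; apply: idx_uniq hm hm'; apply: addg_scl; exact: addg_rgA.
- by have [C C0 h] := up; exists C => // T T1 s us sP; apply: h => // a /sP; rewrite ext.
- have [c c0 h] := lo; exists c => // T /h[s [us sP cT]]; exists s; split=> // a /sP.
  by rewrite ext.
- by have [C C1 h] := sc; exists C => // T /h[a ha]; exists a; rewrite ext.
Qed.

Lemma int_base (R : realType) : base_data (intr : {rmorphism int -> rat}) (fun x : rat => `|ratr x| : R).
Proof.
have absE (a : int) : `|ratr (a%:~R : rat)| = (`|a|%N)%:R :> R by rewrite ratr_int -intr_norm pmulrn.
split.
- exact: intr_inj.
- move=> x; have := coprime_num_den x; have [u [v]] := Bezoutz (numq x) (denq x).
  move=> e cop; exists (numq x), (denq x), u, v; split.
  + by rewrite intr_eq0 denq_neq0.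
  + by rewrite divq_num_den.
  + by rewrite e /gcdz (eqP cop).
- move=> a; rewrite /= intr_eq0 => a0; exists `|a|%N; last by rewrite absE.
  exists [seq (k%:Z)%:~R | k <- iota 0 `|a|%N]; split.
  + by rewrite size_map size_iota.
  + split; first by rewrite map_inj_uniq ?iota_uniq // => k k' /intr_inj [].
    move=> _ _ /mapP[k + ->] /mapP[k' + ->]; rewrite !mem_iota /= !add0n => ka k'a [c /=].
    move=> e; have {e} : (k%:Z - k'%:Z)%:~R = (c * a)%:~R :> rat.
      by rewrite rmorphM /= -e divfK ?intr_eq0 // rmorphB.
    move/intr_inj => e; congr (_%:~R); have : (a %| k%:Z - k'%:Z)%Z by apply/dvdzP; exists c.
    rewrite -eqz_mod_dvd => /eqP; rewrite -modz_abs -[X in _ = X]modz_abs => h.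
    have := congr1 absz h; rewrite !modz_nat !absz_nat !modn_small //. by move=> ->.
  + by move=> _ /mapP[k _ ->]; exists k%:Z.
  + move=> _ [x ->]; exists ((modz x a)%:~R).
      apply/mapP; exists `|modz x a|%N; first by rewrite mem_iota /= add0n -ltz_nat gez0_abs ?modz_ge0 // ltz_mod.
      by rewrite gez0_abs // modz_ge0.
    exists (divz x a); rewrite /= -rmorphB /= {1}(divz_eq x a) addrK rmorphM /= mulfK // intr_eq0 //.
- exists 4 => // T T1 s us sP; have T0 : 0 <= T by exact: le_trans T1.
  pose N := Num.truncn T.
  have sub : {subset s <= [seq k%:Z | k <- iota 0 N.+1] ++ [seq - k%:Z | k <- iota 0 N.+1]}.
    move=> a /sP; rewrite absE => h; have : (`|a| <= N)%N by rewrite truncn_ge_nat.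
    rewrite mem_cat; case: (intP a) => [|k|k] hk; apply/orP.
    + by left; apply/mapP; exists 0%N; rewrite // mem_iota.
    + by left; apply/mapP; exists k.+1; rewrite // mem_iota /=; lia.
    + by right; apply/mapP; exists k.+1; rewrite // mem_iota /=; lia.
  have := uniq_leq_size us sub; rewrite size_cat !size_map !size_iota => h.
  have NT : N%:R <= T by rewrite truncn_le.
  apply: le_trans (_ : (N.+1 + N.+1)%:R <= _); first by rewrite ler_nat.
  by rewrite natrD -natr1; lra.
- exists 1 => // T T1; have T0 : 0 <= T by exact: le_trans T1.
  exists [seq k%:Z | k <- iota 0 (Num.truncn T).+1]; split.
  + by rewrite map_inj_uniq ?iota_uniq // => k k' [].
  + move=> _ /mapP[k + ->]; rewrite mem_iota /= add0n ltnS absE absz_nat truncn_ge_nat //.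
  + by rewrite size_map size_iota mul1r ltW // truncnS_gt.
- exists 2 => [|T T1]; first by rewrite ler1n.
  have T0 : 0 <= T by exact: le_trans T1.
  exists (Num.truncn T).+1%:Z; rewrite absE absz_nat ltW ?truncnS_gt //=.
  have NT : (Num.truncn T)%:R <= T by rewrite truncn_le.
  by rewrite -natr1; lra.
Qed.

Lemma archimedean_absolute_value (R : realType) (L : fieldExtType rat) : separable 1 {:L} ->
  exists2 abs : L -> R, absolute_value abs & forall y : rat, abs y%:A = `|ratr y|.
Proof.
move=> sep; have [phi phiE] := field_embedding (ratr : {rmorphism rat -> R[i]}) sep.
exists (fun x => Normc.normc (phi x)); first split.
- by rewrite rmorph0 Normc.normc0.
- move=> x x0; rewrite lt_neqAle; apply/andP; split; last by case: (phi x) => u v; exact: sqrtr_ge0.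
  by apply: contra_neq x0 => /esym/Normc.eq0_normc/eqP; rewrite fmorph_eq0 => /eqP.
- by move=> x y; rewrite rmorphM Normc.normcM.
- by move=> x y; rewrite rmorphD; exact: le_normcD.
- move=> y; rewrite phiE; transitivity (Normc.normc (ratr y : R)%:C%C).
    by congr Normc.normc; rewrite fmorph_rat.
  by rewrite /= expr0n addr0 sqrtr_sqr.
Qed.

End BaseRings.

(** * Absolute values over the polynomial rings *)

Section FunctionFieldBase.
Local Open Scope classical_set_scope.
Variables (k : finFieldType) (F : fieldType) (j : {rmorphism {poly k} -> F}).
Hypothesis j_inj : injective j.
Hypothesis j_frac : forall x, exists a b, j b != 0 /\ x = j a / j b.
Local Notation Q := #|k|.
Implicit Types (a b : {poly k}) (d : nat).

Definition polys m : seq {poly k} := [seq rVpoly v | v : 'rV[k]_m].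

Lemma polysP m (a : {poly k}) : (a \in polys m) = (size a <= m)%N.
Proof.
apply/mapP/idP => [[v _ ->]|h]; first exact: size_poly.
by exists (poly_rV a); rewrite ?mem_enum // poly_rV_K.
Qed.

Lemma polys_uniq m : uniq (polys m).
Proof. by rewrite map_inj_uniq ?enum_uniq //; apply: can_inj; exact: rVpolyK. Qed.

Lemma size_polys m : size (polys m) = (Q ^ m)%N.
Proof. by rewrite size_map -cardT card_mx mul1n. Qed.

Lemma poly_fraction_coprime x : exists a b u v : {poly k},
  [/\ j b != 0, x = j a / j b & u * a + v * b = 1].
Proof.
have [a [b [jb0 ->]]] := j_frac x.
have b0 : b != 0 by apply: contra_neq jb0 => ->; exact: rmorph0.
have ab : (a != 0) || (b != 0) by rewrite b0 orbT.
have d0 : gcdp a b != 0 by rewrite gcdp_eq0 negb_and.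
have /Bezout_eq1_coprimepP[[u v] /= e] := coprimep_div_gcd ab.
have := divpK (dvdp_gcdl a b); have := divpK (dvdp_gcdr a b).
move: (a %/ gcdp a b) (b %/ gcdp a b) e => a' b' e eb ea.
have jd0 : j (gcdp a b) != 0 by rewrite -(rmorph0 j) (inj_eq j_inj).
exists a', b', u, v; split=> //.
  by move: jb0; rewrite -{1}eb rmorphM mulf_eq0 negb_or => /andP[].
by rewrite -{1}ea -{2}eb !rmorphM -mulf_div divff // mulr1.
Qed.

Lemma poly_index a : j a != 0 -> idx (rgA j) (scl (j a) (rgA j)) (Q ^ (size a).-1).
Proof.
move=> ja0; have a0 : a != 0 by apply: contra_neq ja0 => ->; exact: rmorph0.
have sa : (size a).-1.+1 = size a by rewrite prednK // size_poly_gt0.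
exists [seq j c | c <- polys (size a).-1]; split.
- by rewrite size_map size_polys.
- split; first by rewrite map_inj_uniq ?polys_uniq.
  move=> _ _ /mapP[c + ->] /mapP[d + ->]; rewrite !polysP => hc hd [f /= e].
  have {e} e : c - d = f * a by apply: j_inj; rewrite rmorphM -e rmorphB divfK.
  have [f0|f0] := eqVneq f 0; first by move/eqP: e; rewrite f0 mul0r subr_eq0 => /eqP ->.
  have := leq_trans (size_polyD c (- d)) (_ : _ <= (size a).-1)%N.
  rewrite size_polyN geq_max hc hd => /(_ isT); rewrite e size_mul // -sa.
  by have := size_poly_gt0 f; rewrite f0; case: (size f) => // n _; lia.
- by move=> _ /mapP[c _ ->]; exists c.
- move=> _ [c ->]; exists (j (c %% a)).
    by apply/map_f; rewrite polysP -ltnS sa ltn_modp.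
  exists (c %/ a); rewrite /= -rmorphB {1}(divp_eq c a) addrK rmorphM /= mulfK //.
Qed.

Lemma poly_base (R : realType) (absF : F -> R) : absF 0 = 0 ->
  (forall a, a != 0 -> absF (j a) = (Q ^ (size a).-1)%:R) -> base_data j absF.
Proof.
move=> abs0 absE; have Q1 : (1 < Q)%N by exact: finNzRing_gt1.
have ex_log (T : R) : 1 <= T -> exists N, (Q ^ N)%:R <= T /\ T < (Q ^ N.+1)%:R.
  move=> T1; have T0 : 0 <= T by exact: le_trans T1.
  have t0 : (0 < Num.truncn T)%N by rewrite truncn_gt0.
  exists (trunc_log Q (Num.truncn T)); split.
    by rewrite -truncn_ge_nat // trunc_logP.
  by apply: lt_le_trans (truncnS_gt T) _; rewrite ler_nat trunc_log_ltn.
have small (T : R) N a : 1 <= T -> T < (Q ^ N.+1)%:R -> absF (j a) <= T -> a \in polys N.+1.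
  move=> T1 TN h; rewrite polysP; have [->|a0] := eqVneq a 0; first by rewrite size_poly0.
  move: h; rewrite absE // => h; have := le_lt_trans h TN; rewrite ltr_nat ltn_exp2l //.
  by have := size_poly_gt0 a; rewrite a0; lia.
have big (T : R) N a : 1 <= T -> (Q ^ N)%:R <= T -> a \in polys N.+1 -> absF (j a) <= T.
  move=> T1 TN; rewrite polysP; have [->|a0] := eqVneq a 0; first by rewrite rmorph0 abs0 (le_trans _ T1).
  rewrite absE // => h; apply: le_trans TN; rewrite ler_nat leq_exp2l //; lia.
split.
- exact: j_inj.
- exact: poly_fraction_coprime.
- move=> a ja0; exists (Q ^ (size a).-1)%N; first exact: poly_index.
  by rewrite absE //; apply: contra_neq ja0 => ->; exact: rmorph0.
- exists Q%:R => [|T T1 s us sP]; first by rewrite ltr0n ltnW.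
  have [N [NT TN]] := ex_log T T1.
  have := uniq_leq_size us (fun a h => small T N a T1 TN (sP a h)); rewrite size_polys => h.
  apply: le_trans (_ : (Q ^ N.+1)%:R <= _); first by rewrite ler_nat.
  by rewrite expnS natrM ler_wpM2l.
- exists 1 => // T T1; have [N [NT TN]] := ex_log T T1; exists (polys N.+1).
  by split; [exact: polys_uniq|move=> a; exact: big|rewrite size_polys mul1r ltW].
- exists Q%:R => [|T T1]; first by rewrite ler1n ltnW.
  have [N [NT TN]] := ex_log T T1; exists ('X^(N.+1)).
  rewrite absE ?monic_neq0 ?monicXn // size_polyXn /= (ltW TN) /=.
  by rewrite expnS natrM ler_wpM2l.
Qed.

End FunctionFieldBase.

(** * A place at infinity and its absolute value *)

Section InfinitePlaces.
Variables (k : finFieldType) (F : fieldType) (j : {rmorphism {poly k} -> F}).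
Hypothesis j_inj : injective j.
Hypothesis j_frac : forall x, exists a b, j b != 0 /\ x = j a / j b.
Local Notation Q := #|k|.
Implicit Types (a b : {poly k}) (d : nat).
Local Notation T := (j 'X).

(* [jinf a] is [a (1 / T)]: the places at infinity are those above the prime [1 / T] of
   the ring of polynomials in [1 / T]. *)
Definition jinf : {rmorphism {poly k} -> F} := horner_eval T^-1 \o map_poly (j \o polyC).

Definition polyrev d (a : {poly k}) : {poly k} := \poly_(i < d.+1) a`_(d - i).

Lemma T_neq0 : T != 0.
Proof. by rewrite -(rmorph0 j) (inj_eq j_inj) polyX_eq0. Qed.

Lemma jE d a : (size a <= d.+1)%N -> j a = \sum_(i < d.+1) j (a`_i)%:P * T ^+ i.
Proof.
move=> sa; rewrite -{1}(coefK a) (poly_def) rmorph_sum /= (big_ord_widen _ (fun i => j (a`_i *: 'X^i)) sa).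
rewrite big_mkcond /=; apply: eq_bigr => i _; rewrite -mul_polyC rmorphM rmorphXn.
by case: ltnP => // h; rewrite nth_default // polyC0 rmorph0 mul0r.
Qed.

Lemma jinfE d a : (size a <= d.+1)%N -> jinf a = \sum_(i < d.+1) j (a`_i)%:P * T ^- i.
Proof.
move=> sa; rewrite /jinf /= /horner_eval (horner_coef_wide (n := d.+1)); last first.
  by rewrite (leq_trans (size_poly _ _)).
by apply: eq_bigr => i _; rewrite coef_map /= exprVn.
Qed.

Lemma jinf_prev d a : (size a <= d.+1)%N -> j (polyrev d a) = T ^+ d * jinf a.
Proof.
move=> sa; rewrite (jE (d := d)) ?size_poly // (jinfE sa) mulr_sumr.
rewrite (reindex_inj rev_ord_inj) /=; apply: eq_bigr => i _.
have id : (i <= d)%N by rewrite -ltnS.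
rewrite coef_poly subSS ltnS leq_subr subKn // mulrCA; congr (_ * _).
by rewrite expfB_cond ?(negPf T_neq0) ?add0n.
Qed.

Lemma prevK d a : (size a <= d.+1)%N -> polyrev d (polyrev d a) = a.
Proof.
move=> sa; apply/polyP => i; rewrite !coef_poly ltnS.
case: (leqP i d) => id; last by rewrite nth_default //; exact: leq_trans sa id.
by rewrite ltnS leq_subr subKn.
Qed.

Lemma j_prev d a : (size a <= d.+1)%N -> j a = T ^+ d * jinf (polyrev d a).
Proof. by move=> sa; rewrite -jinf_prev ?prevK ?size_poly. Qed.

Lemma jinf_inj : injective jinf.
Proof.
apply: raddf_inj => a a0; have sa := leqnSn (size a).
have : j (polyrev (size a) a) = 0 by rewrite jinf_prev // a0 mulr0.
rewrite -[RHS](rmorph0 j) => /j_inj e; rewrite -(prevK sa) e.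
by apply/polyP => i; rewrite coef_poly !coef0 if_same.
Qed.

Lemma jinfC c : jinf c%:P = j c%:P.
Proof. by rewrite /jinf /= /horner_eval map_polyC hornerC. Qed.

Lemma jinf_frac x : exists a b, jinf b != 0 /\ x = jinf a / jinf b.
Proof.
have [a [b [b0 ->]]] := j_frac x; pose d := maxn (size a) (size b).
have ea := j_prev (leq_trans (leq_maxl (size a) (size b)) (leqnSn d)).
have eb := j_prev (leq_trans (leq_maxr (size a) (size b)) (leqnSn d)).
exists (polyrev d a), (polyrev d b); split.
  by move: b0; rewrite eb mulf_eq0 negb_or => /andP[].
by rewrite ea eb -mulf_div divff ?mul1r // expf_neq0 // T_neq0.
Qed.

Lemma jinf_X : jinf 'X = T^-1.
Proof. by rewrite /jinf /= /horner_eval map_polyX hornerX. Qed.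

Lemma jinf_bezout x : exists a b u v : {poly k},
  [/\ jinf b != 0, x = jinf a / jinf b & u * a + v * b = 1].
Proof. exact: (poly_fraction_coprime jinf_inj jinf_frac). Qed.

Lemma T_notin a : T <> jinf a.
Proof.
move=> e; have := jinf_prev (leqnSn (size a)); rewrite -e -exprSr -rmorphXn => /j_inj h.
have sr : (size (polyrev (size a) a) <= (size a).+1)%N by exact: size_poly.
by move: sr; rewrite h size_polyXn ltnn.
Qed.

Section PlaceAtInfinity.
Variables (E : fieldType) (iota : {rmorphism F -> E}).
Local Notation O' := (icl jinf iota).
Hypothesis dO : dedekind O'.

(** T is not a polynomial in 1 / T, so 1 / T is not a unit of the integral closure and some place is
    positive on it. A polynomial of degree d is T^d times a polynomial in 1 / T with nonzero
    constant term, and the latter has valuation 0. *)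
Lemma infinite_place : exists w : place E, 0 < w (iota T^-1) /\
  forall a, a != 0 -> w (iota (j a)) = - w (iota T^-1) * (size a).-1%:Z.
Proof.
pose t := iota T^-1; have t0 : t != 0 by rewrite fmorph_eq0 invr_eq0 T_neq0.
have Ot : O' t by rewrite /t -jinf_X; exact: icl_base.
have Oconst c : O' (iota (j c%:P)).
  by rewrite -jinfC; exact: icl_base.
pose I := [set x : E | O' (x / t)]%classic.
have idI : ideal O' I.
  split; rewrite /I /=.
  - by rewrite mul0r; exact: icl0.
  - by move=> x y Ix Iy; rewrite mulrBl; exact: iclB.
  - by move=> a x Oa Ix; rewrite -mulrA; exact: iclM.
  - by move=> x Ix; rewrite -[x](divfK t0); exact: iclM.
have I1 : ~ I 1.
  rewrite /I /= mul1r /t -fmorphV invrK => h.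
  have [a] := icl_fix (jinf_bezout) h; exact: T_notin.
have It : I t by rewrite /I /= divff //; exact: icl1.
have [w [fw Iw]] := ex_place dO idI I1 It t0.
have wt : 0 < w t by have := Iw t It; rewrite vgeE // -gtz0_ge1.
exists w; split=> // a a0.
have wc c : c != 0 -> w (iota (j c%:P)) = 0.
  move=> c0; have jc0 : iota (j c%:P) != 0.
    by rewrite fmorph_eq0 -(rmorph0 j) (inj_eq j_inj) polyC_eq0.
  apply/eqP; rewrite eq_le; apply/andP; split; last by apply: (elimT (finP _ _) fw).
  rewrite -oppr_ge0 -valV -fmorphV.
  have -> : (j c%:P)^-1 = j (c^-1)%:P.
    by apply: (mulIf (x := j c%:P)); [rewrite -(rmorph0 j) (inj_eq j_inj) polyC_eq0|
      rewrite mulVf -?rmorphM -?polyCM ?mulVf ?rmorph1 // -(rmorph0 j) (inj_eq j_inj) polyC_eq0].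
  by apply: (elimT (finP _ _) fw).
have sa : (size a <= (size a).-1.+1)%N by exact: leqSpred.
pose c := polyrev (size a).-1 a; have c0 : c`_0 = lead_coef a by rewrite coef_poly subn0.
have lc0 : lead_coef a != 0 by rewrite lead_coef_eq0.
have jc : w (iota (jinf c)) = 0.
  pose c' : {poly k} := \poly_(i < size a) c`_i.+1.
  have cE : c = c' * 'X + (c`_0)%:P.
    apply/polyP => -[|i]; rewrite coefD coefMX coefC ?add0r //= addr0.
    have -> : c'`_i = if (i < size a)%N then c`_i.+1 else 0 by rewrite coef_poly.
    by case: ltnP => // h; rewrite /c coef_poly; case: ltnP => // h'; lia.
  have cstE := jinfC (lead_coef a).
  have i0 : iota (j (lead_coef a)%:P) != 0.
    by rewrite fmorph_eq0 -(rmorph0 j) (inj_eq j_inj) polyC_eq0.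
  rewrite -(wc _ lc0); have [] // : iota (jinf c) != 0 /\ w (iota (jinf c)) = w (iota (j (lead_coef a)%:P)).
  apply: val_close => //; rewrite wc // add0r.
  have -> : iota (jinf c) - iota (j (lead_coef a)%:P) = iota (jinf c') * t.
    by rewrite {1}cE c0 !(rmorphD, rmorphM) cstE addrK jinf_X.
  by apply: Iw; rewrite /I /= mulfK //; exact: icl_base.
rewrite (j_prev sa) rmorphM valM.
- by rewrite -/c jc addr0 rmorphXn valX -valV -fmorphV invrK -mulr_natr natz.
- by rewrite fmorph_eq0 expf_neq0 // T_neq0.
- rewrite fmorph_eq0 -(rmorph0 jinf) (inj_eq jinf_inj); apply: contra_neq lc0; rewrite -c0 -/c => ->.
  by rewrite coef0.
Qed.

Lemma infinite_absolute_value (R : realType) : exists2 abs : E -> R, absolute_value abs &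
  forall a, a != 0 -> abs (iota (j a)) = (Q ^ (size a).-1)%:R.
Proof.
have [w [e0 wE]] := infinite_place; set e := w (iota T^-1) in e0 wE.
have Q1 : (1 < Q)%N by exact: finNzRing_gt1.
have eR : 0 < e%:~R :> R by rewrite ltr0z.
(* Normalised by q^e = Q, so that the absolute value extends a -> Q^(deg a) without change. *)
pose q : R := Q%:R `^ (e%:~R)^-1.
have q1 : 1 < q.
  rewrite /q -[ltLHS](congr1 (fun f => f (e%:~R)^-1) (powR1 R)); apply: gt0_ltr_powR; rewrite ?invr_gt0 ?nnegrE //.
  by rewrite ltr1n.
have q0 : 0 < q by exact: lt_trans q1.
have qe : q ^ e = Q%:R.
  rewrite -[e]gez0_abs ?ltW // -exprnP -powR_mulrn ?powR_ge0 // /q -powRrM.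
  by rewrite -[X in _^-1 * X]/((`|e|%N)%:~R) gez0_abs ?ltW // mulVf ?gt_eqF // powRr1.
exists (fun x => if x == 0 then 0 else q ^ (- w x)); first split.
- by rewrite eqxx.
- by move=> x x0; rewrite (negPf x0) exprz_gt0.
- move=> x y; rewrite mulf_eq0; have [->|x0] := eqVneq x 0; first by rewrite /= mul0r.
  have [->|y0] := eqVneq y 0; first by rewrite orbT mulr0.
  by rewrite /= valM // opprD expfzDr // gt_eqF.
- move=> x y; have [->|x0] := eqVneq x 0; first by rewrite !add0r.
  have [->|y0] := eqVneq y 0; first by rewrite !addr0 (negPf x0).
  have px := exprz_gt0 (- w x) q0; have py := exprz_gt0 (- w y) q0.
  have [xy0|xy0] := eqVneq (x + y) 0; first by rewrite addr_ge0 ?ltW.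
  have [_ _ /(_ x y x0 y0 xy0) h _] := place_dval w.
  move: h; rewrite ge_min => /orP[h|h].
    by apply: le_trans (_ : q ^ (- w x) <= _); [rewrite ler_eXz2l // lerN2|rewrite lerDl ltW].
  by apply: le_trans (_ : q ^ (- w y) <= _); [rewrite ler_eXz2l // lerN2|rewrite lerDr ltW].
- move=> a a0; have ja0 : iota (j a) != 0 by rewrite fmorph_eq0 -(rmorph0 j) (inj_eq j_inj).
  by rewrite (negPf ja0) wE // mulNr opprK -exprz_exp qe -exprnP natrX.
Qed.

End PlaceAtInfinity.

End InfinitePlaces.

Lemma fraction_ratio (R : idomainType) (x : {fraction R}) :
  exists a b : R, (tofrac b : {fraction R}) != 0 /\ x = tofrac a / tofrac b.
Proof.
elim/quotW: x => r; exists (\n_r), (\d_r).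
have d0 : (tofrac \d_r : {fraction R}) != 0 by rewrite tofrac_eq0 denom_ratioP.
split=> //; apply: (mulIf d0); rewrite divfK //; apply/eqP.
rewrite !piE /FracField.mulf !numden_Ratio ?oner_eq0 ?mulf_neq0 ?denom_ratioP // !FracField.equivfE.
by rewrite !numden_Ratio ?mulr1 ?oner_eq0 ?denom_ratioP // mulrC.
Qed.

(** * Comparison of torsion subgroups *)

Section Torsion.

Definition torsion (V : finZmodType) (k : nat) : {set V} := [set x | x *+ k == 0].

Definition natmulf (V : zmodType) k (x : V) : V := x *+ k.

Lemma natmulf_is_additive (V : zmodType) k : zmod_morphism (@natmulf V k).
Proof. by move=> x y; rewrite /natmulf mulrnBl. Qed.

HB.instance Definition _ (V : zmodType) k :=
  GRing.isZmodMorphism.Build V V (@natmulf V k) (@natmulf_is_additive V k).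

Lemma sgT (V : finZmodType) : sg [set: V].
Proof. by split=> [|x y _ _]; rewrite finset.in_setT. Qed.

End Torsion.

(** * Finite modules linked by extension and norm maps *)

Section ClassGroupBounds.
Variables (A B C : finZmodType) (j : {additive B -> A}) (n : {additive A -> B}).
Variables (j1 : {additive C -> A}) (n1 : {additive A -> C}) (sigma tau : {additive A -> A}).
Variables (l r z q : nat).
Hypotheses (lpr : prime l) (r_gt0 : (0 < r)%N) (rl : (r < l)%N).
Hypotheses (tau_l : forall x, iter l tau x = x) (sigma_r : forall x, iter r sigma x = x).
Hypotheses (tau_sigma : forall x, tau (sigma x) = sigma (iter z tau x)).
Hypotheses (zr : (z ^ r = 1 %[mod l])%N) (zi : forall i, (0 < i < r)%N -> (z ^ i != 1 %[mod l])%N).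
Hypotheses (tau_j : forall b, tau (j b) = j b) (j_n : forall x, j (n x) = \sum_(t < l) iter t tau x).
Hypothesis j_ker : (#|[set b | j b == 0%R]| <= q)%N.
Hypothesis j_coker : (#|[set x | tau x == x]| <= q * #|j @: [set: B]|)%N.
Hypothesis n_index : (#|[set: B]| <= l * #|n @: [set: A]|)%N.
Hypotheses (sigma_j1 : forall c, sigma (j1 c) = j1 c) (n1_j1 : forall c, n1 (j1 c) = c *+ r).
Hypothesis j1_n1 : forall x, j1 (n1 x) = \sum_(t < r) iter t sigma x.

Lemma sg_torsion (V : finZmodType) k : sg (torsion V k).
Proof.
split; first by rewrite inE mul0rn.
by move=> x y; rewrite !inE mulrnBl => /eqP -> /eqP ->; rewrite subr0.
Qed.

Lemma sg_fix : sg [set x | tau x == x].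
Proof.
split; first by rewrite inE raddf0.
by move=> x y; rewrite !inE raddfB => /eqP -> /eqP ->.
Qed.

Lemma torsion_base_le : (#|torsion B l| <= q * #|[set x in torsion A l | tau x == x]|)%N.
Proof.
rewrite (card_im j (sg_torsion _ _)) mulnC; apply: leq_mul.
  apply: leq_trans j_ker; apply: subset_leq_card; apply/fintype.subsetP => b.
  by rewrite !inE => /andP[].
apply: subset_leq_card; apply/fintype.subsetP => _ /imsetP[b + ->].
by rewrite !inE tau_j eqxx andbT -raddfMn => /eqP ->; rewrite raddf0.
Qed.

(** One factor [q] is the index of the image of [j] in the fixed part. The other is the kernel of
    [j]: when j b is l-torsion, b *+ l need only lie in that kernel. *)
Lemma fixed_torsion_le : (#|[set x in torsion A l | tau x == x]| <= q * (q * #|torsion B l|))%N.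
Proof.
have sF : sg [set x in torsion A l | tau x == x].
  have -> : [set x in torsion A l | tau x == x] = torsion A l :&: [set x | tau x == x].
    by apply/setP => x; rewrite !inE.
  by apply: sgI; [exact: sg_torsion|exact: sg_fix].
have := card_cap sF sg_fix (sg_im j (@sgT B)) _ _ j_coker => h; apply: leq_trans (h _ _) _.
- by apply/fintype.subsetP => x; rewrite !inE => /andP[].
- by apply/fintype.subsetP => _ /imsetP[b _ ->]; rewrite inE tau_j.
rewrite leq_mul2l; apply/orP; right; pose X := [set b | j b *+ l == 0].
have sX : sg X.
  split; first by rewrite inE raddf0 mul0rn.
  by move=> x y; rewrite !inE raddfB mulrnBl => /eqP -> /eqP ->; rewrite subr0.
apply: leq_trans (_ : #|X| <= _)%N.
  apply: leq_trans (leq_imset_card j X); apply: subset_leq_card; apply/fintype.subsetP => x.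
  by rewrite !inE => /andP[/andP[xl _] /imsetP[b _ xb]]; rewrite xb imset_f // inE -xb.
rewrite (card_im (@natmulf B l) sX); apply: leq_mul.
  apply: leq_trans j_ker; apply: subset_leq_card; apply/fintype.subsetP => _ /imsetP[b + ->].
  by rewrite !inE /natmulf raddfMn.
by apply: subset_leq_card; apply/fintype.subsetP => b; rewrite !inE => /andP[].
Qed.

Lemma norm_fix : (#|[set x | tau x == x]| <= q * l * #|[set (\sum_(t < l) iter t tau x)%R | x : A]|)%N.
Proof.
apply: leq_trans j_coker _; rewrite -mulnA leq_mul2l; apply/orP; right.
have := card_im_le j (@sgT B) (sg_im n (@sgT A)) (finset.subsetT _) n_index.
rewrite -imset_comp; have -> // : (j \o n) @: [set: A] = [set \sum_(t < l) iter t tau x | x : A].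
by apply/setP => y; apply/imsetP/imsetP => -[x _ ->]; exists x => //=; rewrite j_n.
Qed.

Let N x := \sum_(t < l) iter t tau x.

Lemma iter_tau_Mn t x k : iter t tau (x *+ k) = iter t tau x *+ k.
Proof. by elim: t => //= t ->; rewrite raddfMn. Qed.

(** Multiplication by [e], which is 1 modulo M = l^(m+1) and 0 modulo the part of the order of A
    prime to l, projects A onto its l-primary part and commutes with tau, so it carries [norm_fix]
    over. *)
Lemma norm_fix_primary : exists m,
  (#|[set x in [set x0 : A | x0 *+ l ^ m.+1 == 0%R] | tau x == x]| <=
   q * l * #|[set (\sum_(t < l) iter t tau x)%R | x : A & x *+ l ^ m.+1 == 0%R]|)%N.
Proof.
pose m := logn l #|A|; exists m; set M := (l ^ m.+1)%N.
have A0 : (0 < #|A|)%N by apply/card_gt0P; exists 0.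
have [h lh Ah] := pfactor_coprime lpr A0.
have kA (x : A) : x *+ #|A| = 0.
  have := expg_cardG (finset.in_setT x); rewrite cardsT.
  by rewrite -FinRing.zmodXgE.
have Mx (x : A) : x *+ h *+ M = 0 by rewrite -mulrnA /M expnS mulnCA -Ah mulnC mulrnA kA mul0rn.
have cop : coprime M h by rewrite /M coprimeXl.
pose e := chinese M h 1 0.
have eM : (e = 1 %[mod M])%N by exact: chinese_modl.
have eh : (h %| e)%N by rewrite /dvdn (chinese_modr cop) mod0n.
have eP (x : A) : x *+ M = 0 -> x *+ e = x.
  move=> xM; have /eqP := eM; have M1 : (1 <= e)%N.
    rewrite lt0n; apply: contraPneq eM => ->; rewrite mod0n modn_small //.
    by apply: leq_trans (prime_gt1 lpr) _; rewrite /M expnS leq_pmulr // expn_gt0 prime_gt0.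
  rewrite (eqn_mod_dvd _ M1) => /dvdnP[k ke]; rewrite -[e](subnK M1) ke mulrnDr mulr1n mulnC mulrnA xM.
  by rewrite mul0rn add0r.
have eT (x : A) : x *+ e *+ M = 0 by case/dvdnP: eh => k ->; rewrite mulrnA Mx.
pose f := (@natmulf A e); have fE y : f y = y *+ e by [].
have sN : sg [set N x | x : A].
  split; first by apply/imsetP; exists 0 => //; rewrite /N big1 // => t _; rewrite -[0](mulr0n 0) iter_tau_Mn mulr0n.
  move=> _ _ /imsetP[x _ ->] /imsetP[y _ ->]; apply/imsetP; exists (x - y) => //.
  rewrite /N -sumrB; apply: eq_bigr => t _; elim: (nat_of_ord t) => //= i <-; by rewrite raddfB.
have NF : [set N x | x : A] \subset [set x | tau x == x].
  apply/fintype.subsetP => _ /imsetP[x _ ->]; rewrite inE /N -j_n tau_j //.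
have := card_im_le f sg_fix sN NF norm_fix.
have -> : f @: [set x | tau x == x] = [set x in [set x0 : A | x0 *+ M == 0%R] | tau x == x].
  apply/setP => x; rewrite !inE; apply/imsetP/andP => [[y + ->]|[/eqP xM tx]].
    by rewrite inE => /eqP ty; rewrite fE eT eqxx raddfMn ty.
  by exists x; rewrite ?inE // fE eP.
congr (_ <= _ * _)%N; apply: eq_card => y; apply/imsetP/imsetP => -[x].
  move=> /imsetP[x' _ ->] ->; exists (x' *+ e); first by rewrite inE eT.
  by rewrite -[LHS]/(N x' *+ e) /N -sumrMnl; apply: eq_bigr => t _; rewrite iter_tau_Mn.
rewrite inE => /eqP xM ->; exists (N x); first by apply: imset_f.
by rewrite -[RHS]/(N x *+ e) /N -sumrMnl; apply: eq_bigr => t _; rewrite -iter_tau_Mn eP.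
Qed.

Lemma card_torsion_intermediate : #|torsion C l| = #|[set x in torsion A l | sigma x == x]|.
Proof.
have rc : coprime l r by rewrite prime_coprime // gtnNdvd.
have [k lk] : exists k, (r * k = 1 %[mod l])%N.
  have [k [u [v e]]] : exists k u v, (r * k + v * l = 1 + u * l)%N.
    have [km kn e _] := egcdnP l r_gt0; exists km, kn, 0%N; rewrite mul0n addn0 mulnC e.
    by rewrite gcdnC (eqP rc) addnC.
  by exists k; rewrite -(modnMDl v) addnC mulnC in e *; rewrite -(modnMDl u 1) addnC [(u * l + 1)%N]addnC -e addnC.
have rk (V : zmodType) (x : V) : x *+ l = 0 -> x *+ r *+ k = x.
  move=> xl; have mE a : x *+ a = x *+ (a %% l).
    by rewrite {1}(divn_eq a l) mulrnDr mulnC mulrnA xl mul0rn add0r.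
  by rewrite -mulrnA mE lk -mE.
rewrite -(card_in_imset (f := j1)); last first.
  move=> c d; rewrite !inE => /eqP cl /eqP dl e.
  by rewrite -(rk _ c cl) -(rk _ d dl) -!n1_j1 e.
apply: eq_card => x; rewrite !inE; apply/imsetP/andP => [[c + ->]|[/eqP xl /eqP sx]].
  by rewrite inE sigma_j1 eqxx -raddfMn => /eqP ->; rewrite raddf0.
have it t : iter t sigma x = x by elim: t => //= t ->.
exists (n1 x *+ k); first by rewrite inE mulrnAC -(raddfMn n1) xl raddf0 mul0rn.
rewrite raddfMn j1_n1 (eq_bigr (fun=> x)) => [|t _]; last by rewrite it.
by rewrite sumr_const card_ord rk.
Qed.

Theorem torsion_lower : (#|torsion B l| <= q * (((q * l) ^ r * #|torsion C l|) ^ (2 ^ r)))%N.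
Proof.
have [m hm] := norm_fix_primary.
apply: leq_trans torsion_base_le _; rewrite leq_mul2l card_torsion_intermediate; apply/orP; right.
exact: fixed_bound hm.
Qed.

Theorem torsion_upper : (#|torsion C l| <= (q * (q * #|torsion B l|)) ^ l)%N.
Proof.
rewrite card_torsion_intermediate; apply: leq_trans (_ : #|torsion A l| <= _)%N.
  by apply: subset_leq_card; apply/fintype.subsetP => x; rewrite inE => /andP[].
apply: leq_trans (torsion_bound lpr tau_l) _.
by rewrite leq_exp2r ?prime_gt0 //; exact: fixed_torsion_le.
Qed.

End ClassGroupBounds.

Section FiniteZmodules.

(** An alias of [V] that remembers a list of all its elements, on which the finite group structure
    is then declared. *)
Definition fin_zmod_of (V : zmodType) (s : seq V) (h : forall x, x \in s) : Type := V.

Section Instances.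
Variables (V : zmodType) (s : seq V) (h : forall x, x \in s).
Local Notation T := (fin_zmod_of h).

HB.instance Definition _ := GRing.Zmodule.copy T V.

Lemma fin_zmod_pickleK : pcancel (fun x : T => index (x : V) s) (fun i => if (i < size s)%N then Some (nth 0 s i : T) else None).
Proof. by move=> x; rewrite index_mem h nth_index. Qed.

HB.instance Definition _ := Countable.copy T (pcan_type fin_zmod_pickleK).

Lemma fin_zmod_enumP : Finite.axiom (undup s : seq T).
Proof. by move=> x; rewrite count_uniq_mem ?undup_uniq // mem_undup h. Qed.

HB.instance Definition _ := isFinite.Build T fin_zmod_enumP.

End Instances.

Definition torsion_list (V : zmodType) (l : nat) (s : seq V) :=
  uniq s /\ forall x, (x \in s) = (x *+ l == 0).

Lemma torsion_list_ex (V : zmodType) (s : seq V) (h : forall x, x \in s) (l : nat) :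
  exists2 t : seq V, torsion_list l t & size t = #|torsion (fin_zmod_of h : finZmodType) l|.
Proof.
pose A : finZmodType := fin_zmod_of h.
exists (enum (torsion A l)); last by rewrite [RHS]cardE.
split=> [|x]; first exact: enum_uniq.
by have := mem_enum (torsion A l) x; rewrite inE.
Qed.

Lemma finite_of_kernel (V W : zmodType) (f : V -> W) (q : nat) (s : seq W) : zmod_morphism f ->
  (forall x, x \in s) ->
  (forall t, uniq t -> (forall c, c \in t -> f c = 0) -> (size t <= q)%N) ->
  exists t : seq V, forall c, c \in t.
Proof.
move=> fB hs hq.
have [|k [uk kP hk]] := @finite_of_bound V [set c | f c = 0]%classic q; first by move=> t; exact: hq.
have /choice[g gP] : forall y : W, exists x : V, (exists z, f z = y) -> f x = y.
  by move=> y; case: (pselect (exists z, f z = y)) => [[z zy]|n]; [exists z|exists 0].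
exists [seq g y + c | y <- s, c <- k] => c.
apply/allpairsP; exists (f c, c - g (f c)); split=> //=; last by rewrite addrC subrK.
by apply: hk; rewrite /= fB gP ?subrr //; exists c.
Qed.

Lemma big_cycle (V : nmodType) (gT : finGroupType) (x : gT) (F : gT -> V) :
  \sum_(g in <[x]>%g) F g = \sum_(t < #[x]%g) F (x ^+ t)%g.
Proof.
have -> : <[x]>%g = [set (x ^+ (t : 'I_#[x]%g))%g | t : 'I_#[x]%g].
  apply/setP => y; apply/cycleP/imsetP => [[i ->]|[t _ ->]]; last by exists t.
  have it : (i %% #[x]%g < #[x]%g)%N by rewrite ltn_mod order_gt0.
  by exists (Ordinal it); rewrite //= expg_mod_order.
rewrite big_imset //= => t t' _ _ /eqP; rewrite eq_expg_mod_order !modn_small ?ltn_ord //.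
by move/eqP => e; exact: val_inj.
Qed.

End FiniteZmodules.

(** * The class groups below L *)

Section TowerBound.
Local Open Scope classical_set_scope.
Variables (L K1 K2 : fieldType) (i1 : {rmorphism K1 -> L}) (i2 : {rmorphism K2 -> L}).
Variables (gT : finGroupType) (act : gT -> {rmorphism L -> L}).
Hypothesis act1 : forall x, act 1%g x = x.
Hypothesis actM : forall g h x, act (g * h)%g x = act h (act g x).
Hypothesis faithful : forall g, (forall x, act g x = x) -> g = 1%g.
Variables (sigma tau : gT) (l r z n : nat).
Local Notation H := <[tau]>%G.
Local Notation D := <[sigma]>%G.
Hypotheses (lpr : prime l) (r_gt1 : (1 < r)%N) (rl : (r < l)%N).
Hypotheses (ord_tau : #[tau]%g = l) (ord_sigma : #[sigma]%g = r).
Hypothesis st : (sigma * tau = tau ^+ z * sigma)%g.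
Hypotheses (zr : (z ^ r = 1 %[mod l])%N) (zi : forall i, (0 < i < r)%N -> (z ^ i != 1 %[mod l])%N).
Hypothesis actK2 : forall g y, g \in H -> act g (i2 y) = i2 y.
Hypothesis fix2 : forall x, (forall g, g \in H -> act g x = x) -> exists y, x = i2 y.
Hypothesis actK1 : forall g y, g \in D -> act g (i1 y) = i1 y.
Hypothesis fix1 : forall x, (forall g, g \in D -> act g x = x) -> exists y, x = i1 y.
Hypothesis H90 : forall a, \prod_(g in H) act g a = 1 -> exists2 b, b != 0 & a = b / act tau b.
Variables (OL : set L) (dL : dedekind OL).
Hypothesis OLact : forall g x, OL x -> OL (act g x).
Local Notation O1 := (restrO i1 OL).
Local Notation O2 := (restrO i2 OL).
Hypothesis den2 : forall x, exists d, [/\ d != 0, O2 d & OL (i2 d * x)].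
Hypothesis den1 : forall x, exists d, [/\ d != 0, O1 d & OL (i1 d * x)].
Variables (R : realType) (JL J2 : finType) (nrmL : JL -> L -> R) (nrm2 : J2 -> K2 -> R).
Hypotheses (gdL : global_data OL nrmL) (gd2 : global_data O2 nrm2) (JLn : #|JL| = n).
Variables (p1 : place K1) (p2 : place K2) (pL : place L).
Hypothesis unram : forall w, fin OL w -> ramw i2 p2 w = 1%N.

Let OLH g x : g \in H -> OL x -> OL (act g x). Proof. by move=> _; exact: OLact. Qed.
Let OLD g x : g \in D -> OL x -> OL (act g x). Proof. by move=> _; exact: OLact. Qed.
Let OLT g x : g \in [set: gT]%G -> OL x -> OL (act g x). Proof. by move=> _; exact: OLact. Qed.
Let inT (g : gT) : g \in [set: gT]%G. Proof. exact: finset.in_setT. Qed.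
Let d2 : dedekind O2 := restr_dedekind dL den2.
Let d1 : dedekind O1 := restr_dedekind dL den1.
Let q := (l ^ n.+1)%N.

Local Notation gcc := (gc act1 actM (OL := OL)).

Lemma iter_gc g t c : iter t (gcc g) c = gcc (g ^+ t)%g c.
Proof.
elim: t => [|t IH] /=; first by rewrite expg0 (gc1 act1 actM OLT).
by rewrite IH (gcM act1 actM OLT) // expgSr.
Qed.

Lemma cycle_sum g c : \sum_(h in <[g]>%G) gcc h c = \sum_(t < #[g]%g) iter t (gcc g) c.
Proof. by rewrite big_cycle; apply: eq_bigr => t _; rewrite iter_gc. Qed.

Let uL : unit_bound OL l q.
Proof. by rewrite /q -JLn; apply: (global_unit_bound gdL); exact: prime_gt1. Qed.

Theorem tower_bound : exists (s1 : seq (Clf O1)) (s2 : seq (Clf O2)),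
  [/\ torsion_list l s1, torsion_list l s2,
      (size s2 <= q * ((q * l) ^ r * size s1) ^ (2 ^ r))%N &
      (size s1 <= (q * (q * size s2)) ^ l)%N].
Proof.
have [sA hA] := class_group_finite dL gdL.
have [sB hB] := class_group_finite d2 gd2.
have jB_add := jc_additive act1 actM fix2 dL OLH p2.
have nB_add := nc_additive act1 actM actK2 fix2 dL OLH den2 p2 pL.
have jC_add := jc_additive act1 actM fix1 dL OLD p1.
have nC_add := nc_additive act1 actM actK1 fix1 dL OLD den1 p1 pL.
have g_add g := gc_additive act1 actM OLT (inT g).
have ordD : #|D| = r by rewrite -ord_sigma.
have ordH : #|H| = l by rewrite -ord_tau.
(* K1 is not normal over F, so the finiteness of its class group is deduced from that of L through
   the bounded kernel of the extension map. *)
have [sC hC] : exists sC : seq (Clf O1), forall c, c \in sC.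
  apply: (finite_of_kernel jC_add hA) => t ut tk.
  apply: (ker_bound act1 actM actK1 fix1 dL OLD den1 (tau := sigma) erefl _ ut tk).
  by rewrite ordD; exact: (global_unit_bound gdL).
pose A : finZmodType := fin_zmod_of hA; pose B : finZmodType := fin_zmod_of hB.
pose C : finZmodType := fin_zmod_of hC.
pose mkadd (U V : zmodType) (f : U -> V) (fB : zmod_morphism f) : {additive U -> V} :=
  HB.pack f (GRing.isZmodMorphism.Build U V f fB).
pose j : {additive B -> A} := mkadd B A _ jB_add.
pose nn : {additive A -> B} := mkadd A B _ nB_add.
pose j1 : {additive C -> A} := mkadd C A _ jC_add.
pose n1 : {additive A -> C} := mkadd A C _ nC_add.
pose sg : {additive A -> A} := mkadd A A _ (g_add sigma).
pose ta : {additive A -> A} := mkadd A A _ (g_add tau).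
have tau_l x : iter l ta x = x.
  by rewrite -[LHS]/(iter l (gcc tau) x) iter_gc -ord_tau expg_order (gc1 act1 actM OLT).
have sigma_r x : iter r sg x = x.
  by rewrite -[LHS]/(iter r (gcc sigma) x) iter_gc -ord_sigma expg_order (gc1 act1 actM OLT).
have tau_sigma x : ta (sg x) = sg (iter z ta x).
  rewrite -[LHS]/(gcc tau (gcc sigma x)) -[RHS]/(gcc sigma (iter z (gcc tau) x)) iter_gc.
  by rewrite !(gcM act1 actM OLT) // st.
have tau_j b : ta (j b) = j b by apply: (gc_jc act1 actM actK2 fix2 dL OLH); exact: cycle_id.
have j_n x : j (nn x) = \sum_(t < l) iter t ta x.
  have := jc_nc act1 actM actK2 fix2 dL OLH den2 p2 pL x; rewrite cycle_sum ord_tau; exact.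
have sigma_j1 c : sg (j1 c) = j1 c by apply: (gc_jc act1 actM actK1 fix1 dL OLD); exact: cycle_id.
have n1_j1 c : n1 (j1 c) = c *+ r.
  by have := nc_jc act1 actM actK1 fix1 dL OLD den1 p1 pL c; rewrite ordD; exact.
have j1_n1 x : j1 (n1 x) = \sum_(t < r) iter t sg x.
  have := jc_nc act1 actM actK1 fix1 dL OLD den1 p1 pL x; rewrite cycle_sum ord_sigma; exact.
have j_ker : (#|[set b : B | j b == 0%R]%SET| <= q)%N.
  rewrite cardE; apply: (ker_bound act1 actM actK2 fix2 dL OLH den2 (p0 := p2) (tau := tau) erefl).
  - by rewrite ordH.
  - exact: enum_uniq.
  - move=> c ck; have : (c : B) \in [set b : B | j b == 0%R]%SET by rewrite -mem_enum.
    by rewrite inE => /eqP.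
have j_coker : (#|[set x : A | ta x == x]%SET| <= q * #|j @: [set: B]%SET|)%N.
  apply: card_transversal; [exact: sg_fix|exact: sg_im (@sgT B)|] => s us sX sY.
  apply: (coker_bound actK2 fix2 dL OLH den2 pL (tau := tau) erefl H90 unram _ us).
  - by rewrite ordH.
  - by move=> c /sX; rewrite inE => /eqP.
  - by move=> c d cs ds [k e]; apply: sY => //; rewrite e; apply/imsetP; exists k.
have n_index : (#|[set: B]%SET| <= l * #|nn @: [set: A]%SET|)%N.
  apply: card_transversal; [exact: sgT|exact: sg_im (@sgT A)|] => s us _ sY.
  pose N : set (Clf O2) := [set c | exists x, c = nc i2 H act1 actM p2 pL x].
  have addN : addg N.
    split; first by exists 0; have := raddf0 nn => /esym.
    by move=> _ _ [x ->] [y ->]; exists (x - y); rewrite nB_add.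
  apply: (norm_index d2 dL gd2 gdL lpr (N := N) (res := resw i2 p2) addN _ _ _ _ _ us).
  - move=> c; exists (jc p2 c); have := nc_jc act1 actM actK2 fix2 dL OLH den2 p2 pL c; rewrite ordH.
    by move=> ->.
  - by move=> w; exact: (fin_resw act1 actM fix2 dL OLH).
  - move=> t v ut tv; case: t ut tv => [|w0 t] ut tv; first by [].
    have [fw0 rw0] := tv w0 (mem_head _ _).
    rewrite -ordH cardE -(size_map (fun g => gact act1 actM g w0)); apply: uniq_leq_size ut _ => w wt.
    have [fw rw] := tv w wt.
    have [g gH ->] := resw_trans act1 actM fix2 dL OLH fw0 fw (etrans rw0 (esym rw)).
    by apply: map_f; rewrite mem_enum.
  - by move=> w fw; exact: (Nv_resw act1 actM fix2 dL OLH den2).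
  - move=> w fw nNw; have rw := unram fw.
    (* A trivial decomposition group would make the class below [w] a norm; a nontrivial one
       enlarges the residue field. *)
    case: (pselect (forall g, g \in H -> gact act1 actM g w = w -> g = 1%g)) => [h|].
      exfalso; apply: nNw; exists (cls OL << w >>); exact: (split_norm actK2 fix2 dL OLH den2 pL fw rw h).
    move/existsNP => [g] /not_implyP[gH] /not_implyP[gw g1].
    apply: (inert_Nv actK2 fix2 dL OLH den2 fw rw gH gw).
    by apply/not_existsP => h; apply: g1; apply: faithful => x; apply/eqP; apply: contra_notT (h x).
  - by move=> c d cs ds [x e]; apply: sY => //; rewrite e; apply/imsetP; exists x.
have [s1 t1 z1] := torsion_list_ex hC l; have [s2 t2 z2] := torsion_list_ex hB l.
exists s1, s2; split=> //; rewrite z1 z2.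
  exact: (torsion_lower lpr (ltnW r_gt1) rl tau_l sigma_r tau_sigma zr zi tau_j j_n j_ker j_coker n_index
    sigma_j1 n1_j1 j1_n1).
exact: (torsion_upper lpr (ltnW r_gt1) rl tau_l tau_j j_ker j_coker sigma_j1 n1_j1 j1_n1).
Qed.

End TowerBound.

(** * Ranks *)

Section Rank.
Variables (l : nat).
Hypothesis lpr : prime l.

Let Fl_card : #|'F_l| = l. Proof. exact: card_Fp. Qed.

Lemma val_Fl (a : 'F_l) : (a < l)%N.
Proof. by have := ltn_ord a; rewrite [X in (_ < X)%N -> _]Fp_cast. Qed.

Lemma natmul_modl (V : zmodType) (x : V) k : x *+ l = 0 -> x *+ (k %% l)%N = x *+ k.
Proof. by move=> xl; rewrite {2}(divn_eq k l) mulrnDr mulnC mulrnA xl mul0rn add0r. Qed.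

Lemma val_FlD (a b : 'F_l) : (nat_of_ord (a + b)%R = (a + b) %% l)%N.
Proof. by rewrite /= [X in (_ %% X)%N = _]Fp_cast. Qed.

Lemma val_FlM (a b : 'F_l) : (nat_of_ord (a * b)%R = (a * b) %% l)%N.
Proof. by rewrite /= [X in (_ %% X)%N = _]Fp_cast. Qed.

Lemma torsion_dim_size (V : zmodType) (s : seq V) d : torsion_list l s -> torsion_dim l V d -> size s = (l ^ d)%N.
Proof.
move=> [us sP] [f [fi fr]].
have -> : (l ^ d)%N = size [seq f v | v : 'rV['F_l]_d] by rewrite size_map -cardT card_mx mul1n Fl_card.
apply/perm_size/uniq_perm => //; first by rewrite map_inj_uniq ?enum_uniq.
move=> x; rewrite sP; apply/eqP/mapP => [xl|[v _ ->]].
  by have : [set x | x *+ l = 0]%classic x by []; rewrite -fr => -[v _ <-]; exists v; rewrite ?mem_enum.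
have : range f (f v) by exists v.
by rewrite fr.
Qed.

(** Take an injective additive map into the l-torsion with [d] maximal. If it missed a torsion
    element [x], sending one more coordinate to multiples of [x] would again be injective, nonzero
    coefficients being invertible. *)
Lemma torsion_dim_exists (V : zmodType) (s : seq V) : torsion_list l s -> exists d, torsion_dim l V d.
Proof.
move=> [us sP].
pose P d := `[< exists2 f : {additive 'rV['F_l]_d -> V}, injective f & forall v, f v *+ l = 0 >].
have P0 : P 0%N.
  pose m : {additive 'rV['F_l]_0 -> V} := HB.pack (fun _ : 'rV['F_l]_0 => 0 : V)
    (GRing.isZmodMorphism.Build 'rV['F_l]_0 V (fun _ => 0) (fun _ _ => esym (subr0 (0 : V)))).
  apply/asboolP; exists m => [v w _|v]; last by rewrite -[m v]/0 mul0rn.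
  by apply/rowP => -[].
have Pb d : P d -> (d <= size s)%N.
  move=> /asboolP[f fi fl]; apply: leq_trans (ltnW (ltn_expl d (prime_gt1 lpr))) _.
  have -> : (l ^ d)%N = size [seq f v | v : 'rV['F_l]_d] by rewrite size_map -cardT card_mx mul1n Fl_card.
  apply: uniq_leq_size; first by rewrite map_inj_uniq ?enum_uniq.
  by move=> _ /mapP[v _ ->]; rewrite sP fl.
have exP : exists d, P d by exists 0%N.
case: (ex_maxnP exP Pb) => d /asboolP[f fi fl] dmax; exists d, f; split=> //.
apply/seteqP; split=> [_ [v _ <-]|x xl]; first exact: fl.
apply: contrapT => xr; have : P d.+1; last by move/dmax; rewrite ltnn.
pose g (v : 'rV['F_l]_(1 + d)) := x *+ nat_of_ord (v 0 (lshift d 0)) + f (rsubmx v).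
have gD : {morph g : v w / v + w}.
  move=> v w; rewrite /g mxE val_FlD natmul_modl // mulrnDr !linearD /= raddfD; exact: addrACA.
have g0 : g 0 = 0 by apply: (addrI (g 0)); rewrite -gD !addr0.
have gB : zmod_morphism g.
  by move=> v w; apply: (addIr (g w)); rewrite -gD !subrK.
have ginj : forall v : 'rV['F_l]_(1 + d), g v = 0 -> v = 0.
  move=> v gv; have v0 : v 0 (lshift d 0) = 0.
    apply/eqP; apply: contra_notT xr => a0; set a := v 0 (lshift d 0) in a0.
    exists (- (rsubmx v *+ nat_of_ord (a^-1))%R) => //.
    have xE : x *+ nat_of_ord a = - f (rsubmx v) by apply/eqP; rewrite -addr_eq0; apply/eqP.
    rewrite raddfN raddfMn -mulNrn -xE -mulrnA -natmul_modl // -val_FlM mulfV //=.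
  have rv : rsubmx v = 0 by apply: fi; rewrite raddf0 -gv /g v0 mulr0n add0r.
  rewrite -[v]hsubmxK rv; have -> : lsubmx v = 0.
    by apply/rowP => i; rewrite (ord1 i) !mxE -[RHS]v0; congr (v _ _).
  by rewrite row_mx0.
apply/asboolP; exists (HB.pack g (GRing.isZmodMorphism.Build 'rV['F_l]_(1 + d) V g gB) : {additive 'rV['F_l]_(1 + d) -> V}).
  by apply: raddf_inj => v gv; exact: ginj.
by move=> v; rewrite -[X in X *+ l]/(g v) /g mulrnDl fl addr0 mulrnAC xl mul0rn.
Qed.

Lemma rk_size (V : zmodType) (s : seq V) : torsion_list l s -> size s = (l ^ rk l V)%N.
Proof.
move=> ts; have [d hd] := torsion_dim_exists ts; rewrite /rk; case: xgetP => [k _ hk|/(_ d)//].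
exact: torsion_dim_size hk.
Qed.

End Rank.

(** * Torsion modulo a finitely generated subgroup *)

Section TorsionComparison.
Local Open Scope classical_set_scope.
Variables (l : nat) (V W : zmodType).
Hypothesis lpr : prime l.

Definition zspan (U : zmodType) (gs : seq U) : set U :=
  foldr (fun g X => [set x | exists a : int, X (x - g *~ a)]) [set 0] gs.

Lemma addg_zspan (U : zmodType) (gs : seq U) : addg (zspan gs).
Proof.
elim: gs => [|g gs [IH0 IHB]] /=; split=> //.
- by move=> x y -> ->; rewrite /= subr0.
- by exists 0; rewrite mulr0z subr0.
- move=> x y [a xa] [b yb]; exists (a - b); have := IHB _ _ xa yb; congr (zspan gs _).
  by rewrite mulrzBr !opprB [RHS]addrACA [- y - _]addrC -addrACA [_ - y]addrC.
Qed.

Lemma int_ideal (I : set int) : I 0 -> (forall a b, I a -> I b -> I (a - b)) ->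
  exists d, forall a, I a <-> (d %| a)%Z.
Proof.
move=> I0 IB; have IN a : I a -> I (- a) by move=> Ia; rewrite -sub0r; exact: IB.
have IM a k : I a -> I (a * k).
  move=> Ia; have IMn (m : nat) : I (a * m%:Z).
    elim: m => [|m IH]; first by rewrite mulr0.
    by rewrite -addn1 PoszD mulrDr mulr1 -[a in X in _ + X]opprK; apply: IB => //; exact: IN.
  by case: k => m; [exact: IMn|rewrite NegzE mulrN; exact: IN].
case: (pselect (exists k : nat, I k.+1%:Z)) => [[k Ik]|none]; last first.
  exists 0 => a; rewrite dvd0z; split=> [Ia|/eqP -> //].
  case: (intP a) Ia => [//|m Im|m Im]; case: none; exists m => //.
  by rewrite -[_.+1%:Z]opprK; exact: IN.
have ex : exists m, `[< I m.+1%:Z >] by exists k; apply/asboolP.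
case: (ex_minnP ex) => m /asboolP Im mmin; exists m.+1%:Z => a; split; last first.
  by move=> /dvdzP[b ->]; rewrite mulrC; exact: IM.
move=> Ia; apply/dvdz_mod0P; have r0 : 0 <= (a %% m.+1%:Z)%Z by rewrite modz_ge0.
have rl : (a %% m.+1%:Z)%Z < m.+1%:Z by rewrite ltz_pmod.
have Ir : I (a %% m.+1%:Z)%Z by rewrite /modz mulrC; apply: IB => //; exact: IM.
case: (a %% m.+1%:Z)%Z r0 rl Ir => // -[//|e] _ el Ie.
by have := mmin e; move=> /(_ (introT (asboolP _) Ie)); move: el; rewrite ltz_nat; lia.
Qed.

(** Modulo [Y] the multiples of [g] form a cyclic group Z / d. If l divides d, its l-torsion
    consists of the multiples of c = d / l; otherwise it is trivial and c = 0. *)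
Lemma cyclic_torsion (U : zmodType) (Y : set U) (g : U) : addg Y ->
  exists c : int, forall a, Y (g *~ a *+ l) -> exists b, (b < l)%N /\ Y (g *~ (a - b%:Z * c)).
Proof.
move=> gY; pose I := [set a | Y (g *~ a)].
have [d dP] : exists d, forall a, I a <-> (d %| a)%Z.
  apply: int_ideal; first by rewrite /I /= mulr0z; case: gY.
  by move=> a b; rewrite /I /= mulrzBr; case: gY => _; apply.
have Il a : Y (g *~ a *+ l) -> (d %| a * l%:Z)%Z.
  by move=> Ya; apply/dP; rewrite /I /= mulrzA -pmulrn.
have [/dvdzP[c dE]|ld] := boolP (l %| d)%Z; last first.
  exists 0 => a /Il; rewrite Gauss_dvdzl => [/dP Ia|].
    by exists 0%N; rewrite prime_gt0 // mulr0 subr0.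
  by rewrite coprimezE coprime_sym prime_coprime.
exists c => a /Il; rewrite dE => /dvdzP[k ke]; have l0 : l%:Z != 0 by rewrite eqz_nat -lt0n prime_gt0.
have aE : a = k * c by apply: (mulIf l0); rewrite ke mulrA.
exists `|(k %% l)%Z|%N; split.
  by rewrite -ltz_nat gez0_abs ?modz_ge0 // ltz_pmod // ltz_nat prime_gt0.
rewrite gez0_abs ?modz_ge0 // aE -mulrBl; apply/dP; rewrite dE mulrC.
by rewrite {1}(divz_eq k l) addrK mulrC -mulrA [c * _]mulrC dvdz_mull.
Qed.

Lemma zspan_torsion (U : zmodType) (gs : seq U) : exists2 M,
  idx [set x | zspan gs x /\ x *+ l = 0] [set 0] M & (M <= l ^ size gs)%N.
Proof.
have addgT (X : set U) : addg X -> addg [set x | X x /\ x *+ l = 0].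
  move=> [X0 XB]; split; first by rewrite /= mul0rn.
  by move=> x y [Xx xl] [Xy yl]; split; [exact: XB|rewrite mulrnBl xl yl subr0].
have addg0 : addg ([set 0] : set U) by split=> // x y -> ->; rewrite /= subr0.
elim: gs => [|g gs [M hM IH]].
  exists 1%N => //; exists [:: 0]; split=> //.
  - by split=> // x y; rewrite !inE => /eqP -> /eqP ->.
  - by move=> x; rewrite inE => /eqP ->; rewrite /= mul0rn.
  - by move=> x [/= -> _]; exists 0; rewrite ?inE //= subr0.
pose X := [set x | zspan (g :: gs) x /\ x *+ l = 0]; pose Y := [set x | zspan gs x /\ x *+ l = 0].
have aX : addg X by apply: addgT; exact: addg_zspan.
have aY : addg Y by apply: addgT; exact: addg_zspan.
have YX : Y `<=` X by move=> x [hx xl]; split=> //; exists 0; rewrite mulr0z subr0.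
have [c hc] := cyclic_torsion g (addg_zspan gs).
have /choice[xb xbP] : forall b : nat, exists x : U,
    (exists y, X y /\ zspan gs (y - g *~ (b%:Z * c))) -> X x /\ zspan gs (x - g *~ (b%:Z * c)).
  move=> b; case: (pselect (exists y, X y /\ zspan gs (y - g *~ (b%:Z * c)))) => [[y hy]|no].
    by exists y.
  by exists 0 => h; case: no.
have cov : forall x, X x -> exists2 y, y \in [seq xb b | b <- iota 0 l] & Y (x - y).
  move=> x [[a xa] xl]; have [|b [bl hb]] := hc a.
    have -> : g *~ a *+ l = - ((x - g *~ a) *+ l) by rewrite mulrnBl xl sub0r opprK.
    apply: addgN; first exact: addg_zspan.
    elim: (l) => [|k IHk]; first by rewrite mulr0n; case: (addg_zspan gs).
    by rewrite mulrS; apply: addgD => //; exact: addg_zspan.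
  have hx : zspan gs (x - g *~ (b%:Z * c)).
    have := addgD (addg_zspan gs) xa hb; congr (zspan gs _).
    by rewrite mulrzBr addrA subrK.
  have [|[hxb xbl] hs] := xbP b; first by exists x; split=> //; split=> //; exists a.
  exists (xb b); first by apply: map_f; rewrite mem_iota.
  split; last by rewrite mulrnBl xl xbl subr0.
  have [_ zB] := addg_zspan gs; have := zB _ _ hx hs; congr (zspan gs _).
  by rewrite opprB addrA subrK.
have [k [kl hk]] := idx_cover aX aY YX cov; rewrite size_map size_iota in kl.
exists (k * M)%N; last by rewrite expnS leq_mul.
by apply: (idx_trans aX aY addg0 YX _ hk hM) => _ ->; case: aY.
Qed.

Lemma zspan_mod (U : zmodType) (gs : seq U) : exists2 r : seq U, (size r <= l ^ size gs)%N &
  forall x, zspan gs x -> exists2 y, y \in r & exists2 z, zspan gs z & x - y = z *+ l.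
Proof.
elim: gs => [|g gs [r rl hr]].
  by exists [:: 0] => // x /= ->; exists 0; rewrite ?inE //; exists 0; rewrite ?subr0 ?mul0rn.
exists [seq y + g *~ b%:Z | y <- r, b <- iota 0 l].
  by rewrite size_allpairs size_iota expnS mulnC leq_mul2l rl orbT.
move=> x [a /hr[y yr [z hz e]]]; have l0 : (0 < l)%N by exact: prime_gt0.
have lz : l%:Z != 0 by rewrite eqz_nat -lt0n.
have rE : `|(a %% l)%Z|%N%:Z = (a %% l)%Z by rewrite gez0_abs ?modz_ge0.
exists (y + g *~ `|(a %% l)%Z|%N%:Z).
  by apply: (allpairs_f (fun y b => y + g *~ b%:Z)) => //; rewrite mem_iota add0n /= -ltz_nat rE ltz_pmod.
rewrite rE.
exists (z + g *~ (a %/ l)%Z); first by exists (a %/ l)%Z; rewrite addrK.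
have -> : x = z *+ l + y + g *~ a by rewrite -e !subrK.
by rewrite {1}(divz_eq a l) mulrzDr mulrzA -pmulrn mulrnDl opprD addrACA !addrK.
Qed.

(** The exact sequence K[l] -> V[l] -> W[l] -> K / l K for the kernel K of [f], whose last map lifts
    to V and multiplies by l. As K is generated by the members of [gs], both K[l] and K / l K have
    at most l^(size gs) elements. *)
Lemma torsion_compare (f : V -> W) (gs : seq V) (sW : seq W) : zmod_morphism f ->
  (forall w, exists v, f v = w) -> (forall v, f v = 0 -> zspan gs v) -> (forall v, zspan gs v -> f v = 0) ->
  torsion_list l sW -> exists sV : seq V, [/\ torsion_list l sV,
    (size sV <= l ^ size gs * size sW)%N & (size sW <= l ^ size gs * size sV)%N].
Proof.
move=> fB0 fs kz zk [uW sWP].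
pose f' : {additive V -> W} := HB.pack f (GRing.isZmodMorphism.Build V W f fB0).
have fMn x : f (x *+ l) = f x *+ l by exact: (raddfMn f').
have fB x y : f (x - y) = f x - f y by exact: fB0.
have f0 : f 0 = 0 by exact: (raddf0 f').
pose TV := [set v : V | v *+ l = 0]; pose TK := [set x | zspan gs x /\ x *+ l = 0].
have aTV : addg TV by split; [rewrite /TV /= mul0rn|move=> x y; rewrite /TV /= mulrnBl => -> ->; rewrite subr0].
have aTK : addg TK.
  have [z0 zB] := addg_zspan gs; split; first by rewrite /TK /= mul0rn.
  by move=> x y [hx xl] [hy yl]; split; [exact: zB|rewrite mulrnBl xl yl subr0].
have a0 (U : zmodType) : addg ([set 0] : set U) by split=> // x y -> ->; rewrite /= subr0.
have /choice[g gP] : forall w : W, exists v : V, (exists2 u, TV u & f u = w) -> TV v /\ f v = w.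
  move=> w; case: (pselect (exists2 u, TV u & f u = w)) => [[u Tu fu]|no]; first by exists u.
  by exists 0 => h; case: no.
have cov x : TV x -> exists2 y, y \in map g sW & TK (x - y).
  move=> Tx; have [|Tg fg] := gP (f x); first by exists x.
  exists (g (f x)); first by apply: map_f; rewrite sWP -fMn Tx f0.
  split; first by apply: kz; rewrite fB fg subrr.
  by case: aTV => _; apply.
have [k [ks hk]] := idx_cover aTV aTK (fun x h => proj2 h) cov; rewrite size_map in ks.
have [M hM Ml] := zspan_torsion gs.
have [sV [sVs [uV sepV] sVT covV]] := idx_trans aTV aTK (a0 V) (fun x h => proj2 h)
  (fun x (h : x = 0) => match esym h with erefl => proj1 aTK end) hk hM.
have tV : torsion_list l sV.
  split=> // x; apply/idP/eqP => [/sVT //|Tx].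
  by have [y ys /eqP] := covV x Tx; rewrite subr_eq0 => /eqP ->.
exists sV; split=> //; first by rewrite sVs mulnC leq_mul.
pose TW := [set w : W | w *+ l = 0]; pose FV := [set f v | v in TV].
have aTW : addg TW by split; [rewrite /TW /= mul0rn|move=> x y; rewrite /TW /= mulrnBl => -> ->; rewrite subr0].
have aFV : addg FV.
  case: aTV => T0 TB; split; first by exists 0.
  by move=> _ _ [x Tx <-] [y Ty <-]; exists (x - y); [exact: TB|rewrite fB].
have FW : FV `<=` TW by move=> _ [x Tx <-]; rewrite /TW /= -fMn Tx.
have [r rl hr] := zspan_mod gs.
have /choice[h hP] : forall y : V, exists w : W, (exists v, v *+ l = y /\ TW (f v)) -> exists v, v *+ l = y /\ w = f v /\ TW w.
  move=> y; case: (pselect (exists v, v *+ l = y /\ TW (f v))) => [[v [vy Tv]]|no].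
    by exists (f v) => _; exists v.
  by exists 0 => H; case: no.
have cov2 w : TW w -> exists2 y, y \in map h r & FV (w - y).
  have [v <-] := fs w; rewrite /TW /= => Tw.
  have /kz/hr[y yr [z hz e]] : f (v *+ l) = 0 by rewrite fMn.
  have e' : (v - z) *+ l = y by rewrite mulrnBl -e opprB addrC subrK.
  have fz : f (v - z) = f v by rewrite fB (zk _ hz) subr0.
  have [|v' [v'y [hE Th]]] := hP y.
    by exists (v - z); split=> //; rewrite /TW /= fz.
  exists (h y); first exact: map_f.
  exists (v - z - v'); last by rewrite fB fz hE.
  by rewrite /TV /= mulrnBl e' v'y subrr.
have [m1 [m1r hm1]] := idx_cover aTW aFV FW cov2; rewrite size_map in m1r.
have cov3 w : FV w -> exists2 y, y \in map f sV & [set 0] (w - y).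
  by move=> [v Tv <-]; exists (f v); [apply: map_f; case: tV => _ ->; apply/eqP|rewrite /= subrr].
have F0 : [set 0] `<=` FV by move=> _ ->; case: aFV.
have [m2 [m2r hm2]] := idx_cover aFV (a0 W) F0 cov3; rewrite size_map in m2r.
have hm := idx_trans aTW aFV (a0 W) FW F0 hm1 hm2.
have hW : idx TW [set 0] (size sW).
  exists sW; split=> //.
  - by split=> // x y _ _ /eqP; rewrite subr_eq0 => /eqP.
  - by move=> y; rewrite sWP => /eqP.
  - by move=> x Tx; exists x; rewrite ?sWP ?Tx //= subrr.
rewrite (idx_uniq (a0 W) hW hm); apply: leq_mul => //; exact: leq_trans rl.
Qed.

End TorsionComparison.

(** * Ideals and divisors *)

Section IdealDivisors.
Local Open Scope classical_set_scope.
Variables (K : fieldExtType rat).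
Local Notation O := (@ring_of_integers K).
Hypothesis dO : dedekind O.
Local Notation I_ := (idealD_ O).
Implicit Types (D E : divisor K) (v : place K).

Lemma idealD_neq0 D : exists2 x, x != 0 & I_ D x.
Proof.
case: (pselect (exists v, fin O v)) => [[v fv]|no].
  by have [x [x0 Ix _]] := mul_exact dO D fv; exists x.
by exists 1; [exact: oner_neq0|move=> v fv; case: no; exists v].
Qed.

Lemma idealD_fractional D : fractional_ideal (I_ D).
Proof.
split.
- by move=> v fv; exact: vge0.
- by move=> x y hx hy v fv; apply: vgeD; [exact: hx|exact: hy].
- by move=> a x Oa; exact: idealD_mul.
- have [x x0 Ix] := idealD_neq0 (- D); have [a [b [Oa Ob b0 e]]] := ded_frac dO x.
  have aE : a = b * x by rewrite e mulrC divfK.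
  exists a; first by split=> //; rewrite aE mulf_neq0.
  move=> y Iy; apply: (ded_place dO) => v fv; rewrite -(subrr (coeff v D)) addrC -coeffN.
  have Ia : I_ (- D) a by rewrite aE; exact: idealD_mul.
  by apply: vgeM; [exact: Ia|exact: Iy].
Qed.

(** For the hard inclusion, consider the ideal of the [a] such that [a * z] lies in the product. At
    a given place choose [x] and [y] with exactly the valuations of [D] and [E]; then [z / (x * y)]
    is integral there, which puts an element of valuation 0 into that ideal. *)
Lemma idealM_idealD D E : idealM (I_ D) (I_ E) = I_ (D + E).
Proof.
apply/seteqP; split.
  apply: idealM_min => [v fv|x y hx hy v fv|x y hx hy v fv]; first exact: vge0.
    by apply: vgeD; [exact: hx|exact: hy].
  by rewrite coeffD; apply: vgeM; [exact: hx|exact: hy].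
move=> z Iz; pose M := idealM (I_ D) (I_ E).
have MO a x : O a -> M x -> M (a * x).
  move=> Oa; case=> s sP ->; exists [seq (a * p.1, p.2) | p <- s].
    by move=> _ /mapP[p /sP[p1 p2] ->]; split=> //; exact: idealD_mul.
  by rewrite mulr_sumr big_map; apply: eq_bigr => p _; rewrite mulrA.
have MB x y : M x -> M y -> M (x - y).
  by move=> Mx My; apply: idealMD => //; rewrite -mulN1r; apply: MO => //; rewrite -sub0r; apply: (dedB dO); [exact: ded0|exact: ded1].
pose I := [set a : K | O a /\ M (a * z)].
have idI : ideal O I.
  split.
  - by split; [exact: ded0|rewrite mul0r; exact: idealM0].
  - by move=> x y [Ox Mx] [Oy My]; split; [exact: (dedB dO)|rewrite mulrBl; exact: MB].
  - by move=> a x Oa [Ox Mx]; split; [exact: (dedM dO)|rewrite -mulrA; exact: MO].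
  - by move=> x [].
case: (pselect (I 1)) => [[_]|I1]; first by rewrite mul1r.
have [->|z0] := eqVneq z 0; first exact: idealM0.
have local x y v : fin O v -> I_ D x -> I_ E y -> x != 0 -> y != 0 -> v x + v y <= v z ->
    exists t, [/\ I t, t != 0 & v t = 0].
  move=> fv Ix Iy x0 y0 le; have [|t [Ot t0 vt Otz]] := fin_local dO (x := z / (x * y)) fv.
    by rewrite vgeE ?mulf_neq0 ?invr_eq0 ?mulf_neq0 // valf ?mulf_neq0 // valM // subr_ge0.
  exists t; split=> //; split=> //.
  have -> : t * z = t * (z / (x * y)) * (x * y) by field; rewrite x0 y0.
  by apply: MO => //; exact: idealM_mul.
have [a Ia a0] : exists2 a, I a & a != 0.
  have [x x0 Ix] := idealD_neq0 D; have [y y0 Iy] := idealD_neq0 E.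
  have [a [b [Oa Ob b0 e]]] := ded_frac dO (z / (x * y)).
  exists b => //; split=> //; have -> : b * z = a * (x * y).
    by rewrite -[z](divfK (mulf_neq0 x0 y0)) e; field.
  by apply: MO => //; exact: idealM_mul.
have [v [fv hv]] := ex_place dO idI I1 Ia a0.
have [x [x0 Ix vx]] := mul_exact dO D fv; have [y [y0 Iy vy]] := mul_exact dO E fv.
have [|t [It t0 vt]] := local x y v fv Ix Iy x0 y0.
  by rewrite vx vy -coeffD; have := Iz v fv; rewrite vgeE.
by have := hv t It; rewrite vgeE // vt.
Qed.

Lemma idealD_invertible D : invertible_ideal (I_ D).
Proof.
split; first exact: idealD_fractional.
exists (I_ (- D)); first exact: idealD_fractional.
by rewrite idealM_idealD subrr (idealD0 dO).
Qed.

Definition div_ideal D : ideal_group K := mk_ideal (idealD_invertible D).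

Lemma div_ideal_additive : zmod_morphism div_ideal.
Proof.
have aD D E : div_ideal (D + E) = div_ideal D + div_ideal E.
  by apply: val_inj; rewrite /= -idealM_idealD.
by move=> D E; apply: (addIr (div_ideal E)); rewrite -aD !subrK.
Qed.

Lemma idealD_principal a : a != 0 -> I_ (dv O a) = [set a * x | x in O].
Proof.
move=> a0; have -> : I_ (dv O a) = [set y | O (y / a)] by exact: (idealD_dv dO).
apply/seteqP; split=> [x Ox|_ [x Ox <-]]; last by rewrite /= mulrAC divff // mul1r.
by exists (x / a) => //; rewrite mulrC divfK.
Qed.

Lemma idealD_inj D E v : I_ D = I_ E -> fin O v -> coeff v D = coeff v E.
Proof.
have le D' E' : I_ D' = I_ E' -> fin O v -> coeff v E' <= coeff v D'.
  move=> e fv; have [x [x0 Ix <-]] := mul_exact dO D' fv.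
  have : I_ E' x by rewrite -e.
  by move=> /(_ v fv); rewrite vgeE.
by move=> e fv; apply/eqP; rewrite eq_le !le.
Qed.

Lemma div_ideal_principal D : D \in fprincipal O <-> div_ideal D \in @principal_ideal K.
Proof.
split.
  move=> /fprincipalP[a a0 Da]; apply/principal_idealP; exists a => //=.
  rewrite -idealD_principal //; apply/seteqP; split=> x h v fv; have := h v fv;
    by rewrite (dvE dO) fv Da.
move=> /principal_idealP[a a0 /=]; rewrite -idealD_principal // => e.
apply/fprincipalP; exists a => // v fv; by rewrite (idealD_inj e fv) (dvE dO) fv.
Qed.

Lemma ex_min_seq (T : eqType) (s : seq T) (f : T -> int) x0 : x0 \in s ->
  exists2 x, x \in s & forall y, y \in s -> f x <= f y.
Proof.
elim: s x0 => // x s IH x0 _; case: s IH => [|y s] IH.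
  by exists x; rewrite ?mem_head // => y; rewrite inE => /eqP ->.
have [z zs hz] := IH y (mem_head _ _); have [xz|zx] := leP (f x) (f z).
  exists x; rewrite ?mem_head // => t; rewrite inE => /orP[/eqP -> //|ts].
  exact: le_trans (hz t ts).
exists z; first by rewrite inE zs orbT.
move=> t; rewrite inE => /orP[/eqP ->|]; [exact: ltW|exact: hz].
Qed.

(** In a relation 1 = sum of p.1 * p.2 with factors in [I] and in its inverse [J], the finitely many
    p.1 generate [I]. The divisor is the minimum of their valuations at each place. *)
Lemma div_ideal_surj (I : ideal_group K) : exists D, div_ideal D = I.
Proof.
have [[I0 ID IM _] [J [J0 JD JM _] IJ]] := ideal_groupP I.
have : idealM I J 1 by rewrite IJ; exact: (ded1 dO).
move=> [s sP e1].
have sne : has (fun p => p.1 != 0) s.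
  apply/negPn/negP => /hasPn h; have /eqP := e1; rewrite big_seq big1 ?oner_eq0 // => p /h.
  by rewrite negbK => /eqP ->; rewrite mul0r.
pose t := [seq p.1 | p <- s & p.1 != 0].
have tP x : x \in t -> ideal_set I x /\ x != 0.
  by move=> /mapP[p + ->]; rewrite mem_filter => /andP[p0 /sP[]].
have [x0 x0t] : exists x0, x0 \in t.
  case/hasP: sne => p ps p0; exists p.1; apply/mapP; exists p => //; by rewrite mem_filter p0.
have /choice[m mP] : forall v, exists x, x \in t /\ forall y, y \in t -> v x <= v y.
  by move=> v; have [x xt h] := ex_min_seq v x0t; exists x.
have suppP x : x \in t -> exists S : seq (place K), forall v, fin O v -> v x != 0 -> v \in S.
  by move=> /tP[_]; exact: (fin_supp dO).
have [S SP] : exists S : seq (place K), forall x, x \in t -> forall v, fin O v -> v x != 0 -> v \in S.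
  elim: (t) suppP => [|x t' IH] h; first by exists [::].
  have [y yt|S hS] := IH; first by apply: h; rewrite inE yt orbT.
  have [Sx hSx] := h x (mem_head _ _); exists (Sx ++ S) => y; rewrite inE => /orP[/eqP -> v fv vy|yt v fv vy].
    by rewrite mem_cat hSx.
  by rewrite mem_cat (hS y) ?orbT.
pose D := divf (fun v => if fin O v then v (m v) else 0).
have DE v : fin O v -> coeff v D = v (m v).
  move=> fv; rewrite (divfE (s := S)) ?fv // => w; case: ifP => // fw vw.
  by have [mt _] := mP w; exact: SP mt w fw vw.
exists D; apply: val_inj => /=; apply/seteqP; split=> z Iz.
  have -> : z = \sum_(p <- s) (p.2 * z) * p.1.
    by rewrite -[LHS]mul1r e1 mulr_suml; apply: eq_bigr => p _; rewrite -mulrA mulrC.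
  rewrite big_seq; elim/big_ind: _ => // p ps; have [Ip Jp] := sP p ps.
  apply: IM => //; apply: (ded_place dO) => v fv; have [mt mm] := mP v; have [Im m0] := tP _ mt.
  have : O (p.2 * m v) by rewrite -IJ mulrC; exact: idealM_mul.
  move=> /(fin_vge fv) h; have := Iz v fv; rewrite DE // => h2.
  have [->|z0] := eqVneq z 0; first by rewrite mulr0; exact: vge0.
  have [->|p0] := eqVneq p.2 0; first by rewrite mul0r; exact: vge0.
  move: h h2; rewrite !vgeE ?mulf_neq0 // !valM // => h h2; apply: le_trans h _.
  by rewrite lerD2l.
have zE : z = \sum_(p <- s) (p.2 * z) * p.1.
  by rewrite -[LHS]mul1r e1 mulr_suml; apply: eq_bigr => p _; rewrite -mulrA mulrC.
move=> v fv; rewrite DE // zE big_seq; apply: vge_sum => p ps; have [Ip Jp] := sP p ps.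
have Opz : O (p.2 * z) by rewrite -IJ mulrC; exact: idealM_mul.
have [->|p0] := eqVneq p.1 0; first by rewrite mulr0; exact: vge0.
have pt : p.1 \in t by apply/mapP; exists p => //; rewrite mem_filter p0.
rewrite mulrC; apply: vge_dvd fv Opz _; rewrite vgeE //; exact: (mP v).2.
Qed.

Theorem Cl_torsion_list l (s : seq (Clf O)) : torsion_list l s ->
  exists2 s' : seq (Cl K), torsion_list l s' & size s' = size s.
Proof.
have pr D : D \in fprincipal O -> div_ideal D \in @principal_ideal K.
  by move/div_ideal_principal.
pose f := qmap (@principal_ideal K) div_ideal : Clf O -> Cl K.
have fB : zmod_morphism f := qmap_is_additive div_ideal_additive pr.
have fE D : f (cls O D) = qcls (@principal_ideal K) (div_ideal D).
  exact: (qmapE div_ideal_additive pr).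
pose f' : {additive Clf O -> Cl K} := HB.pack f (GRing.isZmodMorphism.Build _ _ f fB).
have fi : injective f'.
  apply: raddf_inj => c; have [D <-] := cls_surj c; rewrite -[f' _]/(f _) fE => /qcls_eq0/div_ideal_principal.
  by move/qcls_eq0.
move=> [us sP]; exists (map f' s); last by rewrite size_map.
split=> [|x]; first by rewrite map_inj_uniq.
have [c <-] : exists c, f' c = x.
  have [D DE] := div_ideal_surj (generic_quotient.repr x); exists (cls O D).
  by rewrite -[f' _]/(f _) fE DE qcls_repr.
by rewrite mem_map // sP -raddfMn -[in RHS](raddf0 f') (inj_eq fi).
Qed.

End IdealDivisors.

(** * Places at infinity *)

Section PicardGroup.
Local Open Scope classical_set_scope.
Variables (K : fieldType) (O : set K) (dO : dedekind O) (si : seq (place K)).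
Hypothesis siP : forall v, ~~ fin O v -> v \in si.
Variables (l : nat).
Hypothesis lpr : prime l.
Local Notation pcls := (qcls (@principal_divisor K)).

Let gs := [seq pcls << v >> | v <- si & ~~ fin O v].

Lemma supported_zspan (s : seq (place K)) (D : divisor K) : (forall v, coeff v D != 0 -> v \in s) ->
  zspan [seq pcls << v >> | v <- s] (pcls D).
Proof.
elim: s D => [|w s IH] D hD.
  have -> : D = 0 by apply: divP => v; rewrite coeff0; apply/eqP; apply: contraT => /hD.
  by rewrite /= raddf0.
exists (coeff w D); have := IH (D - << w >> *~ coeff w D) => h.
have <- : pcls (D - << w >> *~ coeff w D) = pcls D - pcls << w >> *~ coeff w D by rewrite raddfB /= raddfMz.
apply: h => v; rewrite coeffB (raddfMz (coeff v)) /= coeffU mul1r.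
have [<-|wv] := eqVneq w v; first by rewrite intz subrr.
by rewrite mul0rz subr0 => /hD; rewrite inE eq_sym (negPf wv).
Qed.

Theorem Pic_torsion_list (s : seq (Clf O)) : torsion_list l s -> exists s' : seq (divisor_class_group K),
  [/\ torsion_list l s', (size s' <= l ^ size si * size s)%N & (size s <= l ^ size si * size s')%N].
Proof.
move=> ts.
have pf D : D \in @principal_divisor K -> (idfun D : divisor K) \in fprincipal O.
  by move=> /principal_divisorP[a a0 Da]; apply/fprincipalP; exists a.
have idB : zmod_morphism (idfun : divisor K -> divisor K) by [].
pose f := qmap (S := @principal_divisor K) (fprincipal O) idfun : divisor_class_group K -> Clf O.
have fB : zmod_morphism f := qmap_is_additive idB pf.
have fE D : f (pcls D) = cls O D by exact: (qmapE idB pf).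
have fs c : exists x, f x = c by have [D <-] := cls_surj c; exists (pcls D).
have kz x : f x = 0 -> zspan gs x.
  rewrite -(qcls_repr x); set D := generic_quotient.repr x; rewrite fE => /qcls_eq0/fprincipalP[a a0 Da].
  have [sa saP] := fin_supp dO a0.
  have aE v : coeff v (divf (fun v => v a)) = v a.
    apply: (divfE (s := sa ++ si)) => w wa; rewrite mem_cat; have [fw|/siP ->] := boolP (fin O w); last by rewrite orbT.
    by rewrite saP.
  have -> : pcls D = pcls (D - divf (fun v : place K => v a)).
    apply/qcls_eq; rewrite opprB addrC subrK; apply/principal_divisorP; exists a => //.
  apply: supported_zspan => v; rewrite coeffB aE mem_filter; case: (boolP (fin O v)) => [fv|nf _] /=; last exact: siP.
  by rewrite Da // subrr eqxx.
have zk x : zspan gs x -> f x = 0.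
  pose f' : {additive divisor_class_group K -> Clf O} := HB.pack f (GRing.isZmodMorphism.Build _ _ f fB).
  rewrite /gs; elim: (si) x => [|v si' IH] x /=; first by move=> ->; exact: (raddf0 f').
  case: (boolP (fin O v)) => /= fv; first exact: IH.
  move=> [a /IH]; rewrite -[f _]/(f' _) (raddfB f') (raddfMz f') -[X in X *~ a]/(f _) fE.
  rewrite (cls_eqf (E := 0)) ?raddf0 ?mul0rz ?subr0 // => w fw; rewrite coeffU coeff0 mul1r.
  by case: eqP => // e; move: fv; rewrite e fw.
have [s' [ts' h1 h2]] := torsion_compare lpr fB fs kz zk ts.
have gl : (l ^ size gs <= l ^ size si)%N.
  by rewrite leq_exp2l ?prime_gt1 // size_map size_filter count_size.
exists s'; split=> //; [apply: leq_trans h1 _|apply: leq_trans h2 _]; by rewrite leq_mul2r gl orbT.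
Qed.

End PicardGroup.

Section ValuationsIntegral.
Local Open Scope classical_set_scope.
Variables (A0 : comNzRingType) (F E : fieldType) (j : {rmorphism A0 -> F}) (iota : {rmorphism F -> E}).

(** If v x were negative, the leading term of a monic equation of x would have smaller valuation
    than all the others. *)
Lemma icl_vge (v : place E) : (forall a, vge v 0 (iota (j a))) -> fin (icl j iota) v.
Proof.
move=> ja; apply/finP => x [p pm /rootP px].
have [->|x0] := eqVneq x 0; first by rewrite val0.
rewrite leNgt; apply/negP => vx; set f := map_poly _ p in px.
have fm : f \is monic by rewrite monic_map.
have [n sf] : exists n, size f = n.+2.
  case sz: (size f) => [|[|n]]; last by exists n.
  - by move: (monic_neq0 fm); rewrite -size_poly_eq0 sz.
  - move: px; have /size_poly1P[c c0 ->] : size f == 1%N by rewrite sz.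
    by rewrite hornerC => c0'; rewrite c0' eqxx in c0.
have e : x ^+ n.+1 = - \sum_(i < n.+1) f`_i * x ^+ i.
  have := px; rewrite horner_coef sf big_ord_recr /=.
  have := fm; rewrite monicE lead_coefE sf => /eqP ->; rewrite mul1r addrC => /eqP.
  by rewrite addr_eq0 => /eqP.
have : vge v (v x *+ n) (x ^+ n.+1).
  rewrite e vgeN; apply: vge_sum => i _; rewrite -[v x *+ n]add0r; apply: vgeM.
    by rewrite coef_map; exact: ja.
  have hi : (i <= n)%N by rewrite -ltnS.
  rewrite vgeE ?expf_neq0 // valX -[X in _ *+ X <= _](subnKC hi) mulrnDr gerDl.
  by rewrite mulrn_wle0 // ltW.
by rewrite vgeE ?expf_neq0 // valX mulrS lerDr leNgt vx.
Qed.

Lemma restr_icl (E' : fieldType) (i : {rmorphism E -> E'}) (iota' : {rmorphism F -> E'}) :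
  (forall y, i (iota y) = iota' y) -> restrO i (icl j iota') = icl j iota.
Proof.
move=> h; have mp (p : {poly A0}) : map_poly (iota' \o j) p = map_poly i (map_poly (iota \o j) p).
  by rewrite -map_poly_comp; apply: eq_map_poly => a /=; rewrite h.
apply/seteqP; split=> x [p pm px]; exists p => //; move: px; rewrite mp.
  by rewrite fmorph_root.
by rewrite fmorph_root.
Qed.

End ValuationsIntegral.

(** * The number of infinite places *)

Section InfinitePlacesBound.
Local Open Scope classical_set_scope.
Variables (k : finFieldType) (F : fieldType) (j : {rmorphism {poly k} -> F}).
Hypothesis j_inj : injective j.
Hypothesis j_frac : forall x, exists a b, j b != 0 /\ x = j a / j b.
Local Notation T := (j 'X).
Local Notation jinf := (jinf j).

(** c^Q = c gives Q v(c) = v(c) with Q > 1. *)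
Lemma val_constant (E : fieldType) (iota : {rmorphism F -> E}) (v : place E) (c : k) :
  c != 0 -> v (iota (j c%:P)) = 0.
Proof.
move=> c0; have := congr1 (fun a => v (iota (j a%:P))) (expf_card c).
rewrite !rmorphXn /= valX => h; have Q1 : (1 < #|k|)%N := finNzRing_gt1 k.
move: h; rewrite -[in X in _ *+ X](subnK Q1) addn2; nia.
Qed.

Lemma vge_constant (E : fieldType) (iota : {rmorphism F -> E}) (v : place E) (c : k) :
  vge v 0 (iota (j c%:P)).
Proof.
have [->|c0] := eqVneq c 0; first by rewrite polyC0 !rmorph0; exact: vge0.
by rewrite vgeE ?val_constant // fmorph_eq0 -(rmorph0 j) (inj_eq j_inj) polyC_eq0.
Qed.

(** If v(T) were non-negative, [v] would be non-negative on all polynomials and hence on their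
    integral closure. So T has a pole, and polynomials in 1 / T are [v]-integral. *)
Lemma infinite_placeP (E : fieldType) (iota : {rmorphism F -> E}) (v : place E) :
  ~~ fin (icl j iota) v -> fin (icl jinf iota) v /\ 0 < v (iota T^-1).
Proof.
move=> nf; have T0 := T_neq0 j_inj; have iT0 : iota T != 0 by rewrite fmorph_eq0.
have vT : v (iota T) < 0.
  rewrite ltNge; apply: contra nf => vT; apply: icl_vge => a.
  rewrite (jE j (leqnSn (size a))) rmorph_sum; apply: vge_sum => i _.
  rewrite rmorphM -[0]addr0; apply: vgeM; first exact: vge_constant.
  by rewrite rmorphXn vgeE ?expf_neq0 // valX mulrn_wge0.
have vT' : 0 < v (iota T^-1) by rewrite fmorphV valV oppr_gt0.
split=> //; apply: icl_vge => a.
rewrite (jinfE j (leqnSn (size a))) rmorph_sum; apply: vge_sum => i _.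
rewrite rmorphM -[0]addr0; apply: vgeM; first exact: vge_constant.
by rewrite -exprVn rmorphXn vgeE ?expf_neq0 ?fmorph_eq0 ?invr_eq0 // valX mulrn_wge0 // ltW.
Qed.

Lemma jinf_split (c : {poly k}) : exists c', jinf c = jinf c' * T^-1 + j (c`_0)%:P.
Proof.
pose c' : {poly k} := \poly_(i < size c) c`_i.+1; exists c'.
have cE : c = c' * 'X + (c`_0)%:P.
  apply/polyP => -[|i]; rewrite coefD coefMX coefC ?add0r //= addr0 coef_poly.
  by case: ltnP => // h; rewrite nth_default // (leq_trans h).
by rewrite {1}cE rmorphD rmorphM jinf_X jinfC.
Qed.

Variables (L K : fieldType) (iotaL : {rmorphism F -> L}) (iotaK : {rmorphism F -> K}) (i : {rmorphism K -> L}).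
Hypothesis iE : forall y, i (iotaK y) = iotaL y.
Variables (gT : finGroupType) (G H : {group gT}) (act : gT -> {rmorphism L -> L}).
Hypotheses (act1 : forall x, act 1%g x = x) (actM : forall g h x, act (g * h)%g x = act h (act g x)).
Hypothesis actF : forall g y, g \in G -> act g (iotaL y) = iotaL y.
Hypothesis fixF : forall x, (forall g, g \in G -> act g x = x) -> exists y, x = iotaL y.
Hypothesis faithful : forall g h, g \in G -> h \in G -> (forall x, act g x = act h x) -> g = h.
Hypothesis HG : H \subset G.
Hypothesis actK : forall g y, g \in H -> act g (i y) = i y.
Hypothesis fixK : forall x, (forall g, g \in H -> act g x = x) -> exists y, x = i y.
Local Notation OL' := (icl jinf iotaL).

Lemma jinf_dedekind : dedekind OL'.
Proof.
have jbez := jinf_bezout j_inj j_frac.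
have jidx a : jinf a != 0 -> exists m, idx (rgA jinf) (scl (jinf a) (rgA jinf)) m.
  by move=> ja; exists (#|k| ^ (size a).-1)%N; apply: (poly_index (jinf_inj j_inj)).
have [b [Ob db]] := basis_exists act1 actM actF fixF faithful jbez.
exact: (icl_dedekind act1 actM actF fixF jbez Ob db jidx).
Qed.

Let dL := jinf_dedekind.

Let OLact g x : g \in G -> OL' x -> OL' (act g x).
Proof. by move=> gG; apply: icl_morph => y; exact: actF. Qed.

Let OLactH g x : g \in H -> OL' x -> OL' (act g x).
Proof. by move=> gH; apply: OLact; exact: (fintype.subsetP HG). Qed.

Let denL (x : L) : exists b, jinf b != 0 /\ OL' (iotaL (jinf b) * x).
Proof. exact: (icl_den act1 actM fixF (jinf_bezout j_inj j_frac)). Qed.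

(** Every infinite place of K lies under a place of L above the prime 1 / T of the polynomials in 1
    / T, and these places of L are conjugate under G. This covers subfields K that are not
    normal. *)
Lemma infinite_places_list : exists2 s : seq (place K), (size s <= #|G|)%N &
  forall v, ~~ fin (icl j iotaK) v -> v \in s.
Proof.
case: (pselect (exists v : place K, ~~ fin (icl j iotaK) v)) => [[v0 nf0]|no]; last first.
  by exists [::] => // v nv; case: no; exists v.
have denF x : exists d, [/\ d != 0, restrO iotaL OL' d & OL' (iotaL d * x)].
  by have [b [b0 Ob]] := denL x; exists (jinf b); split=> //; exact: icl_base.
have denK x : exists d, [/\ d != 0, restrO i OL' d & OL' (i d * x)].
  have [b [b0 Ob]] := denL x; exists (iotaK (jinf b)); rewrite iE; split=> //; first by rewrite fmorph_eq0.
  by rewrite /restrO /= iE; exact: icl_base.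
have up v : ~~ fin (icl j iotaK) v -> exists w, [/\ fin OL' w, resw i v0 w = v & 0 < w (iotaL T^-1)].
  move=> /infinite_placeP[fv vT]; rewrite -(restr_icl _ iE) in fv.
  have [w fw wv] := lies_over act1 actM fixK dL OLactH denK v0 fv.
  exists w; split=> //; have [e0 we] := reswP act1 actM fixK dL OLactH v0 fw.
  by rewrite -iE we wv mulr_gt0 // ltz_nat.
have [w0 [fw0 rw0 w0T]] := up _ nf0.
have dF := restr_dedekind dL denF.
have [vF [eF abF]] := above_ex act1 actM fixF dL OLact fw0.
have conj w : fin OL' w -> 0 < w (iotaL T^-1) -> exists2 g, g \in G & w = gact act1 actM g w0.
  move=> fw wT; have := resw_trans act1 actM fixF dL OLact (p0 := vF) fw0 fw; apply.
  have low u : fin OL' u -> 0 < u (iotaL T^-1) -> fin (restrO iotaL OL') (resw iotaL vF u) /\ 0 < resw iotaL vF u T^-1.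
    move=> fu uT; split; first exact: (fin_resw act1 actM fixF dL OLact).
    have [e0 ue] := reswP act1 actM fixF dL OLact vF fu.
    by move: uT; rewrite ue pmulr_lgt0 // ltz_nat.
  have [f1 p1] := low _ fw0 w0T; have [f2 p2] := low _ fw wT.
  (* Both restrictions to F have the same prime, the polynomials in 1 / T without constant term,
     since a nonzero constant has valuation 0. *)
  apply: (fin_inj dF f1 f2) => x [Ox x1]; split=> //.
  have [c xc] := icl_fix (jinf_bezout j_inj j_frac) Ox; subst x.
  have [c' cE] := jinf_split c; have [e0|e0] := eqVneq c`_0 0.
    rewrite cE e0 polyC0 rmorph0 addr0 -[1]add0r; apply: vgeM; last by rewrite vgeE ?invr_eq0 ?T_neq0 // gtz0_ge1.
    by apply: (fin_vge f2); rewrite /restrO /=; exact: icl_base.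
  have h0 := val_constant (idfun : {rmorphism F -> F}) (resw iotaL vF w0) e0.
  have je0 : j (c`_0)%:P != 0 by rewrite -(rmorph0 j) (inj_eq j_inj) polyC_eq0.
  have : vge (resw iotaL vF w0) 1 (j (c`_0)%:P).
    have -> : j (c`_0)%:P = jinf c - jinf c' * T^-1 by rewrite cE addrC addKr.
    apply: vgeB x1 _; rewrite -[1]add0r; apply: vgeM; last by rewrite vgeE ?invr_eq0 ?T_neq0 // gtz0_ge1.
    by apply: (fin_vge f1); rewrite /restrO /=; exact: icl_base.
  by rewrite vgeE // h0.
exists [seq resw i v0 (gact act1 actM g w0) | g <- enum G]; first by rewrite size_map -cardE.
move=> v /up[w [fw wv wT]]; have [g gG we] := conj w fw wT.
by apply/mapP; exists g; rewrite ?mem_enum // -we.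
Qed.

End InfinitePlacesBound.

(** * Subfields of a Galois extension *)

Section BasePlaces.
Local Open Scope classical_set_scope.
Variables (A0 : comNzRingType) (F E : fieldType) (j : {rmorphism A0 -> F}) (iota : {rmorphism F -> E}).
Variables (R : realType) (absF : F -> R) (abs : E -> R).
Hypotheses (bd : base_data j absF) (av : absolute_value abs) (ext : forall y, abs (iota y) = absF y).

(** A base element of absolute value at least 2 is not a unit, because absolute values of base
    elements are natural numbers; so some place is positive on it. Places so obtained serve as
    default values. *)
Lemma place_exists : dedekind (icl j iota) -> exists v : place E, True.
Proof.
move=> dO; have [C C1 h] := base_scale bd.
have [a /andP[a2 _]] := h 2 (ler1n _ 2).
have a0 : j a != 0.
  by apply: contraTneq a2 => ->; rewrite -ext rmorph0 (abs_zero av) -ltNge ltr0n.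
have ia0 : iota (j a) != 0 by rewrite fmorph_eq0.
pose I := [set x | icl j iota (x / iota (j a))].
have idI : ideal (icl j iota) I.
  split; rewrite /I /=.
  - by rewrite mul0r; exact: icl0.
  - by move=> x y Ix Iy; rewrite mulrBl; exact: iclB.
  - by move=> b x Ob Ix; rewrite -mulrA; exact: iclM.
  - by move=> x Ix; rewrite -[x](divfK ia0); apply: iclM => //; exact: icl_base.
have I1 : ~ I 1.
  rewrite /I /= mul1r -fmorphV => /(icl_fix (base_bezout bd))[c cE].
  have c0 : j c != 0 by rewrite -cE invr_eq0.
  have [m _ mE] := base_index bd c0.
  have : absF (j a) * m%:R = 1.
    rewrite mE -!ext -(abs_mul av) -rmorphM -cE mulfV // rmorph1.
    by apply: (mulIf (lt0r_neq0 (abs_pos av (oner_neq0 E)))); rewrite -(abs_mul av) !mul1r.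
  case: m {mE} => [|m]; first by rewrite mulr0 => /eqP; rewrite eq_sym oner_eq0.
  move=> e; have : (2 : R) * 1 <= absF (j a) * m.+1%:R by apply: ler_pM; rewrite ?ler1n.
  by rewrite e mulr1 lern1.
have Ia : I (iota (j a)) by rewrite /I /= divff //; exact: icl1.
by have [v _] := ex_place dO idI I1 Ia ia0; exists v.
Qed.

End BasePlaces.

Section GaloisTower.
Local Open Scope classical_set_scope.
Variables (F : fieldType) (L : splittingFieldType F) (A0 : comNzRingType) (j : {rmorphism A0 -> F}).
Variables (R : realType) (abs : L -> R).
Hypothesis av : absolute_value abs.
Hypothesis bd : base_data j (fun y : F => abs y%:A).
Hypothesis galL : galois 1 {:L}.
Local Notation gT := (gal_of {:L}).
Local Notation G := ('Gal({:L} / 1))%G.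
Local Notation alg K := (GRing.in_alg K).

Definition galm (g : gT) : {rmorphism L -> L} := gal_repr g.

Lemma galm1 x : galm 1%g x = x. Proof. exact: gal_id. Qed.
Lemma galmM g h x : galm (g * h)%g x = galm h (galm g x). Proof. by apply: galM; rewrite memvf. Qed.

Lemma galm_faithful g h : (forall x, galm g x = galm h x) -> g = h.
Proof. by move=> e; apply/eqP/gal_eqP => x _; exact: e. Qed.

Lemma galm_base g y : galm g (alg L y) = alg L y.
Proof. by rewrite /galm /= linearZ /= rmorph1. Qed.

Variable K : {subfield L}.
Local Notation H := ('Gal({:L} / K))%G.
Local Notation iK := (@vsval F L K).

Lemma galm_sub g y : g \in H -> galm g (iK y) = iK y.
Proof. by move=> gH; apply: (fixed_gal (subvf K) gH); exact: subvsP. Qed.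

Lemma galm_fix x : (forall g, g \in H -> galm g x = x) -> exists y, x = iK y.
Proof.
move=> h; have gK : galois K {:L} by apply: galoisS galL; rewrite sub1v subvf.
have xK : x \in K.
  by rewrite -((galois_fixedField gK)); apply/fixedFieldP; [exact: memvf|exact: h].
by exists (vsproj K x); rewrite /= vsprojK.
Qed.

Lemma galm_fixF x : (forall g, g \in G -> galm g x = x) -> exists y, x = alg L y.
Proof.
move=> h; have : x \in 1%VS.
  rewrite -[1%VS]/(1%AS : {vspace L}) -(galois_fixedField galL).
  by apply/fixedFieldP; [exact: memvf|exact: h].
by move=> /vlineP[y ->]; exists y.
Qed.

Lemma iK_alg y : iK (alg (subvs_of K) y) = alg L y.
Proof. by rewrite -[LHS]/(iK (y *: 1)) linearZ rmorph1. Qed.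

Lemma galL_data : dedekind (icl j (alg L)) /\
  global_data (icl j (alg L)) (fun (i : 'I_#|G|) (x : L) => abs (galm (enum_val i) x)).
Proof.
apply: (lattice_data (G := G) (act := galm) bd av) => //.
- exact: galm1.
- exact: galmM.
- by move=> g y _; exact: galm_base.
- exact: galm_fixF.
- by move=> g h _ _; exact: galm_faithful.
Qed.

Lemma den_sub x : exists d, [/\ d != 0, restrO iK (icl j (alg L)) d & icl j (alg L) (iK d * x)].
Proof.
have [b [b0 Ob]] := icl_den galm1 galmM galm_fixF (base_bezout bd) x.
exists (alg (subvs_of K) (j b)); rewrite iK_alg; split=> //; first by rewrite fmorph_eq0.
have h : icl j (alg L) (iK (alg (subvs_of K) (j b))) by rewrite iK_alg; exact: icl_base.
exact: h.
Qed.

Lemma dedekind_sub : dedekind (icl j (alg (subvs_of K))).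
Proof. by rewrite -(restr_icl j iK_alg); apply: restr_dedekind den_sub; have [] := galL_data. Qed.

Lemma abs_sub : absolute_value (fun x : subvs_of K => abs (iK x)).
Proof.
case: av => a0 ap aM aD; split.
- by rewrite rmorph0.
- by move=> x x0; apply: ap; rewrite fmorph_eq0.
- by move=> x y; rewrite rmorphM aM.
- by move=> x y; rewrite rmorphD aD.
Qed.

Lemma place_sub : exists v : place (subvs_of K), True.
Proof. by apply: (place_exists bd abs_sub _ dedekind_sub) => y; rewrite iK_alg. Qed.

Section NormalSubfield.
Hypothesis galK : galois 1 K.

Definition galr (g : gal_of K) (x : subvs_of K) : subvs_of K := Subvs (memv_gal g (subvsP x)).

Lemma galr_is_additive g : zmod_morphism (galr g).
Proof. by move=> x y; apply: val_inj; rewrite /= rmorphB. Qed.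

Lemma galr_is_multiplicative g : monoid_morphism (galr g).
Proof.
have v1 : iK 1 = 1 by exact: rmorph1.
split; first by apply: val_inj; rewrite -[LHS]/(g (iK 1)) v1 rmorph1.
by move=> x y; apply: val_inj; rewrite /= rmorphM.
Qed.

HB.instance Definition _ g := GRing.isZmodMorphism.Build _ _ (galr g) (galr_is_additive g).
HB.instance Definition _ g := GRing.isMonoidMorphism.Build _ _ (galr g) (galr_is_multiplicative g).

(** The absolute value is composed with the Galois group of K over F, which yields as many absolute
    values as the degree of K. Normality of K enters here. *)
Lemma normal_data : exists (J : finType) (nrm : J -> subvs_of K -> R),
  global_data (icl j (alg (subvs_of K))) nrm.
Proof.
have [] := @lattice_data A0 F (subvs_of K) j (alg (subvs_of K)) (gal_of K) 'Gal(K / 1)%G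
  (fun g => galr g) R _ (fun x => abs (iK x)) bd abs_sub.
- by move=> y; rewrite iK_alg.
- by move=> x; apply: val_inj; rewrite /= gal_id.
- by move=> g h x; apply: val_inj; rewrite /= galM // subvsP.
- move=> g y _; apply: val_inj; rewrite -[LHS]/(g (iK (alg (subvs_of K) y))) iK_alg.
  by rewrite -[LHS]/(g (y *: 1)) linearZ rmorph1; exact: esym (iK_alg y).
- move=> x h; have : vsval x \in 1%VS.
    rewrite -[1%VS]/(1%AS : {vspace L}) -(galois_fixedField galK).
    by apply/fixedFieldP => [|g /h /(congr1 vsval) //]; exact: subvsP.
  by move=> /vlineP[y e]; exists y; apply: val_inj; exact: etrans e (esym (iK_alg y)).
- move=> g h _ _ e; apply/eqP/gal_eqP => x xK.
  by have := congr1 vsval (e (Subvs xK)).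
by move=> _ gd; eexists; eexists; exact: gd.
Qed.

End NormalSubfield.

Lemma unramified_ramw (p : place (subvs_of K)) w : unramified_over K -> fin (icl j (alg L)) w ->
  ramw iK p w = 1%N.
Proof.
move=> un fw; have [dL _] := galL_data.
have OLact g x : g \in H -> icl j (alg L) x -> icl j (alg L) (galm g x).
  by move=> _; apply: icl_morph => y; exact: galm_base.
have [e0 we] := reswP galm1 galmM galm_fix dL OLact p fw.
have : [set w x | x in [set x : L | x != 0]] 1.
  by have [x x0 wx] := val_surj w 1; exists x.
rewrite -un => -[x [xK x0] wx].
have := we (vsproj K x); rewrite /= vsprojK // wx => /(congr1 absz)/esym/eqP.
by rewrite abszM absz_nat muln_eq1 => /andP[_ /eqP].
Qed.

End GaloisTower.

Section GaloisTowerBound.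
Local Open Scope classical_set_scope.
Variables (F : fieldType) (L : splittingFieldType F) (A0 : comNzRingType) (j : {rmorphism A0 -> F}).
Variables (R : realType) (abs : L -> R).
Hypothesis av : absolute_value abs.
Hypothesis bd : base_data j (fun y : F => abs y%:A).
Hypothesis galL : galois 1 {:L}.
Variables (K1 K2 : {subfield L}) (sigma tau : gal_of {:L}) (l r z : nat).
Hypothesis galK2 : galois 1 K2.
Hypotheses (lpr : prime l) (r_gt1 : (1 < r)%N) (rl : (r < l)%N).
Hypotheses (ord_tau : #[tau]%g = l) (ord_sigma : #[sigma]%g = r).
Hypothesis st : (sigma * tau = tau ^+ z * sigma)%g.
Hypotheses (zr : (z ^ r = 1 %[mod l])%N) (zi : forall i, (0 < i < r)%N -> (z ^ i != 1 %[mod l])%N).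
Hypothesis gal2 : 'Gal({:L} / K2)%G = <[tau]>%G.
Hypothesis gal1 : 'Gal({:L} / K1)%G = <[sigma]>%G.
Hypothesis unram : unramified_over K2.
Local Notation q := (l ^ #|'Gal({:L} / 1)%G|.+1)%N.

Theorem galois_tower_bound :
  exists (s1 : seq (Clf (icl j (GRing.in_alg (subvs_of K1))))) (s2 : seq (Clf (icl j (GRing.in_alg (subvs_of K2))))),
  [/\ torsion_list l s1, torsion_list l s2,
      (size s2 <= q * ((q * l) ^ r * size s1) ^ (2 ^ r))%N &
      (size s1 <= (q * (q * size s2)) ^ l)%N].
Proof.
have [dL gdL] := galL_data av bd galL.
have [J [nrm gd2]] := normal_data av bd galK2.
have [p1 _] := place_sub av bd galL K1; have [p2 _] := place_sub av bd galL K2.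
have [pL _] : exists p : place L, True by apply: (place_exists bd av _ dL).
rewrite -(restr_icl j (@iK_alg F L K2)) in gd2.
rewrite -(restr_icl j (@iK_alg F L K1)) -(restr_icl j (@iK_alg F L K2)).
have OLact g x : icl j (GRing.in_alg L) x -> icl j (GRing.in_alg L) (galm g x).
  by apply: icl_morph => y; exact: galm_base.
have act1 := @galm1 F L; have actM := @galmM F L.
have faith (g : gal_of {:L}) : (forall x : L, galm g x = x) -> g = 1%g by move=> h; apply: galm_faithful => x; rewrite h galm1.
have aK2 g y : g \in <[tau]>%G -> galm g (@vsval F L K2 y) = vsval y by rewrite -gal2; exact: galm_sub.
have aK1 g y : g \in <[sigma]>%G -> galm g (@vsval F L K1 y) = vsval y by rewrite -gal1; exact: galm_sub.
have fK2 x : (forall g, g \in <[tau]>%G -> galm g x = x) -> exists y, x = @vsval F L K2 y.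
  by rewrite -gal2; exact: (galm_fix galL).
have fK1 x : (forall g, g \in <[sigma]>%G -> galm g x = x) -> exists y, x = @vsval F L K1 y.
  by rewrite -gal1; exact: (galm_fix galL).
have H90 a : \prod_(g in <[tau]>%G) galm g a = 1 -> exists2 b, b != 0 & a = b / galm tau b.
  rewrite -gal2 => /eqP na.
  have gen : generator 'Gal({:L} / K2) tau by rewrite /generator -[X in _ == X]/(gval <[tau]>%G) -gal2.
  by case: (elimT (Hilbert's_theorem_90 gen (memvf a)) na) => b [_ b0] ab; exists b.
have d1 := den_sub bd galL K1; have d2 := den_sub bd galL K2.
have un w : fin (icl j (GRing.in_alg L)) w -> ramw (@vsval F L K2) p2 w = 1%N.
  exact: (unramified_ramw av bd galL p2 unram).
exact: (tower_bound act1 actM faith lpr r_gt1 rl ord_tau ord_sigma st zr zi aK2 fK2 aK1 fK1 H90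
  dL OLact d2 d1 gdL gd2 (card_ord _) p1 pL un).
Qed.

End GaloisTowerBound.

(** * Generators of the Galois group *)

Section GroupStructure.
Local Open Scope group_scope.

Lemma prime_of_case c : case_ok c -> [/\ prime (case_l c), prime (case_r c) & (case_r c < case_l c)%N].
Proof.
case: c => [l [lpr lo]|l r [lpr lo rpr ro lr]] /=.
  by split=> //; rewrite ltn_neqAle prime_gt1 // andbT; apply: contraTneq lo => <-.
split=> //; have l1 := prime_gt1 lpr; have r1 := prime_gt1 rpr.
rewrite ltnNge; apply/negP => lr'; move: lr; rewrite (modn_small r1).
move: lr'; rewrite leq_eqVlt => /orP[/eqP ->|h]; first by rewrite modnn.
by rewrite modn_small // => l1'; rewrite l1' in l1.
Qed.

(** A form common to both presentations. The last clause records that the action is nontrivial: if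
    [s] and [t] commute, the relation becomes a power of [t] with exponent prime to l. *)
Lemma case_generators c (gT : finGroupType) (G : {group gT}) : case_ok c -> case_group c G ->
  exists s t, [/\ G :=: <[t]> <*> <[s]>, s ^+ case_r c = 1, t ^+ case_l c = 1, s \in 'N(<[t]>) &
    commute s t -> t = 1].
Proof.
move=> ok; have [lpr rpr rl] := prime_of_case ok.
have pow1 (t : gT) (k : nat) l : prime l -> t ^+ l = 1 -> coprime l k -> t ^+ k = 1 -> t = 1.
  move=> pl tl ck tk; apply/eqP; rewrite -order_eq1 -dvdn1 -(eqP ck) dvdn_gcd.
  by rewrite !order_dvdn tl tk eqxx.
case: c ok lpr rpr rl => [l|l r] /= ok lpr rpr rl.
  rewrite mul2n => iso; have /isoGrp_hom/existsP[[t s] /= /eqP[defG tl s2 ts]] := isoGrp_trans iso (Grp_dihedral (prime_gt1 lpr)).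
  exists s, t; split=> //.
    by rewrite inE -cycleJ ts cycleV.
  move=> st; apply: (pow1 t 2 l) => //; first by rewrite coprimen2; case: ok.
  have tt : t = t^-1 by rewrite -ts conjgE -st mulKg.
  by rewrite expgS expg1 {1}tt mulVg.
move=> [z oz /isoGrp_hom/existsP[[s t] /= /eqP[defG sr tl sts]]].
have l0 : (0 < l)%N := prime_gt0 lpr.
exists s, t; split=> //.
- by rewrite -defG joingC.
- rewrite -groupV inE -cycleJ conjgE invgK mulgA sts; exact: cycleX.
- move=> st; have e : t ^+ nat_of_ord (val z) = t by rewrite -sts st mulgK.
  have z1 : nat_of_ord (val z) != 1%N.
    apply/eqP => z1; have : z = 1 by apply/val_inj/val_inj; rewrite /= z1 [X in (1 %% X)%N]Fp_cast // modn_small // prime_gt1.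
    by move=> z1'; move: oz; rewrite z1' order1 => r1; rewrite -r1 in rpr.
  have zl := val_Fl lpr (val z).
  case zE : (nat_of_ord (val z)) => [|k]; first by rewrite -e zE.
  apply: (pow1 t k l) => //; last by apply: (mulIg t); rewrite -expgSr -zE e mul1g.
  rewrite prime_coprime // gtnNdvd //; last by rewrite -ltnS -zE (leq_trans zl).
  by case: k zE => // zE; rewrite zE in z1.
Qed.

(** The orders of [s] and [t] bound that of G by l r, and the orders of [H] and [D] force equality.
    [H] is then the only Sylow l-subgroup, since r < l. If z^i = 1 modulo l for some 0 < i < r, then
    sigma, a power of sigma^i, centralises tau; so G is abelian, t = 1, and G is too small. *)
Lemma split_group (gT : finGroupType) (G H D : {group gT}) (l r : nat) (s t : gT) :
  prime l -> prime r -> (r < l)%N -> G :=: <[t]> <*> <[s]> -> s ^+ r = 1 -> t ^+ l = 1 ->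
  s \in 'N(<[t]>) -> (commute s t -> t = 1) -> H \subset G -> D \subset G -> (#|H| * r)%N = #|G| -> (#|D| * l)%N = #|G| ->
  [/\ #|G| = (l * r)%N, #|H| = l, #|D| = r, H <| G & exists sigma tau z,
    [/\ H = <[tau]>%G, D = <[sigma]>%G, sigma * tau = tau ^+ z * sigma,
        z ^ r = 1 %[mod l] & forall i, (0 < i < r)%N -> (z ^ i != 1 %[mod l])%N]].
Proof.
move=> lpr rpr rl defG sr tl nts cst HG DG iH iD.
have cop : coprime l r by rewrite prime_coprime // gtnNdvd // prime_gt0.
have lrG : (l * r %| #|G|)%N by rewrite Gauss_dvd // -{1}iD -iH !dvdn_mull.
have dt : (#[t] %| l)%N by rewrite order_dvdn tl.
have ds : (#[s] %| r)%N by rewrite order_dvdn sr.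
have defG' : G :=: <[t]> * <[s]> by rewrite defG norm_joinEr // cycle_subG.
have Gle : (#|G| <= #[t] * #[s])%N.
  apply: leq_trans (_ : #|G| * #|<[t]> :&: <[s]>| <= _)%N; first by rewrite leq_pmulr // cardG_gt0.
  by rewrite defG' -mul_cardG.
have oG : #|G| = (l * r)%N.
  apply/eqP; rewrite eqn_leq (dvdn_leq (cardG_gt0 _) lrG) andbT; apply: leq_trans Gle _.
  by apply: leq_mul; apply: dvdn_leq => //; exact: prime_gt0.
have oH : #|H| = l by apply/eqP; rewrite -(eqn_pmul2r (prime_gt0 rpr)) iH oG.
have oD : #|D| = r by apply/eqP; rewrite -(eqn_pmul2r (prime_gt0 lpr)) iD oG mulnC.
have nH : H <| G.
  have sylH : l.-Sylow(G) H.
    rewrite pHallE HG oH oG p_part lognM ?prime_gt0 // lognE lpr prime_gt0 // dvdnn divnn prime_gt0 // logn1.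
    by rewrite lognE lpr prime_gt0 //= gtnNdvd // ?prime_gt0 // addn0 expn1.
  have : #|'Syl_l(G)| = 1%N.
    have := card_Syl_mod G lpr; have : (#|'Syl_l(G)| %| r)%N.
      rewrite -(@Gauss_dvdr _ l) ?[(l * r)%N]mulnC; last first.
        rewrite coprime_sym prime_coprime //; apply/negP => h; have := card_Syl_mod G lpr.
        by move/eqP: h => ->.
      by rewrite mulnC -oG card_Syl_dvd.
    move=> /(dvdn_leq (prime_gt0 rpr)) le; rewrite modn_small //; exact: leq_ltn_trans rl.
  rewrite (card_Syl sylH) => /eqP; rewrite indexg_eq1 => h; rewrite /normal HG.
  by apply: fintype.subset_trans h _; rewrite subsetIr.
split=> //.
have [tau Htau] : exists tau, H :=: <[tau]> by apply/cyclicP; rewrite prime_cyclic // oH.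
have [sigma Dsigma] : exists sigma, D :=: <[sigma]> by apply/cyclicP; rewrite prime_cyclic // oD.
have otau : #[tau] = l by rewrite -oH Htau.
have osigma : #[sigma] = r by rewrite -oD Dsigma.
have tauH : tau \in H by rewrite Htau cycle_id.
have sG : sigma \in G by apply: (fintype.subsetP DG); rewrite Dsigma cycle_id.
have nHG := fintype.subsetP (normal_norm nH).
have : tau ^ sigma^-1 \in <[tau]> by rewrite -Htau memJ_norm // nHG // groupV.
move=> /cycleP[z zE].
have st : sigma * tau = tau ^+ z * sigma by rewrite -zE conjgE invgK -!mulgA mulVg mulg1.
have sti i : sigma ^+ i * tau = tau ^+ (z ^ i) * sigma ^+ i.
  elim: i => [|i IH]; first by rewrite !expg0 mul1g mulg1.
  have stk k : sigma * tau ^+ k = tau ^+ (z * k) * sigma.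
    elim: k => [|k IHk]; first by rewrite muln0 !expg0 mul1g mulg1.
    by rewrite expgS mulgA st -mulgA IHk mulgA -expgD mulnS.
  by rewrite expgS -mulgA IH mulgA stk -mulgA expnS.
exists sigma, tau, z; split=> //; try exact: val_inj.
  have := sti r; rewrite -{1 3}osigma expg_order mul1g mulg1 -{1}[tau]expg1 => /eqP.
  by rewrite eq_expg_mod_order otau => /eqP.
move=> i /andP[i0 ir]; apply/negP => zi1.
have com : commute (sigma ^+ i) tau.
  by rewrite /commute sti; congr (_ * _); apply/eqP; rewrite -[X in _ == X]expg1 eq_expg_mod_order otau.
have cs : sigma \in 'C[tau].
  have gi : sigma \in <[sigma ^+ i]>.
    have : generator <[sigma]> (sigma ^+ i) by rewrite generator_coprime osigma prime_coprime // gtnNdvd.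
    by rewrite /generator => /eqP <-; exact: cycle_id.
  move/cycleP: gi => [k ->]; apply: groupX; exact/cent1P/commute_sym.
have cHD : D \subset 'C(H).
  rewrite Htau Dsigma cent_cycle cycle_subG //.
have GHD : G :=: H * D.
  apply/eqP; rewrite eq_sym eqEcard mul_subG //= TI_cardMg ?oG ?oH ?oD //.
  by apply: coprime_TIg; rewrite oH oD.
have abG : abelian G.
  by rewrite GHD abelianM cHD Htau Dsigma !cycle_abelian.
have inG : (t \in G) * (s \in G) by rewrite defG !mem_gen // inE cycle_id ?orbT.
have t1 : t = 1 by apply: cst; have := centsP abG _ inG.2 _ inG.1.
have := Gle; rewrite t1 order1 mul1n oG leqNgt => /negP; case.
apply: leq_ltn_trans (dvdn_leq (prime_gt0 rpr) ds) _.
by rewrite ltn_Pmull ?prime_gt1 ?prime_gt0.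
Qed.

End GroupStructure.

Section CaseBounds.
Variables (F : fieldType) (L : splittingFieldType F) (c : galois_case) (K1 K2 : {subfield L}).
Hypotheses (ok : case_ok c) (cf : case_fields c K1 K2).
Local Notation l := (case_l c).
Local Notation r := (case_r c).

Lemma case_galois : [/\ galois 1 K2, #|'Gal({:L} / 1)%g| = (l * r)%N & exists sigma tau z,
  [/\ #[tau]%g = l, #[sigma]%g = r, 'Gal({:L} / K2)%G = <[tau]>%G, 'Gal({:L} / K1)%G = <[sigma]>%G &
   [/\ (sigma * tau = tau ^+ z * sigma)%g,
    (z ^ r = 1 %[mod l])%N & forall i, (0 < i < r)%N -> (z ^ i != 1 %[mod l])%N]]].
Proof.
have [galL cg d1 d2] := cf; have [lpr rpr rl] := prime_of_case ok.
have [s [t [defG sr tl nts cst]]] := case_generators ok cg.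
have sub (K : {subfield L}) : 'Gal({:L} / K)%G \subset 'Gal({:L} / 1)%G by rewrite galS // sub1v.
have gK (K : {subfield L}) : galois K {:L} by apply: galoisS galL; rewrite sub1v subvf.
have ix (K : {subfield L}) : (#|'Gal({:L} / K)%G| * \dim K)%N = #|'Gal({:L} / 1)%G|.
  by rewrite -(galois_dim (gK K)) -(galois_dim galL) dimv1 divn1 divnK // field_dimS // subvf.
have i2 := ix K2; have i1 := ix K1; rewrite d2 in i2; rewrite d1 in i1.
have [oG oH oD nH [sigma [tau [z [eH eD st zr zi]]]]] :=
  split_group lpr rpr rl defG sr tl nts cst (sub K2) (sub K1) i2 i1.
split=> //.
  by have := normal_fixedField_galois galL nH; rewrite (galois_fixedField (gK K2)).
exists sigma, tau, z; split=> //; first by rewrite -oH eH.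
by rewrite -oD eD.
Qed.

End CaseBounds.

Section Exponents.

Lemma exp_bound_lower (l n r a1 a2 : nat) : (1 < l)%N ->
  (l ^ a2 <= l ^ n.+1 * ((l ^ n.+1 * l) ^ r * l ^ a1) ^ (2 ^ r))%N ->
  (a2 <= n.+1 + (n.+2 * r + a1) * 2 ^ r)%N.
Proof.
by move=> l1; rewrite -expnSr -!expnM -expnD -expnM -expnD leq_exp2l.
Qed.

Lemma exp_bound_upper (l n a1 a2 : nat) : (1 < l)%N ->
  (l ^ a1 <= (l ^ n.+1 * (l ^ n.+1 * l ^ a2)) ^ l)%N ->
  (a1 <= (n.+1 + (n.+1 + a2)) * l)%N.
Proof. by move=> l1; rewrite -!expnD -expnM leq_exp2l. Qed.

End Exponents.

(** * Ranks over the two kinds of base *)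

Section NumberField.
Variables (L : splittingFieldType rat) (c : galois_case) (K1 K2 : {subfield L}).
Hypotheses (ok : case_ok c) (cf : case_fields c K1 K2) (un : unramified_over K2).
Local Notation l := (case_l c).
Local Notation r := (case_r c).
Local Notation n := (l * r)%N.

Lemma icl_ring_of_integers (K : fieldExtType rat) :
  icl (intr : {rmorphism int -> rat}) (GRing.in_alg K) = @ring_of_integers K.
Proof.
have e (p : {poly int}) : map_poly (GRing.in_alg K \o (intr : int -> rat)) p = map_poly (intr : int -> K) p.
  by apply: eq_map_poly => m; rewrite -[LHS]/(GRing.in_alg K m%:~R) rmorph_int.
apply/seteqP; split=> x [p pm px]; exists p => //.
  exact: (eq_ind _ (fun q => root q x) px _ (e p)).
exact: (eq_ind _ (fun q => root q x) px _ (esym (e p))).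
Qed.

Lemma number_field_ranks :
  (rk l (Cl (subvs_of K2)) <= n.+1 + (n.+2 * r + rk l (Cl (subvs_of K1))) * 2 ^ r)%N /\
  (rk l (Cl (subvs_of K1)) <= (n.+1 + (n.+1 + rk l (Cl (subvs_of K2)))) * l)%N.
Proof.
have [galL _ _ _] := cf; have [lpr rpr rl] := prime_of_case ok.
have [galK2 oG [sigma [tau [z [ot os g2 g1 [st zr zi]]]]]] := case_galois ok cf.
have sepL : separable 1 {:L} by case/and3P: galL.
have [abs av absE] := archimedean_absolute_value Rdefinitions.R sepL.
have bd : base_data (intr : {rmorphism int -> rat}) (fun y : rat => abs y%:A).
  by rewrite (_ : (fun y => _) = (fun y : rat => `|ratr y|)); [exact: int_base|exact/funext].
have := galois_tower_bound av bd galL galK2 lpr (prime_gt1 rpr) rl ot os st zr zi g2 g1 un.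
have dd K := dedekind_sub av bd galL K.
rewrite !icl_ring_of_integers oG => -[s1 [s2 [t1 t2 h1 h2]]].
have d1 := dd K1; have d2 := dd K2; rewrite icl_ring_of_integers in d1; rewrite icl_ring_of_integers in d2.
have [s1' t1' z1] := Cl_torsion_list d1 t1; have [s2' t2' z2] := Cl_torsion_list d2 t2.
move: h1 h2; rewrite -z1 -z2 (rk_size lpr t1') (rk_size lpr t2') => h1 h2.
by split; [exact: (exp_bound_lower (prime_gt1 lpr))|exact: (exp_bound_upper (prime_gt1 lpr))].
Qed.

End NumberField.

Section FunctionField.
Variables (p : nat) (L : splittingFieldType {fraction {poly 'F_p}}) (c : galois_case) (K1 K2 : {subfield L}).
Hypotheses (ok : case_ok c) (cf : case_fields c K1 K2) (un : unramified_over K2).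
Local Notation l := (case_l c).
Local Notation r := (case_r c).
Local Notation n := (l * r)%N.

(** [a1] and [a2] are the l-ranks of the class groups of the affine rings, where all the work takes
    place; passing to the complete curves changes each by at most n. *)
Lemma function_field_ranks : exists a1 a2,
  [/\ (a2 <= n.+1 + (n.+2 * r + a1) * 2 ^ r)%N, (a1 <= (n.+1 + (n.+1 + a2)) * l)%N,
    (rk l (Pic (subvs_of K1)) <= n + a1)%N /\ (a1 <= n + rk l (Pic (subvs_of K1)))%N &
    (rk l (Pic (subvs_of K2)) <= n + a2)%N /\ (a2 <= n + rk l (Pic (subvs_of K2)))%N].
Proof.
have [galL _ _ _] := cf; have [lpr rpr rl] := prime_of_case ok; have l1 := prime_gt1 lpr.
have [galK2 oG [sigma [tau [z [ot os g2 g1 [st zr zi]]]]]] := case_galois ok cf.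
pose j : {rmorphism {poly 'F_p} -> {fraction {poly 'F_p}}} := @tofrac {poly 'F_p}.
have j_inj : injective j by move=> a b /eqP; rewrite tofrac_eq => /eqP.
have j_frac x : exists a b, j b != 0 /\ x = j a / j b by exact: fraction_ratio.
have actF (g : gal_of {:L}) y : g \in 'Gal({:L} / 1)%G -> galm g (GRing.in_alg L y) = GRing.in_alg L y.
  by move=> _; exact: galm_base.
have faith (g h : gal_of {:L}) : g \in 'Gal({:L} / 1)%G -> h \in 'Gal({:L} / 1)%G ->
  (forall x : L, galm g x = galm h x) -> g = h by move=> _ _; exact: galm_faithful.
have dinf := jinf_dedekind j_inj j_frac (@galm1 _ L) (@galmM _ L) actF (galm_fixF galL) faith.
have [abs av absE] := infinite_absolute_value j_inj j_frac dinf Rdefinitions.R.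
have bd : base_data j (fun y => abs y%:A).
  by apply: (poly_base j_inj j_frac) => [|a a0]; [rewrite scale0r (abs_zero av)|exact: absE].
have dd K := dedekind_sub av bd galL K.
have [s1 [s2 [t1 t2 h1 h2]]] :=
  galois_tower_bound av bd galL galK2 lpr (prime_gt1 rpr) rl ot os st zr zi g2 g1 un.
have inf (K : {subfield L}) : exists2 s : seq (place (subvs_of K)), (size s <= n)%N &
    forall v, ~~ fin (icl j (GRing.in_alg (subvs_of K))) v -> v \in s.
  have HG : 'Gal({:L} / K)%G \subset 'Gal({:L} / 1)%G by rewrite galS // sub1v.
  have fK x : (forall g, g \in 'Gal({:L} / K)%G -> galm g x = x) -> exists y : subvs_of K, x = vsval y.
    exact: (galm_fix galL).
  have := infinite_places_list j_inj j_frac (@iK_alg _ L K) (@galm1 _ L) (@galmM _ L)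
    actF (galm_fixF galL) faith HG fK.
  by rewrite oG.
have cmp (K : {subfield L}) (s : seq (Clf (icl j (GRing.in_alg (subvs_of K))))) : torsion_list l s ->
    exists2 a, size s = (l ^ a)%N & (rk l (Pic (subvs_of K)) <= n + a)%N /\ (a <= n + rk l (Pic (subvs_of K)))%N.
  move=> ts; exists (rk l (Clf (icl j (GRing.in_alg (subvs_of K))))); first exact: rk_size.
  have [si sin siP] := inf K; have [s' [ts' le1 le2]] := Pic_torsion_list (dd K) siP lpr ts.
  move: le1 le2; rewrite (rk_size lpr ts) (rk_size lpr ts') -!expnD !leq_exp2l // => le1 le2.
  by split; [apply: leq_trans le1 _|apply: leq_trans le2 _]; rewrite leq_add2r.
have [a1 z1 c1] := cmp K1 s1 t1; have [a2 z2 c2] := cmp K2 s2 t2.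
exists a1, a2; rewrite oG z1 z2 in h1 h2; split=> //.
  exact: (exp_bound_lower l1).
exact: (exp_bound_upper l1).
Qed.

End FunctionField.

(** * Recursive functions of the case *)

Section Computability.

Definition rec_args (f g : seq nat -> nat) (i : nat) := if i is 0 then f else g.

Lemma recursive_comp1 (h f : seq nat -> nat) : recursive h -> recursive f -> recursive (fun s => h [:: f s]).
Proof. by move=> hh hf; apply: (rec_comp (n := 1) (g := fun _ => f)). Qed.

Lemma recursive_comp2 (h f g : seq nat -> nat) : recursive h -> recursive f -> recursive g ->
  recursive (fun s => h [:: f s; g s]).
Proof. by move=> hh hf hg; apply: (rec_comp (n := 2) (g := rec_args f g)) => // -[|i]. Qed.

Lemma recursiveS f : recursive f -> recursive (fun s => (f s).+1).
Proof. exact: (recursive_comp1 rec_succ). Qed.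

Lemma recursive_const k : recursive (fun=> k).
Proof. by elim: k => [|k IH]; [exact: rec_zero|exact: recursiveS]. Qed.

Lemma recursiveD f g : recursive f -> recursive g -> recursive (fun s => f s + g s)%N.
Proof.
apply: (recursive_comp2 (h := fun s => (nth 0 s 0 + nth 0 s 1)%N)).
apply: rec_ext (rec_prim (rec_proj 0) (recursiveS (rec_proj 1))) => s /=.
by rewrite nth_behead; elim: (nth 0%N s 0) => //= k ->.
Qed.

Lemma recursiveM f g : recursive f -> recursive g -> recursive (fun s => f s * g s)%N.
Proof.
apply: (recursive_comp2 (h := fun s => (nth 0 s 0 * nth 0 s 1)%N)).
apply: rec_ext (rec_prim rec_zero (recursiveD (rec_proj 1) (rec_proj 2))) => s /=.
by elim: (nth 0%N s 0) => //= k ->; rewrite nth_behead mulSn addnC.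
Qed.

(** The predecessor appears because denominators in [computable] are written as successors; it
    satisfies the recursion x -> 2 x + 1. *)
Lemma recursive_pred_exp2 f : recursive f -> recursive (fun s => (2 ^ f s).-1).
Proof.
apply: (recursive_comp1 (h := fun s => (2 ^ nth 0%N s 0).-1)).
apply: rec_ext (rec_prim rec_zero (recursiveS (recursiveD (rec_proj 1) (rec_proj 1)))) => s /=.
elim: (nth 0%N s 0) => //= k ->; have : (0 < 2 ^ k)%N by rewrite expn_gt0.
by rewrite expnS; lia.
Qed.

Definition code_l (s : seq nat) := nth 0%N s 1.
Definition code_r (s : seq nat) := if nth 0%N s 0 is 0 then 2 else nth 0%N s 2.

Lemma recursive_code_l : recursive code_l. Proof. exact: rec_proj. Qed.

Lemma recursive_code_r : recursive code_r.
Proof.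
apply: rec_ext (rec_prim (recursive_const 2) (rec_proj 3)) => s; rewrite /code_r.
by case: (nth 0%N s 0) => //= k; rewrite nth_behead.
Qed.

Lemma computable_ratio (C : galois_case -> base_scheme -> rat) (f g h : seq nat -> nat) :
  recursive f -> recursive g -> recursive h ->
  (forall c b, let s := rcons (case_code c) (base_code b) in
     C c b = ((f s)%:R - (g s)%:R) / (h s).+1%:R) -> computable C.
Proof. by move=> hf hg hh e; exists f, g, h. Qed.

End Computability.

(** * The constants *)

Section Constants.
Implicit Types (c : galois_case) (b : base_scheme).

Definition case_n c := (case_l c * case_r c)%N.

(** With x1, x2 the final ranks and affine ranks within n of them, the lower bound reads x2 <= (2 n
    + 1) + ((n + 2) r + n + x1) 2^r. Dividing by 2^r and rounding the first term up to 2 n + 1 gives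
    the lower constants. Likewise x1 <= n + (3 n + 2 + x2) l gives the upper ones. *)
Definition lower_slope c b : rat := 1 / (2 ^ case_r c)%:R.
Definition lower_const c b : rat := - (3 * case_n c + 1 + case_r c * (case_n c + 2))%:R.
Definition upper_slope c b : rat := (case_l c)%:R.
Definition upper_const c b : rat := (case_l c * (3 * case_n c + 2) + case_n c)%:R.

Lemma code_lE c b : code_l (rcons (case_code c) (base_code b)) = case_l c.
Proof. by case: c. Qed.

Lemma code_rE c b : code_r (rcons (case_code c) (base_code b)) = case_r c.
Proof. by case: c. Qed.

Let rl := recursive_code_l.
Let rr := recursive_code_r.
Let rn := recursiveM rl rr.

Lemma lower_slope_computable : computable lower_slope.
Proof.
apply: (computable_ratio (recursive_const 1) (recursive_const 0) (recursive_pred_exp2 rr)) => c b s.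
by rewrite /lower_slope code_rE subr0 prednK // expn_gt0.
Qed.

Lemma lower_const_computable : computable lower_const.
Proof.
apply: (computable_ratio (g := fun s => (3 * (code_l s * code_r s) + 1 + code_r s * (code_l s * code_r s + 2))%N)
  (recursive_const 0) _ (recursive_const 0)); last first.
  by move=> c b s; rewrite /lower_const /case_n -(code_lE c b) -(code_rE c b) divr1 sub0r.
apply: recursiveD.
  by apply: recursiveD; [apply: recursiveM; [exact: recursive_const|exact: rn]|exact: recursive_const].
by apply: recursiveM => //; apply: recursiveD; [exact: rn|exact: recursive_const].
Qed.

Lemma upper_slope_computable : computable upper_slope.
Proof.
apply: (computable_ratio rl (recursive_const 0) (recursive_const 0)) => c b s.
by rewrite /upper_slope code_lE subr0 divr1.
Qed.

Lemma upper_const_computable : computable upper_const.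
Proof.
apply: (computable_ratio (f := fun s => (code_l s * (3 * (code_l s * code_r s) + 2) + code_l s * code_r s)%N)
  _ (recursive_const 0) (recursive_const 0)); last first.
  by move=> c b s; rewrite /upper_const /case_n -(code_lE c b) -(code_rE c b) divr1 subr0.
apply: recursiveD; last exact: rn.
apply: recursiveM => //; apply: recursiveD; last exact: recursive_const.
by apply: recursiveM; [exact: recursive_const|exact: rn].
Qed.

Lemma rank_inequalities c b (d a1 a2 x1 x2 : nat) (n := case_n c) :
  (d <= n)%N -> (0 < case_l c)%N ->
  (a2 <= n.+1 + (n.+2 * case_r c + a1) * 2 ^ case_r c)%N -> (a1 <= (n.+1 + (n.+1 + a2)) * case_l c)%N ->
  (x1 <= d + a1)%N /\ (a1 <= d + x1)%N -> (x2 <= d + a2)%N /\ (a2 <= d + x2)%N ->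
  lower_slope c b * x2%:R + lower_const c b <= x1%:R <= upper_slope c b * x2%:R + upper_const c b.
Proof.
move=> dn l0 h1 h2 [h3 h4] [h5 h6]; rewrite /lower_slope /lower_const /upper_slope /upper_const -/n.
have P0 : (0 < 2 ^ case_r c)%N by rewrite expn_gt0.
have PR : 0 < (2 ^ case_r c)%:R :> rat by rewrite ltr0n.
apply/andP; split.
  rewrite lerBlDr mul1r mulrC ler_pdivrMr // -natrD -natrM ler_nat.
  move: P0 h1; set P := (2 ^ _)%N; set r := case_r c; nia.
rewrite -natrM -natrD ler_nat; move: l0 h2; set l := case_l c; nia.
Qed.

End Constants.

Theorem theorem9 :
  exists C1 C2 C3 C4 : galois_case -> base_scheme -> rat,
    [/\ computable C1, computable C2, computable C3 & computable C4] /\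
    forall c : galois_case, case_ok c ->
    [/\ forall b : base_scheme, 0 < C1 c b,
        forall (L : splittingFieldType rat) (K1 K2 : {subfield L}),
          case_fields c K1 K2 ->
          unramified_over K2 ->
          disjoint_from_Fmu (case_l c) K2 ->
          let l := case_l c in
          let b := SpecZ in
          let rk1 : rat := (rk l (Cl (subvs_of K1)))%:R in
          let rk2 : rat := (rk l (Cl (subvs_of K2)))%:R in
          C1 c b * rk2 + C2 c b <= rk1 <= C3 c b * rk2 + C4 c b
      & forall p : nat, prime p -> p != case_l c ->
        forall (L : splittingFieldType {fraction {poly 'F_p}})
               (K1 K2 : {subfield L}),
          case_fields c K1 K2 ->
          unramified_over K2 ->
          disjoint_from_Fmu (case_l c) K2 ->
          let l := case_l c in
          let b := P1 (has_mu l p) in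
          let rk1 : rat := (rk l (Pic (subvs_of K1)))%:R in
          let rk2 : rat := (rk l (Pic (subvs_of K2)))%:R in
          C1 c b * rk2 + C2 c b <= rk1 <= C3 c b * rk2 + C4 c b].
Proof.
exists lower_slope, lower_const, upper_slope, upper_const; split.
  split; [exact: lower_slope_computable|exact: lower_const_computable|
    exact: upper_slope_computable|exact: upper_const_computable].
move=> c ok; have [lpr _ _] := prime_of_case ok; have l0 := prime_gt0 lpr; split.
- by move=> b; rewrite /lower_slope divr_gt0 // ltr0n expn_gt0.
- move=> L K1 K2 cf un _ /=; have [h1 h2] := number_field_ranks ok cf un.
  (* Over the rationals there is no correction at infinity, so d = 0; for function fields d = n. *)
  exact: (rank_inequalities _ (leq0n _) l0 h1 h2).
- move=> p _ _ L K1 K2 cf un _ /=; have [a1 [a2 [h1 h2 h3 h4]]] := function_field_ranks ok cf un.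
  exact: (rank_inequalities _ (leqnn _) l0 h1 h2 h3 h4).
Qed.
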